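(* Assume $\frac12<s<\frac56$ and let $u$ be a weak solution of the stationary fractional Navier--Stokes equations $$(-\Delta)^su+u\cdot\nabla u+\nabla P=0,\qquad\nabla\cdot u=0\qquad\text{in }\mathbb{R}^3,$$ with $\int_{\mathbb{R}^3}|(-\Delta)^{\frac s2}u|^2dx<\infty$. Let $\theta=\frac{4s-2}{3-2s}\in(0,1)$. Then $$\int_{\mathbb{R}^3}|(-\Delta)^{\frac s2}u|^2dx=\liminf_{k\to\infty}\Big\{\int_{\mathbb{R}^3}\sum_{l=k-1}^{k+2}\sum_{l'=l-2}^{k-1}\sum_{l''=[\theta k]}^{k-1}\dot{S}_{l-2}\dot{\Delta}_{l''}u\cdot\nabla\dot{\Delta}_{l'}u\cdot\dot{\Delta}_lu^k\,dx+\int_{\mathbb{R}^3}\sum_{l=k-3}^{k}\sum_{l''=[\frac{k}{2}]}^{k-1}\dot{\Delta}_l\dot{S}_ku\cdot\nabla\dot{\Delta}_{l''}u\cdot\tilde{\dot{\Delta}}_lu^k\,dx+\int_{\mathbb{R}^3}\sum_{l''=[\frac{k}{2}]}^{k-1}\sum_{l\ge k-1}\tilde{\dot{\Delta}}_{l}u^k\cdot\nabla\dot{\Delta}_{l''}u\cdot\dot{\Delta}_lu^k\,dx\Big\},$$ where $k$ ranges over the integers.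
   Context: Fourier transform on $\mathcal{S}'(\mathbb{R}^3)$: $\hat f(\xi)=(2\pi)^{-3/2}\int_{\mathbb{R}^3} e^{-ix\cdot\xi}f(x)\,dx$, with inverse $\mathcal{F}^{-1}$; $(-\Delta)^{\sigma}f=\mathcal{F}^{-1}(|\xi|^{2\sigma}\hat f)$; $\|f\|_{\dot H^\sigma}=(\int_{\mathbb{R}^3}|\xi|^{2\sigma}|\hat f(\xi)|^2d\xi)^{1/2}$. Weak solution: a vector field $u\in\dot H^s(\mathbb{R}^3)$ is a weak solution of the stationary fractional Navier--Stokes equations $(-\Delta)^su+u\cdot\nabla u+\nabla P=0$, $\nabla\cdot u=0$ in $\mathbb{R}^3$ if $u$ is weakly divergence free and, for some $P\in\mathcal{S}'(\mathbb{R}^3)$ and all $\phi\in(C_0^\infty(\mathbb{R}^3))^3$, $$\int_{\mathbb{R}^3}(-\Delta)^{\frac s2}u\cdot(-\Delta)^{\frac s2}\phi\,dx=\int_{\mathbb{R}^3}(u\otimes u):\nabla\phi\,dx+\int_{\mathbb{R}^3}P\,\nabla\cdot\phi\,dx,$$ where $(\nabla\phi)_{i,j}=\partial_j\phi_i$ and the last integral is a duality pairing. Littlewood--Paley notation: $B_r=\{x\in\mathbb{R}^3:|x|\le r\}$. Fix a non-negative $\psi\in C_0^\infty(B_1)$ with $\psi(\xi)=1$ for $|\xi|\le\frac12$, and set $\varphi(\xi)=\psi(2^{-1}\xi)-\psi(\xi)$. For $k\in\mathbb{Z}$ put $\dot\Delta_ku=\mathcal{F}^{-1}(\varphi(2^{-k}\cdot)\hat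 u)$ and $\dot S_ku=\mathcal{F}^{-1}(\psi(2^{-k}\cdot)\hat u)$ (componentwise on vector fields). Also $u^k=u-\dot S_ku$ and $\tilde{\dot\Delta}_lu=\sum_{|l'-l|\le2}\dot\Delta_{l'}u$. For vector fields $a,b,c$: $a\cdot\nabla b\cdot c=\sum_{i,j=1}^3a_j\,\partial_jb_i\,c_i$. $[x]$ denotes the integer part (floor) of $x$. Empty sums are zero. *)

(* Defs.v *)
From HB Require Import structures.
From mathcomp Require Import all_boot all_order all_algebra.
From mathcomp Require Import complex lra.
From mathcomp Require Import all_classical all_reals all_analysis.

Set Implicit Arguments.
Unset Strict Implicit.
Unset Printing Implicit Defensive.

Import Order.TTheory GRing.Theory Num.Theory.
Import numFieldNormedType.Exports.
Import ComplexField.Normc.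

Local Open Scope classical_set_scope.
Local Open Scope complex_scope.
Local Open Scope ring_scope.

Notation R3 R := (R * R * R)%type.

(* Distributions are functionals on all functions R^3 -> C; only their values
   on Schwartz functions are ever constrained (see [tempered]). *)
Notation cfield R := (R3 R -> R[i]).
Notation functional R := ((R3 R -> R[i]) -> R[i]).
Notation vfunctional R := ('I_3 -> (R3 R -> R[i]) -> R[i]).

Definition leb3 (R : realType) : {measure set
    (measurableTypeR R * measurableTypeR R * measurableTypeR R) -> \bar R} :=
  ((@lebesgue_measure R \x @lebesgue_measure R) \x @lebesgue_measure R)%E.

Definition coord3 (R : realType) (j : 'I_3) (x : R3 R) : R :=
  nth 0 [:: x.1.1; x.1.2; x.2] j.

Definition basis3 (R : realType) (j : 'I_3) : R3 R :=
  ((j == 0 :> nat)%:R, (j == 1 :> nat)%:R, (j == 2 :> nat)%:R).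

Definition dot3 (R : realType) (x y : R3 R) : R :=
  \sum_(j < 3) coord3 j x * coord3 j y.

(* The Euclidean norm; the library norm of the product type is the max norm. *)
Definition enorm (R : realType) (x : R3 R) : R := Num.sqrt (dot3 x x).

Definition cint (R : realType) (f : cfield R) : R[i] :=
  (\int[leb3 R]_x complex.Re (f x)) +i* (\int[leb3 R]_x complex.Im (f x)).

Definition pd (R : realType) (j : 'I_3) (f : cfield R) : cfield R := fun x =>
  ('D_(basis3 R j) (fun y => complex.Re (f y)) x : R) +i*
  ('D_(basis3 R j) (fun y => complex.Im (f y)) x : R).

Definition pds (R : realType) (js : seq 'I_3) (f : cfield R) : cfield R :=
  foldr (@pd R) f js.

(* Differentiability of all iterated partial derivatives is equivalent to C^oo:
   it yields their existence and continuity at every order. *)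
Definition smooth (R : realType) (f : cfield R) : Prop :=
  forall (js : seq 'I_3) (x : R3 R),
    differentiable (fun y : R3 R => complex.Re (pds js f y) : R) x /\
    differentiable (fun y : R3 R => complex.Im (pds js f y) : R) x.

Definition test_fun (R : realType) (f : cfield R) : Prop :=
  smooth f /\ exists r : R, forall x, r < enorm x -> f x = 0.

Definition seminorm (R : realType) (N : nat) (f : cfield R) : \bar R :=
  ereal_sup [set (((1 + enorm x) ^+ N * normc (pds js f x))%:E) |
             js in [set js | (size js <= N)%N] & x in [set: R3 R]].

Definition schwartz (R : realType) (f : cfield R) : Prop :=
  smooth f /\ forall N, (seminorm N f < +oo)%E.

Definition tempered (R : realType) (T : functional R) : Prop :=
  (forall (a : R[i]) (f g : cfield R), schwartz f -> schwartz g ->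
     T (fun x => a * f x + g x) = a * T f + T g) /\
  exists (N : nat) (C : R), forall f, schwartz f ->
    ((normc (T f))%:E <= C%:E * seminorm N f)%E.

(* T is invariant under complex conjugation. *)
Definition real_valued (R : realType) (T : functional R) : Prop :=
  forall f, schwartz f -> (forall x, complex.Im (f x) = 0) ->
    complex.Im (T f) = 0.

Definition locally_integrable3 (R : realType) (f : cfield R) : Prop :=
  [/\ measurable_fun [set: R3 R] (fun x => complex.Re (f x)),
      measurable_fun [set: R3 R] (fun x => complex.Im (f x)) &
      forall r : R,
        (\int[leb3 R]_(x in [set x | (enorm x <= r)%R]) (normc (f x))%:E < +oo)%E].

Definition represents (R : realType) (f : cfield R) (T : functional R) : Prop :=
  locally_integrable3 f /\
  forall g, test_fun g -> T g = cint (fun x => f x * g x).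

(* A locally integrable function representing T, unique up to null sets when
   it exists; the zero function otherwise. *)
Definition density (R : realType) (T : functional R) : cfield R :=
  xget (fun=> 0) [set f | represents f T].

Definition dist_of (R : realType) (f : cfield R) : functional R :=
  fun g => cint (fun x => f x * g x).

Definition expi (R : realType) (t : R) : R[i] := cos t +i* sin t.

Definition fourier (R : realType) (f : cfield R) : cfield R := fun xi =>
  ((2 * pi) `^ (- (3 / 2)))%:C * cint (fun x => expi (- dot3 x xi) * f x).

Definition ifourier (R : realType) (f : cfield R) : cfield R := fun x =>
  ((2 * pi) `^ (- (3 / 2)))%:C * cint (fun xi => expi (dot3 x xi) * f xi).

Definition fourierD (R : realType) (T : functional R) : functional R :=
  fun f => T (fourier f).

Definition ifourierD (R : realType) (T : functional R) : functional R :=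
  fun f => T (ifourier f).

Definition mulD (R : realType) (m : R3 R -> R) (T : functional R) :
    functional R :=
  fun f => T (fun x => (m x)%:C * f x).

Definition derivD (R : realType) (j : 'I_3) (T : functional R) :
    functional R :=
  fun f => - T (pd j f).

(* The symbol |xi|^(2 sigma) need not be smooth at 0, so it multiplies the function
   representing the Fourier transform rather than the distribution itself. *)
Definition fracLap (R : realType) (sigma : R) (T : functional R) :
    functional R :=
  ifourierD (dist_of (fun xi =>
    (enorm xi `^ (2 * sigma))%:C * density (fourierD T) xi)).

Definition hnorm (R : realType) (sigma : R) (T : functional R) : \bar R :=
  ((\int[leb3 R]_xi
     (enorm xi `^ (2 * sigma) *
      normc (density (fourierD T) xi) ^+ 2)%R%:E)
    `^ (2^-1)%R)%E.

(* The Fourier transform is required to be a locally integrable function, which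
   excludes polynomials. *)
Definition Hdot (R : realType) (sigma : R) (T : functional R) : Prop :=
  [/\ tempered T, exists g, represents g (fourierD T) &
      (hnorm sigma T < +oo)%E].

Definition div_free (R : realType) (u : vfunctional R) : Prop :=
  forall g, test_fun g -> \sum_(j < 3) u j (pd j g) = 0.

(* The products are bilinear, without complex conjugation. Test fields are
   complex-valued, which by linearity is the same as testing with real ones. *)
Definition momentum_eq (R : realType) (s : R) (u : vfunctional R)
    (P : functional R) (phi : 'I_3 -> cfield R) : Prop :=
  cint (fun x => \sum_(i < 3)
    density (fracLap (s / 2) (u i)) x *
    density (fracLap (s / 2) (dist_of (phi i))) x)
  = cint (fun x => \sum_(i < 3) \sum_(j < 3)
      density (u i) x * density (u j) x * pd j (phi i) x)
    + P (fun x => \sum_(j < 3) pd j (phi j) x).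

Definition weak_solution (R : realType) (s : R) (u : vfunctional R) : Prop :=
  [/\ forall i, Hdot s (u i) /\ real_valued (u i),
      div_free u &
      exists P, tempered P /\
        forall phi : 'I_3 -> cfield R, (forall i, test_fun (phi i)) ->
          momentum_eq s u P phi].

Definition energy (R : realType) (s : R) (u : vfunctional R) : \bar R :=
  (\int[leb3 R]_x
    (\sum_(i < 3) normc (density (fracLap (s / 2) (u i)) x) ^+ 2)%R%:E)%E.

Definition lp_cutoff (R : realType) (psi : R3 R -> R) : Prop :=
  [/\ test_fun (fun x => (psi x)%:C),
      forall x, 0 <= psi x,
      forall x, 1 < enorm x -> psi x = 0 &
      forall x, enorm x <= 2^-1 -> psi x = 1].

Definition lp_annulus (R : realType) (psi : R3 R -> R) : R3 R -> R :=
  fun xi => psi ((2^-1 : R) *: xi) - psi xi.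

(* Sum over the integers a <= l <= b, empty if b < a. *)
Definition sumZ (V : nmodType) (a b : int) (F : int -> V) : V :=
  if b - a + 1 is Posz n then \sum_(i < n) F (a + i%:Z) else 0.

(* Sum over the integers l >= a, as the limit of the partial sums, taken on real
   and imaginary parts. *)
Definition sumZ_ge (R : realType) (a : int) (F : int -> R[i]) : R[i] :=
  let S n := \sum_(i < n) F (a + i%:Z) in
  limn (fun n => complex.Re (S n) : R) +i* limn (fun n => complex.Im (S n) : R).

Definition lpDelta (R : realType) (psi : R3 R -> R) (k : int)
    (u : vfunctional R) : vfunctional R :=
  fun i => ifourierD
    (mulD (fun xi => lp_annulus psi ((2 : R) ^ (- k) *: xi)) (fourierD (u i))).

Definition lpS (R : realType) (psi : R3 R -> R) (k : int)
    (u : vfunctional R) : vfunctional R :=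
  fun i => ifourierD
    (mulD (fun xi => psi ((2 : R) ^ (- k) *: xi)) (fourierD (u i))).

Definition lpHigh (R : realType) (psi : R3 R -> R) (k : int)
    (u : vfunctional R) : vfunctional R :=
  fun i f => u i f - lpS psi k u i f.

Definition lpTilde (R : realType) (psi : R3 R -> R) (l : int)
    (u : vfunctional R) : vfunctional R :=
  fun i f => sumZ (l - 2) (l + 2) (fun l' => lpDelta psi l' u i f).

(* a . grad b . c; the gradient is taken in the distributional sense so that
   it does not depend on the choice of representative in [density]. *)
Definition convect (R : realType) (a b c : vfunctional R) : cfield R := fun x =>
  \sum_(i < 3) \sum_(j < 3)
    density (a j) x * density (derivD j (b i)) x * density (c i) x.

Definition theta (R : realType) (s : R) : R := (4 * s - 2) / (3 - 2 * s).

Lemma theta_itv (R : realType) (s : R) :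
  1 / 2 < s -> s < 5 / 6 -> 0 < theta s < 1.
Proof.
move=> s_gt s_lt; have d_gt0 : 0 < 3 - 2 * s by lra.
by rewrite /theta divr_gt0 //= ?ltr_pdivrMr //; lra.
Qed.

(* Main.v *)
Require Import Defs.
From HB Require Import structures.
From mathcomp Require Import all_boot all_order all_algebra.
From mathcomp Require Import complex ring lra.
From mathcomp Require Import all_classical all_reals all_analysis.
From mathcomp Require Import zify.
From mathcomp Require Import measurable_realfun.
Set Implicit Arguments.
Unset Strict Implicit.
Unset Printing Implicit Defensive.
Import Order.TTheory GRing.Theory Num.Theory.
Import numFieldNormedType.Exports.
Import ComplexField.Normc.
Local Open Scope classical_set_scope.
Local Open Scope complex_scope.
Local Open Scope ring_scope.

(* Let [T a b c] be the integral of [X(a) . grad X(b) . X(c)], where [X(m)] has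
   Fourier transform [m u^], let [psi_k] be the low-frequency multipliers and
   [w_k = 1 - psi_k]. Testing the equation with a divergence-free field which is
   the derivative of a cut-off potential of the frequency localization
   [(psi_k - psi_l) u] gives, since [T 1 v v = 0] for a divergence-free [u],
       int |xi|^(2s) |u^|^2 (psi_k - psi_l) = Q k - Q l,   Q k = T 1 psi_k w_k.
   By the Bernstein inequalities [Q l] tends to 0 as [l] tends to [-oo] because
   [3s < 5/2], so [Q k] tends to the energy as [k] tends to [+oo].

   It remains to decompose [Q k] as a paraproduct. The form [T a b c] vanishes when
   the frequency supports do not interact, i.e. when no three frequencies in the
   supports of [a], [b] and [c] add up to 0; this removes all but the three sums of
   the statement, up to truncating the low frequencies at [theta k] or [k/2]. The
   truncation errors are of order [2^(k (theta (3/2 - s) + 1 - 2s))] times a tail of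
   the energy, which is where the value of [theta] comes from, and
   [2^(k (5 - 10 s)/4)], and tend to 0.

   The densities of all the distributions in the statement are inverse Fourier
   transforms of explicit symbols; only [L^2] and [L^oo] bounds are used. *)

(** The obstacle is that [u] need not be square integrable: near 0 its spectrum is only $|\xi|^{-s}$
    times an $L^2$ function. So [u] is a bounded field plus a square integrable one, and
    $T\,1\,b\,c$ makes sense when [b] is a low-frequency multiplier, whose gradient field lies in
    $L^2\cap L^\infty$, and [c] a high-frequency one. This is why the flux has the form of [Q].
    Bernstein alone bounds [Q k] by $2^{k(5/2-3s)}$. Since $s<5/6$ this decays as $k\to-\infty$ but
    grows as $k\to+\infty$, where the paraproduct is needed. There $\theta$ makes the exponent of
    the first error exactly 0, so its decay comes from the tail of the energy alone; the threshold
    $k/2$ gives the others $\frac12(\frac52-s)-2s$, negative since $s>1/2$. A test field has compact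
    support, a frequency-localized one does not. An antisymmetric potential that is cut off first
    and differentiated afterwards is still exactly divergence free, so the pressure never enters.
    Removing the cutoff involves only the field and its first derivatives, whereas $|\xi|^{2s}\hat
    u$ may grow too fast to be in $L^2$; hence its splitting into a function and a divergence. *)

Section normc_facts.
Context {R : realType}.
Implicit Types z w : R[i].

Lemma complex_eq z w : complex.Re z = complex.Re w ->
  complex.Im z = complex.Im w -> z = w.
Proof. by case: z => a b; case: w => c d /= -> ->. Qed.

Lemma cReM z w : complex.Re (z * w) =
  complex.Re z * complex.Re w - complex.Im z * complex.Im w.
Proof. by case: z; case: w. Qed.

Lemma cImM z w : complex.Im (z * w) =
  complex.Re z * complex.Im w + complex.Im z * complex.Re w.
Proof. by case: z; case: w. Qed.

Lemma cReD z w : complex.Re (z + w) = complex.Re z + complex.Re w.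
Proof. by case: z; case: w. Qed.

Lemma cImD z w : complex.Im (z + w) = complex.Im z + complex.Im w.
Proof. by case: z; case: w. Qed.

Lemma cReN z : complex.Re (- z) = - complex.Re z.
Proof. by case: z. Qed.

Lemma cImN z : complex.Im (- z) = - complex.Im z.
Proof. by case: z. Qed.

Lemma cRe_conj z : complex.Re z^*%C = complex.Re z.
Proof. by case: z. Qed.

Lemma cIm_conj z : complex.Im z^*%C = - complex.Im z.
Proof. by case: z. Qed.

Lemma Re_le_normc z : `|complex.Re z| <= normc z.
Proof.
case: z => a b /=; rewrite -sqrtr_sqr ler_sqrt ?lerDl ?sqr_ge0//.
by rewrite addr_ge0 ?sqr_ge0.
Qed.

Lemma Im_le_normc z : `|complex.Im z| <= normc z.
Proof.
case: z => a b /=; rewrite -sqrtr_sqr ler_sqrt ?lerDr ?sqr_ge0//.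
by rewrite addr_ge0 ?sqr_ge0.
Qed.

Lemma normc_ge0 z : 0 <= normc z.
Proof. exact: le_trans (Re_le_normc z). Qed.

Lemma normc_le_ReIm z : normc z <= `|complex.Re z| + `|complex.Im z|.
Proof.
case: z => a b /=; rewrite -[leRHS]ger0_norm ?addr_ge0// -sqrtr_sqr ler_sqrt.
  rewrite sqrrD !real_normK ?num_real// lerD2r lerDl mulrn_wge0// mulr_ge0//.
exact: sqr_ge0.
Qed.

Lemma normc_sqr z : normc z ^+ 2 = complex.Re z ^+ 2 + complex.Im z ^+ 2.
Proof. by case: z => a b /=; rewrite sqr_sqrtr// addr_ge0 ?sqr_ge0. Qed.

Lemma normcM z w : normc (z * w) = normc z * normc w.
Proof. exact: normcM. Qed.

Lemma normcD z w : normc (z + w) <= normc z + normc w.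
Proof. exact: le_normcD. Qed.

Lemma normcN z : normc (- z) = normc z.
Proof. exact: normcN. Qed.

Lemma normcB z w : normc (z - w) <= normc z + normc w.
Proof. by rewrite -[normc w]normcN normcD. Qed.

Lemma normcC (x : R) : normc x%:C = `|x|.
Proof. by rewrite /= expr0n addr0 sqrtr_sqr. Qed.

Lemma normc_sum I (r : seq I) (P : pred I) (F : I -> R[i]) :
  normc (\sum_(i <- r | P i) F i) <= \sum_(i <- r | P i) normc (F i).
Proof.
elim/big_ind2 : _ => //; first by rewrite normc0.
by move=> x a y b xa yb; rewrite (le_trans (normcD _ _)) ?lerD.
Qed.

Lemma normcD_sqr z w : normc (z + w) ^+ 2 <= 2 * normc z ^+ 2 + 2 * normc w ^+ 2.
Proof.
have h : normc (z + w) ^+ 2 <= (normc z + normc w) ^+ 2.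
  by rewrite ler_sqr ?nnegrE ?addr_ge0 ?normc_ge0// normcD.
by apply: (le_trans h); have := sqr_ge0 (normc z - normc w); lra.
Qed.

Lemma conjcM z w : (z * w)^*%C = z^*%C * w^*%C.
Proof. by case: z => a b; case: w => c d /=; simpc; congr (_ +i* _); ring. Qed.

Lemma normc_conj z : normc z^*%C = normc z.
Proof. by case: z => a b /=; rewrite sqrrN. Qed.

Lemma mul_conjc z : z * z^*%C = (normc z ^+ 2)%:C.
Proof.
rewrite normc_sqr; case: z => a b /=; simpc; apply: complex_eq => /=; ring.
Qed.

End normc_facts.

Lemma measurable_sqrt (R : realType) : measurable_fun [set: R] (@Num.sqrt R).
Proof. by apply: continuous_measurable_fun; exact: sqrt_continuous. Qed.

(** * Complex-valued integrals *)

Section complex_integral.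
Context d (T : measurableType d) (R : realType).
Variable mu : {measure set T -> \bar R}.
Implicit Types (f g : T -> R[i]) (a b : T -> R).

Definition Cint f : R[i] :=
  (\int[mu]_x complex.Re (f x)) +i* (\int[mu]_x complex.Im (f x)).

Definition cmeas f := measurable_fun setT (fun x => complex.Re (f x)) /\
  measurable_fun setT (fun x => complex.Im (f x)).

Definition cinteg f := cmeas f /\ (\int[mu]_x (normc (f x))%:E < +oo)%E.

Lemma cmeas_cst (z : R[i]) : cmeas (fun=> z).
Proof. by split; exact: measurable_cst. Qed.

Lemma cmeas_real a : measurable_fun setT a -> cmeas (fun x => (a x)%:C).
Proof. by split => //=; exact: measurable_cst. Qed.

Lemma cmeasD f g : cmeas f -> cmeas g -> cmeas (fun x => f x + g x).
Proof.
move=> [f1 f2] [g1 g2]; split.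
  by under eq_fun do rewrite cReD; exact: measurable_funD.
by under eq_fun do rewrite cImD; exact: measurable_funD.
Qed.

Lemma cmeasN f : cmeas f -> cmeas (fun x => - f x).
Proof.
move=> [f1 f2]; split.
  by under eq_fun do rewrite cReN; exact: measurableT_comp.
by under eq_fun do rewrite cImN; exact: measurableT_comp.
Qed.

Lemma cmeasB f g : cmeas f -> cmeas g -> cmeas (fun x => f x - g x).
Proof. by move=> mf mg; apply: cmeasD => //; exact: cmeasN. Qed.

Lemma cmeasM f g : cmeas f -> cmeas g -> cmeas (fun x => f x * g x).
Proof.
move=> [f1 f2] [g1 g2]; split.
  by under eq_fun do rewrite cReM; apply: measurable_funB; exact: measurable_funM.
by under eq_fun do rewrite cImM; apply: measurable_funD; exact: measurable_funM.
Qed.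

Lemma cmeas_conj f : cmeas f -> cmeas (fun x => (f x)^*%C).
Proof.
move=> [f1 f2]; split.
  by under eq_fun do rewrite cRe_conj.
under eq_fun do rewrite cIm_conj.
exact: measurableT_comp.
Qed.

Lemma measurable_normc f : cmeas f -> measurable_fun setT (fun x => normc (f x)).
Proof.
move=> [f1 f2].
have -> : (fun x => normc (f x)) =
    (fun x => Num.sqrt (complex.Re (f x) ^+ 2 + complex.Im (f x) ^+ 2)).
  by apply/funext => x; case: (f x).
apply: (measurableT_comp (@measurable_sqrt R)); apply: measurable_funD;
  exact: measurable_funX.
Qed.

Lemma measurable_enormc f : cmeas f ->
  measurable_fun setT (fun x => (normc (f x))%:E).
Proof. by move=> mf; apply/measurable_EFinP; exact: measurable_normc. Qed.

Lemma cinteg_le f a : cmeas f -> measurable_fun setT a ->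
  (\int[mu]_x (a x)%:E < +oo)%E -> (forall x, normc (f x) <= a x) -> cinteg f.
Proof.
move=> mf ma fa le_fa; split => //; apply: le_lt_trans fa.
apply: ge0_le_integral => //.
- by move=> x _; rewrite lee_fin normc_ge0.
- exact: measurable_enormc.
- by apply/measurable_EFinP.
- by move=> x _; rewrite lee_fin.
Qed.

Lemma integrable_dom a f : cinteg f -> measurable_fun setT a ->
  (forall x, `|a x| <= normc (f x)) -> mu.-integrable setT (EFin \o a).
Proof.
move=> [mf foo] ma le_af; apply/integrableP; split; first exact/measurable_EFinP.
apply: le_lt_trans foo; apply: ge0_le_integral => //.
- by apply: measurableT_comp => //; exact/measurable_EFinP.
- exact: measurable_enormc.
- by move=> x _; rewrite lee_fin.
Qed.

Lemma integrableRe f : cinteg f ->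
  mu.-integrable setT (EFin \o (fun x => complex.Re (f x))).
Proof.
by move=> h; apply: (integrable_dom h) => [|x]; [case: h => -[]|exact: Re_le_normc].
Qed.

Lemma integrableIm f : cinteg f ->
  mu.-integrable setT (EFin \o (fun x => complex.Im (f x))).
Proof.
by move=> h; apply: (integrable_dom h) => [|x]; [case: h => -[]|exact: Im_le_normc].
Qed.

Lemma integrable_normc f : cinteg f ->
  mu.-integrable setT (EFin \o (fun x => normc (f x))).
Proof.
move=> h; apply: (integrable_dom h) => [|x]; first by apply: measurable_normc; case: h.
by rewrite ger0_norm ?normc_ge0.
Qed.

Lemma cintegD f g : cinteg f -> cinteg g -> cinteg (fun x => f x + g x).
Proof.
move=> [mf foo] [mg goo].
apply: (cinteg_le (a := fun x => normc (f x) + normc (g x))).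
- exact: cmeasD.
- by apply: measurable_funD; exact: measurable_normc.
- under eq_integral do rewrite EFinD.
  rewrite ge0_integralD//.
  + exact: lte_add_pinfty.
  + by move=> x _; rewrite lee_fin normc_ge0.
  + exact: measurable_enormc.
  + by move=> x _; rewrite lee_fin normc_ge0.
  + exact: measurable_enormc.
- by move=> x; exact: normcD.
Qed.

Lemma cintegMb f g (M : R) : cmeas f -> (forall x, normc (f x) <= M) ->
  cinteg g -> cinteg (fun x => f x * g x).
Proof.
move=> mf fM [mg goo].
(* The bound forces $M\ge0$ only if the type has a point; on an empty type the integral is over the
   empty set. *)
have M0 : 0 <= M \/ forall x : T, False.
  have [[x]|h] := pselect (inhabited T); last by right => x; exact/h/inhabits.
  by left; apply: le_trans (fM x); exact: normc_ge0.
case: M0 => M0; last first.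
  split; first exact: cmeasM.
  rewrite (_ : setT = set0) ?integral_set0//.
  by apply/seteqP; split => // x; case: (M0 x).
apply: (cinteg_le (a := fun x => M * normc (g x))).
- exact: cmeasM.
- by apply: measurable_funM; [exact: measurable_cst|exact: measurable_normc].
- under eq_integral do rewrite EFinM.
  rewrite ge0_integralZl//.
  + by rewrite lte_mul_pinfty.
  + exact: measurable_enormc.
  + by move=> x _; rewrite lee_fin normc_ge0.
- by move=> x; rewrite normcM ler_wpM2r ?normc_ge0.
Qed.

Lemma cintegZ (z : R[i]) f : cinteg f -> cinteg (fun x => z * f x).
Proof. exact: (cintegMb (M := normc z) (cmeas_cst z)). Qed.

Lemma cintegN f : cinteg f -> cinteg (fun x => - f x).
Proof.
by move=> fi; under eq_fun do rewrite -mulN1r; exact: cintegZ.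
Qed.

Lemma cintegB f g : cinteg f -> cinteg g -> cinteg (fun x => f x - g x).
Proof. by move=> fi gi; apply: cintegD => //; exact: cintegN. Qed.

Lemma cinteg0 : cinteg (fun=> 0).
Proof.
split; first exact: cmeas_cst.
by under eq_integral do rewrite normc0; rewrite integral0.
Qed.

Lemma cinteg_sum I (r : seq I) (F : I -> T -> R[i]) :
  (forall i, cinteg (F i)) -> cinteg (fun x => \sum_(i <- r) F i x).
Proof.
move=> mF; elim: r => [|i r IH].
  under eq_fun do rewrite big_nil; exact: cinteg0.
under eq_fun do rewrite big_cons; exact: cintegD.
Qed.

Lemma CintD f g : cinteg f -> cinteg g ->
  Cint (fun x => f x + g x) = Cint f + Cint g.
Proof.
move=> fi gi; apply: complex_eq => /=.
  rewrite -RintegralD//; [|exact: integrableRe..].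
  by apply: eq_Rintegral => x _; rewrite cReD.
rewrite -RintegralD//; [|exact: integrableIm..].
by apply: eq_Rintegral => x _; rewrite cImD.
Qed.

Lemma CintZ (z : R[i]) f : cinteg f -> Cint (fun x => z * f x) = z * Cint f.
Proof.
move=> fi; have fr := integrableRe fi; have fim := integrableIm fi.
have Zr (c : R) (h : T -> R) : mu.-integrable setT (EFin \o h) ->
  mu.-integrable setT (EFin \o (fun x => c * h x)).
  move=> hi; rewrite (_ : _ \o _ = (fun x => c%:E * (EFin \o h) x)%E)//.
  exact: integrableZl.
apply: complex_eq; rewrite ?cReM ?cImM /=.
  rewrite -!RintegralZl// -RintegralB//; [|exact: Zr..].
  by apply: eq_Rintegral => x _; rewrite cReM.
rewrite -!RintegralZl// -RintegralD//; [|exact: Zr..].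
by apply: eq_Rintegral => x _; rewrite cImM.
Qed.

Lemma CintN f : cinteg f -> Cint (fun x => - f x) = - Cint f.
Proof.
by move=> fi; under eq_fun do rewrite -mulN1r; rewrite CintZ// mulN1r.
Qed.

Lemma CintB f g : cinteg f -> cinteg g ->
  Cint (fun x => f x - g x) = Cint f - Cint g.
Proof. by move=> fi gi; rewrite CintD ?CintN//; exact: cintegN. Qed.

Lemma Cint0 : Cint (fun=> 0) = 0.
Proof. by rewrite /Cint /= !Rintegral_cst// !mul0r. Qed.

Lemma Cint_sum I (r : seq I) (F : I -> T -> R[i]) :
  (forall i, cinteg (F i)) ->
  Cint (fun x => \sum_(i <- r) F i x) = \sum_(i <- r) Cint (F i).
Proof.
move=> mF; elim: r => [|i r IH].
  by under eq_fun do rewrite big_nil; rewrite big_nil Cint0.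
under eq_fun do rewrite big_cons.
by rewrite CintD// ?IH ?big_cons//; exact: cinteg_sum.
Qed.

Lemma Cint_conj f : cinteg f -> Cint (fun x => (f x)^*%C) = (Cint f)^*%C.
Proof.
move=> fi; apply: complex_eq => /=.
  by apply: eq_Rintegral => x _; case: (f x).
rewrite -mulN1r -RintegralZl//; last exact: integrableIm.
by apply: eq_Rintegral => x _; case: (f x) => p q /=; rewrite mulN1r.
Qed.

Lemma cinteg_conj f : cinteg f -> cinteg (fun x => (f x)^*%C).
Proof.
move=> [mf foo]; split; first exact: cmeas_conj.
by under eq_integral do rewrite normc_conj.
Qed.

(** The factor 2 comes from estimating real and imaginary parts separately, which is enough for
    convergence. The constant 1, needed for sharp $L^2$ bounds, is obtained in [normc_Cint_le1]. *)
Lemma normc_Cint_le f : cinteg f ->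
  ((normc (Cint f))%:E <= 2%:E * \int[mu]_x (normc (f x))%:E)%E.
Proof.
move=> fi; have ni := integrable_normc fi.
have -> : (\int[mu]_x (normc (f x))%:E)%E = (\int[mu]_x normc (f x))%:E.
  rewrite /Rintegral fineK//; exact: integrable_fin_num.
rewrite -EFinM lee_fin; apply: (le_trans (normc_le_ReIm _)) => /=.
rewrite mulr_natl mulr2n; apply: lerD.
  apply: (le_trans (le_normr_Rintegral _ (integrableRe fi))) => //.
  apply: le_Rintegral => //; last by move=> x _; exact: Re_le_normc.
  by have := integrable_norm (integrableRe fi).
apply: (le_trans (le_normr_Rintegral _ (integrableIm fi))) => //.
apply: le_Rintegral => //; last by move=> x _; exact: Im_le_normc.
by have := integrable_norm (integrableIm fi).
Qed.

Lemma eq_Cint f g : f =1 g -> Cint f = Cint g.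
Proof. by move=> /funext ->. Qed.

Lemma ae_Cint f g : cmeas f -> cmeas g -> {ae mu, forall x, f x = g x} ->
  Cint f = Cint g.
Proof.
move=> [f1 f2] [g1 g2] fg; apply: complex_eq => /=; rewrite /Rintegral;
  congr fine; apply: ae_eq_integral => //; try exact/measurable_EFinP.
- by apply: filterS fg => x ->.
- by apply: filterS fg => x ->.
Qed.

Lemma ae_cinteg f g : cinteg f -> cmeas g -> {ae mu, forall x, f x = g x} ->
  cinteg g.
Proof.
move=> [mf foo] mg fg; split => //.
rewrite -(@ae_eq_integral _ _ _ _ _ _ (fun x => (normc (f x))%:E))//.
- exact: measurable_enormc.
- exact: measurable_enormc.
- by apply: filterS fg => x ->.
Qed.

Lemma cinteg_real a : measurable_fun setT a ->
  (\int[mu]_x `|a x|%:E < +oo)%E -> cinteg (fun x => (a x)%:C).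
Proof.
move=> ma aoo; split; first exact: cmeas_real.
by under eq_integral do rewrite normcC.
Qed.

Lemma dominated0 (g_ : nat -> T -> R) (G : T -> R) :
  (forall n, measurable_fun setT (g_ n)) -> measurable_fun setT G ->
  (\int[mu]_x (G x)%:E < +oo)%E ->
  {ae mu, forall x, forall n, 0 <= g_ n x <= G x} ->
  {ae mu, forall x, g_ ^~ x @ \oo --> (0 : R)} ->
  (\int[mu]_x (g_ n x)%:E)%E @[n --> \oo] --> 0%E.
Proof.
move=> mg mG Goo gG g0.
(* [G] is known to be nonnegative only almost everywhere, so its positive part serves as the
   majorant. *)
have iG : mu.-integrable setT (EFin \o (fun x => Num.max (G x) 0)).
  apply/integrableP; split.
    by apply/measurable_EFinP; apply: measurable_maxr.
  apply: le_lt_trans Goo; rewrite le_eqVlt; apply/orP; left; apply/eqP.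
  apply: ae_eq_integral => //.
  - by apply: measurableT_comp => //; apply/measurable_EFinP; exact: measurable_maxr.
  - exact/measurable_EFinP.
  - apply: filterS gG => x /(_ 0%N)/andP[h1 h2] _ /=; congr EFin.
    have G0 := le_trans h1 h2.
    by rewrite max_l// ger0_norm.
have := @dominated_convergence _ _ _ mu setT measurableT
  (fun n x => (g_ n x)%:E) (fun=> 0%E) _ _ _ _ iG _.
case=> //.
- by move=> n; exact/measurable_EFinP.
- apply: filterS g0 => x h _; exact: (cvg_comp _ _ h).
- apply: filterS gG => x h n _ /=; have /andP[h1 h2] := h n.
  by rewrite lee_fin ger0_norm// le_max h2.
- by move=> _ _; rewrite integral0.
Qed.

Lemma dominated_Cint (f_ : nat -> T -> R[i]) f (G : T -> R) :
  (forall n, cinteg (f_ n)) -> cinteg f -> measurable_fun setT G ->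
  (\int[mu]_x (G x)%:E < +oo)%E ->
  {ae mu, forall x, forall n, normc (f_ n x - f x) <= G x} ->
  {ae mu, forall x, (fun n => normc (f_ n x - f x)) @ \oo --> (0 : R)} ->
  (fun n => normc (Cint (f_ n) - Cint f)) @ \oo --> (0 : R).
Proof.
move=> fni fi mG Goo fG f0.
have h : (\int[mu]_x (normc (f_ n x - f x))%:E)%E @[n --> \oo] --> 0%E.
  apply: (dominated0 (G := G)) => //.
  - move=> n; apply: measurable_normc; apply: cmeasB; [exact: (fni n).1|exact: fi.1].
  - by apply: filterS fG => x hx n; rewrite normc_ge0 hx.
have h2 : (2%:E * \int[mu]_x (normc (f_ n x - f x))%:E)%E @[n --> \oo] --> (0 : \bar R)%E.
  by rewrite -[X in _ --> X](mule0 2%:E); apply: cvgeZl.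

have h3 : (normc (Cint (f_ n) - Cint f))%:E @[n --> \oo] --> (0 : R)%:E.
  apply: (@squeeze_cvge _ _ _ _ (fun=> 0%E) _ _ _ _ _ h2); last exact: cvg_cst.
  apply: nearW => n; rewrite lee_fin normc_ge0 andTb -CintB//.
  by apply: normc_Cint_le; exact: cintegB.
by have /fine_cvgP[_] := h3.
Qed.

Lemma cauchy_schwarz (a b : T -> R) (p q : R) :
  measurable_fun setT a -> measurable_fun setT b -> 0 <= p -> 0 <= q ->
  (\int[mu]_x (a x ^+ 2)%:E <= (p ^+ 2)%:E)%E ->
  (\int[mu]_x (b x ^+ 2)%:E <= (q ^+ 2)%:E)%E ->
  (\int[mu]_x `|a x * b x|%:E <= (p * q)%:E)%E.
Proof.
move=> ma mb p0 q0 ap bq.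
(* Strictly larger [p'] and [q'] can be divided by; the case of a zero norm then follows by letting
   them decrease. *)
have key p' q' : p < p' -> q < q' -> (\int[mu]_x `|a x * b x|%:E <= (p' * q')%:E)%E.
  move=> pp' qq'.
  have p'0 : 0 < p' by exact: le_lt_trans pp'.
  have q'0 : 0 < q' by exact: le_lt_trans qq'.
  have ap' : (\int[mu]_x (a x ^+ 2)%:E <= (p' ^+ 2)%:E)%E.
    by apply: (le_trans ap); rewrite lee_fin ler_sqr ?nnegrE// ltW.
  have bq' : (\int[mu]_x (b x ^+ 2)%:E <= (q' ^+ 2)%:E)%E.
    by apply: (le_trans bq); rewrite lee_fin ler_sqr ?nnegrE// ltW.
  (* These weights make $tA^2+rB^2-AB$ a multiple of a square and give $tp'^2+rq'^2=p'q'$. *)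
  pose t := q' / (2 * p'); pose r := p' / (2 * q').
  have t0 : 0 < t by rewrite divr_gt0// mulr_gt0.
  have r0 : 0 < r by rewrite divr_gt0// mulr_gt0.
  have ma2 : measurable_fun setT (fun x => (a x ^+ 2)%:E).
    by apply/measurable_EFinP; exact: measurable_funX.
  have mb2 : measurable_fun setT (fun x => (b x ^+ 2)%:E).
    by apply/measurable_EFinP; exact: measurable_funX.
  apply: (@le_trans _ _ (\int[mu]_x (t%:E * (a x ^+ 2)%:E + r%:E * (b x ^+ 2)%:E))%E).
    apply: ge0_le_integral => //.
    - by apply/measurable_EFinP; apply: measurableT_comp => //; exact: measurable_funM.
    - by apply: emeasurable_funD; exact: measurable_funeM.
    - move=> x _; rewrite -!EFinM -EFinD lee_fin /t /r normrM.
      rewrite -(real_normK (num_real (a x))) -(real_normK (num_real (b x))).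
      set A := `|a x|; set B := `|b x|.
      have -> : q' / (2 * p') * A ^+ 2 + p' / (2 * q') * B ^+ 2 =
        A * B + (q' * A - p' * B) ^+ 2 / (2 * p' * q') by field; lra.
      by rewrite lerDl divr_ge0 ?sqr_ge0// !mulr_ge0// ltW.
  rewrite ge0_integralD//; last 4 first.
  - by move=> x _; rewrite -EFinM lee_fin mulr_ge0 ?sqr_ge0// ltW.
  - exact: measurable_funeM.
  - by move=> x _; rewrite -EFinM lee_fin mulr_ge0 ?sqr_ge0// ltW.
  - exact: measurable_funeM.
  rewrite !ge0_integralZl ?lee_fin ?(ltW t0) ?(ltW r0)//; last 2 first.
  - by move=> x _; rewrite lee_fin sqr_ge0.
  - by move=> x _; rewrite lee_fin sqr_ge0.
  apply: (@le_trans _ _ (t%:E * (p' ^+ 2)%:E + r%:E * (q' ^+ 2)%:E)%E).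
    by apply: leeD; apply: lee_wpmul2l; rewrite ?lee_fin// ltW.
  by rewrite -!EFinM -EFinD lee_fin le_eqVlt; apply/orP; left; apply/eqP;
    rewrite /t /r; field; lra.
apply/lee_addgt0Pr => e e0; rewrite -EFinD.
(* For $m\le1$ one has $(p+m)(q+m)-pq=m(p+q+m)\le m(p+q+1)$. *)
have [e' [e'0 he]] : exists e', 0 < e' /\ (p + e') * (q + e') <= p * q + e.
  exists (Num.min 1 (e / (p + q + 1))).
  have d0 : 0 < p + q + 1 by lra.
  have m0 : 0 < Num.min 1 (e / (p + q + 1)) by rewrite lt_min ltr01 divr_gt0.
  split => //; set m := Num.min _ _ in m0 *.
  have m1 : m <= 1 by rewrite ge_min lexx.
  have m2 : m * (p + q + 1) <= e by rewrite -ler_pdivlMr// ge_min lexx orbT.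
  have : m * m <= m * 1 by rewrite ler_wpM2l// ltW.
  lra.
by apply: (le_trans (key (p + e') (q + e') _ _)); rewrite ?ltrDl ?lee_fin.
Qed.

End complex_integral.
Arguments Cint : simpl never.

(** * Fubini's theorem for complex-valued integrals *)

Section complex_fubini.
Context d1 d2 (T1 : measurableType d1) (T2 : measurableType d2) (R : realType).
Variables (m1 : {sigma_finite_measure set T1 -> \bar R})
  (m2 : {sigma_finite_measure set T2 -> \bar R}).

Lemma Cint_Fubini (f : T1 * T2 -> R[i]) : cinteg (m1 \x m2)%E f ->
  Cint m1 (fun x => Cint m2 (fun y => f (x, y))) =
  Cint m2 (fun y => Cint m1 (fun x => f (x, y))).
Proof.
move=> fi.
have key (h : T1 * T2 -> R) : (m1 \x m2)%E.-integrable setT (EFin \o h) ->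
  \int[m1]_x \int[m2]_y h (x, y) = \int[m2]_y \int[m1]_x h (x, y).
  move=> hi; have := Fubini hi => /= FF.
  rewrite /Rintegral.
  (* [Rintegral] applies [fine] to the inner integral, which changes it only on the null set where
     it is not finite. *)
  have -> : (\int[m1]_x (fine (\int[m2]_y (h (x, y))%:E))%:E = 
             \int[m1]_x \int[m2]_y (h (x, y))%:E)%E.
    have ae := ae_integrable1 hi.
    have mm := measurable_fubini_F hi.
    apply: ae_eq_integral => //.
      by apply/measurable_EFinP; apply: measurableT_comp => //; exact: mm.
    by apply: filterS ae => x hx _; rewrite /= fineK// integrable_fin_num.
  have -> : (\int[m2]_y (fine (\int[m1]_x (h (x, y))%:E))%:E = 
             \int[m2]_y \int[m1]_x (h (x, y))%:E)%E.
    have ae := ae_integrable2 hi.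
    have mm := measurable_fubini_G hi.
    apply: ae_eq_integral => //.
      by apply/measurable_EFinP; apply: measurableT_comp => //; exact: mm.
    by apply: filterS ae => x hx _; rewrite /= fineK// integrable_fin_num.
  by rewrite FF.
apply: complex_eq; rewrite /Cint /=.
  by apply: (key (fun z => complex.Re (f z))); exact: integrableRe.
by apply: (key (fun z => complex.Im (f z))); exact: integrableIm.
Qed.

Lemma Cint_Fubini1 (f : T1 * T2 -> R[i]) : cinteg (m1 \x m2)%E f ->
  Cint m1 (fun x => Cint m2 (fun y => f (x, y))) = Cint (m1 \x m2)%E f.
Proof.
move=> fi.
have key (h : T1 * T2 -> R) : (m1 \x m2)%E.-integrable setT (EFin \o h) ->
  \int[m1]_x \int[m2]_y h (x, y) = \int[(m1 \x m2)%E]_z h z.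
  move=> hi; have := integral12_prod_meas1 hi => /= FF.
  rewrite /Rintegral.
  have -> : (\int[m1]_x (fine (\int[m2]_y (h (x, y))%:E))%:E = 
             \int[m1]_x \int[m2]_y (h (x, y))%:E)%E.
    have ae := ae_integrable1 hi.
    have mm := measurable_fubini_F hi.
    apply: ae_eq_integral => //.
      by apply/measurable_EFinP; apply: measurableT_comp => //; exact: mm.
    by apply: filterS ae => x hx _; rewrite /= fineK// integrable_fin_num.
  by rewrite -FF.
apply: complex_eq; rewrite /Cint /=.
  by apply: (key (fun z => complex.Re (f z))); exact: integrableRe.
by apply: (key (fun z => complex.Im (f z))); exact: integrableIm.
Qed.

Lemma cmeas_fst (f : T1 -> R[i]) : cmeas f -> cmeas (fun z : T1 * T2 => f z.1).
Proof.
by move=> [f1 f2]; split; [exact: (measurableT_comp f1)|exact: (measurableT_comp f2)].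
Qed.

Lemma cmeas_snd (f : T2 -> R[i]) : cmeas f -> cmeas (fun z : T1 * T2 => f z.2).
Proof.
by move=> [f1 f2]; split; [exact: (measurableT_comp f1)|exact: (measurableT_comp f2)].
Qed.

(** [e] is typically the character $e^{ix\cdot\xi}$: this supplies the integrability behind Fubini's
    theorem for Fourier integrals. *)
Lemma cinteg_prod (f : T1 -> R[i]) (g : T2 -> R[i]) (e : T1 * T2 -> R[i]) (M : R) :
  cinteg m1 f -> cinteg m2 g -> cmeas e -> (forall z, normc (e z) <= M) ->
  cinteg (m1 \x m2)%E (fun z => e z * (f z.1 * g z.2)).
Proof.
move=> [mf foo] [mg goo] me eM; apply: (cintegMb me eM); split.
  by apply: cmeasM; [exact: cmeas_fst|exact: cmeas_snd].
rewrite fubini_tonelli1//=; last 2 first.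
- by apply: measurable_enormc; apply: cmeasM; [exact: cmeas_fst|exact: cmeas_snd].
- by move=> z; rewrite lee_fin normc_ge0.
rewrite /fubini_F /=.
under eq_integral do under eq_integral do rewrite normcM EFinM.
under eq_integral => x _ do (rewrite ge0_integralZl ?lee_fin ?normc_ge0//;
  [|exact: measurable_enormc|by move=> y _; rewrite lee_fin normc_ge0]).
rewrite ge0_integralZr//.
- rewrite lte_mul_pinfty ?integral_ge0// ?ge0_fin_numE ?integral_ge0//;
  by move=> x _; rewrite lee_fin normc_ge0.
- exact: measurable_enormc.
- by move=> x _; rewrite lee_fin normc_ge0.
- by apply: integral_ge0 => x _; rewrite lee_fin normc_ge0.
Qed.

Lemma cinteg_tensor (f : T1 -> R[i]) (g : T2 -> R[i]) : cinteg m1 f ->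
  cinteg m2 g -> cinteg (m1 \x m2)%E (fun z => f z.1 * g z.2).
Proof.
move=> fi gi; under eq_fun do rewrite -[_ * _]mul1r.
by apply: (cinteg_prod (e := fun=> 1) (M := 1)) => // z; rewrite normc1.
Qed.

Lemma Cint_prod (f : T1 -> R[i]) (g : T2 -> R[i]) : cinteg m1 f -> cinteg m2 g ->
  Cint (m1 \x m2)%E (fun z => f z.1 * g z.2) = Cint m1 f * Cint m2 g.
Proof.
move=> fi gi; rewrite -Cint_Fubini1/=; last exact: cinteg_tensor.
under eq_fun do rewrite CintZ// mulrC.
by rewrite CintZ// mulrC.
Qed.

End complex_fubini.

Notation M3 R := (measurableTypeR R * measurableTypeR R * measurableTypeR R)%type.

(** The exhaustions are taken monotone so that every point of the product lies in a rectangle whose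
    two sides have the same index. *)
Lemma prod_sigma_finite d1 d2 (T1 : measurableType d1) (T2 : measurableType d2)
  (R : realType) (m1 : {sigma_finite_measure set T1 -> \bar R})
  (m2 : {sigma_finite_measure set T2 -> \bar R}) : sigma_finite setT (m1 \x m2)%E.
Proof.
have /sigma_finiteP[F [TF ndF Foo]] := sigma_finiteT m1.
have /sigma_finiteP[G [TG ndG Goo]] := sigma_finiteT m2.
exists (fun n => F n `*` G n).
  rewrite -setXTT TF TG predeqE => -[x y]; split.
    move=> [/= [n _ Fnx] [k _ Gky]]; exists (maxn n k) => //; split.
    - by move: x Fnx; exact/subsetPset/ndF/leq_maxl.
    - by move: y Gky; exact/subsetPset/ndG/leq_maxr.
  by move=> [n _ []/= ? ?]; split; exists n.
move=> k; have [? ?] := Foo k; have [? ?] := Goo k.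
split; first exact: measurableX.
by rewrite product_measure1E// lte_mul_pinfty// ge0_fin_numE.
Qed.

Definition sfprod d1 d2 (T1 : measurableType d1) (T2 : measurableType d2)
    (R : realType) (m1 : {sigma_finite_measure set T1 -> \bar R})
    (m2 : {sigma_finite_measure set T2 -> \bar R}) :
    {sigma_finite_measure set (T1 * T2)%type -> \bar R} :=
  HB.pack_for {sigma_finite_measure set (T1 * T2)%type -> \bar R} (m1 \x m2)%E
    (Measure_isSigmaFinite.Build _ _ _ (m1 \x m2)%E (prod_sigma_finite m1 m2)).

(* [leb3] with its sigma-finiteness, as required by the Fubini theorems. *)
Definition leb3s (R : realType) : {sigma_finite_measure set (M3 R) -> \bar R} :=
  sfprod (sfprod (@lebesgue_measure R) (@lebesgue_measure R)) (@lebesgue_measure R).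

Lemma cintE (R : realType) (f : cfield R) : cint f = Cint (leb3 R) f.
Proof. by []. Qed.

(** * Lebesgue measure on R^3 *)

Section change_of_variables.
Context {R : realType}.

(** The image of [m] under [phi] is [c] times [m]; it is phrased with integrals of nonnegative
    functions so that it passes to products by Tonelli's theorem. *)
Definition scaling d (T : measurableType d) (m : {measure set T -> \bar R})
    (phi : T -> T) (c : R) := measurable_fun setT phi /\
  forall f : T -> \bar R, measurable_fun setT f -> (forall x, (0 <= f x)%E) ->
    (\int[m]_x f (phi x) = c%:E * \int[m]_x f x)%E.

(** Uniqueness of Lebesgue measure: $|r|$ times the image measure gives every half-open interval its
    length. *)
Lemma scaling1 (r a : R) : r != 0 ->
  scaling (@lebesgue_measure R) (fun x => r * x + a) `|r|^-1.
Proof.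
move=> r0; have mphi : measurable_fun [set: measurableTypeR R] (fun x : R => r * x + a).
  by apply: measurable_funD => //; exact: measurable_funM.
split => // f mf f0.
have c0 : 0 <= `|r| by [].
pose pm : {measure set (measurableTypeR R) -> \bar R} :=
  @measure_function_pushforward__canonical__measure_function_Measure
  _ _ (measurableTypeR R) (measurableTypeR R) R (@lebesgue_measure R) _ mphi.
pose m' : {measure set (measurableTypeR R) -> \bar R} := mscale (NngNum c0) pm.
have r1 : 0 < `|r| by rewrite normr_gt0.
have key : forall A, measurable A -> @lebesgue_measure R A = m' A.
  apply: lebesgue_measure_unique => X [[c e] _ <-].
  transitivity (`|r|%:E * @lebesgue_measure R ((fun x : R => r * x + a)%R @^-1` `]c, e]%classic))%E; last by [].
  have [r_gt|r_lt|] := ltgtP 0 r; last by move=> h; rewrite -h eqxx in r0.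
    have -> : (fun x : R => r * x + a) @^-1` `]c, e]%classic =
        `](c - a) / r, (e - a) / r]%classic.
      apply/seteqP; split => x /=; rewrite !in_itv /= ltr_pdivrMr// ler_pdivlMr//; lra.
    rewrite !lebesgue_measure_itv /= !lte_fin ltr_pM2r ?invr_gt0// ltrD2r.
    case: ifP => _; last by rewrite mule0.
    by rewrite -!EFinB -EFinM gtr0_norm//; congr EFin; field; lra.
  (* For $r<0$ the preimage is closed on the left and open on the right, which leaves its length
     unchanged. *)
  have -> : (fun x : R => r * x + a) @^-1` `]c, e]%classic =
      `[(e - a) / r, (c - a) / r[%classic.
    apply/seteqP; split => x /=; rewrite !in_itv /= ltr_ndivlMr// ler_ndivrMr//; lra.
  rewrite !lebesgue_measure_itv /= !lte_fin ltr_nM2r ?invr_lt0// ltrD2r.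
  case: ifP => _; last by rewrite mule0.
  by rewrite -!EFinB -EFinM ltr0_norm//; congr EFin; field; lra.
have -> : (\int[@lebesgue_measure R]_x f x = \int[m']_x f x)%E.
  by apply: eq_measure_integral => A mA _; exact: key.
rewrite /m' ge0_integral_mscale//= ge0_integral_pushforward//=.
by rewrite muleA -EFinM mulVf ?gt_eqF// mul1e.
Qed.

Lemma scaling_prod d1 d2 (T1 : measurableType d1) (T2 : measurableType d2)
  (m1 : {sigma_finite_measure set T1 -> \bar R})
  (m2 : {sigma_finite_measure set T2 -> \bar R}) phi1 phi2 (c1 c2 : R) :
  0 <= c1 -> 0 <= c2 ->
  scaling m1 phi1 c1 -> scaling m2 phi2 c2 ->
  scaling (sfprod m1 m2) (fun z => (phi1 z.1, phi2 z.2)) (c1 * c2).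
Proof.
move=> c10 c20 [mphi1 h1] [mphi2 h2].
have mphi : measurable_fun [set: T1 * T2] (fun z => (phi1 z.1, phi2 z.2)).
  by apply: measurable_fun_pair; exact: measurableT_comp.
split => // f mf f0; rewrite /= !fubini_tonelli1//; last exact: measurableT_comp.
rewrite /fubini_F /=.
have mF : measurable_fun setT (fun x => \int[m2]_y f (x, y))%E.
  exact: (measurable_fun_fubini_tonelli_F f).
transitivity (\int[m1]_x (c2%:E * \int[m2]_y f (phi1 x, y)))%E.
  apply: eq_integral => x _; rewrite (h2 (fun y => f (phi1 x, y)))//.
  by apply: measurableT_comp => //; exact: measurable_fun_pair.
rewrite ge0_integralZl; [|by []|exact: (measurableT_comp mF mphi1)| |by []]; last first.
  by move=> x _; exact: integral_ge0.
rewrite (h1 (fun x => \int[m2]_y f (x, y)))%E//.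
  by rewrite muleA -EFinM (mulrC c2).
by move=> x; exact: integral_ge0.
Qed.

Lemma scaling_leb3 (r : R) (a : R3 R) : r != 0 ->
  scaling (leb3 R) (fun x : M3 R => r *: (x : R3 R) + a : R3 R) (`|r| ^- 3).
Proof.
move=> r0.
have -> : (fun x : M3 R => r *: (x : R3 R) + a : R3 R) =
  (fun z : M3 R => (((r * z.1.1 + a.1.1) , (r * z.1.2 + a.1.2)), r * z.2 + a.2)).
  by apply/funext => -[[x y] z]; case: a => -[a1 a2] a3.
have -> : `|r| ^- 3 = `|r|^-1 * `|r|^-1 * `|r|^-1.
  by rewrite -exprVn !exprS expr0 mulr1 mulrA.
have n0 : 0 <= `|r|^-1 by rewrite invr_ge0.
have h12 := scaling_prod n0 n0 (scaling1 a.1.1 r0) (scaling1 a.1.2 r0).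
exact: (scaling_prod (mulr_ge0 n0 n0) n0 h12 (scaling1 a.2 r0)).
Qed.

Lemma measurable_aff (r : R) (a : R3 R) : r != 0 ->
  measurable_fun [set: M3 R] (fun x : M3 R => r *: (x : R3 R) + a : M3 R).
Proof. by move=> r0; have [] := scaling_leb3 a r0. Qed.

Lemma cmeas_aff (r : R) (a : R3 R) (f : cfield R) : r != 0 ->
  cmeas (T := M3 R) f -> cmeas (T := M3 R) (fun x => f (r *: x + a)).
Proof.
move=> r0 [f1 f2]; have mphi := measurable_aff a r0.
by split; [exact: (measurableT_comp f1 mphi)|exact: (measurableT_comp f2 mphi)].
Qed.

Lemma cinteg_aff (r : R) (a : R3 R) (f : cfield R) : r != 0 ->
  cinteg (leb3 R) f -> cinteg (leb3 R) (fun x => f (r *: x + a)).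
Proof.
move=> r0 [mf foo]; split; first exact: cmeas_aff.
have [_ /(_ (fun x => (normc (f x))%:E)) ->] := scaling_leb3 a r0.
- by rewrite lte_mul_pinfty// lee_fin invr_ge0 exprn_ge0.
- exact: measurable_enormc.
- by move=> x; rewrite lee_fin normc_ge0.
Qed.

Lemma Cint_aff (r : R) (a : R3 R) (f : cfield R) : r != 0 ->
  cinteg (leb3 R) f ->
  Cint (leb3 R) (fun x => f (r *: x + a)) = (`|r| ^- 3)%:C * Cint (leb3 R) f.
Proof.
move=> r0 fi.
have key (h : R3 R -> R) : (leb3 R).-integrable setT (EFin \o h) ->
  (leb3 R).-integrable setT (EFin \o (fun x : M3 R => h (r *: (x : R3 R) + a))) ->
  \int[leb3 R]_x h (r *: x + a) = `|r| ^- 3 * \int[leb3 R]_x h x.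
  move=> hi hi'.
  have [mphi H] := scaling_leb3 a r0.
  have mh : measurable_fun setT (EFin \o h) by exact: measurable_int hi.
  rewrite /Rintegral; set c := _ ^- 3.
  (* [scaling_leb3] is about nonnegative functions, so positive and negative parts are treated
     separately. *)
  have -> : (\int[leb3 R]_x (h (r *: x + a))%:E = c%:E * \int[leb3 R]_x (h x)%:E)%E.
    rewrite [LHS]integralE [in RHS]integralE muleBr//; last exact: integrable_add_def.
    rewrite -!H//.
    - by congr (_ - _)%E; apply: eq_integral => x _; rewrite ?funeposE ?funenegE.
    - exact: measurable_funeneg.
    - exact: measurable_funepos.
  by rewrite fineM// integrable_fin_num.
have fi' := cinteg_aff a r0 fi.
apply: complex_eq; rewrite ?cReM ?cImM /Cint /= !mul0r ?subr0 ?addr0.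
  by rewrite (key (fun x => complex.Re (f x)))//; exact: integrableRe.
by rewrite (key (fun x => complex.Im (f x)))//; exact: integrableIm.
Qed.

End change_of_variables.

Lemma cinteg3_le (R : realType) (f : cfield R) (a : R3 R -> R) :
  cmeas (T := M3 R) f -> measurable_fun [set: M3 R] (a : M3 R -> R) ->
  (\int[leb3 R]_x (a x)%:E < +oo)%E -> (forall x, normc (f x) <= a x) ->
  cinteg (leb3 R) f.
Proof. exact: (@cinteg_le _ (M3 R) R (leb3 R) f a). Qed.

(** * Integrable weights on R^3 *)

Section weights.
Context {R : realType}.
Local Notation leb := (@lebesgue_measure R).

Lemma integralT_oneDsqrV :
  (\int[leb]_x ((1 + x ^+ 2)^-1)%:E = pi%:E :> \bar R)%E.
Proof.
have h0 (x : R) : 0 < 1 + x ^+ 2 by rewrite ltr_wpDr// sqr_ge0.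
rewrite ge0_symfun_integralT.
- rewrite (_ : [set x : R | 0 <= x] = `[0, +oo[%classic); last first.
    by apply/seteqP; split => x /=; rewrite in_itv /= andbT.
  have := @integral0y_oneDsqr R; rewrite /oneDsqr => ->.
  by rewrite -EFinM; congr EFin; field.
- by move=> x; rewrite invr_ge0 ltW.
- exact: continuous_oneDsqrV.
- by move=> x /=; rewrite sqrrN.
Qed.

Definition prod3 (p q r : R -> R[i]) : cfield R := fun x => p x.1.1 * q x.1.2 * r x.2.

Lemma cinteg_prod3 p q r : cinteg leb p -> cinteg leb q -> cinteg leb r ->
  cinteg (leb3 R) (prod3 p q r).
Proof.
move=> hp hq hr.
have h1 : cinteg (sfprod leb leb) (fun z => p z.1 * q z.2).
  exact: cinteg_tensor.
exact: (cinteg_tensor h1 hr).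
Qed.

Lemma Cint_prod3 p q r : cinteg leb p -> cinteg leb q -> cinteg leb r ->
  Cint (leb3 R) (prod3 p q r) = Cint leb p * Cint leb q * Cint leb r.
Proof.
move=> hp hq hr.
have h1 : cinteg (sfprod leb leb) (fun z => p z.1 * q z.2).
  exact: cinteg_tensor.
rewrite -(Cint_prod hp hq); exact: (@Cint_prod _ _ _ _ R (sfprod leb leb) leb _ _ h1 hr).
Qed.

Definition cauchyw (x : R) : R := (1 + x ^+ 2)^-1.

Lemma cauchyw_gt0 x : 0 < cauchyw x.
Proof. by rewrite invr_gt0 ltr_wpDr// sqr_ge0. Qed.

Lemma measurable_cauchyw : measurable_fun [set: R] cauchyw.
Proof. by apply: continuous_measurable_fun; exact: continuous_oneDsqrV. Qed.

Lemma cinteg_cauchyw : cinteg leb (fun x => (cauchyw x)%:C).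
Proof.
apply: cinteg_real; first exact: measurable_cauchyw.
under eq_integral do rewrite ger0_norm ?(ltW (cauchyw_gt0 _))//.
by rewrite integralT_oneDsqrV ltry.
Qed.

Lemma Cint_cauchyw : Cint leb (fun x => (cauchyw x)%:C) = pi%:C.
Proof.
apply: complex_eq; rewrite /Cint /=; last by rewrite Rintegral_cst// mul0r.
by rewrite /Rintegral integralT_oneDsqrV.
Qed.

Definition cauchyw3 (x : R3 R) : R := cauchyw x.1.1 * cauchyw x.1.2 * cauchyw x.2.

Lemma prod3_real (a b c : R -> R) x :
  prod3 (fun t => (a t)%:C) (fun t => (b t)%:C) (fun t => (c t)%:C) x =
  (a x.1.1 * b x.1.2 * c x.2)%:C.
Proof. by rewrite /prod3 -!rmorphM. Qed.

Lemma cinteg_cauchyw3 : cinteg (leb3 R) (fun x => (cauchyw3 x)%:C).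
Proof.
under eq_fun do rewrite -prod3_real.
by apply: cinteg_prod3; exact: cinteg_cauchyw.
Qed.

Lemma Cint_cauchyw3 : Cint (leb3 R) (fun x => (cauchyw3 x)%:C) = (pi ^+ 3)%:C.
Proof.
under eq_fun do rewrite -prod3_real.
rewrite Cint_prod3 ?Cint_cauchyw; [|exact: cinteg_cauchyw..].
by rewrite -!rmorphM; congr (_%:C); rewrite !exprS expr0 mulr1 mulrA.
Qed.

Lemma coord3_sqr_le j (x : R3 R) : coord3 j x ^+ 2 <= dot3 x x.
Proof.
rewrite /dot3 (bigD1 j)//= expr2 lerDl sumr_ge0// => i _.
by rewrite -expr2 sqr_ge0.
Qed.

Lemma dot3_ge0 (x : R3 R) : 0 <= dot3 x x.
Proof. by apply: sumr_ge0 => i _; rewrite -expr2 sqr_ge0. Qed.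

Lemma enorm_ge0 (x : R3 R) : 0 <= enorm x.
Proof. exact: sqrtr_ge0. Qed.

Lemma enorm_sqr (x : R3 R) : enorm x ^+ 2 = dot3 x x.
Proof. by rewrite sqr_sqrtr// dot3_ge0. Qed.

Lemma coord3_le j (x : R3 R) : `|coord3 j x| <= enorm x.
Proof. by rewrite -sqrtr_sqr ler_sqrt ?dot3_ge0// coord3_sqr_le. Qed.

Lemma coordE (x : R3 R) : [/\ x.1.1 = coord3 0 x, x.1.2 = coord3 1 x & x.2 = coord3 2 x].
Proof. by []. Qed.

(** The standard integrable majorant. Its exponent comes from $1+x_j^2\le(1+|x|)^2$ for each of the
    three coordinates, which puts it below the product of three Cauchy weights. *)
Definition wgt (x : R3 R) : R := (1 + enorm x) ^- 6.

Lemma opp_enorm_gt0 (x : R3 R) : 0 < 1 + enorm x.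
Proof. by rewrite ltr_pwDl// enorm_ge0. Qed.

Lemma wgt_gt0 (x : R3 R) : 0 < wgt x.
Proof. by rewrite invr_gt0 exprn_gt0// opp_enorm_gt0. Qed.

Lemma wgt_le x : wgt x <= cauchyw3 x.
Proof.
have key j : 1 + coord3 j x ^+ 2 <= (1 + enorm x) ^+ 2.
  rewrite sqrrD expr1n mul1r enorm_sqr; have := coord3_sqr_le j x; have := enorm_ge0 x; lra.
have p0 j : 0 < 1 + coord3 j x ^+ 2 by rewrite ltr_wpDr// sqr_ge0.
have [e0 e1 e2] := coordE x.
rewrite /wgt /cauchyw3 /cauchyw e0 e1 e2 -!invfM lef_pV2 ?posrE ?mulr_gt0 ?exprn_gt0 ?opp_enorm_gt0//.
rewrite (_ : 6%N = (2 + 2 + 2)%N)// !exprD.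
by rewrite !ler_pM// ?mulr_ge0 ?(ltW (p0 _)).
Qed.

Lemma measurable_coord3 j : measurable_fun [set: M3 R] (fun x : M3 R => coord3 j (x : R3 R)).
Proof.
have -> : (fun x : M3 R => coord3 j (x : R3 R)) = nth (fun=> 0)
   [:: (fun x : M3 R => x.1.1) ; (fun x : M3 R => x.1.2); (fun x : M3 R => x.2)] j.
  by apply/funext => x; case: j => -[|[|[|]]].
case: j => -[|[|[|]]] //= _.
- exact: (measurableT_comp measurable_fst measurable_fst).
- exact: (measurableT_comp measurable_snd measurable_fst).
- exact: measurable_snd.
Qed.

Lemma measurable_dot3 (a : R3 R) : measurable_fun [set: M3 R] (fun x : M3 R => dot3 (x : R3 R) a).
Proof.
apply: measurable_sum => j; apply: measurable_funM => //; exact: measurable_coord3.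
Qed.

Lemma measurable_enorm : measurable_fun [set: M3 R] (fun x : M3 R => enorm (x : R3 R)).
Proof.
apply: (measurableT_comp (@measurable_sqrt R)).
by apply: measurable_sum => j; apply: measurable_funM; exact: measurable_coord3.
Qed.

Lemma measurable_wgt : measurable_fun [set: M3 R] (wgt : M3 R -> R).
Proof.
(* The absolute value makes the function of $t$ continuous on the whole line. *)
have -> : (wgt : M3 R -> R) = (fun t : R => ((1 + `|t|) ^+ 6)^-1) \o (fun x => enorm (x : R3 R)).
  by apply/funext => x /=; rewrite /wgt ger0_norm ?enorm_ge0.
apply: measurableT_comp; last exact: measurable_enorm.
apply: continuous_measurable_fun => x; apply: cvgV.
  by rewrite expf_neq0// gt_eqF// ltr_pwDl.
apply: (@continuous_comp _ _ _ (fun t : R => 1 + `|t|) (fun t => t ^+ 6)).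
  by apply: cvgD; [exact: cvg_cst|exact: norm_continuous].
exact: exprn_continuous.
Qed.

Lemma cinteg_wgt : cinteg (leb3 R) (fun x => (wgt x)%:C).
Proof.
apply: (cinteg3_le (a := cauchyw3)).
- exact: cmeas_real measurable_wgt.
- exact: cinteg_cauchyw3.1.1.
- have [_ ] := cinteg_cauchyw3; apply: le_lt_trans; apply: ge0_le_integral => //.
  + by move=> x _; rewrite lee_fin (le_trans (ltW (wgt_gt0 x)) (wgt_le x)).
  + by apply/measurable_EFinP; exact: cinteg_cauchyw3.1.1.
  + by apply: measurable_enormc; exact: cinteg_cauchyw3.1.
  + by move=> x _; rewrite lee_fin normcC ler_norm.
- by move=> x; rewrite normcC ger0_norm ?wgt_le// ltW// wgt_gt0.
Qed.

Lemma cinteg_decay (f : cfield R) (M : R) : cmeas (T := M3 R) f ->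
  (forall x, (1 + enorm x) ^+ 6 * normc (f x) <= M) -> cinteg (leb3 R) f.
Proof.
move=> mf fM; have w1 (x : R3 R) : 0 < (1 + enorm x) ^+ 6 by rewrite exprn_gt0// opp_enorm_gt0.
have M0 : 0 <= M by apply: le_trans (fM 0); rewrite mulr_ge0 ?normc_ge0// ltW.
have [_ woo] := cintegZ M%:C cinteg_wgt.
apply: (cinteg3_le (a := fun x => normc (M%:C * (wgt x)%:C))) => //.
  apply: measurable_normc; exact: (cintegZ M%:C cinteg_wgt).1.
by move=> x; rewrite normcM !normcC !ger0_norm ?(ltW (wgt_gt0 x))// ler_pdivlMr// mulrC.
Qed.

End weights.

(** * Differential calculus *)

Section differentiability.
Context {R : realType}.
Implicit Types (f g : cfield R) (h : R3 R -> R) (x v a : R3 R) (j : 'I_3).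

Lemma coord3D j x v : coord3 j (x + v) = coord3 j x + coord3 j v.
Proof. by case: j => -[|[|[|]]]. Qed.

Lemma coord3Z j (k : R) v : coord3 j (k *: v) = k * coord3 j v.
Proof. by case: j => -[|[|[|]]]. Qed.

Lemma coord3N j v : coord3 j (- v) = - coord3 j v.
Proof. by case: j => -[|[|[|]]]. Qed.

Lemma coord3_basis i j : coord3 j (basis3 R i) = (i == j)%:R.
Proof. by case: i => -[|[|[|]]] //= ?; case: j => -[|[|[|]]]. Qed.

Lemma dot3Dr a x v : dot3 a (x + v) = dot3 a x + dot3 a v.
Proof. by rewrite -big_split; apply: eq_bigr => i _; rewrite coord3D mulrDr. Qed.

Lemma dot3Zr a (k : R) v : dot3 a (k *: v) = k * dot3 a v.
Proof. by rewrite /dot3 mulr_sumr; apply: eq_bigr => i _; rewrite coord3Z mulrCA. Qed.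

Lemma dot3C a v : dot3 a v = dot3 v a.
Proof. by apply: eq_bigr => i _; rewrite mulrC. Qed.

Lemma dot3Dl a x v : dot3 (a + x) v = dot3 a v + dot3 x v.
Proof. by rewrite !(dot3C _ v) dot3Dr. Qed.

Lemma dot3Zl a (k : R) v : dot3 (k *: a) v = k * dot3 a v.
Proof. by rewrite !(dot3C _ v) dot3Zr. Qed.

Lemma dot3Nl a v : dot3 (- a) v = - dot3 a v.
Proof. by rewrite -scaleN1r dot3Zl mulN1r. Qed.

Lemma dot3Nr a v : dot3 a (- v) = - dot3 a v.
Proof. by rewrite dot3C dot3Nl dot3C. Qed.

Lemma dot3_basis a j : dot3 a (basis3 R j) = coord3 j a.
Proof.
rewrite /dot3 (bigD1 j)//= coord3_basis eqxx mulr1 big1 ?addr0// => i ij.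
by rewrite coord3_basis eq_sym (negbTE ij) mulr0.
Qed.

Lemma enormN x : enorm (- x) = enorm x.
Proof. by rewrite /enorm dot3Nl dot3Nr opprK. Qed.

Lemma enormZ (k : R) x : enorm (k *: x) = `|k| * enorm x.
Proof.
by rewrite /enorm dot3Zl dot3Zr mulrA -expr2 sqrtrM ?sqr_ge0// sqrtr_sqr.
Qed.

Lemma coord3_norm j v : `|coord3 j v| <= `|v|.
Proof.
rewrite !prod_normE; case: j => -[|[|[|]]] //= ?; rewrite /coord3/= !le_max ?lexx ?orbT//.
Qed.

(** The norm on the right is the maximum norm, so the best constant would be $\sqrt3$. *)
Lemma enorm_norm v : enorm v <= 2 * `|v|.
Proof.
rewrite -(@ler_sqr _ (enorm v)) ?nnegrE ?mulr_ge0 ?enorm_ge0// enorm_sqr.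
have h j : coord3 j v * coord3 j v <= `|v| ^+ 2.
  by rewrite -expr2 -real_normK ?num_real// ler_sqr ?nnegrE// coord3_norm.
rewrite /dot3 !big_ord_recl big_ord0 /=.
have := h ord0; have := h (lift ord0 ord0); have := h (lift ord0 (lift ord0 ord0)).
have := sqr_ge0 `|v|; lra.
Qed.

(** A coordinatewise bound, sufficient for continuity and Taylor estimates; the sharp inequality is
    [dot3_CS]. *)
Lemma dot3_le a v : `|dot3 a v| <= enorm a * (3 * enorm v).
Proof.
apply: (le_trans (ler_norm_sum _ _ _)).
rewrite (_ : 3 = \sum_(i < 3) (1 : R)); last by rewrite sumr_const card_ord.
rewrite mulr_suml mulr_sumr; apply: ler_sum => i _.
by rewrite mul1r normrM ler_pM// coord3_le.
Qed.

Fact dot3_linear a : linear (dot3 a : R3 R -> R).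
Proof. by move=> k x v; rewrite dot3Dr dot3Zr. Qed.

HB.instance Definition _ a := GRing.isLinear.Build R (R3 R) R _ (dot3 a : R3 R -> R) (dot3_linear a).

Lemma dot3_continuous a : continuous (dot3 a : R3 R -> R).
Proof.
move=> x; apply/(@cvgrPdist_le _ R^o) => e e0.
have d0 : 0 < enorm a * 6 + 1 by have := enorm_ge0 a; lra.
near=> y.
rewrite -linearB /=; apply: (le_trans (dot3_le _ _)).
have h1 : `|x - y| <= e / (enorm a * 6 + 1).
  by near: y; apply: cvgr_dist_le => //; rewrite divr_gt0.
have h2 := enorm_norm (x - y).
have := enorm_ge0 a => a0.
apply: (@le_trans _ _ (enorm a * 6 * (e / (enorm a * 6 + 1)))).
  rewrite -mulrA ler_wpM2l//; lra.
have : e / (enorm a * 6 + 1) * (enorm a * 6 + 1) = e by rewrite mulfVK// gt_eqF.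
have : 0 < e / (enorm a * 6 + 1) by rewrite divr_gt0.
lra.
Unshelve. all: by end_near. Qed.

Lemma second_order_diff (V : normedModType R) (h : V -> R^o) (L : {linear V -> R^o})
    (x : V) (C : R) : 0 <= C -> continuous L ->
  (forall v : V, `|h (x + v) - h x - L v| <= C * `|v| ^+ 2) ->
  differentiable h x /\ 'd h x = L :> (V -> R^o).
Proof.
move=> C0 cL hC.
have ho : h \o shift x = cst (h x) + L +o_ 0 id.
  apply/eqaddoP => e e0; near=> v.
  rewrite /= !fctE /= (addrC v).
  have -> : h (x + v) - (h x + L v) = h (x + v) - h x - L v by rewrite opprD addrA.
  apply: (le_trans (hC v)); rewrite expr2 mulrA ler_wpM2r//.
  (* The denominator $C+1$ covers the case $C=0$. *)
  have h1 : `|v| <= e / (C + 1).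
    near: v; apply: nbhs0_le; rewrite divr_gt0//; lra.
  apply: (@le_trans _ _ (C * (e / (C + 1)))); first by rewrite ler_wpM2l.
  have : e / (C + 1) * (C + 1) = e by rewrite mulfVK// gt_eqF//; lra.
  have : 0 < e / (C + 1) by rewrite divr_gt0//; lra.
  lra.
have dE := diff_unique cL ho.
split => //; apply/diff_locallyP; rewrite dE; split => //.
Unshelve. all: by end_near. Qed.

(* A second order bound with explicit constant is all that is ever needed to
   differentiate under the integral sign. *)
Lemma quadratic_diff h x a (C : R) :
  (forall v, `|h (x + v) - h x - dot3 a v| <= C * enorm v ^+ 2) ->
  differentiable h x /\ forall j, 'D_(basis3 R j) h x = coord3 j a.
Proof.
move=> hC; have C0 : 0 <= C.
  have := hC (basis3 R 0); rewrite enorm_sqr (dot3_basis (basis3 R 0)) coord3_basis mulr1.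
  exact: le_trans.
have [||v|hd dE] := @second_order_diff (R3 R) h (dot3 a : {linear R3 R -> R^o}) x (4 * C).
- by rewrite mulr_ge0.
- exact: dot3_continuous.
- apply: (le_trans (hC v)); rewrite (_ : 4 * C * _ = C * (2 * `|v|) ^+ 2); last by ring.
  by rewrite ler_wpM2l// ler_sqr ?nnegrE ?mulr_ge0 ?enorm_ge0// enorm_norm.
by split => // j; rewrite deriveE// dE; exact: dot3_basis.
Qed.

End differentiability.

(* Stated over an abstract normed space: unification on the concrete product
   space is prohibitively slow. *)
Section complex_derivative.
Context {R : realType} {V : normedModType R}.
Implicit Types (f g : V -> R[i]) (x v : V).

Definition vdiff f x := differentiable (fun y => complex.Re (f y) : R^o) x /\
  differentiable (fun y => complex.Im (f y) : R^o) x.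

Definition vder v f x : R[i] :=
  ('D_v (fun y => complex.Re (f y) : R^o) x : R) +i* ('D_v (fun y => complex.Im (f y) : R^o) x : R).

Lemma vdiffD f g x : vdiff f x -> vdiff g x -> vdiff (fun y => f y + g y) x.
Proof.
move=> [f1 f2] [g1 g2]; split.
  by under eq_fun do rewrite cReD; exact: (differentiableD f1 g1).
by under eq_fun do rewrite cImD; exact: (differentiableD f2 g2).
Qed.

Lemma vdiffM f g x : vdiff f x -> vdiff g x -> vdiff (fun y => f y * g y) x.
Proof.
move=> [f1 f2] [g1 g2]; split.
  under eq_fun do rewrite cReM.
  exact: (differentiableB (differentiableM f1 g1) (differentiableM f2 g2)).
under eq_fun do rewrite cImM.
exact: (differentiableD (differentiableM f1 g2) (differentiableM f2 g1)).
Qed.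

Lemma vdiff_cst (z : R[i]) x : vdiff (fun=> z) x.
Proof. by split; exact: differentiable_cst. Qed.

Lemma vder_cst v (z : R[i]) x : vder v (fun=> z) x = 0.
Proof. by rewrite /vder !derive_cst. Qed.

Lemma vdiff_derivable f x v : vdiff f x ->
  derivable (fun y => complex.Re (f y) : R^o) x v /\
  derivable (fun y => complex.Im (f y) : R^o) x v.
Proof. by move=> [d1 d2]; split; exact: diff_derivable. Qed.

Lemma vderD v f g x : vdiff f x -> vdiff g x ->
  vder v (fun y => f y + g y) x = vder v f x + vder v g x.
Proof.
move=> /(@vdiff_derivable _ _ v)[f1 f2] /(@vdiff_derivable _ _ v)[g1 g2].
rewrite /vder; apply: complex_eq; rewrite ?cReD ?cImD /=.
  by under eq_fun do rewrite cReD; exact: (deriveD f1 g1).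
by under eq_fun do rewrite cImD; exact: (deriveD f2 g2).
Qed.

Lemma vderM v f g x : vdiff f x -> vdiff g x ->
  vder v (fun y => f y * g y) x = vder v f x * g x + f x * vder v g x.
Proof.
move=> /(@vdiff_derivable _ _ v)[f1 f2] /(@vdiff_derivable _ _ v)[g1 g2].
rewrite /vder; apply: complex_eq; rewrite ?cReD ?cImD ?cReM ?cImM /=.
  under eq_fun do rewrite cReM.
  rewrite (deriveB (derivableM f1 g1) (derivableM f2 g2)).
  by rewrite (deriveM f1 g1) (deriveM f2 g2) /GRing.scale /=; ring.
under eq_fun do rewrite cImM.
rewrite (deriveD (derivableM f1 g2) (derivableM f2 g1)).
by rewrite (deriveM f1 g2) (deriveM f2 g1) /GRing.scale /=; ring.
Qed.

Lemma vdiff_conj f x : vdiff f x -> vdiff (fun y => (f y)^*%C) x.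
Proof.
move=> [f1 f2]; split.
  by under eq_fun do rewrite cRe_conj.
by under eq_fun do rewrite cIm_conj; exact: (differentiableN f2).
Qed.

Lemma vder_conj v f x : vdiff f x -> vder v (fun y => (f y)^*%C) x = (vder v f x)^*%C.
Proof.
move=> /(@vdiff_derivable _ _ v)[f1 f2]; rewrite /vder; apply: complex_eq => /=.
  by under eq_fun do rewrite cRe_conj.
by under eq_fun do rewrite cIm_conj; exact: (deriveN f2).
Qed.

Lemma diff_aff (r : R) (a : V) (h : V -> R^o) x : differentiable h (r *: x + a) ->
  differentiable (fun y => h (r *: y + a)) x /\
  forall v, 'D_v (fun y => h (r *: y + a)) x = r * 'D_v h (r *: x + a).
Proof.
move=> dh.
have dA : is_diff x (fun y : V => r *: y + a) ( *:%R r).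
  have := is_diffD (is_diff_scaler r x) (is_diff_cst a x).
  by rewrite addr0.
have dhA : differentiable (h \o (fun y : V => r *: y + a)) x.
  by apply: differentiable_comp => //; case: dA.
split => // v; rewrite deriveE// (_ : (fun y => _) = h \o (fun y : V => r *: y + a))//.
rewrite diff_comp//.
by rewrite /= (@diff_val _ _ _ _ _ _ _ dA) linearZ /= deriveE.
Qed.

Lemma vdiff_aff (r : R) a f x : vdiff f (r *: x + a) ->
  vdiff (fun y => f (r *: y + a)) x.
Proof. by move=> [f1 f2]; split; [have [] := diff_aff f1|have [] := diff_aff f2]. Qed.

Lemma vder_aff v (r : R) a f x : vdiff f (r *: x + a) ->
  vder v (fun y => f (r *: y + a)) x = r%:C * vder v f (r *: x + a).
Proof.
move=> [f1 f2]; have [_ e1] := diff_aff f1; have [_ e2] := diff_aff f2.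
rewrite /vder; apply: complex_eq; rewrite ?cReM ?cImM /=.
  by rewrite (e1 v) mul0r subr0.
by rewrite (e2 v) mul0r addr0.
Qed.

End complex_derivative.

(** * Closure properties of smooth functions *)

Section smooth_functions.
Context {R : realType}.
Implicit Types (f g : cfield R) (h : R3 R -> R) (x v a : R3 R) (j : 'I_3).

Definition cdiff f x := differentiable (fun y => complex.Re (f y) : R) x /\
  differentiable (fun y => complex.Im (f y) : R) x.

Lemma cdiffD f g x : cdiff f x -> cdiff g x -> cdiff (fun y => f y + g y) x.
Proof. exact: (@vdiffD R (R3 R) f g x). Qed.

Lemma cdiffM f g x : cdiff f x -> cdiff g x -> cdiff (fun y => f y * g y) x.
Proof. exact: (@vdiffM R (R3 R) f g x). Qed.

Lemma cdiff_cst (z : R[i]) x : cdiff (fun=> z) x.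
Proof. exact: (@vdiff_cst R (R3 R) z x). Qed.

Lemma pd_cst j (z : R[i]) : pd j (fun=> z) = (fun=> 0) :> cfield R.
Proof. by apply/funext => x; exact: (@vder_cst R (R3 R) _ z x). Qed.

Lemma pdD j f g x : cdiff f x -> cdiff g x ->
  pd j (fun y => f y + g y) x = pd j f x + pd j g x.
Proof. exact: (@vderD R (R3 R) (basis3 R j) f g x). Qed.

Lemma pdM j f g x : cdiff f x -> cdiff g x ->
  pd j (fun y => f y * g y) x = pd j f x * g x + f x * pd j g x.
Proof. exact: (@vderM R (R3 R) (basis3 R j) f g x). Qed.

Lemma cdiff_conj f x : cdiff f x -> cdiff (fun y => (f y)^*%C) x.
Proof. exact: (@vdiff_conj R (R3 R) f x). Qed.

Lemma pd_conj j f x : cdiff f x -> pd j (fun y => (f y)^*%C) x = (pd j f x)^*%C.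
Proof. exact: (@vder_conj R (R3 R) (basis3 R j) f x). Qed.

Lemma cdiff_aff (r : R) a f x : cdiff f (r *: x + a) ->
  cdiff (fun y => f (r *: y + a)) x.
Proof. exact: (@vdiff_aff R (R3 R) r a f x). Qed.

Lemma pd_aff j (r : R) a f x : cdiff f (r *: x + a) ->
  pd j (fun y => f (r *: y + a)) x = r%:C * pd j f (r *: x + a).
Proof. exact: (@vder_aff R (R3 R) (basis3 R j) r a f x). Qed.

Lemma cdiff_coord j x : cdiff (fun y => (coord3 j y)%:C) x.
Proof.
split; last exact: (@differentiable_cst R (R3 R) R 0 x).
have [|//] := @quadratic_diff R (coord3 j) x (basis3 R j) 0.
move=> v; rewrite coord3D (addrC (coord3 j x)) addrK dot3C dot3_basis subrr normr0 mul0r//.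
Qed.

Lemma pd_coord i j : pd i (fun y => (coord3 j y)%:C) = (fun=> (i == j)%:R) :> cfield R.
Proof.
apply/funext => x.
have [|_ h] := @quadratic_diff R (coord3 j) x (basis3 R j) 0.
  by move=> v; rewrite coord3D (addrC (coord3 j x)) addrK dot3C dot3_basis subrr normr0 mul0r.
transitivity ('D_(basis3 R i) (coord3 j) x +i* ('D_(basis3 R i) (fun=> 0 : R) x)); first by [].
rewrite h (@derive_cst R (R3 R) R 0) coord3_basis eq_sym.
by case: (i == j).
Qed.

(* Finite-order smoothness, on which closure properties are proved by induction. *)
Definition smoothN n f := forall js x, (size js <= n)%N -> cdiff (pds js f) x.

Lemma smoothP f : smooth f <-> forall n, smoothN n f.
Proof.
split => [sf n js x _|sf js x]; first by have [] := sf js x.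
exact: (sf (size js) js x).
Qed.

Lemma pds_rcons js j f : pds (rcons js j) f = pds js (pd j f).
Proof. by rewrite /pds -cats1 foldr_cat. Qed.

Lemma smoothN0 f : smoothN 0 f <-> forall x, cdiff f x.
Proof.
by split => [sf x|sf js x]; [exact: (sf [::] x)|case: js => //= _; exact: sf].
Qed.

Lemma smoothNS n f : smoothN n.+1 f <-> (forall x, cdiff f x) /\ forall j, smoothN n (pd j f).
Proof.
split => [sf|[sf sfj] js x].
  split => [x|j js x js_n]; first exact: (sf [::] x).
  by rewrite -pds_rcons; apply: sf; rewrite size_rcons.
case/lastP: js => [|js j]; first by rewrite /= => _; exact: sf.
by rewrite size_rcons pds_rcons; exact: sfj.
Qed.

Lemma smoothNW n f : smoothN n.+1 f -> smoothN n f.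
Proof. by move=> sf js x js_n; apply: sf; rewrite ltnW// ltnS. Qed.

Lemma smoothN_cdiff n f x : smoothN n f -> cdiff f x.
Proof. by move=> sf; exact: (sf [::] x). Qed.

Lemma smoothND n f g : smoothN n f -> smoothN n g -> smoothN n (fun y => f y + g y).
Proof.
elim: n f g => [|n IH] f g sf sg.
  by apply/smoothN0 => x; apply: cdiffD; [exact: smoothN_cdiff sf|exact: smoothN_cdiff sg].
have cf x : cdiff f x by exact: smoothN_cdiff sf.
have cg x : cdiff g x by exact: smoothN_cdiff sg.
apply/smoothNS; split => [x|j]; first exact: cdiffD.
rewrite (_ : pd j _ = (fun y => pd j f y + pd j g y)); last first.
  by apply/funext => x; rewrite pdD.
by apply: IH; [have /smoothNS[_] := sf|have /smoothNS[_] := sg]; exact.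
Qed.

Lemma smoothNM n f g : smoothN n f -> smoothN n g -> smoothN n (fun y => f y * g y).
Proof.
elim: n f g => [|n IH] f g sf sg.
  by apply/smoothN0 => x; apply: cdiffM; [exact: smoothN_cdiff sf|exact: smoothN_cdiff sg].
have cf x : cdiff f x by exact: smoothN_cdiff sf.
have cg x : cdiff g x by exact: smoothN_cdiff sg.
apply/smoothNS; split => [x|j]; first exact: cdiffM.
rewrite (_ : pd j _ = (fun y => pd j f y * g y + f y * pd j g y)); last first.
  by apply/funext => x; rewrite pdM.
have /smoothNS[_ /(_ j) sfj] := sf; have /smoothNS[_ /(_ j) sgj] := sg.
by apply: smoothND; apply: IH => //; exact: smoothNW.
Qed.

Lemma smoothN_cst n (z : R[i]) : smoothN n (fun=> z).
Proof.
elim: n z => [|n IH] z; first by apply/smoothN0 => x; exact: cdiff_cst.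
apply/smoothNS; split => [x|j]; first exact: cdiff_cst.
by rewrite pd_cst.
Qed.

Lemma smoothN_conj n f : smoothN n f -> smoothN n (fun y => (f y)^*%C).
Proof.
elim: n f => [|n IH] f sf.
  by apply/smoothN0 => x; apply: cdiff_conj; exact: smoothN_cdiff sf.
have cf x : cdiff f x by exact: smoothN_cdiff sf.
apply/smoothNS; split => [x|j]; first exact: cdiff_conj.
rewrite (_ : pd j _ = (fun y => (pd j f y)^*%C)); last first.
  by apply/funext => x; rewrite pd_conj.
by apply: IH; have /smoothNS[_] := sf.
Qed.

Lemma smoothN_aff n (r : R) a f : smoothN n f -> smoothN n (fun y => f (r *: y + a)).
Proof.
elim: n f => [|n IH] f sf.
  by apply/smoothN0 => x; apply: cdiff_aff; exact: smoothN_cdiff sf.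
have cf x : cdiff f x by exact: smoothN_cdiff sf.
apply/smoothNS; split => [x|j]; first exact: cdiff_aff.
rewrite (_ : pd j _ = (fun y => r%:C * pd j f (r *: y + a))); last first.
  by apply/funext => x; rewrite pd_aff.
apply: smoothNM; first exact: smoothN_cst.
by apply: IH; have /smoothNS[_] := sf.
Qed.

Lemma smoothD f g : smooth f -> smooth g -> smooth (fun y => f y + g y).
Proof. by move=> /smoothP sf /smoothP sg; apply/smoothP => n; exact: smoothND. Qed.

Lemma smoothM f g : smooth f -> smooth g -> smooth (fun y => f y * g y).
Proof. by move=> /smoothP sf /smoothP sg; apply/smoothP => n; exact: smoothNM. Qed.

Lemma smooth_cst (z : R[i]) : smooth (fun=> z : R[i]).
Proof. by apply/smoothP => n; exact: smoothN_cst. Qed.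

Lemma smoothZ (z : R[i]) f : smooth f -> smooth (fun y => z * f y).
Proof. by move=> sf; apply: smoothM => //; exact: smooth_cst. Qed.

Lemma smoothN' f : smooth f -> smooth (fun y => - f y).
Proof. by move=> sf; under eq_fun do rewrite -mulN1r; exact: smoothZ. Qed.

Lemma smooth_conj f : smooth f -> smooth (fun y => (f y)^*%C).
Proof. by move=> /smoothP sf; apply/smoothP => n; exact: smoothN_conj. Qed.

Lemma smooth_aff (r : R) a f : smooth f -> smooth (fun y => f (r *: y + a)).
Proof. by move=> /smoothP sf; apply/smoothP => n; exact: smoothN_aff. Qed.

Lemma smooth_pd j f : smooth f -> smooth (pd j f).
Proof. by move=> sf js x; rewrite -pds_rcons; exact: sf. Qed.

Lemma smooth_cdiff f x : smooth f -> cdiff f x.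
Proof. by move=> sf; exact: (sf [::] x). Qed.

Lemma smooth_coord j : smooth (fun y => (coord3 j y)%:C : R[i]).
Proof.
apply/smoothP => -[|n]; first by apply/smoothN0 => x; exact: cdiff_coord.
apply/smoothNS; split => [x|i]; first exact: cdiff_coord.
by rewrite pd_coord; exact: smoothN_cst.
Qed.

Lemma pdDE j f g : smooth f -> smooth g ->
  pd j (fun y => f y + g y) = (fun y => pd j f y + pd j g y).
Proof. by move=> sf sg; apply/funext => x; rewrite pdD//; exact: smooth_cdiff. Qed.

Lemma pdME j f g : smooth f -> smooth g ->
  pd j (fun y => f y * g y) = (fun y => pd j f y * g y + f y * pd j g y).
Proof. by move=> sf sg; apply/funext => x; rewrite pdM//; exact: smooth_cdiff. Qed.

Lemma pdZE j (z : R[i]) f : smooth f -> pd j (fun y => z * f y) = (fun y => z * pd j f y).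
Proof.
move=> sf; rewrite pdME//; last exact: smooth_cst.
by apply/funext => x; rewrite pd_cst mul0r add0r.
Qed.

Lemma pd_affE j (r : R) a f : smooth f ->
  pd j (fun y => f (r *: y + a)) = (fun y => r%:C * pd j f (r *: y + a)).
Proof. by move=> sf; apply/funext => x; rewrite pd_aff//; exact: smooth_cdiff. Qed.

Lemma pd_conjE j f : smooth f -> pd j (fun y => (f y)^*%C) = (fun y => (pd j f y)^*%C).
Proof. by move=> sf; apply/funext => x; rewrite pd_conj//; exact: smooth_cdiff. Qed.

Lemma smooth_sum I (s : seq I) (F : I -> cfield R) : (forall i, smooth (F i)) ->
  smooth (fun y => \sum_(i <- s) F i y).
Proof.
move=> sF; elim: s => [|i s IH].
  by under eq_fun do rewrite big_nil; exact: smooth_cst.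
by under eq_fun do rewrite big_cons; exact: smoothD.
Qed.

Lemma pd_sumE j I (s : seq I) (F : I -> cfield R) : (forall i, smooth (F i)) ->
  pd j (fun y => \sum_(i <- s) F i y) = (fun y => \sum_(i <- s) pd j (F i) y).
Proof.
move=> sF; elim: s => [|i s IH].
  under eq_fun do rewrite big_nil; rewrite pd_cst.
  by apply/funext => x; rewrite big_nil.
under eq_fun do rewrite big_cons; rewrite pdDE ?IH//; last exact: smooth_sum.
by apply/funext => x; rewrite big_cons.
Qed.

End smooth_functions.

(** * The character and its second-order expansion *)

Section expi.
Context {R : realType}.
Implicit Types (t u : R).

Definition ii : R[i] := 0 +i* 1.

Lemma expiD t u : expi (t + u) = expi t * expi u.
Proof. by rewrite /expi; apply: complex_eq; rewrite ?cReM ?cImM /= ?cosD ?sinD; ring. Qed.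

Lemma expi0 : expi 0 = 1 :> R[i].
Proof. by rewrite /expi cos0 sin0. Qed.

Lemma normc_expi t : normc (expi t) = 1.
Proof. by rewrite /expi /= cos2Dsin2 sqrtr1. Qed.

Lemma conjc_expi t : (expi t)^*%C = expi (- t).
Proof. by rewrite /expi cosN sinN. Qed.

Lemma normc_ii : normc ii = 1.
Proof. by rewrite /ii /= expr0n /= add0r expr1n sqrtr1. Qed.

Lemma ii2 : ii * ii = -1.
Proof. by apply: complex_eq; rewrite ?cReM ?cImM ?cReN ?cImN /=; ring. Qed.

(** The derivative is bounded only for $|c|\le|t|$, so [C] may depend on [t]. This allows
    bootstrapping: $|\sin c|\le|c|$ yields $|\cos t-1|\le t^2$, and $|\cos c-1|\le|c|$ yields $|\sin
    t-t|\le t^2$. *)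
Lemma mvt_bound (f df : R -> R) (t C : R) : (forall x, is_derive x (1 : R) f (df x)) ->
  (forall c, `|c| <= `|t| -> `|df c| <= C) -> `|f t - f 0| <= C * `|t|.
Proof.
move=> fd fC.
have fc : continuous f.
  by move=> x; apply/differentiable_continuous/derivable1_diffP.
have [t0|t0|t0] := ltgtP 0 t; last by rewrite -t0 subrr normr0 mulr0.
- have [c] := MVT t0 (fun x _ => fd x) (continuous_subspaceT fc).
  rewrite in_itv /= => /andP[c0 ct] ->; rewrite subr0 normrM ler_wpM2r// fC//.
  by rewrite !gtr0_norm// ltW.
- have [c] := MVT t0 (fun x _ => fd x) (continuous_subspaceT fc).
  rewrite in_itv /= => /andP[c0 ct] e; rewrite distrC e sub0r normrM normrN ler_wpM2r// fC//.
  by rewrite !ltr0_norm// lerN2 ltW.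
Qed.

Lemma abs_sin_le t : `|sin t| <= `|t|.
Proof.
rewrite -[leRHS]mul1r -[in leLHS](subr0 (sin t)) -(@sin0 R).
by apply: (mvt_bound (df := cos)) => c _; rewrite ler_norml cos_geN1 cos_le1.
Qed.

Lemma abs_cosB1_le t : `|cos t - 1| <= `|t| ^+ 2.
Proof.
rewrite -[in leLHS](@cos0 R) expr2.
apply: (mvt_bound (df := fun x => - sin x)) => c ct.
by rewrite normrN (le_trans (abs_sin_le c)).
Qed.

Lemma abs_cosB1_le1 t : `|cos t - 1| <= `|t|.
Proof.
rewrite -[in leLHS](@cos0 R) -[leRHS]mul1r.
apply: (mvt_bound (df := fun x => - sin x)) => c ct.
by rewrite normrN ler_norml sin_geN1 sin_le1.
Qed.

Lemma abs_sinB_le t : `|sin t - t| <= `|t| ^+ 2.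
Proof.
have -> : sin t - t = (sin t - t) - (sin 0 - 0) by rewrite sin0 !subr0.
rewrite expr2.
apply: (mvt_bound (f := fun t => sin t - t) (df := fun x => cos x - 1)) => c ct.
exact: le_trans (abs_cosB1_le1 c) ct.
Qed.

(** The constant is not optimal; a quadratic bound is all that [cquadratic_diff] asks for when
    Fourier integrals are differentiated. *)
Lemma normc_expiB1 t : normc (expi t - 1 - ii * t%:C) <= 2 * t ^+ 2.
Proof.
apply: (le_trans (normc_le_ReIm _)).
have -> : complex.Re (expi t - 1 - ii * t%:C) = cos t - 1.
  by rewrite !cReD !cReN cReM /=; ring.
have -> : complex.Im (expi t - 1 - ii * t%:C) = sin t - t.
  by rewrite !cImD !cImN cImM /=; ring.
rewrite -(real_normK (num_real t)).
have := abs_cosB1_le t; have := abs_sinB_le t; lra.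
Qed.

Lemma measurable_cos : measurable_fun [set: R] (@cos R).
Proof. by apply: continuous_measurable_fun; exact: continuous_cos. Qed.

Lemma measurable_sin : measurable_fun [set: R] (@sin R).
Proof. by apply: continuous_measurable_fun; exact: continuous_sin. Qed.

Lemma cmeas_expi d (T : measurableType d) (f : T -> R) : measurable_fun setT f ->
  cmeas (fun x => expi (f x)).
Proof.
by move=> mf; split => /=; [exact: (measurableT_comp measurable_cos)|exact: (measurableT_comp measurable_sin)].
Qed.

End expi.

(** * Open sets and measurability in R^3 *)

Section open_sets.
Context {R : realType}.

(** Second countability in a form with two uses: [G c n] is any set comparable with the cube of
    centre [c] and size $1/(n+1)$, either an open cube or the positivity set of a bump function. The
    centres are rational and the pairs of a centre and a size are enumerated by [pickle]. *)
Lemma open_cover3 (G : R3 R -> nat -> set (R3 R)) (K : R) (U : set (R3 R)) :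
  (forall c n y, (forall j, `|coord3 j (y - c)| < n.+1%:R^-1) -> G c n y) ->
  (forall c n y, G c n y -> forall j, `|coord3 j (y - c)| <= K / n.+1%:R) ->
  open U ->
  exists F : nat -> set (R3 R), (forall n, F n = set0 \/ exists c m, F n = G c m) /\
    U = \bigcup_n F n.
Proof.
move=> G1 G2 oU.
pose P (p : (rat * rat * rat) * nat) := G (ratr p.1.1.1, ratr p.1.1.2, ratr p.1.2) p.2.
pose F n := if unpickle n is Some p then (if `[< P p `<=` U >] then P p else set0) else set0.
have FE p : F (pickle p) = if `[< P p `<=` U >] then P p else set0 by rewrite /F pickleK.
exists F; split.
  move=> n; rewrite /F; case: (unpickle n) => [p|]; last by left.
  by case: ifP => _; [right; exists (ratr p.1.1.1, ratr p.1.1.2, ratr p.1.2), p.2|left].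
apply/seteqP; split => [x Ux|x [n _]]; last first.
  by rewrite /F; case: (unpickle n) => // p; case: ifP => // /asboolP; apply.
have [e e0 xeU] : exists2 e : R, 0 < e & forall y, (forall j, `|coord3 j (y - x)| < e) -> U y.
  have /nbhs_ballP[e e0 be] : nbhs x U by exact: open_nbhs_nbhs.
  exists e => // y ye; apply: be.
  rewrite -ball_normE /= distrC !prod_normE !gt_max.
  have := ye ord0; have := ye (lift ord0 ord0); have := ye (lift ord0 (lift ord0 ord0)).
  by rewrite /coord3 /= => -> -> ->.
(* In each coordinate a point of [G c n] is within $K/(n+1)$ of [c], and [c] is within $1/(n+1)$ of
   [x]. *)
have [n hn] : exists n : nat, (`|K| + 1) / n.+1%:R < e.
  have hA := archi_boundP (divr_ge0 (addr_ge0 (normr_ge0 K) ler01) (ltW e0)).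
  exists (Num.Def.archi_bound ((`|K| + 1) / e)).
  rewrite ltr_pdivrMr ?ltr0n// mulrC -ltr_pdivrMr//.
  by apply: (lt_le_trans hA); rewrite ler_nat.
have n0 : 0 < (n.+1%:R)^-1 :> R by rewrite invr_gt0 ltr0n.
have rc (t : R) : exists q : rat, `|t - ratr q| < n.+1%:R^-1.
  move: n0; set d := (n.+1%:R^-1 : R) => d0.
  have /rat_in_itvoo[q] : t - d < t + d by lra.
  rewrite in_itv /= => /andP[h1 h2]; exists q; rewrite ltr_norml; apply/andP; split; lra.
have [q1 h1] := rc x.1.1; have [q2 h2] := rc x.1.2; have [q3 h3] := rc x.2.
pose p := ((q1, q2, q3), n); pose c : R3 R := (ratr q1, ratr q2, ratr q3).
have xc j : `|coord3 j (x - c)| < n.+1%:R^-1 by case: j => -[|[|[|]]].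
exists (pickle p); first exact: I.
rewrite FE.
have PU : P p `<=` U.
  move=> y /G2 hy; apply: xeU => j.
  have -> : y - x = (y - c) - (x - c) by rewrite opprB addrA subrK.
  rewrite coord3D coord3N; apply: (le_lt_trans (ler_normB _ _)); apply: le_lt_trans hn.
  rewrite mulrDl mul1r lerD ?(ltW (xc j))//; apply: (le_trans (hy j)).
  by rewrite ler_wpM2r ?(ltW n0)// ler_norm.
by rewrite (asboolT PU); exact: G1.
Qed.

Definition box3 (c : R3 R) (n : nat) : set (R3 R) :=
  [set y | forall j, `|coord3 j (y - c)| < n.+1%:R^-1].

Lemma measurable_box3 c n : measurable (box3 c n : set (M3 R)).
Proof.
have -> : box3 c n = \bigcap_(j in [set: 'I_3])
    ((fun x : M3 R => coord3 j (x : R3 R)) @^-1` ball (coord3 j c) n.+1%:R^-1).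
  apply/seteqP; split => [y hy j _|y hy j].
    by rewrite /= -ball_normE /= distrC -coord3N -coord3D; exact: hy.
  by have := hy j I; rewrite /= -ball_normE /= distrC -coord3N -coord3D.
apply: fin_bigcap_measurable => // j _.
rewrite -[X in measurable X]setTI; apply: measurable_coord3 => //.
exact: measurable_ball.
Qed.

(** Measurable means in the product sigma-algebra and open means in the product topology; countable
    covers by cubes connect the two. *)
Lemma open_measurable3 (U : set (R3 R)) : open U -> measurable (U : set (M3 R)).
Proof.
move=> oU; have [||F [hF ->]] := @open_cover3 box3 1 U _ _ oU.
- by [].
- by move=> c n y hy j; rewrite mul1r ltW// hy.
- apply: bigcupT_measurable => n; have [->|[c [m ->]]] := hF n; first exact: measurable0.
  exact: measurable_box3.
Qed.

Lemma continuous_measurable3 (h : R3 R -> R) : continuous h ->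
  measurable_fun [set: M3 R] (h : M3 R -> R).
Proof.
move=> ch; apply: (measurability _ (RGenOpens.measurableE R)).
move=> _ [_ [a [b ->] <-]]; rewrite setTI; apply: open_measurable3.
by have /continuousP := ch; apply; exact: interval_open.
Qed.

Lemma smooth_continuous (f : cfield R) : smooth f ->
  continuous (fun x => complex.Re (f x) : R) /\ continuous (fun x => complex.Im (f x) : R).
Proof.
move=> sf; split => x; have [d1 d2] := sf [::] x; exact: differentiable_continuous.
Qed.

Lemma smooth_cmeas (f : cfield R) : smooth f -> cmeas (T := M3 R) f.
Proof.
by move=> /smooth_continuous[c1 c2]; split; exact: continuous_measurable3.
Qed.

End open_sets.

Lemma cRe_sum (R : realType) I (r : seq I) (F : I -> R[i]) :
  complex.Re (\sum_(i <- r) F i) = \sum_(i <- r) complex.Re (F i).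
Proof.
by elim: r => [|i r IH]; rewrite ?big_nil// !big_cons cReD IH.
Qed.

Lemma cIm_sum (R : realType) I (r : seq I) (F : I -> R[i]) :
  complex.Im (\sum_(i <- r) F i) = \sum_(i <- r) complex.Im (F i).
Proof.
by elim: r => [|i r IH]; rewrite ?big_nil// !big_cons cImD IH.
Qed.

Lemma cRe_rM (R : realType) (a : R) (z : R[i]) : complex.Re (a%:C * z) = a * complex.Re z.
Proof. by rewrite cReM /= mul0r subr0. Qed.

Lemma cIm_rM (R : realType) (a : R) (z : R[i]) : complex.Im (a%:C * z) = a * complex.Im z.
Proof. by rewrite cImM /= mul0r addr0. Qed.

Lemma cquadratic_diff (R : realType) (f : cfield R) (x : R3 R) (a : 'I_3 -> R[i]) (C : R) :
  (forall v, normc (f (x + v) - f x - \sum_j (coord3 j v)%:C * a j) <= C * enorm v ^+ 2) ->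
  cdiff f x /\ forall j, pd j f x = a j.
Proof.
move=> hb.
pose aR : R3 R := (complex.Re (a 0), complex.Re (a 1), complex.Re (a 2)).
pose aI : R3 R := (complex.Im (a 0), complex.Im (a 1), complex.Im (a 2)).
have aRE j : coord3 j aR = complex.Re (a j).
  by case: j => -[|[|[|]]] //= h; rewrite /coord3 /=; congr (complex.Re (a _)); exact/val_inj.
have aIE j : coord3 j aI = complex.Im (a j).
  by case: j => -[|[|[|]]] //= h; rewrite /coord3 /=; congr (complex.Im (a _)); exact/val_inj.
have [|d1 D1] := @quadratic_diff R (fun y => complex.Re (f y)) x aR C.
  move=> v; apply: le_trans (hb v); apply: le_trans (Re_le_normc _).
  rewrite !cReD !cReN cRe_sum (_ : \sum_(i < 3) _ = dot3 aR v)//.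
  by apply: eq_bigr => j _; rewrite cRe_rM aRE mulrC.
have [|d2 D2] := @quadratic_diff R (fun y => complex.Im (f y)) x aI C.
  move=> v; apply: le_trans (hb v); apply: le_trans (Im_le_normc _).
  rewrite !cImD !cImN cIm_sum (_ : \sum_(i < 3) _ = dot3 aI v)//.
  by apply: eq_bigr => j _; rewrite cIm_rM aIE mulrC.
split; first by [].
by move=> j; rewrite /pd D1 D2 aRE aIE; case: (a j).
Qed.

(** * Test functions, Schwartz functions and the Fourier transform *)

Section fourier_integrals.
Context {R : realType}.
Implicit Types (F G f g : cfield R) (x v xi : R3 R) (j : 'I_3).
Local Notation L1 := (cinteg (leb3 R)).
Local Notation cmeas3 := (cmeas (T := M3 R)).

Definition fcst : R := (2 * pi) `^ (- (3 / 2)).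

Lemma fcst_gt0 : 0 < fcst.
Proof. by rewrite powR_gt0// mulr_gt0// pi_gt0. Qed.

Lemma fcst_ge0 : 0 <= fcst. Proof. exact: ltW fcst_gt0. Qed.

Lemma ifourierE F x :
  ifourier F x = fcst%:C * Cint (leb3 R) (fun xi => expi (dot3 x xi) * F xi).
Proof. by []. Qed.

(** The analysis is carried out for [ifourier]; the direct transform is reached by reflection. *)
Lemma fourierE F x : fourier F x = ifourier F (- x).
Proof.
rewrite /fourier /ifourier; congr (_ * cint _); apply/funext => y.
by rewrite dot3Nl dot3C.
Qed.

Lemma cmeas_char x : cmeas3 (fun xi => expi (dot3 x xi)).
Proof.
under eq_fun do rewrite dot3C.
exact: (cmeas_expi (measurable_dot3 x)).
Qed.

Lemma cinteg_char x F : L1 F -> L1 (fun xi => expi (dot3 x xi) * F xi).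
Proof.
by move=> hF; apply: (cintegMb (M := 1) (cmeas_char x)) => // xi; rewrite normc_expi.
Qed.

Lemma ifourier_add F G x : L1 F -> L1 G ->
  ifourier (fun xi => F xi + G xi) x = ifourier F x + ifourier G x.
Proof.
move=> hF hG; rewrite !ifourierE -mulrDr -CintD; [|exact: cinteg_char..].
by under eq_fun do rewrite mulrDr.
Qed.

Lemma ifourierZ (z : R[i]) F x : L1 F ->
  ifourier (fun xi => z * F xi) x = z * ifourier F x.
Proof.
move=> hF; rewrite !ifourierE [RHS]mulrCA; congr (_ * _).
rewrite -CintZ; last exact: cinteg_char.
by apply: eq_Cint => xi; rewrite mulrCA.
Qed.

Lemma ifourierB F G x : L1 F -> L1 G ->
  ifourier (fun xi => F xi - G xi) x = ifourier F x - ifourier G x.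
Proof.
move=> hF hG; under [in LHS]eq_fun do rewrite -mulN1r.
rewrite ifourier_add//; last exact: cintegZ.
by rewrite ifourierZ// mulN1r.
Qed.

Lemma ifourier_le F x : L1 F ->
  ((normc (ifourier F x))%:E <= (2 * fcst)%:E * \int[leb3 R]_xi (normc (F xi))%:E)%E.
Proof.
move=> hF; rewrite ifourierE normcM normcC ger0_norm ?fcst_ge0// EFinM (mulrC 2).
rewrite [X in (_ <= X * _)%E]EFinM -muleA.
rewrite lee_wpmul2l ?lee_fin ?fcst_ge0//.
apply: (le_trans (normc_Cint_le (cinteg_char x hF))).
by under eq_integral do rewrite normcM normc_expi mul1r.
Qed.

(** The class on which Fourier integrals are smooth: it contains the Schwartz functions as well as
    the square integrable symbols of bounded support. *)
Definition moment F := forall N, L1 (fun xi => ((1 + enorm xi) ^+ N)%:C * F xi).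

Lemma moment_L1 F : moment F -> L1 F.
Proof.
move=> /(_ 0%N); under eq_fun do rewrite expr0 mul1r; exact.
Qed.

Lemma measurable_wX N : measurable_fun [set: M3 R] (fun xi : M3 R => (1 + enorm (xi : R3 R)) ^+ N).
Proof.
by apply: measurable_funX; apply: measurable_funD => //; exact: measurable_enorm.
Qed.

Lemma moment_mul F (m : cfield R) (C : R) k : cmeas3 m ->
  (forall xi, normc (m xi) <= C * (1 + enorm xi) ^+ k) -> moment F ->
  moment (fun xi => m xi * F xi).
Proof.
move=> mm mC hF N; have hi := cintegZ C%:C (hF (N + k)%N).
have mF : cmeas3 F by have [] := moment_L1 hF.
have w0 (xi : R3 R) n : 0 <= (1 + enorm xi) ^+ n by rewrite exprn_ge0// ltW// opp_enorm_gt0.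
apply: (cinteg3_le (a := fun xi => normc (C%:C * (((1 + enorm xi) ^+ (N + k))%:C * F xi)))).
- by apply: cmeasM; [exact: cmeas_real (measurable_wX N)|exact: cmeasM].
- by apply: measurable_normc; have [] := hi.
- by have [] := hi.
- move=> xi; rewrite !normcM !normcC !ger0_norm//.
    rewrite exprD (mulrCA _ (normc (m xi))) !mulrA ler_wpM2r ?normc_ge0//.
    by rewrite -mulrA (mulrCA C) mulrC ler_wpM2l// mulrC.
  (* Nonnegativity of [C], read off at the origin, where the weight is 1. *)
  by apply: le_trans (_ : normc (m 0) <= _); rewrite ?normc_ge0//;
    have := mC 0; rewrite /enorm /dot3 big1 ?sqrtr0 ?addr0 ?expr1n ?mulr1// => j _;
    rewrite (_ : coord3 j 0 = 0) ?mul0r//; case: j => -[|[|[|]]].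
Qed.

Definition iximul j F : cfield R := fun xi => ii * (coord3 j xi)%:C * F xi.

Lemma cmeas_coord j : cmeas3 (fun xi => (coord3 j xi)%:C).
Proof. exact: cmeas_real (measurable_coord3 j). Qed.

Lemma moment_iximul j F : moment F -> moment (iximul j F).
Proof.
apply: (moment_mul (C := 1) (k := 1)).
  by apply: cmeasM; [exact: cmeas_cst|exact: cmeas_coord].
move=> xi; rewrite normcM normc_ii normcC !mul1r expr1.
by apply: (le_trans (coord3_le j xi)); rewrite lerDr.
Qed.

(** Taylor expansion of the character under the integral sign. Here $18=2\cdot3^2$ with 2 from
    [normc_expiB1] and 3 from [dot3_le], while [2 * fcst] is the constant of [ifourier_le]. *)
Lemma ifourier_expand F x v : moment F ->
  ((normc (ifourier F (x + v) - ifourier F x -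
    \sum_j (coord3 j v)%:C * ifourier (iximul j F) x))%:E <=
  ((2 * fcst) * 18 * enorm v ^+ 2)%:E * \int[leb3 R]_xi (normc (((1 + enorm xi) ^+ 2)%:C * F xi))%:E)%E.
Proof.
move=> mF; have F1 := moment_L1 mF.
have F1j j : L1 (iximul j F) by exact/moment_L1/moment_iximul.
pose D xi := (expi (dot3 v xi) - 1 - ii * (dot3 v xi)%:C) * F xi.
have sumE xi : \sum_(j < 3) (coord3 j v)%:C * iximul j F xi = ii * (dot3 v xi)%:C * F xi.
  rewrite /iximul /dot3 rmorph_sum /= mulr_sumr mulr_suml; apply: eq_bigr => j _.
  by rewrite rmorphM /=; ring.
have S1 : L1 (fun xi => \sum_(j < 3) (coord3 j v)%:C * iximul j F xi).
  by apply: cinteg_sum => j; exact: cintegZ.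
have E1 : \sum_j (coord3 j v)%:C * ifourier (iximul j F) x =
    ifourier (fun xi => \sum_(j < 3) (coord3 j v)%:C * iximul j F xi) x.
  rewrite ifourierE.
  under [in RHS]eq_fun do rewrite mulr_sumr.
  rewrite Cint_sum; last by move=> j; apply: cinteg_char; exact: cintegZ.
  rewrite mulr_sumr; apply: eq_bigr => j _; rewrite -ifourierZ//.
have E2 : ifourier F (x + v) = ifourier (fun xi => expi (dot3 v xi) * F xi) x.
  rewrite !ifourierE; congr (_ * _); apply: eq_Cint => xi.
  by rewrite dot3Dl expiD mulrA.
have c1 := cinteg_char v F1.
rewrite E1 E2 -ifourierB// -ifourierB//; last exact: cintegB.
apply: (le_trans (ifourier_le _ _)); first by apply: cintegB => //; exact: cintegB.
rewrite -(mulrA _ 18) [X in (_ <= X * _)%E]EFinM -muleA.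
apply: lee_wpmul2l; first by rewrite lee_fin mulr_ge0// fcst_ge0.
rewrite -ge0_integralZl//; last 3 first.
- by apply: measurable_enormc; have [] := mF 2%N.
- by move=> xi _; rewrite lee_fin normc_ge0.
- by rewrite lee_fin mulr_ge0// sqr_ge0.
apply: ge0_le_integral => //.
- by move=> xi _; rewrite lee_fin normc_ge0.
- apply: measurable_enormc; apply: cmeasB; last by have [] := S1.
  by apply: cmeasB; [have [] := c1|have [] := F1].
- by apply: measurable_funeM; apply: measurable_enormc; have [] := mF 2%N.
move=> xi _; rewrite -EFinM lee_fin sumE.
have -> : expi (dot3 v xi) * F xi - F xi - ii * (dot3 v xi)%:C * F xi =
  (expi (dot3 v xi) - 1 - ii * (dot3 v xi)%:C) * F xi by ring.
rewrite !normcM normcC mulrA ler_wpM2r ?normc_ge0//.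
apply: (le_trans (normc_expiB1 _)).
rewrite ger0_norm ?sqr_ge0// -(real_normK (num_real (dot3 v xi))).
have h : `|dot3 v xi| ^+ 2 <= (enorm v * (3 * (1 + enorm xi))) ^+ 2.
  rewrite ler_sqr ?nnegrE ?mulr_ge0 ?enorm_ge0 ?(ltW (opp_enorm_gt0 _))//.
  apply: (le_trans (dot3_le _ _)); rewrite ler_wpM2l ?enorm_ge0// ler_wpM2l// lerDr//.
apply: (le_trans (ler_wpM2l _ h)) => //.
by rewrite le_eqVlt; apply/orP; left; apply/eqP; ring.
Qed.

Lemma ifourier_cdiff F x : moment F ->
  cdiff (ifourier F) x /\ forall j, pd j (ifourier F) x = ifourier (iximul j F) x.
Proof.
move=> mF; have [_ F2] := mF 2%N.
set I := (\int[leb3 R]_xi _)%E in F2.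
have I0 : (0 <= I)%E by apply: integral_ge0 => xi _; rewrite lee_fin normc_ge0.
have IE : I = (fine I)%:E by rewrite fineK// ge0_fin_numE.
apply: (cquadratic_diff (C := 2 * fcst * 18 * fine I)) => v.
have := ifourier_expand x v mF; rewrite -/I IE -EFinM lee_fin.
by rewrite mulrAC.
Qed.

Lemma pd_ifourier j F : moment F -> pd j (ifourier F) = ifourier (iximul j F).
Proof. by move=> mF; apply/funext => x; have [] := ifourier_cdiff x mF. Qed.

Lemma smooth_ifourier F : moment F -> smooth (ifourier F).
Proof.
move=> mF; apply/smoothP => n; elim: n F mF => [|n IH] F mF.
  by apply/smoothN0 => x; have [] := ifourier_cdiff x mF.
apply/smoothNS; split => [x|j]; first by have [] := ifourier_cdiff x mF.
by rewrite pd_ifourier//; apply: IH; exact: moment_iximul.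
Qed.

End fourier_integrals.

(** * Test functions and Schwartz seminorms *)

Section test_functions.
Context {R : realType}.
Implicit Types (f g : cfield R) (x v xi a : R3 R) (j : 'I_3).
Local Notation L1 := (cinteg (leb3 R)).
Local Notation cmeas3 := (cmeas (T := M3 R)).

Lemma test_cmeas f : test_fun f -> cmeas3 f.
Proof. by case=> sf _; exact: smooth_cmeas. Qed.

Lemma testD f g : test_fun f -> test_fun g -> test_fun (fun x => f x + g x).
Proof.
move=> [sf [r fr]] [sg [t gt]]; split; first exact: smoothD.
by exists (Num.max r t) => x; rewrite gt_max => /andP[h1 h2]; rewrite fr// gt// addr0.
Qed.

Lemma testM f g : test_fun f -> smooth g -> test_fun (fun x => f x * g x).
Proof.
move=> [sf [r fr]] sg; split; first exact: smoothM.
by exists r => x h; rewrite fr// mul0r.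
Qed.

Lemma testMl f g : smooth g -> test_fun f -> test_fun (fun x => g x * f x).
Proof. by move=> sg tf; under eq_fun do rewrite mulrC; exact: testM. Qed.

Lemma testZ (z : R[i]) f : test_fun f -> test_fun (fun x => z * f x).
Proof. by move=> tf; apply: testMl => //; exact: smooth_cst. Qed.

Lemma testN f : test_fun f -> test_fun (fun x => - f x).
Proof. by move=> tf; under eq_fun do rewrite -mulN1r; exact: testZ. Qed.

Lemma testB f g : test_fun f -> test_fun g -> test_fun (fun x => f x - g x).
Proof. by move=> tf tg; apply: testD => //; exact: testN. Qed.

Lemma test_sum I (s : seq I) (F : I -> cfield R) : (forall i, test_fun (F i)) ->
  test_fun (fun y => \sum_(i <- s) F i y).
Proof.
move=> sF; elim: s => [|i s IH].
  under eq_fun do rewrite big_nil; split; first exact: smooth_cst.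
  by exists 0.
by under eq_fun do rewrite big_cons; exact: testD.
Qed.

Lemma enorm_le_sum x : enorm x <= `|coord3 0 x| + `|coord3 1 x| + `|coord3 2 x|.
Proof.
rewrite -(@ler_sqr _ (enorm x)) ?nnegrE ?addr_ge0 ?enorm_ge0// enorm_sqr.
rewrite /dot3 !big_ord_recl big_ord0 addr0.
have -> : lift ord0 ord0 = 1 :> 'I_3 by exact/val_inj.
have -> : lift ord0 (lift ord0 ord0) = 2 :> 'I_3 by exact/val_inj.
rewrite -!expr2 -(real_normK (num_real (coord3 0 x))) -(real_normK (num_real (coord3 1 x))).
rewrite -(real_normK (num_real (coord3 2 x))).
move: (normr_ge0 (coord3 0 x)) (normr_ge0 (coord3 1 x)) (normr_ge0 (coord3 2 x)).
set p := `|_|; set q := `|_|; set r := `|_| => p0 q0 r0.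
rewrite -subr_ge0 (_ : _ - _ = 2 * (p * q + p * r + q * r)); last by ring.
by rewrite mulr_ge0// !addr_ge0// mulr_ge0.
Qed.

Lemma dot3_CS x v : dot3 x v <= enorm x * enorm v.
Proof.
have [x0|x0] := eqVneq (enorm x) 0.
  have h := dot3_le x v; rewrite x0 mul0r normr_le0 in h.
  by rewrite (eqP h) x0 mul0r.
have [v0|v0] := eqVneq (enorm v) 0.
  have h := dot3_le v x; rewrite v0 mul0r normr_le0 in h.
  by rewrite dot3C (eqP h) v0 mulr0.
have xp : 0 < enorm x by rewrite lt_neqAle eq_sym x0 enorm_ge0.
have vp : 0 < enorm v by rewrite lt_neqAle eq_sym v0 enorm_ge0.
(* The square of this vector is $2|x||v|\,(|x||v|-x\cdot v)$. *)
have := dot3_ge0 (enorm v *: x - enorm x *: v).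
rewrite !(dot3Dl, dot3Dr, dot3Nl, dot3Nr, dot3Zl, dot3Zr) -!enorm_sqr (dot3C v x).
set p := enorm x; set q := enorm v; set d := dot3 x v => h.
have h2 : 0 <= (p * q) * (p * q - d) by lra.
by rewrite pmulr_rge0 ?mulr_gt0// subr_ge0 in h2.
Qed.

Lemma enormD x v : enorm (x + v) <= enorm x + enorm v.
Proof.
rewrite -(@ler_sqr _ (enorm _)) ?nnegrE ?addr_ge0 ?enorm_ge0// enorm_sqr.
rewrite !(dot3Dl, dot3Dr) -!enorm_sqr (dot3C v x) sqrrD.
by have := dot3_CS x v; lra.
Qed.

Lemma enormB x v : enorm (x - v) <= enorm x + enorm v.
Proof. by rewrite -(enormN v) enormD. Qed.

Lemma test_aff (r : R) a f : r != 0 -> test_fun f -> test_fun (fun x => f (r *: x + a)).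
Proof.
move=> r0 [sf [t ft]]; split; first exact: smooth_aff.
exists ((t + enorm a) / `|r|) => x; rewrite ltr_pdivrMr ?normr_gt0// => h.
apply: ft; have := enormB (r *: x + a) a; rewrite addrK enormZ; lra.
Qed.

Lemma near_enorm_gt (r : R) x : r < enorm x -> \forall y \near x, r < enorm y.
Proof.
move=> rx; near=> y.
have h1 : `|x - y| <= (enorm x - r) / 4.
  by near: y; apply: cvgr_dist_le => //; rewrite divr_gt0// subr_gt0.
have h2 := enormD y (x - y); rewrite addrC subrK in h2.
have h3 := enorm_norm (x - y); lra.
Unshelve. all: by end_near. Qed.

Lemma pd_vanish j f (r : R) x : (forall y, r < enorm y -> f y = 0) -> r < enorm x ->
  pd j f x = 0.
Proof.
move=> fr rx.
have fx : \forall y \near x, f y = 0.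
  by near=> y; apply: fr; near: y; exact: near_enorm_gt.
rewrite /pd (@near_eq_derive R (R3 R) R _ (fun=> 0)); last first.
  by near=> y; rewrite (near fx y).
rewrite (@near_eq_derive R (R3 R) R (fun y => complex.Im (f y)) (fun=> 0)); last first.
  by near=> y; rewrite (near fx y).
by rewrite !(@derive_cst R (R3 R) R 0).
Unshelve. all: by end_near. Qed.

Lemma test_pd j f : test_fun f -> test_fun (pd j f).
Proof.
move=> [sf [r fr]]; split; first exact: smooth_pd.
by exists r => x; exact: pd_vanish.
Qed.

Lemma test_pds js f : test_fun f -> test_fun (pds js f).
Proof. by move=> tf; elim: js => //= j js; exact: test_pd. Qed.

Lemma compact_cube (r : R) : compact [set x : R3 R | forall j, `|coord3 j x| <= r].
Proof.
have -> : [set x : R3 R | forall j, `|coord3 j x| <= r] =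
    (`[-r, r]%classic `*` `[-r, r]%classic) `*` `[-r, r]%classic.
  apply/seteqP; split => x /=; rewrite !in_itv /= -!ler_norml.
    by move=> h; split; first split; [exact: (h 0)|exact: (h 1)|exact: (h 2)].
  by move=> [[h1 h2] h3] j; case: j => -[|[|[|]]].
by apply: compact_setX; [apply: compact_setX|]; exact: segment_compact.
Qed.

Lemma test_bounded f : test_fun f -> exists M : R, forall x, normc (f x) <= M.
Proof.
move=> [sf [r fr]].
have [c1 c2] := smooth_continuous sf.
pose h x : R := `|complex.Re (f x)| + `|complex.Im (f x)|.
have ch : continuous h.
  by move=> x; apply: cvgD; apply: cvg_norm; [exact: c1|exact: c2].
have [|||c _ hc] := @compact_EVT_max _ R h [set x : R3 R | forall j, `|coord3 j x| <= `|r|].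
- exists 0 => j; rewrite (_ : coord3 j 0 = 0) ?normr0//; by case: j => -[|[|[|]]].
- exact: compact_cube.
- exact: continuous_subspaceT.
exists (h c) => x; apply: (le_trans (normc_le_ReIm _)).
have [xr|xr] := leP (enorm x) `|r|.
  apply: hc; rewrite inE => j; exact: le_trans (coord3_le j x) xr.
rewrite fr ?normr0 ?addr0; last by apply: le_lt_trans xr; exact: ler_norm.
by rewrite addr_ge0.
Qed.

(** There are finitely many words of length at most [N], so bounds that hold for each of them can be
    made uniform. The predicate is abstract because it serves both for seminorms of test functions
    and for derivatives of the cutoff. *)
Lemma bounded_words (B : seq 'I_3 -> R -> Prop) (N : nat) :
  (forall js M M', M <= M' -> B js M -> B js M') ->
  (forall js, exists M, B js M) -> exists M, forall js, (size js <= N)%N -> B js M.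
Proof.
move=> Bm; elim: N B Bm => [|N IH] B Bm hB.
  by have [M hM] := hB [::]; exists M => -[].
have [M0 h0] := hB [::].
have hj j : exists M, forall js, (size js <= N)%N -> B (j :: js) M.
  by apply: (IH (fun js => B (j :: js))) => // js M M'; exact: Bm.
have [M hM] := choice hj.
exists (Num.max M0 (\big[Num.max/M0]_j M j)) => -[_|j js js_N].
  by apply: Bm h0; rewrite le_max lexx.
apply: Bm (hM j js js_N); rewrite le_max; apply/orP; right.
exact: le_bigmax.
Qed.

(** Real-valued form of a bound on [seminorm], by [seminormP]; all later estimates are in this
    form. *)
Definition schwartz_bound f N M := forall js x, (size js <= N)%N ->
  (1 + enorm x) ^+ N * normc (pds js f x) <= M.

Lemma seminormP f N M : schwartz_bound f N M <-> (seminorm N f <= M%:E)%E.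
Proof.
split => [h|h js x js_N].
  by apply: ub_ereal_sup => _ [js js_N [x _ <-]]; rewrite lee_fin; exact: h.
rewrite -lee_fin; apply: le_trans h; apply: ereal_sup_ubound.
by exists js => //; exists x.
Qed.

Lemma seminorm_ge0 f N : (0 <= seminorm N f)%E.
Proof.
apply: (@le_trans _ _ ((1 + enorm (0 : R3 R)) ^+ N * normc (pds [::] f 0))%:E).
  by rewrite lee_fin mulr_ge0 ?normc_ge0// exprn_ge0// ltW// opp_enorm_gt0.
by apply: ereal_sup_ubound; exists [::] => //; exists 0.
Qed.

Lemma schwartzP f : schwartz f <-> smooth f /\ forall N, exists M, schwartz_bound f N M.
Proof.
split=> -[sf h]; split => // N.
  exists (fine (seminorm N f)); apply/seminormP.
  by rewrite fineK// ge0_fin_numE ?seminorm_ge0.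
by have [M /seminormP hM] := h N; exact: le_lt_trans hM (ltry _).
Qed.

Lemma test_schwartz f : test_fun f -> schwartz f.
Proof.
move=> tf; apply/schwartzP; split => [|N]; first by case: tf.
have [_ [r fr]] := tf.
have [|js|M hM] := @bounded_words
  (fun js M => forall x, (1 + enorm x) ^+ N * normc (pds js f x) <= M) N.
- by move=> js M M' MM' h x; exact: le_trans (h x) MM'.
- have tj := test_pds js tf; have [M hM] := test_bounded tj.
  have [_ [t ht]] := tj.
have M0 : 0 <= M := le_trans (normc_ge0 _) (hM 0).
exists ((1 + `|t|) ^+ N * M) => x.
have [xt|xt] := leP (enorm x) `|t|; last first.
  rewrite ht; last by apply: le_lt_trans xt; exact: ler_norm.
  by rewrite normc0 mulr0 mulr_ge0// exprn_ge0// addr_ge0.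
rewrite ler_pM ?normc_ge0 ?exprn_ge0// ?(ltW (opp_enorm_gt0 _))//.
by rewrite lerXn2r ?nnegrE ?addr_ge0 ?enorm_ge0// lerD2l.
by exists M => js x js_N; exact: hM.
Qed.

Lemma schwartz_smooth f : schwartz f -> smooth f. Proof. by case. Qed.

Lemma schwartz_pd j f : schwartz f -> schwartz (pd j f).
Proof.
move=> /schwartzP[sf h]; apply/schwartzP; split; first exact: smooth_pd.
move=> N; have [M hM] := h N.+1; exists M => js x js_N; rewrite -pds_rcons.
have szN : (size (rcons js j) <= N.+1)%N by rewrite size_rcons.
apply: le_trans (hM _ x szN); rewrite ler_wpM2r ?normc_ge0// exprS ler_peMl ?exprn_ge0 ?(ltW (opp_enorm_gt0 _))//.
by rewrite lerDl enorm_ge0.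
Qed.

Lemma schwartz_cmeas f : schwartz f -> cmeas3 f.
Proof. by move=> /schwartz_smooth; exact: smooth_cmeas. Qed.

Lemma schwartz_moment f : schwartz f -> moment f.
Proof.
move=> sf N; have /schwartzP[sm h] := sf; have [M hM] := h (6 + N)%N.
apply: (cinteg_decay (M := M)).
  by apply: cmeasM; [exact: cmeas_real (measurable_wX N)|exact: schwartz_cmeas].
move=> x; have := hM [::] x isT; rewrite exprD /= normcM normcC ger0_norm ?mulrA//.
by rewrite exprn_ge0// ltW// opp_enorm_gt0.
Qed.

Lemma schwartz_L1 f : schwartz f -> L1 f.
Proof. by move=> /schwartz_moment/moment_L1. Qed.

Lemma test_L1 f : test_fun f -> L1 f.
Proof. by move=> /test_schwartz/schwartz_L1. Qed.

End test_functions.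

Lemma derive_line (R : realType) (V : normedModType R) (h : V -> R^o) (x v : V) (t : R) :
  differentiable h (t *: v + x) ->
  is_derive t (1 : R) (fun s : R => h (s *: v + x)) ('D_v h (t *: v + x)).
Proof.
move=> dh.
have dA : is_diff t (fun s : R => s *: v + x) (fun s : R => s *: v).
  have := is_diffD (@is_diff_scalel R V t v) (is_diff_cst x (t : R^o)).
  by rewrite addr0.
have dhA : differentiable (h \o (fun s : R => s *: v + x)) t.
  by apply: differentiable_comp => //; case: dA.
apply: DeriveDef; first exact/derivable1_diffP.
rewrite deriveE// (_ : (fun s => _) = h \o (fun s : R => s *: v + x))//.
rewrite diff_comp//.
by rewrite /= (@diff_val _ _ _ _ _ _ _ dA) scale1r deriveE.
Qed.

(** * The Fourier transform on the Schwartz space *)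

Section schwartz_space.
Context {R : realType}.
Implicit Types (f g h : cfield R) (x v xi a : R3 R) (j : 'I_3).
Local Notation L1 := (cinteg (leb3 R)).
Local Notation cmeas3 := (cmeas (T := M3 R)).

Lemma wX_ge0 x n : 0 <= (1 + enorm x) ^+ n.
Proof. by rewrite exprn_ge0// ltW// opp_enorm_gt0. Qed.

Lemma enorm_basis j : enorm (basis3 R j) = 1.
Proof. by rewrite /enorm dot3_basis coord3_basis eqxx sqrtr1. Qed.

(** Provides the integrable majorant of the difference quotients. A move of length at most 1 changes
    $1+|x|$ by a factor of at most 2, whence $64=2^6$; the other factor 2 adds real and imaginary
    parts. *)
Lemma pd_line_bound j h x (M : R) (t : R) : (forall y, cdiff h y) -> 0 <= t <= 1 ->
  (forall y, (1 + enorm y) ^+ 6 * normc (pd j h y) <= M) ->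
  normc (h (t *: basis3 R j + x) - h x) <= (128 * M * wgt x) * t.
Proof.
move=> dh /andP[t0 t1] hM.
have M0 : 0 <= M by apply: le_trans (hM 0); rewrite mulr_ge0 ?normc_ge0// exprn_ge0// ltW// opp_enorm_gt0.
have key s : `|s| <= `|t| -> normc (pd j h (s *: basis3 R j + x)) <= 64 * M * wgt x.
  rewrite (ger0_norm t0) => st.
  set y := _ + x.
  have hy : 1 + enorm x <= 2 * (1 + enorm y).
    have := enormB y (s *: basis3 R j); rewrite /y (addrC _ x) addrK enormZ enorm_basis mulr1.
    by have := enorm_ge0 (x + s *: basis3 R j); lra.
  have hy6 : (1 + enorm x) ^+ 6 <= 64 * (1 + enorm y) ^+ 6.
    rewrite (_ : 64 * _ = (2 * (1 + enorm y)) ^+ 6); last by ring.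
    by rewrite lerXn2r ?nnegrE ?mulr_ge0 ?(ltW (opp_enorm_gt0 _)).
  rewrite /wgt ler_pdivlMr ?exprn_gt0 ?opp_enorm_gt0// mulrC.
  apply: (le_trans (ler_wpM2r (normc_ge0 _) hy6)).
  by rewrite -mulrA ler_wpM2l.
have h1 : `|complex.Re (h (t *: basis3 R j + x)) - complex.Re (h x)| <= (64 * M * wgt x) * `|t|.
  have := @mvt_bound R (fun s => complex.Re (h (s *: basis3 R j + x)))
    (fun s => complex.Re (pd j h (s *: basis3 R j + x))) t (64 * M * wgt x).
  rewrite scale0r add0r; apply => [s|c ct]; last exact: le_trans (Re_le_normc _) (key c ct).
  by apply: (@derive_line R (R3 R) (fun y => complex.Re (h y))); have [] := dh (s *: basis3 R j + x).
have h2 : `|complex.Im (h (t *: basis3 R j + x)) - complex.Im (h x)| <= (64 * M * wgt x) * `|t|.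
  have := @mvt_bound R (fun s => complex.Im (h (s *: basis3 R j + x)))
    (fun s => complex.Im (pd j h (s *: basis3 R j + x))) t (64 * M * wgt x).
  rewrite scale0r add0r; apply => [s|c ct]; last exact: le_trans (Im_le_normc _) (key c ct).
  by apply: (@derive_line R (R3 R) (fun y => complex.Im (h y))); have [] := dh (s *: basis3 R j + x).
apply: (le_trans (normc_le_ReIm _)); rewrite cReD cReN cImD cImN.
rewrite (ger0_norm t0) in h1 h2; lra.
Qed.

Lemma harmonic_dnbhs : (fun n => (n.+1%:R^-1 : R)) @ \oo --> (0 : R)^'.
Proof.
move=> U [e e0 eU]; have := @cvg_harmonic R => /(_ (ball 0 e)) [].
  by apply: nbhsx_ballx.
move=> N _ hN; exists N => // n /hN hn; apply: eU => //=.
Qed.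

Lemma pd_difference_quotient j h x : cdiff h x ->
  (fun n => normc ((n.+1%:R)%:C * (h ((n.+1%:R^-1 : R) *: basis3 R j + x) - h x) - pd j h x))
    @ \oo --> (0 : R).
Proof.
move=> [d1 d2].
have key (k : R3 R -> R) : differentiable k x ->
   (fun n => `|n.+1%:R * (k ((n.+1%:R^-1 : R) *: basis3 R j + x) - k x) - 'D_(basis3 R j) k x|)
     @ \oo --> (0 : R).
  move=> dk; have dv : derivable (k : R3 R -> R^o) x (basis3 R j) by exact: diff_derivable.
  have c : (fun n => (n.+1%:R^-1)^-1 * (k ((n.+1%:R^-1 : R) *: basis3 R j + x) - k x))
     @ \oo --> ('D_(basis3 R j) (k : R3 R -> R^o) x : R).
    exact: (cvg_comp _ _ harmonic_dnbhs dv).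
  rewrite -(normr0 R) -(subrr ('D_(basis3 R j) k x)).
  apply: cvg_norm; apply: cvgB; last exact: cvg_cst.
  by move: c; under eq_fun do rewrite invrK.
have s : (fun n => `|n.+1%:R * (complex.Re (h ((n.+1%:R^-1 : R) *: basis3 R j + x)) - complex.Re (h x)) - 'D_(basis3 R j) (fun y => complex.Re (h y)) x|
   + `|n.+1%:R * (complex.Im (h ((n.+1%:R^-1 : R) *: basis3 R j + x)) - complex.Im (h x)) - 'D_(basis3 R j) (fun y => complex.Im (h y)) x|) @ \oo --> (0 : R).
  by rewrite -(addr0 0); apply: cvgD; [exact: key d1|exact: key d2].
apply: squeeze_cvgr s; last exact: cvg_cst.
apply: nearW => n; rewrite normc_ge0 /=.
apply: (le_trans (normc_le_ReIm _)).
by rewrite cReD cReN cRe_rM cReD cReN cImD cImN cIm_rM cImD cImN.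
Qed.

(* Integrals of derivatives vanish by translation invariance. *)
Lemma Cint_pd0 j h (M : R) : (forall y, cdiff h y) -> L1 h -> cmeas3 (pd j h) ->
  (forall y, (1 + enorm y) ^+ 6 * normc (pd j h y) <= M) -> Cint (leb3 R) (pd j h) = 0.
Proof.
move=> dh hi mp hM.
have pdi : L1 (pd j h) by exact: (cinteg_decay mp hM).
pose D n x := (n.+1%:R)%:C * (h ((n.+1%:R^-1 : R) *: basis3 R j + x) - h x).
have hin n : L1 (fun x => h ((n.+1%:R^-1 : R) *: basis3 R j + x)).
  have := cinteg_aff ((n.+1%:R^-1 : R) *: basis3 R j) (oner_neq0 R) hi.
  by under eq_fun do rewrite scale1r addrC.
have Di n : L1 (D n) by apply: cintegZ; exact: cintegB.
have D0 n : Cint (leb3 R) (D n) = 0.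
  rewrite CintZ; last exact: cintegB.
  rewrite CintB//; have := Cint_aff ((n.+1%:R^-1 : R) *: basis3 R j) (oner_neq0 R) hi.
  under eq_Cint do rewrite scale1r addrC.
  by rewrite normr1 expr1n invr1 mul1r => ->; rewrite subrr mulr0.
(* $129=128+1$: the difference quotient and the derivative to which it converges. *)
have [wm woo] := cintegZ (129 * M)%:C (@cinteg_wgt R).
have M0 : 0 <= M by apply: le_trans (hM 0); rewrite mulr_ge0 ?normc_ge0// exprn_ge0// ltW// opp_enorm_gt0.
have lim := @dominated_Cint _ (M3 R) R (leb3 R) D (pd j h)
  (fun x => normc ((129 * M)%:C * (wgt x)%:C)) Di pdi (measurable_normc wm) woo.
have {lim} := lim _ _.
have -> : (fun n => normc (Cint (leb3 R) (D n) - Cint (leb3 R) (pd j h))) =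
   (fun=> normc (Cint (leb3 R) (pd j h))).
  by apply/funext => n; rewrite D0 sub0r normcN.
move=> lim; apply: eq0_normc.
apply: (@cvg_unique _ (@Rhausdorff R) ((fun=> normc (Cint (leb3 R) (pd j h))) @ \oo)).
  exact: cvg_cst.
apply: lim.
  apply: aeW => x n; have n0 : 0 < n.+1%:R :> R by rewrite ltr0n.
  have b1 := @pd_line_bound j h x M n.+1%:R^-1 dh _ hM.
  have {b1} : normc (D n x) <= 128 * M * wgt x.
    rewrite /D normcM normcC gtr0_norm// mulrC -ler_pdivlMr// b1//.
    by rewrite invr_ge0 (ltW n0)/= invf_le1// ler1n.
  have b2 : normc (pd j h x) <= M * wgt x.
    by rewrite ler_pdivlMr ?exprn_gt0 ?opp_enorm_gt0// mulrC.
  move=> b1; apply: (le_trans (normcB _ _)).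
  rewrite [leRHS]normcM !normcC !ger0_norm ?(ltW (wgt_gt0 x)) ?mulr_ge0//.
  by rewrite (_ : 129 * M * _ = 128 * M * wgt x + M * wgt x) ?lerD//; ring.
by apply: aeW => x; exact: pd_difference_quotient.
Qed.

Lemma char_cdiff x xi : cdiff (fun xi => expi (dot3 x xi)) xi /\
  forall j, pd j (fun xi => expi (dot3 x xi)) xi = ii * (coord3 j x)%:C * expi (dot3 x xi).
Proof.
apply: (cquadratic_diff (C := 2 * (3 * enorm x) ^+ 2)) => v.
have -> : expi (dot3 x (xi + v)) - expi (dot3 x xi) -
   \sum_j (coord3 j v)%:C * (ii * (coord3 j x)%:C * expi (dot3 x xi)) =
   (expi (dot3 x v) - 1 - ii * (dot3 x v)%:C) * expi (dot3 x xi).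
  rewrite dot3Dr addrC expiD [X in _ = (_ - ii * X) * _]rmorph_sum /= 2!mulrBl mul1r mulr_sumr mulr_suml.
  rewrite addrC (mulrC (expi (dot3 x xi))); congr (_ - _).
  by apply: eq_bigr => j _; rewrite rmorphM /=; ring.
rewrite normcM normc_expi mulr1; apply: (le_trans (normc_expiB1 _)).
rewrite -mulrA ler_wpM2l// -exprMn -(real_normK (num_real (dot3 x v))) ler_sqr ?nnegrE ?mulr_ge0 ?enorm_ge0//.
by rewrite (mulrC 3) -mulrA dot3_le.
Qed.

(** Integration by parts: the integral of $\partial_j(e^{ix\cdot\xi}f)$ vanishes by [Cint_pd0]. *)
Lemma ifourier_pd j f x : schwartz f ->
  ifourier (pd j f) x = - (ii * (coord3 j x)%:C * ifourier f x).
Proof.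
move=> sf; pose e xi := expi (dot3 x xi).
have smf := schwartz_smooth sf.
have de xi : cdiff e xi by have [] := char_cdiff x xi.
have pe xi : pd j e xi = ii * (coord3 j x)%:C * e xi by have [_] := char_cdiff x xi; exact.
have dfe xi : cdiff (fun xi => e xi * f xi) xi by apply: cdiffM => //; exact: smooth_cdiff.
have pfe : pd j (fun xi => e xi * f xi) = fun xi => ii * (coord3 j x)%:C * (e xi * f xi) + e xi * pd j f xi.
  by apply/funext => xi; rewrite pdM//; [rewrite pe mulrA|exact: smooth_cdiff].
have L1f := cinteg_char x (schwartz_L1 sf).
have L1p := cinteg_char x (schwartz_L1 (schwartz_pd j sf)).
have [_ /(_ 6%N)[M hM]] := (schwartzP f).1 sf.
have := @Cint_pd0 j (fun xi => e xi * f xi) (enorm x * M + M) dfe L1f.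
rewrite pfe CintD//; last exact: cintegZ.
rewrite CintZ// => h; rewrite !ifourierE -[X in _ * X](addKr (ii * (coord3 j x)%:C * Cint (leb3 R) (fun xi => e xi * f xi))).
rewrite h ?addr0; first by rewrite mulrN (mulrCA fcst%:C).
- by apply: cmeasD; [have [] := cintegZ (ii * (coord3 j x)%:C) L1f|have [] := L1p].
- move=> y; have h1 := hM [::] y isT; have h2 := hM [:: j] y isT; rewrite /= in h1 h2.
  apply: (le_trans (ler_wpM2l _ (normcD _ _))); first by rewrite exprn_ge0// ltW// opp_enorm_gt0.
  rewrite mulrDr lerD//; last by rewrite normcM normc_expi mul1r.
  rewrite !normcM normc_ii normcC normc_expi !mul1r mulrCA.
  by rewrite ler_pM ?coord3_le ?(mulr_ge0 (wX_ge0 _ _) (normc_ge0 _))//.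
Qed.

Lemma smooth_pds js f : smooth f -> smooth (pds js f).
Proof. by move=> sf; elim: js => //= j l; exact: smooth_pd. Qed.

Lemma pdsD js f g : smooth f -> smooth g ->
  pds js (fun y => f y + g y) = (fun y => pds js f y + pds js g y).
Proof. by move=> sf sg; elim: js => //= i l ->; rewrite pdDE//; exact: smooth_pds. Qed.

Lemma pdsZ js (z : R[i]) f : smooth f -> pds js (fun y => z * f y) = (fun y => z * pds js f y).
Proof. by move=> sf; elim: js => //= i l ->; rewrite pdZE//; exact: smooth_pds. Qed.

(** $2^{|js|}$ is the number of terms of the Leibniz formula. The induction removes the derivative
    applied first, so that it meets a product and not an iterated derivative of one. *)
Lemma leibniz_bound n f g x (A B : R) : smooth f -> smooth g ->
  (forall js, (size js <= n)%N -> normc (pds js f x) <= A) ->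
  (forall js, (size js <= n)%N -> normc (pds js g x) <= B) ->
  forall js, (size js <= n)%N -> normc (pds js (fun y => f y * g y) x) <= 2 ^+ size js * (A * B).
Proof.
move=> sf sg fA gB js; elim/last_ind: js n f g sf sg fA gB => [|js j IH] n f g sf sg fA gB js_n.
  by rewrite expr0 mul1r /= normcM ler_pM ?normc_ge0//; [exact: (fA [::])|exact: (gB [::])].
rewrite pds_rcons pdME//; move: js_n; rewrite size_rcons => js_n.
rewrite pdsD; [|by apply: smoothM => //; exact: smooth_pd..].
apply: (le_trans (normcD _ _)); rewrite exprS -mulrA mulr_natl mulr2n.
case: n js_n fA gB => // n js_n fA gB.
apply: lerD; apply: (IH n) => //; try exact: smooth_pd.
- by move=> l l_n; rewrite -pds_rcons; apply: fA; rewrite size_rcons.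
- by move=> l l_n; apply: gB; exact: leqW.
- by move=> l l_n; apply: fA; exact: leqW.
- by move=> l l_n; rewrite -pds_rcons; apply: gB; rewrite size_rcons.
Qed.

Lemma schwartzD f g : schwartz f -> schwartz g -> schwartz (fun x => f x + g x).
Proof.
move=> /schwartzP[sf hf] /schwartzP[sg hg]; apply/schwartzP; split; first exact: smoothD.
move=> N; have [M hM] := hf N; have [M' hM'] := hg N; exists (M + M') => js x js_N.
rewrite pdsD//; apply: (le_trans (ler_wpM2l (wX_ge0 _ _) (normcD _ _))).
by rewrite mulrDr lerD ?hM ?hM'.
Qed.

Lemma schwartzZ (z : R[i]) f : schwartz f -> schwartz (fun x => z * f x).
Proof.
move=> /schwartzP[sf hf]; apply/schwartzP; split; first exact: smoothZ.
move=> N; have [M hM] := hf N; exists (normc z * M) => js x js_N.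
by rewrite pdsZ// normcM mulrCA ler_wpM2l ?normc_ge0// hM.
Qed.

Lemma schwartz0 : schwartz (fun=> 0 : R[i]).
Proof. by apply: test_schwartz; split; [exact: smooth_cst|exists 0]. Qed.

Lemma pds_conj js f : smooth f -> pds js (fun y => (f y)^*%C) = (fun y => (pds js f y)^*%C).
Proof. by move=> sf; elim: js => //= i l ->; rewrite pd_conjE//; exact: smooth_pds. Qed.

Lemma schwartz_conj f : schwartz f -> schwartz (fun x => (f x)^*%C).
Proof.
move=> /schwartzP[sf hf]; apply/schwartzP; split; first exact: smooth_conj.
by move=> N; have [M hM] := hf N; exists M => js x js_N; rewrite pds_conj// normc_conj hM.
Qed.

Lemma pds_coord_le js j x :
  normc (pds js (fun xi => ii * (coord3 j xi)%:C) x) <= 1 + enorm x.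
Proof.
rewrite (@pdsZ _ ii (fun xi => (coord3 j xi)%:C)); last exact: smooth_coord.
rewrite normcM normc_ii mul1r; case/lastP: js => [|js i].
  by rewrite /= expr0n addr0 sqrtr_sqr (le_trans (coord3_le j x))// lerDr.
rewrite pds_rcons pd_coord.
have : pds js (fun=> (i == j)%:R : R[i]) x = (i == j)%:R \/ pds js (fun=> (i == j)%:R : R[i]) x = 0.
  case/lastP: js => [|js k]; first by left.
  right; rewrite pds_rcons pd_cst; elim: js x => //= l js IH x.
  have -> : pds js (fun=> 0) = (fun=> 0 : R[i]) by apply/funext => y; exact: IH.
  by rewrite pd_cst.
by move=> [|] ->; case: (i == j); rewrite ?normc1 ?normc0 ?lerDl ?enorm_ge0 ?addr_ge0 ?enorm_ge0.
Qed.

Lemma smooth_iximul j f : smooth f -> smooth (iximul j f).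
Proof.
by move=> sf; apply: smoothM => //; apply: smoothZ; exact: smooth_coord.
Qed.

Lemma schwartz_bound_iximul j f N M : smooth f -> schwartz_bound f N.+1 M ->
  schwartz_bound (iximul j f) N (2 ^+ N * M).
Proof.
move=> sf hM js x js_N; have w0 := opp_enorm_gt0 x.
have hf l : (size l <= N)%N -> normc (pds l f x) <= M / (1 + enorm x) ^+ N.+1.
  by move=> l_N; rewrite ler_pdivlMr ?exprn_gt0// mulrC; apply: hM; exact: leqW.
have sc : smooth (fun xi : R3 R => ii * (coord3 j xi)%:C) by apply: smoothZ; exact: smooth_coord.
have := leibniz_bound sc sf (fun l (_ : (size l <= N)%N) => pds_coord_le l j x) hf js_N.
have M0 : 0 <= M / (1 + enorm x) ^+ N.+1 := le_trans (normc_ge0 _) (hf [::] isT).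
move=> h; apply: (le_trans (ler_wpM2l (wX_ge0 _ _) h)).
apply: (@le_trans _ _ ((1 + enorm x) ^+ N * (2 ^+ N * ((1 + enorm x) * (M / (1 + enorm x) ^+ N.+1))))).
  rewrite ler_wpM2l ?wX_ge0// ler_wpM2r ?(mulr_ge0 (ltW w0) M0)//.
  by rewrite ler_weXn2l// ler1n.
rewrite exprS invfM le_eqVlt; apply/orP; left; apply/eqP; field.
by rewrite expf_neq0 gt_eqF.
Qed.

Lemma schwartz_bound_ge0 f N M : schwartz_bound f N M -> 0 <= M.
Proof. by move=> /(_ [::] 0 isT); apply: le_trans; rewrite mulr_ge0 ?wX_ge0 ?normc_ge0. Qed.

Lemma schwartz_boundW f N N' M : (N' <= N)%N -> schwartz_bound f N M -> schwartz_bound f N' M.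
Proof.
move=> NN h js x js_N; apply: le_trans (h js x (leq_trans js_N NN)).
by rewrite ler_wpM2r ?normc_ge0// ler_weXn2l// lerDl enorm_ge0.
Qed.

Lemma schwartz_iximul j f : schwartz f -> schwartz (iximul j f).
Proof.
move=> /schwartzP[sf hf]; apply/schwartzP; split; first exact: smooth_iximul.
by move=> N; have [M hM] := hf N.+1; exists (2 ^+ N * M); exact: schwartz_bound_iximul.
Qed.

Definition iximuls js f := foldr (@iximul R) f js.

Lemma pds_ifourier js f : schwartz f -> pds js (ifourier f) = ifourier (iximuls js f).
Proof.
move=> sf; elim: js => //= j js ->; rewrite pd_ifourier//.
by apply: schwartz_moment; elim: js => //= i l; exact: schwartz_iximul.
Qed.

Definition wint : R := fine (\int[leb3 R]_x (wgt x)%:E).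

Lemma wint_fin : (\int[leb3 R]_x (wgt x)%:E)%E = wint%:E.
Proof.
have [_ h] := @cinteg_wgt R; rewrite /wint fineK//.
rewrite ge0_fin_numE; last by apply: integral_ge0 => x _; rewrite lee_fin ltW// wgt_gt0.
by move: h; under eq_integral do rewrite normcC ger0_norm ?(ltW (wgt_gt0 _))//.
Qed.

Lemma ifourier_decay0 f x (K : R) : L1 f -> (forall y, (1 + enorm y) ^+ 6 * normc (f y) <= K) ->
  normc (ifourier f x) <= 2 * fcst * wint * K.
Proof.
move=> hf fK; rewrite -lee_fin; apply: (le_trans (ifourier_le x hf)).
have K0 : 0 <= K by apply: le_trans (fK 0); rewrite mulr_ge0 ?wX_ge0 ?normc_ge0.
rewrite -mulrA [leRHS]EFinM; apply: lee_wpmul2l; first by rewrite lee_fin mulr_ge0// fcst_ge0.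
rewrite mulrC EFinM -wint_fin -ge0_integralZl//; last 2 first.
- by apply/measurable_EFinP; exact: measurable_wgt.
- by move=> y _; rewrite lee_fin ltW// wgt_gt0.
apply: ge0_le_integral => //.
- by move=> y _; rewrite lee_fin normc_ge0.
- by apply: measurable_enormc; have [] := hf.
- by apply: measurable_funeM; apply/measurable_EFinP; exact: measurable_wgt.
- move=> y _; rewrite -EFinM lee_fin /wgt ler_pdivlMr ?exprn_gt0 ?opp_enorm_gt0//.
  by rewrite mulrC.
Qed.

(** Each factor $1+|x|\le1+|x_1|+|x_2|+|x_3|$ is traded for [f] itself or one of its three
    derivatives; the four terms give $4^k$. The fixed weight of exponent 6 makes the remaining
    integrals converge. *)
Lemma ifourier_decay k f x (K : R) : schwartz f ->
  (forall js, (size js <= k)%N -> forall y, (1 + enorm y) ^+ 6 * normc (pds js f y) <= K) ->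
  (1 + enorm x) ^+ k * normc (ifourier f x) <= 4 ^+ k * (2 * fcst * wint * K).
Proof.
elim: k f => [|k IH] f sf fK.
  rewrite !expr0 !mul1r; apply: ifourier_decay0; first exact: schwartz_L1.
  exact: (fK [::]).
rewrite (exprSr (1 + enorm x)) -mulrA.
have e1 : 1 + enorm x <= 1 + (`|coord3 0 x| + `|coord3 1 x| + `|coord3 2 x|).
  by rewrite lerD2l enorm_le_sum.
apply: (le_trans (ler_wpM2l (wX_ge0 _ _) (ler_wpM2r (normc_ge0 _) e1))).
have cE j : `|coord3 j x| * normc (ifourier f x) = normc (ifourier (pd j f) x).
  by rewrite ifourier_pd// normcN (normcM (ii * _)) (normcM ii) normc_ii normcC mul1r.
rewrite (exprS 4) -(mulrA 4); set A := 4 ^+ k * _.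
have B j : (1 + enorm x) ^+ k * normc (ifourier (pd j f) x) <= A.
  apply: IH; first exact: schwartz_pd.
  by move=> js js_k y; rewrite -pds_rcons; apply: fK; rewrite size_rcons.
have B0 : (1 + enorm x) ^+ k * normc (ifourier f x) <= A.
  by apply: IH => // js js_k; apply: fK; exact: leqW.
rewrite (_ : 4 * A = A + (A + A + A)); last by ring.
by rewrite !mulrDl mul1r !mulrDr !cE !lerD.
Qed.

(** Continuity of the transform, with a constant independent of [f], as needed for sequences. In
    [N + 6 + N], derivatives of the transform become at most [N] multiplications by $i\xi_j$, each
    costing one order; the weight costs [N] derivatives of [f]; and 6 pays for integrability. *)
Lemma schwartz_bound_ifourier N : exists2 C : R, 0 <= C & forall f M, schwartz f ->
  schwartz_bound f (N + 6 + N) M -> schwartz_bound (ifourier f) N (C * M).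
Proof.
pose D : R := (2 ^+ (N + 6 + N)) ^+ N.
have wi0 : 0 <= wint.
  by rewrite -lee_fin -wint_fin; apply: integral_ge0 => x _; rewrite lee_fin ltW// wgt_gt0.
exists (4 ^+ N * (2 * fcst * wint * D)).
  by rewrite !mulr_ge0 ?exprn_ge0 ?fcst_ge0.
move=> f M sf hM js x js_N; rewrite pds_ifourier//.
have M0 := schwartz_bound_ge0 hM.
have sI l : schwartz (iximuls l f) by elim: l => //= i l; exact: schwartz_iximul.
have hb l n : (size l + n <= N)%N -> schwartz_bound (iximuls l f) (N + 6 + n) ((2 ^+ (N + 6 + N)) ^+ size l * M).
  elim: l n => [|i l IH] n /= l_N; first by rewrite expr0 mul1r; apply: schwartz_boundW hM; rewrite leq_add2l.
  have /schwartz_bound_iximul h : schwartz_bound (iximuls l f) (N + 6 + n).+1 ((2 ^+ (N + 6 + N)) ^+ size l * M).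
    by rewrite -addnS; apply: IH; rewrite addnS -addSn.
  have sm := schwartz_smooth (sI l).
  move=> k y k_N; apply: (le_trans (h i sm k y k_N)).
  rewrite exprS -mulrA ler_wpM2r ?mulr_ge0 ?exprn_ge0// ler_weXn2l ?ler1n// leq_add2l.
  by apply: leq_trans l_N; rewrite leq_addl.
have {hb} hb : schwartz_bound (iximuls js f) (N + 6) (D * M).
  have h := hb js 0%N; rewrite !addn0 in h.
  move=> k y k_N; apply: (le_trans (h js_N k y k_N)).
  by rewrite ler_wpM2r// /D ler_weXn2l// exprn_ege1// ler1n.
have := @ifourier_decay N (iximuls js f) x (D * M) (sI js).
rewrite (_ : 4 ^+ N * _ = 4 ^+ N * (2 * fcst * wint * D) * M); last by rewrite !mulrA.
apply => k k_N y; apply: le_trans (hb k y _); last by rewrite (leq_trans k_N)// leq_addr.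
by rewrite ler_wpM2r ?normc_ge0// ler_weXn2l ?leq_addl// lerDl enorm_ge0.
Qed.

Lemma schwartz_ifourier f : schwartz f -> schwartz (ifourier f).
Proof.
move=> sf; apply/schwartzP; split; first exact/smooth_ifourier/schwartz_moment.
move=> N; have [C C0 hC] := schwartz_bound_ifourier N.
have [_ /(_ (N + 6 + N)%N)[M hM]] := (schwartzP f).1 sf.
by exists (C * M); exact: hC.
Qed.

End schwartz_space.

(** * Fourier inversion *)

Section laplace_kernel.
Context {R : realType}.
Local Notation leb := (@lebesgue_measure R).
Implicit Types (e s t : R).

(** The damping factor of Abel summation. Its transform is a Cauchy kernel, whose mass is known from
    $\int(1+x^2)^{-1}dx=\pi$. *)
Definition lapl e t : R := expR (- (e * `|t|)).

Lemma lapl_gt0 e t : 0 < lapl e t. Proof. exact: expR_gt0. Qed.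

Lemma lapl_le1 e t : 0 <= e -> lapl e t <= 1.
Proof. by move=> e0; rewrite /lapl -expR0 ler_expR oppr_le0 mulr_ge0. Qed.

Lemma continuous_lapl e : continuous (lapl e).
Proof.
move=> t; apply: (@continuous_comp _ _ _ (fun t : R => - (e * `|t|)) expR).
  by apply: cvgN; apply: cvgM; [exact: cvg_cst|exact: norm_continuous].
exact: continuous_expR.
Qed.

(** The added 1 makes the integrand nonnegative, so that the fundamental theorem of calculus on a
    half-line applies; [F] is the explicit antiderivative. The case $s=0$ then gives the mass of
    [lapl e], which can be subtracted. *)
Lemma integral_lapl_cos e s : 0 < e ->
  (\int[leb]_t (lapl e t * (1 + cos (s * t)))%:E = (2 / e + 2 * e / (e ^+ 2 + s ^+ 2))%:E)%E.
Proof.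
move=> e0; have d0 : 0 < e ^+ 2 + s ^+ 2 by rewrite ltr_pwDl ?exprn_gt0 ?sqr_ge0.
pose f t : R := expR (- e * t) * (1 + cos (s * t)).
pose F t : R := expR (- e * t) * ((s * sin (s * t) - e * cos (s * t)) / (e ^+ 2 + s ^+ 2) - e^-1).
have dexp t : is_derive t (1 : R) (fun t => expR (- e * t)) (- e * expR (- e * t)).
  have := @is_derive1_comp R expR (fun t => - e * t) t _ _ (is_derive_expR _) (is_deriveZ (- e) (is_derive_id t 1)).
  by rewrite /GRing.scale /= mulr1 mulrC.
have dF t : is_derive t (1 : R) F (f t).
  have ds : is_derive t (1 : R) (fun t => sin (s * t)) (s * cos (s * t)).
    have := @is_derive1_comp R sin (fun t => s * t) t _ _ (is_derive_sin _) (is_deriveZ s (is_derive_id t 1)).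
    by rewrite /GRing.scale /= mulr1 mulrC.
  have dc : is_derive t (1 : R) (fun t => cos (s * t)) (- (s * sin (s * t))).
    have := @is_derive1_comp R cos (fun t => s * t) t _ _ (is_derive_cos _) (is_deriveZ s (is_derive_id t 1)).
    by rewrite /GRing.scale /= mulr1 mulrC -mulrN.
  apply: is_derive_eq; rewrite /f /GRing.scale /=; field.
  by rewrite !gt_eqF.
have cF t : {for t, continuous F} by apply/differentiable_continuous/derivable1_diffP.
have cf : continuous f.
  have cexp t : {for t, continuous (fun t => expR (- e * t))}.
    by apply/differentiable_continuous/derivable1_diffP.
  move=> t; apply: cvgM; first exact: cexp.
  apply: cvgD; first exact: cvg_cst.
  apply: (@continuous_comp _ _ _ (fun t : R => s * t) cos); last exact: continuous_cos.
  by apply: cvgM; [exact: cvg_cst|exact: cvg_id].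
have F0 : F t @[t --> +oo%R] --> (0 : R).
  pose C : R := (`|s| + e) / (e ^+ 2 + s ^+ 2) + e^-1.
  have E : (C * expR (- (e * t))) @[t --> +oo%R] --> (0 : R).
    rewrite -(mulr0 C); apply: cvgM; first exact: cvg_cst.
    apply: (cvg_comp (fun t => e * t) (fun t => expR (- t))); last exact: cvgr_expR.
    exact: (gt0_cvgMry e0 cvg_id).
  apply: norm_cvg0; apply: squeeze_cvgr E; last exact: cvg_cst.
  apply: nearW => t; rewrite normr_ge0 /= /F normrM mulrC mulNr (ger0_norm (expR_ge0 _)).
  rewrite ler_wpM2r ?expR_ge0//; apply: (le_trans (ler_normB _ _)).
  rewrite /C [`|e^-1|]ger0_norm ?invr_ge0 ?(ltW e0)// lerD2r normrM.
  rewrite [`|_^-1|]ger0_norm ?invr_ge0 ?(ltW d0)// ler_wpM2r ?invr_ge0 ?(ltW d0)//.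
  apply: (le_trans (ler_normB _ _)); rewrite !normrM (ger0_norm (ltW e0)) lerD//.
    by rewrite ler_piMr// ler_norml sin_geN1 sin_le1.
  by rewrite ler_piMr ?(ltW e0)// ler_norml cos_geN1 cos_le1.
have E0 : (\int[leb]_(t in `[0%R, +oo[) (f t)%:E = 0%:E - (F 0)%:E)%E.
  apply: (ge0_continuous_FTC2y _ _ F0).
  - by move=> x _; rewrite mulr_ge0 ?expR_ge0//; have := cos_geN1 (s * x); lra.
  - exact: continuous_subspaceT.
  - by move=> x _; apply: ex_derive.
  - by apply: cvg_at_right_filter; exact: cF.
  - by move=> x _; rewrite derive1E; exact: derive_val.
rewrite ge0_symfun_integralT.
- rewrite (_ : [set x : R | 0 <= x] = `[0, +oo[%classic); last first.
    by apply/seteqP; split => x /=; rewrite in_itv /= andbT.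
  have -> : (\int[leb]_(x in `[0%R, +oo[) (lapl e x * (1 + cos (s * x)))%:E =
             \int[leb]_(x in `[0%R, +oo[) (f x)%:E)%E.
    apply: eq_integral => t; rewrite inE /= in_itv /= andbT => t0.
    by rewrite /lapl /f ger0_norm// mulNr.
  rewrite E0 /F !mulr0 expR0 sin0 cos0 mulr0 mulr1 mul1r -EFinB -EFinM; congr EFin.
  by field; rewrite !gt_eqF.
- by move=> t; rewrite mulr_ge0 ?(ltW (lapl_gt0 _ _))//; have := cos_geN1 (s * t); lra.
- move=> t; apply: cvgM; first exact: continuous_lapl.
  apply: cvgD; first exact: cvg_cst.
  apply: (@continuous_comp _ _ _ (fun t : R => s * t) cos); last exact: continuous_cos.
  by apply: cvgM; [exact: cvg_cst|exact: cvg_id].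
- by move=> t /=; rewrite /lapl normrN mulrN cosN.
Qed.

Lemma measurable_lapl e : measurable_fun [set: R] (lapl e).
Proof. by apply: continuous_measurable_fun; exact: continuous_lapl. Qed.

Lemma integral_lapl e : 0 < e -> (\int[leb]_t (lapl e t)%:E = (2 / e)%:E)%E.
Proof.
move=> e0; have := integral_lapl_cos 0 e0.
under eq_integral do rewrite mul0r cos0 mulrC (_ : (1 + 1 : R) = 2)// EFinM.
rewrite ge0_integralZl//; last 2 first.
- by apply/measurable_EFinP; exact: measurable_lapl.
- by move=> t _; rewrite lee_fin ltW// lapl_gt0.
move=> h; have : (2^-1%:E * (2%:E * \int[leb]_t (lapl e t)%:E) = 2^-1%:E * (2 / e + 2 * e / (e ^+ 2 + 0 ^+ 2))%:E)%E.
  by rewrite h.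
rewrite muleA -!EFinM mulVf// mul1e => ->; congr EFin.
by rewrite expr0n addr0; field; rewrite gt_eqF.
Qed.

Lemma cinteg_lapl e : 0 < e -> cinteg leb (fun t => (lapl e t)%:C).
Proof.
move=> e0; apply: cinteg_real; first exact: measurable_lapl.
by under eq_integral do rewrite ger0_norm ?(ltW (lapl_gt0 _ _))//; rewrite integral_lapl// ltry.
Qed.

Lemma cinteg_lapl_char e s : 0 < e -> cinteg leb (fun t => (lapl e t)%:C * expi (s * t)).
Proof.
move=> e0; under eq_fun do rewrite mulrC.
apply: (cintegMb (M := 1)) (cinteg_lapl e0).
  by apply: cmeas_expi; exact: measurable_funM.
by move=> t; rewrite normc_expi.
Qed.

Lemma Cint_lapl_char e s : 0 < e ->
  Cint leb (fun t => (lapl e t)%:C * expi (s * t)) = (2 * e / (e ^+ 2 + s ^+ 2))%:C.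
Proof.
move=> e0.
have li : leb.-integrable setT (EFin \o lapl e) := integrableRe (cinteg_lapl e0).
have ci : leb.-integrable setT (EFin \o (fun t => lapl e t * cos (s * t))).
  rewrite (_ : (fun t => _) = (fun t => complex.Re ((lapl e t)%:C * expi (s * t)))).
    exact: (integrableRe (cinteg_lapl_char s e0)).
  by apply/funext => t; rewrite cRe_rM.
have si : leb.-integrable setT (EFin \o (fun t => lapl e t * sin (s * t))).
  rewrite (_ : (fun t => _) = (fun t => complex.Im ((lapl e t)%:C * expi (s * t)))).
    exact: (integrableIm (cinteg_lapl_char s e0)).
  by apply/funext => t; rewrite cIm_rM.
have lE : \int[leb]_t lapl e t = 2 / e by rewrite /Rintegral integral_lapl.
apply: complex_eq; rewrite /Cint /=.
  transitivity (\int[leb]_t (lapl e t * cos (s * t))).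
    by apply: eq_Rintegral => t _; rewrite mul0r subr0.
  have : \int[leb]_t (lapl e t * (1 + cos (s * t))) = 2 / e + 2 * e / (e ^+ 2 + s ^+ 2).
    by rewrite /Rintegral integral_lapl_cos.
  under eq_Rintegral do rewrite mulrDr mulr1.
  by rewrite RintegralD// lE => /addrI.
transitivity (\int[leb]_t (lapl e t * sin (s * t))).
  by apply: eq_Rintegral => t _; rewrite mul0r addr0.
(* The sine part vanishes by oddness: reflecting $t$ in the integral of
   [lapl e t * (1 + sin (s * t))] changes the sign of the sine only, and the 1 keeps the integrand
   nonnegative, as [scaling1] requires. *)
have m1 : (-1 : R) != 0 by rewrite oppr_eq0 oner_neq0.
have [_ H] := scaling1 0 m1.
have ms : measurable_fun [set: R] (fun t => (lapl e t * (1 + sin (s * t)))%:E).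
  apply/measurable_EFinP; apply: measurable_funM; first exact: measurable_lapl.
  apply: measurable_funD => //; apply: (measurableT_comp (@measurable_sin R)).
  exact: measurable_funM.
have h0 t : (0 <= (lapl e t * (1 + sin (s * t)))%:E)%E.
  by rewrite lee_fin mulr_ge0 ?(ltW (lapl_gt0 _ _))//; have := sin_geN1 (s * t); lra.
have := H _ ms h0; rewrite normrN normr1 invr1 mul1e => /(congr1 fine).
rewrite -[LHS]/(\int[leb]_t (lapl e (-1 * t + 0) * (1 + sin (s * (-1 * t + 0))))).
rewrite -[RHS]/(\int[leb]_t (lapl e t * (1 + sin (s * t)))).
rewrite (@eq_Rintegral _ _ _ leb setT (fun t => lapl e t - lapl e t * sin (s * t))); last first.
  by move=> t _; rewrite addr0 mulN1r /lapl normrN mulrN sinN mulrDr mulr1 mulrN.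
rewrite [RHS](@eq_Rintegral _ _ _ leb setT (fun t => lapl e t + lapl e t * sin (s * t))); last first.
  by move=> t _; rewrite mulrDr mulr1.
rewrite RintegralB// RintegralD//; lra.
Qed.

End laplace_kernel.

Lemma cinteg_Fubini1 d1 d2 (T1 : measurableType d1) (T2 : measurableType d2) (R : realType)
    (m1 : {sigma_finite_measure set T1 -> \bar R})
    (m2 : {sigma_finite_measure set T2 -> \bar R}) (f : T1 * T2 -> R[i]) :
  cinteg (m1 \x m2)%E f -> cinteg m1 (fun x => Cint m2 (fun y => f (x, y))).
Proof.
move=> fi.
have mi (h : T1 * T2 -> R) : (m1 \x m2)%E.-integrable setT (EFin \o h) ->
    measurable_fun setT (fun x => \int[m2]_y h (x, y)).
  by move=> hi; apply: measurableT_comp => //; exact: measurable_fubini_F hi.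
have mm : cmeas (fun x => Cint m2 (fun y => f (x, y))).
  by split; apply: (mi (fun z => _ (f z))); [exact: integrableRe|exact: integrableIm].
split => //.
have mn := measurable_enormc fi.1.
have foo : (\int[m1]_x fubini_F m2 (EFin \o (fun z => normc (f z))) x < +oo)%E.
  have := fi.2; rewrite fubini_tonelli1//.
  by move=> z; rewrite lee_fin normc_ge0.
apply: (@le_lt_trans _ _ (\int[m1]_x (2%:E * fubini_F m2 (EFin \o (fun z => normc (f z))) x))%E).
  apply: ge0_le_integral.
  - by [].
  - by move=> x _; rewrite lee_fin normc_ge0.
  - exact: measurable_enormc mm.
  - apply: measurable_funeM; apply: measurable_fun_fubini_tonelli_F => //.
    by move=> z; rewrite lee_fin normc_ge0.
  - move=> x _; rewrite /fubini_F.
    have [fx|] := ltP (\int[m2]_y (normc (f (x, y)))%:E)%E +oo%E; last first.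
      by rewrite leye_eq => /eqP ->; rewrite mulry gtr0_sg// mul1e leey.
    apply: normc_Cint_le; split => //.
    by split; [exact: (measurableT_comp fi.1.1)|exact: (measurableT_comp fi.1.2)].
rewrite ge0_integralZl//.
- by rewrite lte_mul_pinfty.
- apply: measurable_fun_fubini_tonelli_F => //.
  by move=> z; rewrite lee_fin normc_ge0.
- by move=> x _; apply: integral_ge0 => y _; rewrite lee_fin normc_ge0.
Qed.

(** * The inversion theorem by Abel summation *)

Section inversion.
Context {R : realType}.
Implicit Types (F G h : cfield R) (x y xi : R3 R).
Local Notation L1 := (cinteg (leb3 R)).
Local Notation cmeas3 := (cmeas (T := M3 R)).

Lemma measurable_dot3_pair :
  measurable_fun [set: M3 R * M3 R] (fun z : M3 R * M3 R => dot3 (z.1 : R3 R) (z.2 : R3 R)).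
Proof.
rewrite /dot3; apply: measurable_sum => j; apply: measurable_funM.
  exact: (measurableT_comp (measurable_coord3 j) measurable_fst).
exact: (measurableT_comp (measurable_coord3 j) measurable_snd).
Qed.

Lemma dominated3 (f_ : nat -> cfield R) (f : cfield R) (g : R3 R -> R) :
  (forall n, L1 (f_ n)) -> L1 f -> L1 (fun x => (g x)%:C) ->
  (forall x n, normc (f_ n x - f x) <= g x) ->
  (forall x, (fun n => normc (f_ n x - f x)) @ \oo --> (0 : R)) ->
  (fun n => normc (Cint (leb3 R) (f_ n) - Cint (leb3 R) f)) @ \oo --> (0 : R).
Proof.
move=> fni fi [mg goo] fg f0; apply: (dominated_Cint fni fi mg.1).
- have g0 x : 0 <= g x by apply: le_trans (fg x 0%N); rewrite normc_ge0.
  by under eq_integral do rewrite -[X in X%:E](ger0_norm (g0 _)) -normcC.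
- exact: aeW.
- exact: aeW.
Qed.

Lemma Cint3Z (z : R[i]) F : L1 F ->
  Cint (leb3 R) (fun x => z * F x) = z * Cint (leb3 R) F.
Proof. exact: CintZ. Qed.

(** Fubini's theorem for $e^{ix\cdot\xi}F(x)G(\xi)$. By this duality the transform of functions
    agrees with that of distributions and extends to $L^2$. *)
Lemma ifourier_mult F G : L1 F -> L1 G ->
  Cint (leb3 R) (fun x => F x * ifourier G x) = Cint (leb3 R) (fun x => G x * ifourier F x).
Proof.
move=> hF hG.
have H : cinteg (leb3s R \x leb3s R)%E
    (fun z : M3 R * M3 R => expi (dot3 z.1 z.2) * (F z.1 * G z.2)).
  apply: (cinteg_prod (m1 := leb3s R) (m2 := leb3s R) (M := 1) hF hG) => [|z].
    exact: (cmeas_expi measurable_dot3_pair).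
  by rewrite normc_expi.
pose k (x y : R3 R) := expi (dot3 x y) * (F x * G y).
have E : Cint (leb3 R) (fun x => Cint (leb3 R) (k x)) =
    Cint (leb3 R) (fun y => Cint (leb3 R) (k^~ y)) := Cint_Fubini H.
have hL : L1 (fun x => Cint (leb3 R) (k x)).
  exact: (cinteg_Fubini1 H).
have hR : L1 (fun y => Cint (leb3 R) (k^~ y)).
  have H2 : cinteg (leb3s R \x leb3s R)%E (fun z : M3 R * M3 R => k z.2 z.1).
    rewrite (_ : (fun z => _) = (fun z : M3 R * M3 R => expi (dot3 z.1 z.2) * (G z.1 * F z.2))).
      apply: (cinteg_prod (m1 := leb3s R) (m2 := leb3s R) (M := 1) hG hF) => [|z].
        exact: (cmeas_expi measurable_dot3_pair).
      by rewrite normc_expi.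
    by apply/funext => z; rewrite /k dot3C [F _ * _]mulrC.
  exact: (cinteg_Fubini1 H2).
transitivity (fcst%:C * Cint (leb3 R) (fun x => Cint (leb3 R) (k x))).
  rewrite -(Cint3Z _ hL); apply: eq_Cint => x; rewrite ifourierE mulrCA; congr (_ * _).
  rewrite -CintZ; last exact: cinteg_char.
  by apply: eq_Cint => y; rewrite mulrCA.
rewrite E -(Cint3Z _ hR); apply: eq_Cint => x; rewrite ifourierE mulrCA; congr (_ * _).
rewrite -CintZ; last exact: cinteg_char.
by apply: eq_Cint => y; rewrite /k dot3C [F y * _]mulrC mulrCA.
Qed.

Lemma ifourier_reflect h xi : L1 h -> ifourier (fun y => h (- y)) xi = ifourier h (- xi).
Proof.
move=> hh; rewrite !ifourierE; congr (_ * _).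
have := @Cint_aff R (-1) 0 (fun y => expi (dot3 (- xi) y) * h y) _ (cinteg_char (- xi) hh).
rewrite normrN normr1 expr1n invr1 mul1r => <-; last by rewrite oppr_eq0 oner_neq0.
by apply: eq_Cint => y; rewrite addr0 scaleN1r dot3Nl dot3Nr opprK.
Qed.

Lemma cvg0_le (a b : nat -> R) : (forall n, 0 <= a n <= b n) ->
  b @ \oo --> (0 : R) -> a @ \oo --> (0 : R).
Proof.
by move=> ab hb; apply: (squeeze_cvgr _ (cvg_cst (0 : R)) hb); exact: nearW.
Qed.

Lemma cvg_normc (a : nat -> R[i]) (z : R[i]) :
  (fun n => complex.Re (a n)) @ \oo --> (complex.Re z : R) ->
  (fun n => complex.Im (a n)) @ \oo --> (complex.Im z : R) ->
  (fun n => normc (a n - z)) @ \oo --> (0 : R).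
Proof.
move=> h1 h2.
have d1 : (fun n => `|complex.Re (a n) - complex.Re z|) @ \oo --> (0 : R).
  by rewrite -(normr0 R) -(subrr (complex.Re z)); apply: cvg_norm; apply: cvgB => //; exact: cvg_cst.
have d2 : (fun n => `|complex.Im (a n) - complex.Im z|) @ \oo --> (0 : R).
  by rewrite -(normr0 R) -(subrr (complex.Im z)); apply: cvg_norm; apply: cvgB => //; exact: cvg_cst.
have hs : (fun n => `|complex.Re (a n) - complex.Re z| + `|complex.Im (a n) - complex.Im z|)
    @ \oo --> (0 : R) by rewrite -(addr0 0); exact: cvgD.
apply: cvg0_le hs => n.
rewrite normc_ge0; apply: le_trans (normc_le_ReIm _) _.
by rewrite !(cReD, cImD, cReN, cImN).
Qed.

(** Complex limits are expressed throughout by the real sequence [normc] of a difference tending to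
    0; identities are proved by computing such a limit in two ways. *)
Lemma normc_cvg_unique (a : nat -> R[i]) (A B : R[i]) :
  (fun n => normc (a n - A)) @ \oo --> (0 : R) ->
  (fun n => normc (a n - B)) @ \oo --> (0 : R) -> A = B.
Proof.
move=> hA hB; apply/subr0_eq/eq0_normc/eqP; rewrite eq_le normc_ge0 andbT.
have hs : (fun n => normc (a n - A) + normc (a n - B)) @ \oo --> (0 : R).
  by rewrite -(addr0 0); exact: cvgD.
rewrite -(cvg_lim (@Rhausdorff R) hs); apply: limr_ge; first by apply/cvg_ex; exists 0.
apply: nearW => n; rewrite -(normcN (a n - A)); apply: le_trans (normcD _ _).
by rewrite opprB addrA subrK.
Qed.

Definition laplker e xi : R := lapl e xi.1.1 * lapl e xi.1.2 * lapl e xi.2.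

Lemma laplker_char e y xi : (laplker e xi)%:C * expi (dot3 y xi) =
  prod3 (fun t => (lapl e t)%:C * expi (coord3 0 y * t))
        (fun t => (lapl e t)%:C * expi (coord3 1 y * t))
        (fun t => (lapl e t)%:C * expi (coord3 2 y * t)) xi.
Proof.
rewrite /laplker /dot3 !big_ord_recl big_ord0 addr0 !expiD /prod3 !rmorphM /=.
rewrite [coord3 ord0 xi]/= [coord3 (lift ord0 ord0) xi]/= [coord3 (lift _ (lift _ _)) xi]/=.
rewrite [coord3 0 y]/= [coord3 1 y]/= [coord3 2 y]/=.
rewrite [coord3 ord0 y]/= [coord3 (lift ord0 ord0) y]/= [coord3 (lift _ (lift _ _)) y]/=.
by rewrite !mulrA; ring.
Qed.

Lemma cinteg_laplker_char e y : 0 < e -> L1 (fun xi => (laplker e xi)%:C * expi (dot3 y xi)).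
Proof.
move=> e0; under eq_fun do rewrite laplker_char.
by apply: cinteg_prod3; exact: cinteg_lapl_char.
Qed.

Lemma Cint_laplker_char e y : 0 < e ->
  Cint (leb3 R) (fun xi => (laplker e xi)%:C * expi (dot3 y xi)) =
  (8 * e ^- 3 * cauchyw3 (e^-1 *: y))%:C.
Proof.
move=> e0; under eq_fun do rewrite laplker_char.
rewrite Cint_prod3; [|exact: cinteg_lapl_char..].
rewrite !Cint_lapl_char// -!rmorphM; congr (_%:C).
rewrite /cauchyw3 /cauchyw /=.
have p (t : R) : e ^+ 2 + t ^+ 2 != 0 by rewrite gt_eqF// ltr_pwDl ?exprn_gt0 ?sqr_ge0.

have E (t : R) : 2 * e / (e ^+ 2 + t ^+ 2) = 2 * e^-1 * (1 + (e^-1 * t) ^+ 2)^-1.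
  have -> : 1 + (e^-1 * t) ^+ 2 = (e ^+ 2 + t ^+ 2) / e ^+ 2 by field; rewrite gt_eqF.
  by rewrite invf_div; field; rewrite p gt_eqF.
rewrite !E -[y.1.1]/(coord3 0 y) -[y.1.2]/(coord3 1 y) -[y.2]/(coord3 2 y) /GRing.scale /=.
by rewrite -exprVn; ring.
Qed.

Lemma fcst_sqr : (fcst) ^+ 2 * (8 * pi ^+ 3) = 1 :> R.
Proof.
have p0 : (0 : R) < 2 * pi by rewrite mulr_gt0// pi_gt0.
rewrite /fcst -powR_mulrn ?powR_ge0// -powRrM.
rewrite (_ : - (3 / 2) * 2%:R = - 3%:R) ?powRN; last by lra.
rewrite powR_mulrn ?ltW// (_ : 8 * pi ^+ 3 = (2 * pi) ^+ 3); last by rewrite exprMn; congr (_ * _); ring.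
by rewrite mulVf// expf_eq0 gt_eqF.
Qed.

Lemma cvg_lapl t : (fun n => lapl (harmonic n) t) @ \oo --> (1 : R).
Proof.
have h0 : (fun n => - (harmonic n * `|t|)) @ \oo --> (0 : R).
  rewrite -[0](oppr0 R) -(mul0r `|t|); apply: cvgN; apply: cvgM; last exact: cvg_cst.
  exact: cvg_harmonic.
have := cvg_comp _ expR h0 (@continuous_expR R 0).
by rewrite expR0.
Qed.

Lemma cvg_laplker xi : (fun n => laplker (harmonic n) xi) @ \oo --> (1 : R).
Proof.
rewrite (_ : (1 : R) = 1 * 1 * 1); last by rewrite !mulr1.
by apply: cvgM; [apply: cvgM|]; exact: cvg_lapl.
Qed.

Lemma laplker_itv e xi : 0 < e -> 0 < laplker e xi <= 1.
Proof.
move=> e0; rewrite /laplker !mulr_gt0 ?lapl_gt0//=.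
by rewrite !mulr_ile1 ?mulr_ge0 ?(ltW (lapl_gt0 _ _)) ?lapl_le1 ?(ltW e0).
Qed.

Lemma ifourier_laplker e x y : 0 < e ->
  ifourier (fun xi => (laplker e xi)%:C * expi (dot3 x xi)) y =
  (fcst * (8 * e ^- 3 * cauchyw3 (e^-1 *: (x + y))))%:C.
Proof.
move=> e0; rewrite ifourierE [RHS]rmorphM; congr (_ * _).
rewrite -[RHS]Cint_laplker_char//; apply: eq_Cint => xi; by rewrite mulrCA -expiD dot3Dl [dot3 y _ + _]addrC.
Qed.

(** The damped integrals [a n] have two limits. By dominated convergence they tend to the double
    transform; by the multiplication formula they are averages of [h] near [x] against a Cauchy
    kernel, which tend to a multiple of [h x]. The constants match by [fcst_sqr]. *)
Lemma inversion h x (M : R) : L1 h -> L1 (ifourier h) -> (forall y, normc (h y) <= M) ->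
  continuous (fun y => complex.Re (h y) : R) -> continuous (fun y => complex.Im (h y) : R) ->
  ifourier (fun xi => ifourier h (- xi)) x = h x.
Proof.
move=> hh fh hM c1 c2.
have fh' : L1 (fun xi => ifourier h (- xi)).
  under eq_fun do rewrite -scaleN1r -[_ *: _]addr0.
  by apply: (@cinteg_aff R (-1) 0) => //; rewrite oppr_eq0 oner_neq0.
have e0 n : (0 : R) < harmonic n by rewrite /harmonic invr_gt0.
pose a n := Cint (leb3 R)
  (fun xi => (laplker (harmonic n) xi)%:C * expi (dot3 x xi) * ifourier h (- xi)).
have mlk n : cmeas3 (fun xi => (laplker (harmonic n) xi)%:C * expi (dot3 x xi)).
  by have [] := cinteg_laplker_char x (e0 n).
have lk1 n xi : normc ((laplker (harmonic n) xi)%:C * expi (dot3 x xi)) <= 1.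
  have /andP[l0 l1] := laplker_itv xi (e0 n).
  by rewrite normcM normc_expi mulr1 normcC gtr0_norm.
have aA : (fun n => normc (a n - Cint (leb3 R) (fun xi => expi (dot3 x xi) * ifourier h (- xi))))
    @ \oo --> (0 : R).
  apply: (@dominated3 (fun n xi => (laplker (harmonic n) xi)%:C * expi (dot3 x xi) * ifourier h (- xi))
    (fun xi => expi (dot3 x xi) * ifourier h (- xi)) (fun xi => 2 * normc (ifourier h (- xi)))).
  - by move=> n; apply: (cintegMb (M := 1)).
  - exact: cinteg_char.
  - apply: cinteg_real; first by apply: measurable_funM => //; apply: measurable_normc; case: fh'.
    have [_] := cintegZ 2%:C fh'.
    by under eq_integral do rewrite normcM normcC -[normc (ifourier _ _)]ger0_norm ?normc_ge0// -normrM.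
  - move=> xi n; rewrite -mulrBl normcM ler_wpM2r ?normc_ge0//.
    apply: (le_trans (normcB _ _)); rewrite normc_expi; have := lk1 n xi; lra.
  - move=> xi; rewrite (_ : (fun n => _) = (fun n => `|laplker (harmonic n) xi - 1| * normc (ifourier h (- xi)))); last first.
      apply/funext => n; rewrite -mulrBl -{2}[expi _]mul1r -mulrBl.
      by rewrite !normcM normc_expi mulr1 -normcC rmorphB.
    rewrite -[X in _ --> X](mul0r (normc (ifourier h (- xi)))); apply: cvgM; last exact: cvg_cst.
    rewrite -(normr0 R); apply: cvg_norm; rewrite -(subrr 1); apply: cvgB; last exact: cvg_cst.
    exact: cvg_laplker.
(* The substitution $y=ez-x$ moves the parameter from the kernel into the argument of [h], so that
   the limit can be taken by domination. *)
have aE n : a n = (fcst * 8)%:C * Cint (leb3 R) (fun z => h (x - harmonic n *: z) * (cauchyw3 z)%:C).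
  set e := harmonic n; have en : 0 < e by exact: e0.
  have e1 : e != 0 by rewrite gt_eqF.
  have hm : L1 (fun y => h (- y)).
    under eq_fun do rewrite -scaleN1r -[_ *: _]addr0.
    by apply: (@cinteg_aff R (-1) 0) => //; rewrite oppr_eq0 oner_neq0.
  have mc : measurable_fun [set: M3 R] (cauchyw3 (R := R)) by have [] := (@cinteg_cauchyw3 R).1.
  have cw1 y : `|cauchyw3 y : R| <= 1.
    rewrite ger0_norm /cauchyw3 ?mulr_ge0 ?(ltW (cauchyw_gt0 _))//.
    have w1 (t : R) : cauchyw t <= 1 by rewrite /cauchyw invf_le1 ?ltr_pwDl ?sqr_ge0// lerDl sqr_ge0.
    by rewrite !mulr_ile1 ?mulr_ge0 ?(ltW (cauchyw_gt0 _)).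
  pose Q y := (cauchyw3 (e^-1 *: y + e^-1 *: x))%:C * h (- y).
  have hQ : L1 Q.
    apply: (cintegMb (M := 1)) => // [|y]; last by rewrite normcC.
    by apply: (@cmeas_aff R e^-1 (e^-1 *: x) (fun y => (cauchyw3 y)%:C)); rewrite ?invr_neq0//; exact: cmeas_real.
  have := Cint_aff (- x) e1 hQ; rewrite (ger0_norm (ltW en)).
  rewrite (_ : (fun y => Q _) = (fun z => h (x - e *: z) * (cauchyw3 z)%:C)); last first.
    apply/funext => z; rewrite /Q mulrC opprD opprK addrC scalerDr scalerA mulVf// scale1r.
    by rewrite scalerN subrK.
  move=> ->; rewrite /a.
  transitivity (Cint (leb3 R) (fun xi => (laplker e xi)%:C * expi (dot3 x xi) * ifourier (fun y => h (- y)) xi)).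
    by apply: eq_Cint => xi; rewrite ifourier_reflect.
  rewrite ifourier_mult//; last exact: cinteg_laplker_char.
  rewrite mulrA -rmorphM -(Cint3Z _ hQ); apply: eq_Cint => y.
  rewrite ifourier_laplker// /Q mulrC mulrA -rmorphM -scalerDr [y + x]addrC.
  by congr (_%:C * _); rewrite !mulrA.
have w0 z : 0 <= cauchyw3 z :> R by rewrite /cauchyw3 !mulr_ge0 ?(ltW (cauchyw_gt0 _)).
have aB : (fun n => normc (a n - (fcst * 8)%:C * (h x * (pi ^+ 3)%:C))) @ \oo --> (0 : R).
  under eq_fun do rewrite aE -mulrBr normcM.
  rewrite -(mulr0 (normc (fcst * 8 : R)%:C)); apply: cvgM; first exact: cvg_cst.
  rewrite -Cint_cauchyw3 -(Cint3Z _ (@cinteg_cauchyw3 R)).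
  have ih n : L1 (fun z => h (x - harmonic n *: z) * (cauchyw3 z)%:C).
    apply: (cintegMb (M := M)) (@cinteg_cauchyw3 R) => //.
    under eq_fun do rewrite addrC -scaleNr.
    by apply: (@cmeas_aff R (- harmonic n) x) hh.1; rewrite oppr_eq0 gt_eqF.
  apply: (@dominated3 (fun n z => h (x - harmonic n *: z) * (cauchyw3 z)%:C)
    (fun z => h x * (cauchyw3 z)%:C) (fun z => (2 * M) * cauchyw3 z)) => //.
  - by apply: cintegZ; exact: cinteg_cauchyw3.
  - under eq_fun do rewrite rmorphM; apply: cintegZ; exact: cinteg_cauchyw3.
  - move=> z n; rewrite -mulrBl normcM normcC (ger0_norm (w0 z)) ler_wpM2r//.
    apply: (le_trans (normcB _ _)); have := hM x; have := hM (x - harmonic n *: z); lra.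
  - move=> z.
    have cz : (fun n => x - harmonic n *: z) @ \oo --> x.
      rewrite -[X in _ --> X]subr0 -(scale0r z); apply: cvgB; first exact: cvg_cst.
      by apply: cvgZr_tmp; exact: cvg_harmonic.
    under eq_fun do rewrite -mulrBl normcM.
    rewrite -(mul0r (normc (cauchyw3 z)%:C)); apply: cvgM; last exact: cvg_cst.
    by apply: cvg_normc; [exact: (cvg_comp _ _ cz (c1 x))|exact: (cvg_comp _ _ cz (c2 x))].
rewrite ifourierE (normc_cvg_unique aA aB) mulrCA [h x * _]mulrC !mulrA -!rmorphM.
rewrite (_ : _ * pi ^+ 3 = 1) ?mul1r//.
by transitivity (fcst ^+ 2 * (8 * pi ^+ 3) : R); [ring|exact: fcst_sqr].
Qed.

Lemma schwartz_bdd h : schwartz h -> exists M : R, forall y, normc (h y) <= M.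
Proof.
move=> /schwartzP[_ /(_ 0%N)[M hM]]; exists M => y.
by have := hM [::] y isT; rewrite expr0 mul1r.
Qed.

Lemma pds_reflect js h : smooth h ->
  pds js (fun y => h (- y)) = (fun y => ((-1) ^+ size js)%:C * pds js h (- y)).
Proof.
move=> sh; elim: js => [|j js IH] /=; first by apply/funext => y; rewrite mul1r.
have sf := smooth_pds js sh.
have E : (fun y => pds js h (- y)) = (fun y => pds js h ((-1 : R) *: y + 0)).
  by apply/funext => y; rewrite scaleN1r addr0.
rewrite IH pdZE; last by rewrite E; exact: smooth_aff.
rewrite E pd_affE//; apply/funext => y.
by rewrite scaleN1r addr0 mulrA -rmorphM exprSr.
Qed.

Lemma schwartz_bound_reflect h N (M : R) : smooth h -> schwartz_bound h N M ->
  schwartz_bound (fun x => h (- x)) N M.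
Proof.
move=> sh hM js x js_N; rewrite pds_reflect// normcM normcC normrX normrN1 expr1n mul1r.
by rewrite -[enorm x]enormN; exact: hM.
Qed.

Lemma schwartz_reflect h : schwartz h -> schwartz (fun x => h (- x)).
Proof.
move=> /schwartzP[sh hM]; apply/schwartzP; split.
  rewrite (_ : (fun _ => _) = (fun y => h ((-1 : R) *: y + 0))).
    exact: smooth_aff.
  by apply/funext => y; rewrite scaleN1r addr0.
by move=> N; have [M hN] := hM N; exists M; exact: schwartz_bound_reflect.
Qed.

Lemma fourier_reflectE h : schwartz h -> fourier h = ifourier (fun x => h (- x)).
Proof.
by move=> sh; apply/funext => x; rewrite fourierE ifourier_reflect//; exact: schwartz_L1.
Qed.

Lemma schwartz_fourier h : schwartz h -> schwartz (fourier h).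
Proof. by move=> sh; rewrite fourier_reflectE//; exact/schwartz_ifourier/schwartz_reflect. Qed.

Lemma fourierK h : schwartz h -> ifourier (fourier h) = h.
Proof.
move=> sh; apply/funext => x; have [M hM] := schwartz_bdd sh.
have [c1 c2] := smooth_continuous (schwartz_smooth sh).
rewrite -[RHS](inversion x (schwartz_L1 sh) (schwartz_L1 (schwartz_ifourier sh)) hM c1 c2).
by congr (ifourier _ x); apply/funext => xi; rewrite fourierE.
Qed.

Lemma ifourierK h : schwartz h -> fourier (ifourier h) = h.
Proof.
move=> sh; apply/funext => x.
transitivity (ifourier (fourier h) x); last by rewrite fourierK.
rewrite fourierE -ifourier_reflect; last exact/schwartz_L1/schwartz_ifourier.
by congr (ifourier _ x); apply/funext => xi; rewrite fourierE.
Qed.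

(** By inversion [h] is a Fourier integral, and on the Fourier side the two derivatives are
    multiplications, which commute. *)
Lemma pdC i j h : schwartz h -> pd i (pd j h) = pd j (pd i h).
Proof.
move=> sh; rewrite -(fourierK sh); set F := fourier h.
have sF : schwartz F by exact: schwartz_fourier.
have mF : moment F by exact: schwartz_moment.
have m k : moment (iximul k F) by exact/schwartz_moment/schwartz_iximul.
rewrite (pd_ifourier j mF) (pd_ifourier i mF) (pd_ifourier i (m j)) (pd_ifourier j (m i)).
congr (ifourier _); apply/funext => xi; rewrite /iximul; ring.
Qed.

End inversion.

(** * Cutoffs in physical space and convergence in the Schwartz space *)

Section cutoffs.
Context {R : realType}.
Implicit Types (f g h : cfield R) (x : R3 R) (js : seq 'I_3).
Local Notation L1 := (cinteg (leb3 R)).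
Local Notation eps n := (harmonic n : R).

Lemma eps_gt0 n : 0 < eps n. Proof. by rewrite /harmonic invr_gt0. Qed.

Lemma eps_le1 n : eps n <= 1.
Proof. by rewrite /harmonic invf_le1 ?ltr0n// ler1n. Qed.

Lemma pds_cst js (z : R[i]) : js != [::] -> pds js (fun=> z) = (fun=> 0) :> cfield R.
Proof.
case: js => // j js _; rewrite /= -/(pds _ _).
suff [w ->] : exists w, pds js (fun=> z) = (fun=> w) :> cfield R by rewrite pd_cst.
elim: js => [|i js [w IH]] /=; first by exists z.
by exists 0; rewrite IH pd_cst.
Qed.

Lemma pds_dilate js (r : R) h : smooth h ->
  pds js (fun y => h (r *: y)) = (fun y => (r ^+ size js)%:C * pds js h (r *: y)).
Proof.
move=> sh; elim: js => [|j js IH] /=; first by apply/funext => y; rewrite mul1r.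
have sf := smooth_pds js sh.
have E : (fun y => pds js h (r *: y)) = (fun y => pds js h (r *: y + 0)).
  by apply/funext => y; rewrite addr0.
rewrite IH pdZE; last by rewrite E; exact: smooth_aff.
rewrite E pd_affE//; apply/funext => y.
by rewrite addr0 mulrA -rmorphM exprSr.
Qed.

(** Convergence to 0 in the Schwartz space, with the explicit rate $1/(n+1)$ in every seminorm. A
    rate makes the notion stable under all operators with seminorm bounds, and it passes to tempered
    distributions. *)
Definition vanishing (F_ : nat -> cfield R) := (forall n, schwartz (F_ n)) /\
  forall N, exists C : R, forall n, schwartz_bound (F_ n) N (C * eps n).

Lemma vanishing_ifourier F_ : vanishing F_ -> vanishing (fun n => ifourier (F_ n)).
Proof.
move=> [sf hf]; split=> [n|N]; first exact: schwartz_ifourier.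
have [C C0 hC] := @schwartz_bound_ifourier R N; have [D hD] := hf (N + 6 + N)%N.
by exists (C * D) => n; rewrite -mulrA; apply: hC.
Qed.

Lemma vanishing_fourier F_ : vanishing F_ -> vanishing (fun n => fourier (F_ n)).
Proof.
move=> vf; have [sf hf] := vanishing_ifourier vf.
have E n : fourier (F_ n) = (fun x => ifourier (F_ n) (- x)).
  by apply/funext => x; rewrite fourierE.
split=> [n|N]; first by case: vf => s _; exact: schwartz_fourier.
have [C hC] := hf N; exists C => n; rewrite E.
by apply: schwartz_bound_reflect => //; exact: schwartz_smooth.
Qed.

Lemma vanishing_pd j F_ : vanishing F_ -> vanishing (fun n => pd j (F_ n)).
Proof.
move=> [sf hf]; split=> [n|N]; first exact: schwartz_pd.
have [C hC] := hf N.+1; exists C => n js x js_N; rewrite -pds_rcons.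
apply: le_trans (hC n (rcons js j) x _); last by rewrite size_rcons.
rewrite ler_wpM2r ?normc_ge0// exprS ler_peMl ?exprn_ge0 ?(ltW (opp_enorm_gt0 _))//.
by rewrite lerDl enorm_ge0.
Qed.

Lemma tempered_bound (T : functional R) : tempered T -> exists (N : nat) (C : R), 0 <= C /\
  forall f M, schwartz f -> schwartz_bound f N M -> normc (T f) <= C * M.
Proof.
move=> [_ [N [C hC]]]; exists N, `|C|; split; first exact: normr_ge0.
move=> f M sf /seminormP hM; rewrite -lee_fin EFinM.
apply: (le_trans (hC f sf)).
apply: (@le_trans _ _ (`|C|%:E * seminorm N f)%E).
  by apply: lee_wpmul2r; rewrite ?seminorm_ge0// lee_fin ler_norm.
by apply: lee_wpmul2l => //; rewrite lee_fin.
Qed.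

Lemma tempered_vanishing (T : functional R) F_ : tempered T -> vanishing F_ ->
  (fun n => normc (T (F_ n))) @ \oo --> (0 : R).
Proof.
move=> /tempered_bound[N [C [C0 hC]]] [sf hf]; have [D hD] := hf N.
have h0 : (fun n => C * D * eps n) @ \oo --> (0 : R).
  by rewrite -(mulr0 (C * D)); apply: cvgM; [exact: cvg_cst|exact: cvg_harmonic].
by apply: cvg0_le h0 => n; rewrite normc_ge0 -mulrA hC.
Qed.

Variable psi : R3 R -> R.
Hypothesis hpsi : lp_cutoff psi.

(** The Littlewood-Paley bump, dilated by $n+1$, also serves as the cutoff in physical space. *)
Definition cutoff n x : R[i] := (psi (eps n *: x))%:C.

Lemma psi_test : test_fun (fun x => (psi x)%:C). Proof. by case: hpsi. Qed.

Lemma cutoff_aff n : cutoff n = (fun x => (fun y => (psi y)%:C) (eps n *: x + 0)).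
Proof. by apply/funext => x; rewrite addr0. Qed.

Lemma cutoff_test n : test_fun (cutoff n).
Proof. by rewrite cutoff_aff; apply: (test_aff 0 _ psi_test); rewrite gt_eqF ?eps_gt0. Qed.

(** [lp_cutoff] does not bound [psi] by 1, so a bound [M] is carried through all estimates. *)
Lemma psi_bdd : exists2 M : R, 1 <= M & forall x, 0 <= psi x <= M.
Proof.
have [M hM] := test_bounded psi_test; have [_ p0 _ p1] := hpsi.
have E x : psi x <= M by have := hM x; rewrite normcC ger0_norm.
exists M => [|x]; last by rewrite p0 E.
by rewrite -(p1 0) ?E// /enorm /dot3 big1 ?sqrtr0 ?invr_ge0// => j _; rewrite -[0](scale0r 0) coord3Z !mul0r.
Qed.

Lemma cvg_cutoff x : (fun n => normc (cutoff n x - 1)) @ \oo --> (0 : R).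
Proof.
have [_ _ _ p1] := hpsi.
have h0 : (fun n => eps n * enorm x) @ \oo --> (0 : R).
  by rewrite -(mul0r (enorm x)); apply: cvgM; [exact: cvg_harmonic|exact: cvg_cst].
have : \forall n \near \oo, eps n * enorm x < 2^-1 by apply: cvgr_lt h0 _ _; rewrite invr_gt0.
move=> near1; apply: cvg_near_cst; apply: filterS near1 => n hn.
by rewrite /cutoff p1 ?subrr ?normc0// enormZ ger0_norm ?(ltW (eps_gt0 n))// ltW.
Qed.

(** Without derivatives the difference is 0 unless $|x|/(n+1)>\frac12$, and then $1\le2|x|/(n+1)$;
    every derivative produces a factor $1/(n+1)$ by itself. *)
Lemma cutoff_bound N : exists2 B : R, 0 <= B & forall js n x, (size js <= N)%N ->
  normc (pds js (fun y => cutoff n y - 1) x) <= B * (1 + enorm x) * eps n.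
Proof.
have [M M1 hM] := psi_bdd; have [tp _ _ p1] := hpsi.
have [||B hB] := @bounded_words R
  (fun js B => 0 <= B /\ forall y, normc (pds js (fun y => (psi y)%:C) y) <= B) N.
- by move=> js C C' CC [C0 h]; split=> [|y]; [exact: le_trans CC|exact: le_trans (h y) CC].
- move=> js; have [B hB] := test_bounded (test_pds js tp); exists B; split => //.
  exact: le_trans (normc_ge0 _) (hB 0).
have B0 : 0 <= B by have [] := hB [::] isT.
exists (2 * (M + 1) + B) => [|js n x js_N]; first by rewrite addr_ge0// mulr_ge0//; lra.
have e0 := eps_gt0 n; have e1 := eps_le1 n; have n0 := enorm_ge0 x.
have s1 : smooth (fun _ : R3 R => - 1 : R[i]) by exact: smooth_cst.
rewrite (pdsD js (proj1 (cutoff_test n)) s1).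
case: js js_N => [_|j js js_N].
  rewrite -[pds [::] _ x]/(cutoff n x) -[pds [::] _ x]/(-1).
  have [le2|gt2] := leP (enorm (eps n *: x)) 2^-1.
    by rewrite /cutoff p1// subrr normc0 !mulr_ge0 ?(ltW e0)//; lra.
  rewrite /cutoff (_ : _ - 1 = (psi (eps n *: x) - 1)%:C); last by rewrite rmorphB.
  rewrite normcC.
  have h1 : `|psi (eps n *: x) - 1| <= M + 1.
    by apply: (le_trans (ler_normB _ _)); rewrite normr1 lerD2r; have /andP[p0 pM] := hM (eps n *: x); rewrite ger0_norm.
  apply: (le_trans h1); move: gt2; rewrite enormZ (ger0_norm (ltW e0)) => gt2.
  apply: (@le_trans _ _ ((2 * (M + 1)) * (enorm x * eps n))).
    by rewrite mulrAC ler_peMl//; lra.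
  rewrite mulrA; apply: ler_wpM2r; first exact: ltW.
  by apply: ler_pM; lra.
rewrite pds_cst// addr0 (pds_dilate (j :: js) (eps n) (proj1 tp)).
rewrite normcM normcC ger0_norm ?exprn_ge0 ?(ltW e0)//.
have [_ hj] := hB (j :: js) js_N.
apply: (@le_trans _ _ (eps n * B)).
  apply: ler_pM; [exact: exprn_ge0 (ltW e0)|exact: normc_ge0| |exact: hj].
  by rewrite exprS ler_piMr ?(ltW e0)// exprn_ile1 ?(ltW e0).
rewrite mulrC ler_wpM2r ?(ltW e0)//; apply: (@le_trans _ _ (2 * (M + 1) + B)); first lra.
by rewrite ler_peMr//; lra.
Qed.

(** The growth $1+|x|$ in [cutoff_bound] is absorbed by one more order of decay of [h]. *)
Lemma vanishing_cutoff h : schwartz h -> vanishing (fun n x => (cutoff n x - 1) * h x).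
Proof.
move=> sh; have smh := schwartz_smooth sh.
have sc n : smooth (fun x => cutoff n x - 1).
  by apply: smoothD; [case: (cutoff_test n)|exact: smooth_cst].
have H N : exists C : R, forall n, schwartz_bound (fun x => (cutoff n x - 1) * h x) N (C * eps n).
  have [B B0 hB] := cutoff_bound N; have /schwartzP[_ /(_ N.+1)[M hM]] := sh.
  exists (2 ^+ N * (B * M)) => n js x js_N.
  have x0 := opp_enorm_gt0 x; have e0 := eps_gt0 n.
  have M0 := schwartz_bound_ge0 hM.
  have := @leibniz_bound R N _ h x (B * (1 + enorm x) * eps n) (M / (1 + enorm x) ^+ N.+1) (sc n) smh _ _ js js_N.
  move=> /(_ (fun js => hB js n x)) L.
  have {}L : normc (pds js (fun y => (cutoff n y - 1) * h y) x) <=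
      2 ^+ size js * (B * (1 + enorm x) * eps n * (M / (1 + enorm x) ^+ N.+1)).
    apply: L => ks ks_N; rewrite ler_pdivlMr ?exprn_gt0// mulrC; apply: hM.
    exact: leq_trans ks_N _.
  apply: (le_trans (ler_wpM2l (exprn_ge0 _ (ltW x0)) L)).
  have -> : (1 + enorm x) ^+ N * (2 ^+ size js * (B * (1 + enorm x) * eps n * (M / (1 + enorm x) ^+ N.+1)))
      = 2 ^+ size js * (B * M * eps n).
    by rewrite exprS; field; rewrite gt_eqF ?exprn_gt0// gt_eqF.
  by rewrite -[leRHS]mulrA ler_wpM2r ?mulr_ge0 ?(ltW e0)// ler_weXn2l//; lra.
split => // n; apply/schwartzP; split; first exact: smoothM.
by move=> N; have [C hC] := H N; exists (C * eps n).
Qed.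

Lemma cutoffM_test n h : smooth h -> test_fun (fun x => cutoff n x * h x).
Proof. by move=> sh; apply: testM => //; exact: cutoff_test. Qed.

End cutoffs.

Lemma ae_imp d (T : measurableType d) (R : realType) (mu : {measure set T -> \bar R})
    (P Q : T -> Prop) :
  (forall x, P x -> Q x) -> {ae mu, forall x, P x} -> {ae mu, forall x, Q x}.
Proof. by move=> PQ; apply: filterS. Qed.

Lemma ae_imp2 d (T : measurableType d) (R : realType) (mu : {measure set T -> \bar R})
    (P Q S : T -> Prop) : (forall x, P x -> Q x -> S x) ->
  {ae mu, forall x, P x} -> {ae mu, forall x, Q x} -> {ae mu, forall x, S x}.
Proof. by move=> PQ; apply: filterS2. Qed.

(** * The fundamental lemma *)

Section fundamental_lemma.
Context {R : realType}.
Variable psi : R3 R -> R.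
Hypothesis hpsi : lp_cutoff psi.
Implicit Types (f g h H : cfield R) (x : R3 R).
Local Notation L1 := (cinteg (leb3 R)).
Local Notation cmeas3 := (cmeas (T := M3 R)).

(** A pi-system generating the Borel sets and adapted to test functions: the bounds $0\le f\le1$
    make $1-(1-f)^n$ increase to the indicator of $\{f>0\}$. *)
Definition positivity_sets : set (set (R3 R)) := [set E | exists f : R3 R -> R,
  [/\ test_fun (fun x => (f x)%:C), forall x, 0 <= f x <= 1 & E = [set x | 0 < f x]]].

Lemma positivity_setI : setI_closed positivity_sets.
Proof.
move=> _ _ [f [tf f01 ->]] [g [tg g01 ->]]; exists (fun x => f x * g x); split.
- under eq_fun do rewrite rmorphM; apply: testM => //; exact: (proj1 tg).
- move=> x; have /andP[f0 f1] := f01 x; have /andP[g0 g1] := g01 x.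
  by rewrite mulr_ge0//= mulr_ile1.
- apply/seteqP; split => x /=.
    by move=> [f0 g0]; rewrite mulr_gt0.
  have /andP[f0 _] := f01 x; have /andP[g0 _] := g01 x.
  move=> fg; split; rewrite lt_neqAle ?f0 ?g0 andbT eq_sym; apply/eqP => E.
    by move: fg; rewrite E mul0r ltxx.
  by move: fg; rewrite E mulr0 ltxx.
Qed.

Lemma open_positivity (U : set (R3 R)) : open U -> <<s positivity_sets >> U.
Proof.
have [M M1 hM] := psi_bdd hpsi; have [tp p0 ps p1] := hpsi.
have M0 : 0 < M by lra.
(* With the factor $(n+1)/6$ a point whose coordinates are within $1/(n+1)$ of [c], hence at
   distance at most $3/(n+1)$, falls where [psi] is 1, and positivity implies a distance of at most
   $6/(n+1)$. *)
pose b (c : R3 R) (n : nat) (y : R3 R) : R := M^-1 * psi ((n.+1%:R / 6) *: y + - ((n.+1%:R / 6) *: c)).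
have r0 n : 0 < n.+1%:R / 6 :> R by rewrite divr_gt0.
have bE c n y : (n.+1%:R / 6) *: y + - ((n.+1%:R / 6) *: c) = (n.+1%:R / 6 : R) *: (y - c).
  by rewrite scalerBr.
move=> oU; have [||F [hF ->]] := @open_cover3 R (fun c n => [set y | 0 < b c n y]) 6 U _ _ oU.
- move=> c n y hy; rewrite /= /b bE p1 ?mulr1 ?invr_gt0// enormZ (ger0_norm (ltW (r0 n))).
  have e3 : enorm (y - c) <= 3 * n.+1%:R^-1.
    apply: (le_trans (enorm_le_sum _)).
    have := hy 0; have := hy 1; have := hy 2; set a := n.+1%:R^-1; lra.
  apply: (le_trans (ler_wpM2l (ltW (r0 n)) e3)).
  have aux (a : R) : a != 0 -> a / 6 * (3 * a^-1) = 2^-1 by move=> a0; field.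
  by rewrite aux ?pnatr_eq0.
- move=> c n y /=; rewrite /b bE => h j.
  have : enorm ((n.+1%:R / 6 : R) *: (y - c)) <= 1.
    by rewrite leNgt; apply/negP => /ps E; move: h; rewrite E mulr0 ltxx.
  rewrite enormZ (ger0_norm (ltW (r0 n))) => h1.
  apply: (le_trans (coord3_le _ _)).
  have aux (a : R) : a != 0 -> a / 6 * (6 / a) = 1 by move=> a0; field.
  by rewrite -(@ler_pM2l _ (n.+1%:R / 6))// aux ?pnatr_eq0.
- apply: sigma_algebra_bigcup => n; have [->|[c [m ->]]] := hF n.
    exact: sigma_algebra0.
  apply: sub_sigma_algebra; exists (b c m); split => //.
    rewrite /b; under eq_fun do rewrite rmorphM; apply: testZ.
    by apply: (@test_aff R (m.+1%:R / 6) _ (fun y => (psi y)%:C)) => //; rewrite gt_eqF.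
  move=> y; have /andP[q0 qM] := hM ((m.+1%:R / 6) *: y + - ((m.+1%:R / 6) *: c)).
  by rewrite /b mulr_ge0 ?invr_ge0 ?(ltW M0)//= ler_pdivrMl// mulr1.
Qed.

(** The product sigma-algebra is generated by the coordinates, and these are continuous, hence
    measurable for the sigma-algebra of positivity sets. *)
Lemma measurable_positivity (E : set (M3 R)) : measurable E -> <<s positivity_sets >> E.
Proof.
pose T := g_sigma_algebraType positivity_sets.
have mc (k : R3 R -> R) : continuous k -> measurable_fun [set: T] (k : T -> R).
  move=> ck; apply: (measurability _ (RGenOpens.measurableE R)).
  move=> _ [_ [a [b ->] <-]]; rewrite setTI; apply: open_positivity.
  by have /continuousP := ck; apply; exact: interval_open.
have mi : measurable_fun [set: T] (fun x : T => (x : M3 R)).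
  apply/measurable_fun_pairP; split; first apply/measurable_fun_pairP; first split.
  - apply: (mc (fun x => x.1.1)) => x; apply: (cvg_comp fst fst); [exact: cvg_fst|exact: cvg_fst].
  - apply: (mc (fun x => x.1.2)) => x; apply: (cvg_comp fst snd); [exact: cvg_fst|exact: cvg_snd].
  - by apply: (mc (fun x => x.2)) => x; exact: cvg_snd.
by move=> mE; have := mi measurableT _ mE; rewrite setTI.
Qed.

Lemma cinteg_indic H (E : set (M3 R)) : measurable E -> L1 H -> L1 (fun x => (\1_E x)%:C * H x).
Proof.
move=> mE hH; apply: (cintegMb (M := 1)) => // [|x]; first exact: cmeas_real.
by rewrite normcC indicE; case: (_ \in _); rewrite ?normr0 ?normr1.
Qed.

(** The pi-lambda theorem: the sets over which [H] has integral 0 form a lambda-system, which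
    contains the positivity sets by monotone approximation. *)
Lemma Cint_indic0 H : L1 H -> Cint (leb3 R) H = 0 ->
  (forall f, test_fun f -> Cint (leb3 R) (fun x => f x * H x) = 0) ->
  forall E : set (M3 R), measurable E -> Cint (leb3 R) (fun x => (\1_E x)%:C * H x) = 0.
Proof.
move=> hH H0 Hf E mE.
pose D : set (set (R3 R)) := [set E | measurable (E : set (M3 R)) /\
  Cint (leb3 R) (fun x => (\1_E x)%:C * H x) = 0].
suff : D E by case.
have := @lambda_system_subset _ _ positivity_setI setT D.
apply => //; last exact: measurable_positivity.
- split => //.
  + split => //; rewrite -[RHS]H0; apply: eq_Cint => x.
    by rewrite indicE in_setT mul1r.
  + move=> A B BA [mA A0] [mB B0]; split; first exact: measurableD.
    have := CintB (cinteg_indic mA hH) (cinteg_indic mB hH); rewrite A0 B0 subr0 => <-.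
    apply: eq_Cint => x; rewrite -mulrBl -rmorphB; congr (_%:C * _); rewrite !indicE in_setD.
    case: (boolP (x \in B)) => /= xB; last by rewrite subr0 andbT.
    by rewrite andbF; move: xB; rewrite inE => /BA; rewrite -in_setE => ->; rewrite subrr.
  + move=> F ndF FD; have mF n : measurable (F n : set (M3 R)) by case: (FD n).
    have mU : measurable (\bigcup_n F n : set (M3 R)) by exact: bigcupT_measurable.
    split => //; apply: (@normc_cvg_unique R (fun n => Cint (leb3 R) (fun x => (\1_(F n) x)%:C * H x))).
      apply: (@dominated3 R (fun n x => (\1_(F n) x)%:C * H x) _ (fun x => normc (H x))).
      - by move=> n; exact: cinteg_indic.
      - exact: cinteg_indic.
      - apply: cinteg_real; first by apply: measurable_normc; case: hH.
        by under eq_integral do rewrite ger0_norm ?normc_ge0//; case: hH.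
      - move=> x n; rewrite -mulrBl normcM ler_piMl ?normc_ge0// -rmorphB normcC !indicE.
        by case: (_ \in _); case: (_ \in _); rewrite ?subrr ?subr0 ?sub0r ?normrN ?normr0 ?normr1 ?ler01.
      - move=> x; have [[n _ Fnx]|nF] := pselect ((\bigcup_n F n) x).
          apply: cvg_near_cst; near=> m.
          have Fmx : F m x by apply: (subsetPset _ _ (ndF n m _)) Fnx; near: m; exact: nbhs_infty_ge.
          by rewrite !indicE !mem_set ?subrr ?normc0//; exists n.
        apply: cvg_near_cst; apply: nearW => m; rewrite !indicE !memNset ?subrr ?normc0//.
        by move=> Fmx; apply: nF; exists m.
    apply: cvg_near_cst; apply: nearW => n; have [_ ->] := FD n; by rewrite subrr normc0.
- move=> _ [f [tf f01 ->]].
  have mf : measurable ([set x | 0 < f x] : set (M3 R)).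
    have [c1 _] := smooth_continuous (proj1 tf).
    rewrite (_ : [set x | _] = f @^-1` `]0, +oo[%classic); last first.
      by apply/seteqP; split => x; rewrite /= in_itv /= andbT.
    rewrite -[X in measurable X]setTI; apply: (continuous_measurable3 c1) => //.
  (* The functions $1-(1-f)^n$ are test functions, bounded by 1, with limit the indicator of
     $\{f>0\}$. *)
  split => //; apply: (@normc_cvg_unique R (fun n => Cint (leb3 R) (fun x => (1 - (1 - f x) ^+ n)%:C * H x))).
    have p01 n x : 0 <= 1 - (1 - f x) ^+ n <= 1.
      have /andP[f0 f1] := f01 x.
      have : 0 <= (1 - f x) ^+ n <= 1 by rewrite exprn_ge0 ?exprn_ile1 ?subr_ge0 ?gerBl.
      lra.
    apply: (@dominated3 R (fun n x => (1 - (1 - f x) ^+ n)%:C * H x) _ (fun x => normc (H x))).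
    + move=> n; apply: (cintegMb (M := 1)) => // [|x]; last first.
        by rewrite normcC; have /andP[h0 h1] := p01 n x; rewrite ger0_norm.
      apply: cmeas_real; apply: measurable_funB => //; apply: measurable_funX.
      by apply: measurable_funB => //; exact: (smooth_cmeas (proj1 tf)).1.
    + exact: cinteg_indic.
    + apply: cinteg_real; first by apply: measurable_normc; case: hH.
      by under eq_integral do rewrite ger0_norm ?normc_ge0//; case: hH.
    + move=> x n; rewrite -mulrBl normcM ler_piMl ?normc_ge0// -rmorphB normcC indicE.
      have /andP[h0 h1] := p01 n x.
      by case: (_ \in _); rewrite ler_norml; apply/andP; split; rewrite /= ?mulr1n ?mulr0n; lra.
    + move=> x; have /andP[f0 f1] := f01 x.
      have hw : (fun n => (1 - f x) ^+ n * (0 < f x)%R%:R * normc (H x)) @ \oo --> (0 : R).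
        have [fx|fx] := ltP 0 (f x); last by under eq_fun do rewrite mulr0 mul0r; exact: cvg_cst.
        rewrite -(mul0r (normc (H x))) -(mul0r (1 : R)).
        apply: cvgM; last exact: cvg_cst.
        apply: cvgM; last exact: cvg_cst.
        by apply: cvg_expr; rewrite ger0_norm ?subr_ge0//; lra.
      apply: cvg0_le hw => n; rewrite normc_ge0 -mulrBl normcM -rmorphB normcC ler_wpM2r ?normc_ge0//.
      rewrite indicE; have [fx|fx] := ltP 0 (f x).
        rewrite mem_set//= mulr1 addrAC subrr add0r normrN ger0_norm// exprn_ge0// subr_ge0//.
      rewrite memNset/=; last by rewrite ltNge fx.
      have -> : f x = 0 by apply/le_anti/andP.
      by rewrite !subr0 expr1n subrr normr0 mulr0.
  apply: cvg_near_cst; apply: nearW => n.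
  rewrite (_ : Cint _ _ = 0) ?subrr ?normc0//; apply: Hf.
  elim: n => [|n IH].
    by under eq_fun do rewrite expr0 subrr; have := testZ 0 tf; under eq_fun do rewrite mul0r.
  (* With $p_n=1-(1-f)^n$ one has $p_{n+1}=p_n+f(1-p_n)$, which preserves test functions. *)
  rewrite (_ : (fun x => _) = (fun x => (1 - (1 - f x) ^+ n)%:C + (f x)%:C * (1 - (1 - (1 - f x) ^+ n)%:C))).
    apply: testD => //; apply: testM => //; apply: smoothD; first exact: smooth_cst.
    by apply: smoothN'; case: IH.
  apply/funext => x.
  by apply: complex_eq; rewrite ?(cReD, cImD, cReM, cImM, cReN, cImN) /= ?exprS; ring.
Unshelve. all: by end_near.
Qed.

Lemma measurable_enorm_le (r : R) : measurable ([set x | enorm x <= r] : set (M3 R)).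
Proof.
rewrite (_ : [set x | _] = (enorm (R := R)) @^-1` `]-oo, r]%classic); last first.
  by apply/seteqP; split => x; rewrite /= in_itv /=.
by rewrite -[X in measurable X]setTI; apply: measurable_enorm.
Qed.

Lemma locint_test h g : locally_integrable3 h -> test_fun g -> L1 (fun x => h x * g x).
Proof.
move=> [h1 h2 hr] tg; have [M hM] := test_bounded tg; have [sg [r gr]] := tg.
have mg := test_cmeas tg; have mh : cmeas3 h by split.
have mB := measurable_enorm_le r.
have M0 : 0 <= M := le_trans (normc_ge0 _) (hM 0).
split; first exact: cmeasM.
have mn : measurable_fun [set: M3 R] (fun x => (normc (h x))%:E) by exact: measurable_enormc.
have mr : measurable_fun [set: M3 R] ((fun x => (normc (h x))%:E) \_ [set x | enorm x <= r]).
  first [by apply/(measurable_restrictT _ mB); exact: (measurable_funTS mn) |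
   by apply/(measurable_restrictT _ mB).1; exact: (measurable_funTS mn)].
apply: (@le_lt_trans _ _ (\int[leb3 R]_x (M%:E * ((fun x => (normc (h x))%:E) \_ [set x | (enorm x <= r)%R]) x))%E).
  apply: ge0_le_integral => //.
  - by move=> x _; rewrite lee_fin normc_ge0.
  - by apply: measurable_enormc; exact: cmeasM.
  - exact: measurable_funeM.
  - move=> x _; rewrite patchE; case: ifPn => [xr|]; rewrite normcM.
      by rewrite -EFinM lee_fin mulrC ler_wpM2r ?normc_ge0.
    by rewrite notin_setE /= => /negP; rewrite -ltNge => /gr ->; rewrite normc0 mulr0 mule0.
rewrite ge0_integralZl//.
- by rewrite -integral_mkcond lte_mul_pinfty.
- by move=> x _; rewrite patchE; case: ifP => // _; rewrite lee_fin normc_ge0.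
Qed.

Lemma fundamental_L1 H : L1 H ->
  (forall E : set (M3 R), measurable E -> Cint (leb3 R) (fun x => (\1_E x)%:C * H x) = 0) ->
  {ae leb3 R, forall x, H x = 0}.
Proof.
move=> hH H0.
have key (k : R3 R -> R) : (leb3 R).-integrable setT (EFin \o k) ->
    (forall E : set (M3 R), measurable E -> \int[leb3 R]_x (\1_E x * k x) = 0) ->
    {ae leb3 R, forall x, k x = 0}.
  move=> ki k0.
  have := @integral_ae_eq _ _ _ (leb3 R) setT measurableT (cst 0%E) (EFin \o k) ki (measurable_cst _).
  have h (E : set (M3 R)) : E `<=` setT -> measurable E ->
      (\int[leb3 R]_(x in E) (EFin \o k) x = \int[leb3 R]_(x in E) cst 0 x)%E.
    move=> _ mE; rewrite integral0 integral_mkcond.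
    have -> : ((EFin \o k) \_ E) = (fun x => (\1_E x * k x)%:E).
      apply/funext => x; rewrite patchE indicE; case: ifP => _; first by rewrite mul1r.
      by rewrite mul0r.
    have fin : (leb3 R).-integrable setT (EFin \o (fun x => \1_E x * k x)).
      apply: (le_integrable _ _ _ ki) => //.
        apply/measurable_EFinP; apply: measurable_funM => //.
        by apply/measurable_EFinP; exact: measurable_int ki.
      move=> x _; rewrite /= lee_fin normrM ler_piMl// indicE.
      by case: (_ \in _); rewrite ?normr0 ?normr1.
    have E1 := k0 E mE; rewrite -[LHS]fineK.
      by rewrite -[fine _]/(\int[leb3 R]_x (\1_E x * k x)) E1.
    exact: integrable_fin_num fin.
  move=> /(_ h); apply: ae_imp => x /(_ I) /= [].
  by [].
have a1 : {ae leb3 R, forall x, complex.Re (H x) = 0}.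
  apply: key; first exact: integrableRe.
  by move=> E mE; have := congr1 (@complex.Re R) (H0 E mE); rewrite /Cint /= => E0; rewrite -[RHS]E0; apply: eq_Rintegral => x _; rewrite cRe_rM.
have a2 : {ae leb3 R, forall x, complex.Im (H x) = 0}.
  apply: key; first exact: integrableIm.
  by move=> E mE; have := congr1 (@complex.Im R) (H0 E mE); rewrite /Cint /= => E0; rewrite -[RHS]E0; apply: eq_Rintegral => x _; rewrite cIm_rM.
by apply: ae_imp2 a1 a2 => x e1 e2; exact: complex_eq.
Qed.

(** [h] is only locally integrable, so the $L^1$ version is applied to [h] times each cutoff; the
    countably many null sets are then united. *)
Lemma fundamental h : locally_integrable3 h ->
  (forall g, test_fun g -> Cint (leb3 R) (fun x => h x * g x) = 0) ->
  {ae leb3 R, forall x, h x = 0}.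
Proof.
move=> lh h0.
have tc n := cutoff_test hpsi n.
have An n : {ae leb3 R, forall x, h x * cutoff psi n x = 0}.
  have hL := locint_test lh (tc n).
  apply: fundamental_L1 => //; apply: Cint_indic0 => //; first exact: h0.
  move=> f tf; rewrite -[RHS](h0 (fun x => f x * cutoff psi n x)); last exact: testM (proj1 (tc n)).
  by apply: eq_Cint => x; rewrite mulrCA.
have := @ae_foralln _ _ _ (leb3 R) (fun n x => h x * cutoff psi n x = 0) An.
apply: ae_imp => x hx.
apply: (@normc_cvg_unique R (fun n => h x * cutoff psi n x)); last first.
  by under eq_fun do rewrite hx subr0 normc0; exact: cvg_cst.
under eq_fun do rewrite -{2}[h x]mulr1 -mulrBr normcM.
by rewrite -(mulr0 (normc (h x))); apply: cvgM; [exact: cvg_cst|exact: cvg_cutoff].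
Qed.

Lemma locintB f g : locally_integrable3 f -> locally_integrable3 g ->
  locally_integrable3 (fun x => f x - g x).
Proof.
move=> [f1 f2 fr] [g1 g2 gr].
have mf : cmeas3 f by split.
have mg : cmeas3 g by split.
have [m1 m2] := cmeasB mf mg; split => // r.
apply: (@le_lt_trans _ _ (\int[leb3 R]_(x in [set x | (enorm x <= r)%R]) ((normc (f x))%:E + (normc (g x))%:E))%E).
  apply: ge0_le_integral.
  - exact: measurable_enorm_le.
  - by move=> x _; rewrite lee_fin normc_ge0.
  - by apply: measurable_funTS; apply: measurable_enormc; split.
  - by apply: emeasurable_funD; apply: measurable_funTS; exact: measurable_enormc.
  - by move=> x _; rewrite -EFinD lee_fin normcB.
rewrite ge0_integralD; first by apply: lte_add_pinfty; [exact: fr|exact: gr].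
- exact: measurable_enorm_le.
- by move=> x _; rewrite lee_fin normc_ge0.
- by apply: measurable_funTS; exact: measurable_enormc.
- by move=> x _; rewrite lee_fin normc_ge0.
- by apply: measurable_funTS; exact: measurable_enormc.
Qed.

Lemma represents_ae f g (T : functional R) : represents f T -> represents g T ->
  {ae leb3 R, forall x, f x = g x}.
Proof.
move=> [lf rf] [lg rg].
have : {ae leb3 R, forall x, f x - g x = 0}.
  apply: fundamental; first exact: locintB.
  move=> h th; under eq_Cint do rewrite mulrBl.
  by rewrite CintB; [rewrite -!cintE -rf// -rg// subrr|exact: locint_test..].
by apply: ae_imp => x /subr0_eq.
Qed.

Lemma density_represents f (T : functional R) : represents f T -> represents (density T) T.
Proof. by move=> rf; exact: (@xgetPex _ (fun=> 0) [set f | represents f T]) (ex_intro _ f rf). Qed.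

Lemma density_ae f (T : functional R) : represents f T -> {ae leb3 R, forall x, density T x = f x}.
Proof. by move=> rf; exact: represents_ae (density_represents rf) rf. Qed.

(** An equality of functions and not merely almost everywhere: the choice operator is applied to one
    and the same set of representatives. *)
Lemma density_eq (T T' : functional R) : (forall g, test_fun g -> T g = T' g) -> density T = density T'.
Proof.
move=> TT'; rewrite /density; congr (xget _ _); apply/seteqP; split => f [lf rf]; split => // g tg.
  by rewrite -TT'// rf.
by rewrite TT'// rf.
Qed.

End fundamental_lemma.

Section sharp_bound.
Context d (T : measurableType d) (R : realType).
Variable mu : {measure set T -> \bar R}.
Implicit Types f : T -> R[i].

(** A rotation by the unit number $\bar z/|z|$ makes the integral $z$ real and nonnegative; then
    only real parts have to be compared. *)
Lemma normc_Cint_le1 f : cinteg mu f ->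
  ((normc (Cint mu f))%:E <= \int[mu]_x (normc (f x))%:E)%E.
Proof.
move=> fi; have [z0|z0] := eqVneq (Cint mu f) 0.
  by rewrite z0 normc0; apply: integral_ge0 => x _; rewrite lee_fin normc_ge0.
set z := Cint mu f; have nz : 0 < normc z.
  by rewrite lt_neqAle normc_ge0 andbT eq_sym; apply/eqP => /eq0_normc /eqP; apply/negP.
pose w : R[i] := z^*%C * (normc z)^-1%:C.
have nw : normc w = 1 by rewrite normcM normc_conj normcC ger0_norm ?invr_ge0 ?(ltW nz)// mulfV// gt_eqF.
have wi := cintegZ w fi.
have E : \int[mu]_x complex.Re (w * f x) = normc z.
  have := congr1 (@complex.Re R) (CintZ w fi); rewrite -/z {2}/w mulrAC [_^*%C * z]mulrC mul_conjc.
  by rewrite -rmorphM expr2 -mulrA mulfV ?gt_eqF// mulr1.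
have ri := integrableRe wi.
rewrite -E /Rintegral fineK; last exact: integrable_fin_num.
under [leRHS]eq_integral do rewrite -[normc (f _)]mul1r -nw -normcM.
apply: le_integral => //; first exact: integrable_normc.
by move=> x _; rewrite lee_fin; apply: le_trans (ler_norm _) (Re_le_normc _).
Qed.

End sharp_bound.

(** * Plancherel's theorem *)

Section square_integrable.
Context {R : realType}.
Implicit Types (f g h F G m : cfield R) (x y xi : R3 R) (p q M : R).
Local Notation L1 := (cinteg (leb3 R)).
Local Notation cmeas3 := (cmeas (T := M3 R)).

(** [p] is an upper bound for the $L^2$ norm; carrying a bound avoids both extended reals and the
    computation of norms. *)
Definition l2 f p := [/\ cmeas3 f, 0 <= p &
  (\int[leb3 R]_x (normc (f x) ^+ 2)%:E <= (p ^+ 2)%:E)%E].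

Lemma measurable_normc_sqr f : cmeas3 f -> measurable_fun [set: M3 R] (fun x => (normc (f x) ^+ 2)%:E).
Proof. by move=> mf; apply/measurable_EFinP; apply: measurable_funX; exact: measurable_normc. Qed.

Lemma l2W f p q : p <= q -> l2 f p -> l2 f q.
Proof.
move=> pq [mf p0 fp]; split => //; first exact: le_trans pq.
by apply: (le_trans fp); rewrite lee_fin ler_sqr ?nnegrE// (le_trans p0).
Qed.

Lemma l2_le f g p : cmeas3 f -> (forall x, normc (f x) <= normc (g x)) -> l2 g p -> l2 f p.
Proof.
move=> mf fg [mg p0 gp]; split => //; apply: le_trans gp; apply: ge0_le_integral => //.
- by move=> x _; rewrite lee_fin sqr_ge0.
- exact: measurable_normc_sqr.
- exact: measurable_normc_sqr.
- by move=> x _; rewrite lee_fin ler_sqr ?nnegrE ?normc_ge0.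
Qed.

Lemma l2_ae f g p : cmeas3 f -> {ae leb3 R, forall x, f x = g x} -> l2 g p -> l2 f p.
Proof.
move=> mf fg [mg p0 gp]; split => //.
rewrite (@ae_eq_integral _ _ _ (leb3 R) setT (fun x => (normc (g x) ^+ 2)%:E))//.
- exact: measurable_normc_sqr.
- exact: measurable_normc_sqr.
- by apply: ae_imp fg => x -> _.
Qed.

Lemma l2Z (z : R[i]) f p : l2 f p -> l2 (fun x => z * f x) (normc z * p).
Proof.
move=> [mf p0 fp]; split; first by apply: cmeasM => //; exact: cmeas_cst.
  by rewrite mulr_ge0 ?normc_ge0.
have z0 : (0 <= (normc z ^+ 2)%:E)%E by rewrite lee_fin sqr_ge0.
under eq_integral do rewrite normcM exprMn EFinM.
rewrite ge0_integralZl//.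
- by rewrite exprMn [leRHS]EFinM lee_wpmul2l// lee_fin sqr_ge0.
- exact: measurable_normc_sqr.
- by move=> x _; rewrite lee_fin sqr_ge0.
Qed.

Lemma l2Mb m f M p : cmeas3 m -> (forall x, normc (m x) <= M) -> l2 f p ->
  l2 (fun x => m x * f x) (M * p).
Proof.
move=> mm mM lf; have M0 : 0 <= M := le_trans (normc_ge0 _) (mM 0).
have := l2Z M%:C lf; rewrite normcC ger0_norm//; apply: l2_le.
  by apply: cmeasM => //; case: lf.
by move=> x; rewrite !normcM normcC ger0_norm// ler_wpM2r ?normc_ge0.
Qed.

(** From $|a+b|^2\le2|a|^2+2|b|^2$; the loss with respect to the triangle inequality is harmless,
    because sums occur only in qualitative or limiting arguments. *)
Lemma l2D f g p q : l2 f p -> l2 g q -> l2 (fun x => f x + g x) (2 * (p + q)).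
Proof.
move=> [mf p0 fp] [mg q0 gq]; split; [exact: cmeasD|by rewrite mulr_ge0// addr_ge0|].
apply: (@le_trans _ _ (\int[leb3 R]_x (2%:E * (normc (f x) ^+ 2)%:E + 2%:E * (normc (g x) ^+ 2)%:E))%E).
  apply: ge0_le_integral => //.
  - by move=> x _; rewrite lee_fin sqr_ge0.
  - by apply: measurable_normc_sqr; exact: cmeasD.
  - by apply: emeasurable_funD; apply: measurable_funeM; exact: measurable_normc_sqr.
  - by move=> x _; rewrite -!EFinM -EFinD lee_fin normcD_sqr.
rewrite ge0_integralD//; last 4 first.
- by move=> x _; rewrite -EFinM lee_fin mulr_ge0// sqr_ge0.
- by apply: measurable_funeM; exact: measurable_normc_sqr.
- by move=> x _; rewrite -EFinM lee_fin mulr_ge0// sqr_ge0.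
- by apply: measurable_funeM; exact: measurable_normc_sqr.
rewrite !ge0_integralZl//; last 4 first.
- exact: measurable_normc_sqr.
- by move=> x _; rewrite lee_fin sqr_ge0.
- exact: measurable_normc_sqr.
- by move=> x _; rewrite lee_fin sqr_ge0.
apply: (@le_trans _ _ (2%:E * (p ^+ 2)%:E + 2%:E * (q ^+ 2)%:E)%E).
  by apply: leeD; apply: lee_wpmul2l; rewrite ?lee_fin.
rewrite -!EFinM -EFinD lee_fin; have := mulr_ge0 p0 q0; have := sqr_ge0 p; have := sqr_ge0 q; lra.
Qed.

Lemma l2N f p : l2 f p -> l2 (fun x => - f x) p.
Proof.
move=> [mf p0 fp]; split => //; first exact: cmeasN.
by under eq_integral do rewrite normcN.
Qed.

Lemma l2B f g p q : l2 f p -> l2 g q -> l2 (fun x => f x - g x) (2 * (p + q)).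
Proof. by move=> lf lg; apply: (l2D lf); exact: l2N. Qed.

Lemma l2_conj f p : l2 f p -> l2 (fun x => (f x)^*%C) p.
Proof.
move=> [mf p0 fp]; split => //; first exact: cmeas_conj.
by under eq_integral do rewrite normc_conj.
Qed.

Lemma l2_reflect f p : l2 f p -> l2 (fun x => f (- x)) p.
Proof.
have m1 : (-1 : R) != 0 by rewrite oppr_eq0 oner_neq0.
move=> [mf p0 fp]; split => //.
  under eq_fun do rewrite -scaleN1r -[_ *: _]addr0.
  exact: cmeas_aff.
have [_ /(_ (fun x => (normc (f x) ^+ 2)%:E))] := scaling_leb3 0 m1.
under eq_integral do rewrite addr0 scaleN1r.
rewrite normrN normr1 expr1n invr1 mul1e => ->//; first exact: measurable_normc_sqr.
by move=> x; rewrite lee_fin sqr_ge0.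
Qed.

Lemma l2_mul f g p q : l2 f p -> l2 g q -> L1 (fun x => f x * g x) /\
  (\int[leb3 R]_x (normc (f x * g x))%:E <= (p * q)%:E)%E.
Proof.
move=> [mf p0 fp] [mg q0 gq].
have h : (\int[leb3 R]_x (normc (f x * g x))%:E <= (p * q)%:E)%E.
  under eq_integral do rewrite normcM -[X in X%:E]ger0_norm ?mulr_ge0 ?normc_ge0//.
  by apply: cauchy_schwarz => //; exact: measurable_normc.
split => //; split; first exact: cmeasM.
exact: le_lt_trans h (ltry _).
Qed.

Lemma l2_Cint_mul f g p q : l2 f p -> l2 g q ->
  normc (Cint (leb3 R) (fun x => f x * g x)) <= p * q.
Proof.
move=> lf lg; have [h1 h2] := l2_mul lf lg.
by rewrite -lee_fin; apply: le_trans (normc_Cint_le1 h1) h2.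
Qed.

Lemma locint_bound f : cmeas3 f -> (forall r, exists G : R3 R -> R,
    L1 (fun x => (G x)%:C) /\ forall x, enorm x <= r -> normc (f x) <= G x) ->
  locally_integrable3 f.
Proof.
move=> mf fG; split; [exact: mf.1|exact: mf.2|move=> r].
have [G [[mG Goo] hG]] := fG r.
apply: le_lt_trans Goo.
apply: (@le_trans _ _ (\int[leb3 R]_(x in [set x | (enorm x <= r)%R]) (normc (G x)%:C)%:E)%E).
  apply: ge0_le_integral.
  - exact: measurable_enorm_le.
  - by move=> x _; rewrite lee_fin normc_ge0.
  - by apply: measurable_funTS; exact: measurable_enormc.
  - by apply: measurable_funTS; exact: measurable_enormc.
  - by move=> x xr; rewrite lee_fin normcC; exact: le_trans (hG x xr) (ler_norm _).
apply: ge0_subset_integral => //; first exact: measurable_enorm_le.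
  exact: measurable_enormc.
by move=> x _; rewrite lee_fin normc_ge0.
Qed.

Lemma L1_realD (a b : R3 R -> R) : L1 (fun x => (a x)%:C) -> L1 (fun x => (b x)%:C) ->
  L1 (fun x => (a x + b x)%:C).
Proof. by move=> ha hb; have := cintegD ha hb; under eq_fun do rewrite -rmorphD. Qed.

Lemma L1_realZ (c : R) (a : R3 R -> R) : L1 (fun x => (a x)%:C) -> L1 (fun x => (c * a x)%:C).
Proof. by move=> ha; have := cintegZ c%:C ha; under eq_fun do rewrite -rmorphM. Qed.

Lemma L1_normc f : L1 f -> L1 (fun x => (normc (f x))%:C).
Proof.
move=> hf; apply: cinteg_real; first by apply: measurable_normc; case: hf.
by under eq_integral do rewrite ger0_norm ?normc_ge0//; case: hf.
Qed.

Lemma l2_normc_sqr f p : l2 f p -> L1 (fun x => (normc (f x) ^+ 2)%:C).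
Proof.
move=> [mf p0 fp]; apply: cinteg_real; first by apply: measurable_funX; exact: measurable_normc.
by under eq_integral do rewrite ger0_norm ?sqr_ge0//; exact: le_lt_trans fp (ltry _).
Qed.

Lemma L1_locint f : L1 f -> locally_integrable3 f.
Proof.
move=> hf; apply: locint_bound; first by case: hf.
by move=> r; exists (fun x => normc (f x)); split => //; exact: L1_normc.
Qed.

(** On a ball the constant 1 is dominated by a multiple of the integrable weight, so the volume of
    balls never has to be computed. *)
Lemma one_le_wgt r x : enorm x <= r -> 1 <= (1 + r) ^+ 6 * wgt x.
Proof.
move=> xr; have x0 := opp_enorm_gt0 x; rewrite /wgt ler_pdivlMr ?exprn_gt0// mul1r.
by rewrite lerXn2r ?nnegrE ?(ltW x0)//; have := enorm_ge0 x; lra.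
Qed.

Lemma l2_locint f p : l2 f p -> locally_integrable3 f.
Proof.
move=> lf; apply: locint_bound; first by case: lf.
move=> r; exists (fun x => normc (f x) ^+ 2 + (1 + r) ^+ 6 * wgt x); split.
  apply: L1_realD; first exact: l2_normc_sqr lf.
  by apply: L1_realZ; exact: cinteg_wgt.
(* $|f|\le|f|^2+\frac14$. *)
move=> x /one_le_wgt; have := sqr_ge0 (normc (f x) - 2^-1); lra.
Qed.

Lemma bounded_locint f M : cmeas3 f -> (forall x, normc (f x) <= M) -> locally_integrable3 f.
Proof.
move=> mf fM; have M0 : 0 <= M := le_trans (normc_ge0 _) (fM 0).
apply: locint_bound => // r; exists (fun x => M * ((1 + r) ^+ 6 * wgt x)); split.
  by do 2 apply: L1_realZ; exact: cinteg_wgt.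
by move=> x /one_le_wgt w1; apply: (le_trans (fM x)); rewrite ler_peMr.
Qed.

Lemma L1_bounded_l2 f M : L1 f -> (forall x, normc (f x) <= M) -> exists p, l2 f p.
Proof.
move=> [mf foo] fM; have M0 : 0 <= M := le_trans (normc_ge0 _) (fM 0).
pose I := fine (\int[leb3 R]_x (normc (f x))%:E)%E.
have IE : (\int[leb3 R]_x (normc (f x))%:E = I%:E)%E.
  by rewrite /I fineK// ge0_fin_numE//; apply: integral_ge0 => x _; rewrite lee_fin normc_ge0.
have I0 : 0 <= I by rewrite -lee_fin -IE; apply: integral_ge0 => x _; rewrite lee_fin normc_ge0.
exists (M * I + 1); split => //; first by rewrite addr_ge0 ?mulr_ge0.
apply: (@le_trans _ _ (\int[leb3 R]_x (M%:E * (normc (f x))%:E))%E).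
  apply: ge0_le_integral => //.
  - by move=> x _; rewrite lee_fin sqr_ge0.
  - exact: measurable_normc_sqr.
  - by apply: measurable_funeM; exact: measurable_enormc.
  - by move=> x _; rewrite -EFinM lee_fin expr2 ler_wpM2r ?normc_ge0.
rewrite ge0_integralZl//; last 2 first.
- exact: measurable_enormc.
- by move=> x _; rewrite lee_fin normc_ge0.
by rewrite IE -EFinM lee_fin; have := mulr_ge0 M0 I0; set c := M * I; have := sqr_ge0 c; lra.
Qed.

Lemma schwartz_l2 h : schwartz h -> exists p, l2 h p.
Proof. by move=> sh; have [M hM] := schwartz_bdd sh; exact: L1_bounded_l2 (schwartz_L1 sh) hM. Qed.

Lemma test_l2 h : test_fun h -> exists p, l2 h p.
Proof. by move=> /test_schwartz; exact: schwartz_l2. Qed.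

End square_integrable.

(** * The Fourier transform as a contraction in the square norm *)

Section contraction.
Context {R : realType}.
Implicit Types (f g h F G : cfield R) (x y xi eta : R3 R) (p q M e : R).
Local Notation L1 := (cinteg (leb3 R)).
Local Notation cmeas3 := (cmeas (T := M3 R)).

Lemma eq_Cint3 F G : (forall x, F x = G x) -> Cint (leb3 R) F = Cint (leb3 R) G.
Proof. by move=> FG; congr Cint; exact/funext. Qed.

Lemma integral_Cint (a : R3 R -> R) : L1 (fun x => (a x)%:C) ->
  (\int[leb3 R]_x (a x)%:E = (complex.Re (Cint (leb3 R) (fun x => (a x)%:C)))%:E)%E.
Proof.
move=> ha; have ri := integrableRe ha.
by rewrite /Cint /= /Rintegral fineK//; exact: integrable_fin_num ri.
Qed.

Lemma integral_le_Cint (a : R3 R -> R) : L1 (fun x => (a x)%:C) ->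
  (\int[leb3 R]_x (a x)%:E <= (normc (Cint (leb3 R) (fun x => (a x)%:C)))%:E)%E.
Proof. by move=> ha; rewrite integral_Cint// lee_fin; apply: le_trans (ler_norm _) (Re_le_normc _). Qed.

(** Measurability is extracted from Fubini's theorem, which needs an integrand integrable in both
    variables: the weight [wgt x] is inserted for this and divided out afterwards. *)
Lemma cmeas_ifourier F : L1 F -> cmeas3 (ifourier F).
Proof.
move=> hF.
have H : cinteg (leb3s R \x leb3s R)%E
    (fun z : M3 R * M3 R => expi (dot3 z.1 z.2) * ((wgt (z.1 : R3 R))%:C * F z.2)).
  apply: (cinteg_prod (m1 := leb3s R) (m2 := leb3s R) (M := 1) (@cinteg_wgt R) hF) => [|z].
    exact: (cmeas_expi measurable_dot3_pair).
  by rewrite normc_expi.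
have [mW _] : L1 (fun x => Cint (leb3 R) (fun xi => expi (dot3 x xi) * ((wgt x)%:C * F xi))).
  exact: (cinteg_Fubini1 H).
have E : ifourier F = (fun x => (fcst * (wgt x)^-1)%:C *
    Cint (leb3 R) (fun xi => expi (dot3 x xi) * ((wgt x)%:C * F xi))).
  apply/funext => x.
  rewrite (@eq_Cint _ _ R (leb3 R) _ (fun xi => (wgt x)%:C * (expi (dot3 x xi) * F xi))); last first.
    by move=> xi; rewrite mulrCA.
  rewrite Cint3Z; last exact: cinteg_char.
  by rewrite mulrA -rmorphM -mulrA mulVf ?mulr1// gt_eqF// wgt_gt0.
rewrite E; apply: cmeasM => //; apply: cmeas_real; apply: measurable_funM => //.
under eq_fun do rewrite /wgt invrK.
by apply: measurable_funX; apply: measurable_funD => //; exact: measurable_enorm.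
Qed.

Lemma ifourier_bound F : L1 F -> exists M, forall x, normc (ifourier F x) <= M.
Proof.
move=> hF; exists (2 * fcst * fine (\int[leb3 R]_xi (normc (F xi))%:E)%E) => x.
rewrite -lee_fin [leRHS]EFinM fineK; first exact: ifourier_le.
by rewrite ge0_fin_numE; [case: hF|apply: integral_ge0 => y _; rewrite lee_fin normc_ge0].
Qed.

Lemma cinteg_laplker e : 0 < e -> L1 (fun x => (laplker e x)%:C).
Proof.
move=> e0; have := cinteg_laplker_char 0 e0.
by under eq_fun do rewrite -[0](scale0r (0 : R3 R)) dot3Zl mul0r expi0 mulr1.
Qed.

(** A product of Cauchy kernels of width [e], normalized to mass 1; it is [fcst ^+ 2] times the
    integral of the damping factor [laplker e] against the character. *)
Definition cauchyk e y : R := fcst ^+ 2 * (8 * e ^- 3 * cauchyw3 (e^-1 *: y)).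

Lemma cauchyk_ge0 e y : 0 < e -> 0 <= cauchyk e y.
Proof.
move=> e0; rewrite /cauchyk; apply: mulr_ge0; first exact: sqr_ge0.
apply: mulr_ge0; first by rewrite mulr_ge0 ?invr_ge0 ?exprn_ge0 ?(ltW e0).
by rewrite /cauchyw3; do 2?apply: mulr_ge0; exact: ltW (cauchyw_gt0 _).
Qed.

Lemma cauchyk_mass e x : 0 < e -> (\int[leb3 R]_y (cauchyk e (x + y))%:E = 1)%E.
Proof.
move=> e0; have e1 : e^-1 != 0 by rewrite invr_neq0// gt_eqF.
have E y : (cauchyk e (x + y))%:C = (fcst ^+ 2 * (8 * e ^- 3))%:C *
    (fun z => (cauchyw3 z)%:C) (e^-1 *: y + e^-1 *: x).
  by rewrite /cauchyk -scalerDr [y + x]addrC -rmorphM mulrA.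
have i0 := cinteg_aff (e^-1 *: x) e1 (@cinteg_cauchyw3 R).
have i1 : L1 (fun y => (cauchyk e (x + y))%:C).
  by under eq_fun do rewrite E; exact: cintegZ.
rewrite integral_Cint// (eq_Cint3 E) Cint3Z// (Cint_aff (e^-1 *: x) e1 (@cinteg_cauchyw3 R)) Cint_cauchyw3.
rewrite -!rmorphM; congr EFin; rewrite /= ger0_norm ?invr_ge0 ?(ltW e0)//.
by rewrite -[RHS]fcst_sqr exprVn; field; rewrite gt_eqF.
Qed.

Lemma conj_ifourier F x : L1 F -> (ifourier F x)^*%C = ifourier (fun y => (F (- y))^*%C) x.
Proof.
move=> hF; rewrite (@ifourier_reflect R (fun y => (F y)^*%C)); last exact: cinteg_conj.
rewrite !ifourierE conjcM -Cint_conj; last exact: cinteg_char.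
congr (_ * _); first by rewrite /= oppr0.
by apply: eq_Cint => y; rewrite conjcM conjc_expi dot3Nl.
Qed.

Lemma ifourier_damped F e xi : L1 F -> 0 < e ->
  ifourier (fun x => (laplker e x)%:C * (ifourier F x)^*%C) xi =
  Cint (leb3 R) (fun eta => (F (- eta))^*%C * (cauchyk e (xi + eta))%:C).
Proof.
move=> hF e0; set Fc := fun y => (F (- y))^*%C.
have hFc : L1 Fc.
  apply: cinteg_conj; under eq_fun do rewrite -scaleN1r -[_ *: _]addr0.
  by apply: (@cinteg_aff R (-1) 0) => //; rewrite oppr_eq0 oner_neq0.
have hG := cinteg_laplker_char xi e0.
transitivity (fcst%:C * Cint (leb3 R) (fun x => (laplker e x)%:C * expi (dot3 xi x) * ifourier Fc x)).
  rewrite ifourierE; congr (_ * _); apply: eq_Cint => x.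
  by rewrite conj_ifourier// mulrA [expi _ * _]mulrC.
rewrite ifourier_mult// -Cint3Z.
  apply: eq_Cint => y; rewrite ifourier_laplker// mulrCA -rmorphM; congr (_ * _%:C).
  by rewrite /cauchyk mulrA -expr2.
have [M hM] := ifourier_bound hG.
under eq_fun do rewrite mulrC; apply: (cintegMb (M := M)) => //; exact: cmeas_ifourier.
Qed.

Lemma measurable_cauchyk_pair e : measurable_fun [set: M3 R * M3 R]
  (fun z : M3 R * M3 R => cauchyk e ((z.1 : R3 R) + (z.2 : R3 R))).
Proof.
apply: measurable_funM => //; apply: measurable_funM => //.
have mc : measurable_fun [set: M3 R] (@cauchyw3 R : M3 R -> R) by have [] := (@cinteg_cauchyw3 R).1.
suff mg : measurable_fun [set: M3 R * M3 R]
    (fun z : M3 R * M3 R => (e^-1 *: ((z.1 : R3 R) + (z.2 : R3 R)) : M3 R)).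
  exact: (measurableT_comp mc mg).
have mj j : measurable_fun [set: M3 R * M3 R] (fun z : M3 R * M3 R => e^-1 * (coord3 j (z.1 : R3 R) + coord3 j (z.2 : R3 R))).
  apply: measurable_funM => //; apply: measurable_funD.
    exact: (measurableT_comp (measurable_coord3 j) measurable_fst).
  exact: (measurableT_comp (measurable_coord3 j) measurable_snd).
apply/measurable_fun_pairP; split; first apply/measurable_fun_pairP; first split.
- exact: (mj 0).
- exact: (mj 1).
- exact: (mj 2).
Qed.

Lemma measurable_cauchyk1 e x :
  measurable_fun [set: M3 R] (fun y : M3 R => cauchyk e (x + (y : R3 R))).
Proof.
have mp : measurable_fun [set: M3 R] (fun y : M3 R => (x : M3 R, y)) by exact: measurable_pair1.
exact: (measurableT_comp (measurable_cauchyk_pair e) mp).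
Qed.

(** Schur's test: the kernel has mass 1 in each variable, so each half contributes at most
    $p^2/2$. *)
Lemma schur_cauchyk F p e : l2 F p -> 0 < e ->
  (\int[leb3s R]_xi \int[leb3s R]_eta
    ((normc (F xi) ^+ 2 / 2 * cauchyk e (xi + eta))%:E +
     (normc (F (- eta)) ^+ 2 / 2 * cauchyk e (xi + eta))%:E) <= (p ^+ 2)%:E)%E.
Proof.
move=> lF e0; have [mF p0 Fp] := lF; have [mF' _ Fp'] := l2_reflect lF.
pose f1 (z : M3 R * M3 R) := (normc (F z.1) ^+ 2 / 2 * cauchyk e (z.1 + z.2))%:E.
pose f2 (z : M3 R * M3 R) := (normc (F (- (z.2 : R3 R))) ^+ 2 / 2 * cauchyk e (z.1 + z.2))%:E.
have mk := measurable_cauchyk_pair e.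
have m1 : measurable_fun [set: M3 R * M3 R] f1.
  apply/measurable_EFinP; apply: measurable_funM => //; apply: measurable_funM => //.
  apply: measurable_funX; apply: (measurable_normc (f := fun z : M3 R * M3 R => F z.1)).
  exact: cmeas_fst mF.
have m2 : measurable_fun [set: M3 R * M3 R] f2.
  apply/measurable_EFinP; apply: measurable_funM => //; apply: measurable_funM => //.
  apply: measurable_funX; apply: (measurable_normc (f := fun z : M3 R * M3 R => F (- (z.2 : R3 R)))).
  exact: cmeas_snd mF'.
have mkx := measurable_cauchyk1 e.
have f10 z : (0 <= f1 z)%E by rewrite lee_fin mulr_ge0 ?cauchyk_ge0// divr_ge0 ?sqr_ge0.
have f20 z : (0 <= f2 z)%E by rewrite lee_fin mulr_ge0 ?cauchyk_ge0// divr_ge0 ?sqr_ge0.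
have inner (c : R) x : 0 <= c -> (\int[leb3 R]_y (c * cauchyk e (x + y))%:E = c%:E)%E.
  move=> c0; under eq_integral do rewrite EFinM.
  rewrite ge0_integralZl//.
  - by rewrite cauchyk_mass// mule1.
  - by apply/measurable_EFinP; exact: mkx.
  - by move=> y _; rewrite lee_fin cauchyk_ge0.
have half (f : cfield R) : cmeas3 f -> (\int[leb3 R]_x (normc (f x) ^+ 2)%:E <= (p ^+ 2)%:E)%E ->
    (\int[leb3 R]_x (normc (f x) ^+ 2 / 2)%:E <= (p ^+ 2 / 2)%:E)%E.
  move=> mf fp; under eq_integral do rewrite mulrC EFinM.
  rewrite ge0_integralZl ?lee_fin ?invr_ge0//.
  - by rewrite [leRHS]EFinM muleC; apply: lee_wpmul2r => //; rewrite lee_fin.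
  - exact: measurable_normc_sqr.
  - by move=> x _; rewrite lee_fin sqr_ge0.
rewrite -[X in (X <= _)%E](@fubini_tonelli1 _ _ _ _ R (leb3s R) (leb3s R) (fun z => f1 z + f2 z)%E); last 2 first.
- exact: emeasurable_funD.
- by move=> z; exact: adde_ge0.
rewrite ge0_integralD//.
rewrite [X in (X + _)%E](@fubini_tonelli1 _ _ _ _ R (leb3s R) (leb3s R) f1)//.
rewrite [X in (_ + X)%E](@fubini_tonelli2 _ _ _ _ R (leb3s R) (leb3s R) f2)//.
apply: (@le_trans _ _ ((p ^+ 2 / 2)%:E + (p ^+ 2 / 2)%:E)%E); last first.
  by rewrite -EFinD lee_fin; lra.
apply: leeD.
  rewrite (eq_integral (fun x : M3 R => (normc (F x) ^+ 2 / 2)%:E)).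
    exact: half.
  by move=> x _; rewrite /fubini_F /f1 /=; apply: inner; rewrite divr_ge0 ?sqr_ge0.
rewrite (eq_integral (fun x : M3 R => (normc (F (- (x : R3 R))) ^+ 2 / 2)%:E)).
  exact: (half (fun x => F (- x))).
move=> y _; rewrite /fubini_G /f2 /=.
under eq_integral do rewrite addrC.
by apply: inner; rewrite divr_ge0 ?sqr_ge0.
Qed.

(** By the multiplication formula the damped square norm is the double integral of
    $F(\xi)\overline{F(-\eta)}$ against the Cauchy kernel at $\xi+\eta$, and $ab\le(a^2+b^2)/2$
    reduces it to [schur_cauchyk]. The damping makes every integral absolutely convergent. *)
Lemma damped_le F p e : L1 F -> l2 F p -> 0 < e ->
  (\int[leb3 R]_x (laplker e x * normc (ifourier F x) ^+ 2)%:E <= (p ^+ 2)%:E)%E.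
Proof.
move=> hF lF e0; have [M hM] := ifourier_bound hF.
have mI := cmeas_ifourier hF.
pose gK x := (laplker e x)%:C * (ifourier F x)^*%C.
have hK : L1 gK.
  rewrite /gK; under eq_fun do rewrite mulrC; apply: (cintegMb (M := M)) => //.
  - exact: cmeas_conj.
  - by move=> x; rewrite normc_conj.
  - exact: cinteg_laplker.
have E x : (laplker e x * normc (ifourier F x) ^+ 2)%:C = gK x * ifourier F x.
  by rewrite /gK -mulrA [_^*%C * _]mulrC mul_conjc -rmorphM.
have hKI : L1 (fun x => gK x * ifourier F x).
  by under eq_fun do rewrite mulrC; exact: (cintegMb (M := M)).
apply: (le_trans (integral_le_Cint _)); first by under eq_fun do rewrite E.
rewrite (eq_Cint3 E) ifourier_mult//.
have [N hN] := ifourier_bound hK.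
have mK := cmeas_ifourier hK.
apply: (le_trans (normc_Cint_le1 _)).
  by under eq_fun do rewrite mulrC; exact: (cintegMb (M := N)).
apply: le_trans (schur_cauchyk lF e0).
have [mF p0 _] := lF; have [mF' _ _] := l2_reflect lF.
have mk := measurable_cauchyk_pair e.
have hF' : L1 (fun y => F (- y)).
  under eq_fun do rewrite -scaleN1r -[_ *: _]addr0.
  by apply: (@cinteg_aff R (-1) 0) => //; rewrite oppr_eq0 oner_neq0.
have mkx := measurable_cauchyk1 e.
have mc : cmeas3 (fun y => F (- y)) by [].
apply: ge0_le_integral.
- by [].
- by move=> x _; rewrite lee_fin normc_ge0.
- by apply: measurable_enormc; exact: cmeasM.
- apply: (@measurable_fun_fubini_tonelli_F _ _ _ _ R (leb3s R) (fun z : M3 R * M3 R =>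
    (normc (F z.1) ^+ 2 / 2 * cauchyk e (z.1 + z.2))%:E +
    (normc (F (- (z.2 : R3 R))) ^+ 2 / 2 * cauchyk e (z.1 + z.2))%:E)%E).
    apply: emeasurable_funD; apply/measurable_EFinP; apply: measurable_funM => //; apply: measurable_funM => //; apply: measurable_funX.
      apply: (measurable_normc (f := fun z : M3 R * M3 R => F z.1)); exact: cmeas_fst mF.
    apply: (measurable_normc (f := fun z : M3 R * M3 R => F (- (z.2 : R3 R)))); exact: cmeas_snd mF'.
  by move=> z; rewrite -EFinD lee_fin addr_ge0// mulr_ge0 ?cauchyk_ge0// divr_ge0 ?sqr_ge0.
- move=> x _; rewrite normcM EFinM ifourier_damped//.
  have kb : exists M, forall y, normc ((cauchyk e (x + y))%:C : R[i]) <= M.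
    exists (fcst ^+ 2 * (8 * e ^- 3 * 1)) => y; rewrite normcC ger0_norm ?cauchyk_ge0//.
    rewrite ler_wpM2l ?sqr_ge0// ler_wpM2l ?mulr_ge0 ?invr_ge0 ?exprn_ge0 ?(ltW e0)//.
    have w1 (t : R) : 0 <= cauchyw t <= 1.
      by rewrite (ltW (cauchyw_gt0 _))/= /cauchyw invf_le1 ?ltr_pwDl ?sqr_ge0// lerDl sqr_ge0.
    have [/andP[a0 a1] /andP[b0 b1] /andP[c0 c1]] : [/\ 0 <= cauchyw (e^-1 *: (x + y)).1.1 <= 1,
      0 <= cauchyw (e^-1 *: (x + y)).1.2 <= 1 & 0 <= cauchyw (e^-1 *: (x + y)).2 <= 1] by [].
    by rewrite /cauchyw3 !mulr_ile1 ?mulr_ge0.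
  have [K hKb] := kb.
  have iFk : L1 (fun y => (F (- y))^*%C * (cauchyk e (x + y))%:C).
    under eq_fun do rewrite mulrC; apply: (cintegMb (M := K)) => //.
      by apply: cmeas_real; exact: mkx.
    exact: cinteg_conj.
  apply: (le_trans (lee_wpmul2l _ (normc_Cint_le1 iFk))); first by rewrite lee_fin normc_ge0.
  rewrite -ge0_integralZl ?lee_fin ?normc_ge0//; last 2 first.
  - by apply: measurable_enormc; case: iFk.
  - by move=> y _; rewrite lee_fin normc_ge0.
  apply: ge0_le_integral => //.
  - by move=> y _; rewrite -EFinM lee_fin mulr_ge0 ?normc_ge0.
  - by apply: measurable_funeM; apply: measurable_enormc; case: iFk.
  - apply: emeasurable_funD; apply/measurable_EFinP; apply: measurable_funM => //.
    by apply: measurable_funM => //; apply: measurable_funX; exact: measurable_normc.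
  - move=> y _; rewrite -EFinM -EFinD lee_fin normcM normc_conj normcC ger0_norm ?cauchyk_ge0//.
    rewrite mulrA -mulrDl ler_wpM2r ?cauchyk_ge0//.
    have := sqr_ge0 (normc (F x) - normc (F (- y))); lra.
Qed.

Lemma limn_einf_le (v : nat -> \bar R) (c : \bar R) : (forall n, v n <= c)%E -> (limn_einf v <= c)%E.
Proof.
move=> vc; rewrite limn_einf_lim; apply: lime_le; first exact: is_cvg_einfs.
apply: nearW => n; apply: le_trans (vc n); apply: ereal_inf_lbound.
by exists n => //=.
Qed.

Lemma normc_dist (z w : R[i]) : `|normc z - normc w| <= normc (z - w).
Proof.
have h1 : normc z <= normc (z - w) + normc w by rewrite -{1}(subrK w z) normcD.
have h2 : normc w <= normc (z - w) + normc z.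
  by rewrite -[z - w]opprB normcN -{1}(subrK z w) normcD.
by rewrite ler_norml; apply/andP; split; lra.
Qed.

Lemma l2_fatou (F_ : nat -> cfield R) f p : (forall n, l2 (F_ n) p) -> cmeas3 f ->
  {ae leb3 R, forall x, (fun n => normc (F_ n x - f x)) @ \oo --> (0 : R)} -> l2 f p.
Proof.
move=> lF mf Ff; have [_ p0 _] := lF 0%N; split => //.
have mF n : cmeas3 (F_ n) by case: (lF n).
have me : measurable_fun [set: M3 R] (fun x : M3 R => limn_einf (fun n => (normc (F_ n x) ^+ 2)%:E)).
  apply: (emeasurable_fun_cvg (fun n x => einfs (fun k => (normc (F_ k x) ^+ 2)%:E) n)).
    by move=> m; apply: measurable_fun_einfs => n; exact: measurable_normc_sqr.
  by move=> x _; rewrite limn_einf_lim; exact: is_cvg_einfs.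
rewrite (@ae_eq_integral _ _ _ (leb3 R) setT (fun x => limn_einf (fun n => (normc (F_ n x) ^+ 2)%:E)))//.
- apply: le_trans (fatou _ _ _ _) _ => //.
  + by move=> n; exact: measurable_normc_sqr.
  + by move=> n x _; rewrite lee_fin sqr_ge0.
  + by apply: limn_einf_le => n; case: (lF n).
- exact: measurable_normc_sqr.
- apply: ae_imp Ff => x hx _.
  have h : (fun n => (normc (F_ n x) ^+ 2)%:E) @ \oo --> (normc (f x) ^+ 2)%:E.
    apply: cvg_EFin; first exact: nearW.
    have hn : (fun n => normc (F_ n x)) @ \oo --> normc (f x).
      apply/subr_cvg0; apply: norm_cvg0; apply: cvg0_le hx => n; rewrite normr_ge0/=.
      exact: normc_dist.
    by rewrite expr2; apply: cvgM.
  by rewrite (cvg_limn_einf_sup h).1.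
Qed.

(** The damping is removed by Fatou's lemma; its square root multiplies the transform, so that the
    squared modulus carries the damping itself. *)
Lemma ifourier_l2 F p : L1 F -> l2 F p -> l2 (ifourier F) p.
Proof.
move=> hF lF; have [_ p0 _] := lF; have mI := cmeas_ifourier hF.
have e0 n : (0 : R) < harmonic n by exact: eps_gt0.
have s0 n x : 0 <= laplker (harmonic n : R) x by have /andP[/ltW] := laplker_itv x (e0 n).
apply: (@l2_fatou (fun n x => (Num.sqrt (laplker (harmonic n) x))%:C * ifourier F x)) => //.
- move=> n; split => //.
    apply: cmeasM => //; apply: cmeas_real; apply: (measurableT_comp (@measurable_sqrt R)).
    exact: (cinteg_laplker (e0 n)).1.1.
  under eq_integral do rewrite normcM normcC ger0_norm ?sqrtr_ge0// exprMn sqr_sqrtr//.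
  exact: damped_le.
- apply: aeW => x; under eq_fun do rewrite -{2}[ifourier F x]mul1r -mulrBl normcM.
  rewrite -(mul0r (normc (ifourier F x))); apply: cvgM; last exact: cvg_cst.
  under eq_fun do rewrite -[1]/(1%:C) -rmorphB normcC.
  rewrite -(normr0 R) -(subrr (1 : R)); apply: cvg_norm; apply: cvgB; last exact: cvg_cst.
  by have := cvg_comp _ (@Num.sqrt R) (cvg_laplker x) (@sqrt_continuous R 1); rewrite sqrtr1.
Qed.

End contraction.

(** * Extension of the transform to L^2 and Parseval's identity *)

Section plancherel.
Context {R : realType}.
Implicit Types (f g h F G : cfield R) (x y xi eta : R3 R) (p q M e : R).
Local Notation L1 := (cinteg (leb3 R)).
Local Notation cmeas3 := (cmeas (T := M3 R)).

Lemma Cint3N F : L1 F -> Cint (leb3 R) (fun x => - F x) = - Cint (leb3 R) F.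
Proof. exact: CintN. Qed.

Lemma Cint3D F G : L1 F -> L1 G ->
  Cint (leb3 R) (fun x => F x + G x) = Cint (leb3 R) F + Cint (leb3 R) G.
Proof. exact: CintD. Qed.

Lemma Cint3B F G : L1 F -> L1 G ->
  Cint (leb3 R) (fun x => F x - G x) = Cint (leb3 R) F - Cint (leb3 R) G.
Proof. exact: CintB. Qed.

Definition trunc n F : cfield R := fun x => (\1_[set x | enorm x <= n%:R] x)%:C * F x.

Lemma cmeas_ball n : cmeas3 (fun x => (\1_[set x | enorm x <= n%:R] x : R)%:C).
Proof. by apply: cmeas_real; apply: measurable_indic; exact: measurable_enorm_le. Qed.

Lemma indic_norm (E : set (R3 R)) x : `|\1_E x : R| <= 1.
Proof. by rewrite indicE; case: (_ \in _); rewrite ?normr0 ?normr1. Qed.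

Lemma trunc_cmeas n F : cmeas3 F -> cmeas3 (trunc n F).
Proof. by move=> mF; apply: cmeasM => //; exact: cmeas_ball. Qed.

Lemma trunc_l2 n F p : l2 F p -> l2 (trunc n F) p.
Proof.
move=> lF; rewrite -[p]mul1r; apply: l2Mb => //; first exact: cmeas_ball.
by move=> x; rewrite normcC indic_norm.
Qed.

Lemma trunc_L1 n F p : l2 F p -> L1 (trunc n F).
Proof.
move=> lF; have [mF _ _] := lF.
have hG : L1 (fun x => (normc (F x) ^+ 2 + (1 + n%:R) ^+ 6 * wgt x)%:C).
  by apply: L1_realD; [exact: l2_normc_sqr lF|apply: L1_realZ; exact: cinteg_wgt].
apply: (cinteg3_le (a := fun x => normc (F x) ^+ 2 + (1 + n%:R) ^+ 6 * wgt x)).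
- exact: trunc_cmeas.
- exact: hG.1.1.
- by rewrite integral_Cint// ltry.
- move=> x; rewrite normcM normcC indicE; have [xn|] := boolP (x \in _).
    rewrite normr1 mul1r; move: xn; rewrite inE /= => /one_le_wgt.
    have := sqr_ge0 (normc (F x) - 2^-1); lra.
  by rewrite normr0 mul0r addr_ge0 ?sqr_ge0// mulr_ge0 ?(ltW (wgt_gt0 _))// exprn_ge0// addr_ge0.
Qed.

Lemma trunc_cvg F p e : l2 F p -> 0 < e -> exists n, l2 (fun x => F x - trunc n F x) e.
Proof.
move=> lF e0; have [mF p0 Fp] := lF.
have lD n : l2 (fun x => F x - trunc n F x) (1 * p).
  rewrite (_ : (fun x => _) = (fun x => (1 - \1_[set x | enorm x <= n%:R] x : R)%:C * F x)); last first.
    by apply/funext => x; rewrite /trunc rmorphB mulrBl mul1r.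
  apply: l2Mb => //; first by apply: cmeas_real; apply: measurable_funB => //; exact: (cmeas_ball n).1.
  by move=> x; rewrite normcC indicE; case: (_ \in _); rewrite ?subrr ?subr0 ?normr0 ?normr1.
have D0 : (fun n => normc (Cint (leb3 R) (fun x => (normc (F x - trunc n F x) ^+ 2)%:C) -
    Cint (leb3 R) (fun=> 0))) @ \oo --> (0 : R).
  apply: (@dominated3 R (fun n x => (normc (F x - trunc n F x) ^+ 2)%:C) (fun=> 0) (fun x => normc (F x) ^+ 2)).
  - by move=> n; exact: l2_normc_sqr (lD n).
  - exact: cinteg0.
  - exact: l2_normc_sqr lF.
  - move=> x n; rewrite subr0 normcC ger0_norm ?sqr_ge0// ler_sqr ?nnegrE ?normc_ge0//.
    rewrite /trunc -{1}[F x]mul1r -mulrBl normcM ler_piMl ?normc_ge0//.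
    by rewrite -[1 in X in normc X]/(1%:C) -rmorphB normcC indicE; case: (_ \in _); rewrite ?subrr ?subr0 ?normr0 ?normr1.
  - move=> x; apply: cvg_near_cst; exists (Num.Def.archi_bound (enorm x)) => // n hn.
    have hn' : (Num.Def.archi_bound (enorm x) <= n)%N := hn.
    have E : trunc n F x = F x.
      rewrite /trunc indicE mem_set ?mul1r//=.
      by apply: ltW; apply: lt_le_trans (archi_boundP (enorm_ge0 x)) _; rewrite ler_nat.
    by rewrite E subrr normc0 expr0n subr0 normcC normr0.
have : \forall n \near \oo, normc (Cint (leb3 R) (fun x => (normc (F x - trunc n F x) ^+ 2)%:C) -
    Cint (leb3 R) (fun=> 0)) < e ^+ 2 by apply: (cvgr_lt _ D0); rewrite exprn_gt0.
case=> n _ /(_ n (leqnn n)) hn0.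
have hn : normc (Cint (leb3 R) (fun x => (normc (F x - trunc n F x) ^+ 2)%:C)) < e ^+ 2.
  by move: hn0; rewrite Cint0 subr0.
exists n; have [mD _ _] := lD n; split => //; first exact: ltW.
by apply: (le_trans (integral_le_Cint (l2_normc_sqr (lD n)))); rewrite lee_fin ltW.
Qed.

Local Notation r k := ((4^-1 : R) ^+ k).

Lemma r_gt0 k : 0 < r k. Proof. by rewrite exprn_gt0. Qed.

Lemma r_le k j : (k <= j)%N -> r j <= r k.
Proof. by move=> kj; rewrite ler_wiXn2l//; lra. Qed.

Lemma cvg_r (c : R) : (fun k => c * r k) @ \oo --> (0 : R).
Proof.
rewrite -(mulr0 c); apply: cvgM; first exact: cvg_cst.
by apply: cvg_expr; rewrite ger0_norm//; lra.
Qed.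

(** The summability in the Riesz-Fischer theorem. At the rate $4^{-k}$ the series of the integrals
    of $2^k|D_k|^2$ converges, and $\sum_k2^k|D_k|^2$ controls $\sum_k|D_k|$ pointwise. *)
Lemma l2_series_ae (D : nat -> cfield R) : (forall k, l2 (D k) (4 * r k)) ->
  {ae leb3 R, forall x, exists C : R, forall n, \sum_(k < n) normc (D k x) <= C}.
Proof.
move=> lD; have mD k : cmeas3 (D k) by case: (lD k).
pose S x : \bar R := (\sum_(0 <= k <oo) (2 ^+ k * normc (D k x) ^+ 2)%:E)%E.
have mt k : measurable_fun [set: M3 R] (fun x : M3 R => (2 ^+ k * normc (D k x) ^+ 2)%:E).
  by under eq_fun do rewrite EFinM; apply: measurable_funeM; exact: measurable_normc_sqr.
have t0 k x : (0 <= (2 ^+ k * normc (D k x) ^+ 2)%:E)%E.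
  by rewrite lee_fin mulr_ge0 ?sqr_ge0// exprn_ge0.
have IS : (\int[leb3 R]_x S x <= 32%:E)%E.
  rewrite /S integral_nneseries//; apply: le_trans (@epsilon_trick0 R 32 xpredT _) => //.
  apply: lee_nneseries => [k _ _|k _]; first by apply: integral_ge0 => x _.
  under eq_integral do rewrite EFinM.
  rewrite ge0_integralZl ?lee_fin ?exprn_ge0//; last 2 first.
  - exact: measurable_normc_sqr.
  - by move=> x _; rewrite lee_fin sqr_ge0.
  have [_ _ hk] := lD k.
  apply: (le_trans (lee_wpmul2l _ hk)); first by rewrite lee_fin exprn_ge0.
  rewrite -EFinM lee_fin natrX [_ ^+ k.+1]exprS exprMn.
  have E : (r k) ^+ 2 * 2 ^+ k * 2 ^+ k = r k.
    by rewrite -exprM mulnC exprM -!exprMn; congr (_ ^+ _); field.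
  have k2 : 0 < 2 ^+ k :> R by rewrite exprn_gt0.
  rewrite ler_pdivlMr ?mulr_gt0//.
  have -> : 2 ^+ k * (4 ^+ 2 * r k ^+ 2) * (2 * 2 ^+ k) = 32 * (r k ^+ 2 * 2 ^+ k * 2 ^+ k) by ring.
  rewrite E; have : r k <= 1 by rewrite exprn_ile1//; lra.
  by set c := r k; lra.
have Si : (leb3 R).-integrable setT S.
  apply/integrableP; split.
    by apply: ge0_emeasurable_sum => // k x _ _; exact: t0.
  under eq_integral do rewrite gee0_abs ?nneseries_ge0//.
  exact: le_lt_trans IS (ltry _).
have := integrable_ae measurableT Si; apply: ae_imp => x /(_ I) Sx.
exists (2 + fine (S x)) => n.
(* $d\le c^{-1}+cd^2$ with $c=2^k$, by completing the square. *)
have h (k : nat) : normc (D k x) <= 2^-1 ^+ k + 2 ^+ k * normc (D k x) ^+ 2.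
  have k2 : 0 < 2 ^+ k :> R by rewrite exprn_gt0.
  rewrite exprVn; set c := 2 ^+ k in k2 *; set d := normc _.
  have : 0 <= c^-1 * ((1 - c * d) ^+ 2 + c * d + 0) by rewrite mulr_ge0 ?invr_ge0 ?(ltW k2)// !addr_ge0 ?sqr_ge0// mulr_ge0 ?(ltW k2) ?normc_ge0.
  have -> : c^-1 * ((1 - c * d) ^+ 2 + c * d + 0) = c^-1 + c * d ^+ 2 - d by field; rewrite gt_eqF.
  lra.
apply: (@le_trans _ _ (\sum_(k < n) (2^-1 ^+ k + 2 ^+ k * normc (D k x) ^+ 2))).
  exact: ler_sum.
rewrite big_split/= lerD//.
  have -> : \sum_(i < n) (2^-1 : R) ^+ i = 2 - 2 * 2^-1 ^+ n.
    elim: n => [|m IH]; first by rewrite big_ord0 expr0 mulr1 subrr.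
    by rewrite big_ord_recr/= IH exprS; field.
  by rewrite gerBl mulr_ge0// exprn_ge0// invr_ge0.
rewrite -lee_fin fineK// -sumEFin /S.
rewrite -(big_mkord xpredT (fun k => (2 ^+ k * normc (D k x) ^+ 2)%:E)).
exact: nneseries_lim_ge.
Qed.

Lemma series_cvg (D : nat -> R) (C : R) : (forall n, \sum_(k < n) `|D k| <= C) ->
  cvgn (fun n => \sum_(k < n) D k).
Proof.
move=> hC.
have : cvgn (series D).
  apply: normed_cvg; rewrite /normed_series_of seriesEord; apply: nondecreasing_is_cvgn.
    by apply/nondecreasing_seqP => n; rewrite /= big_ord_recr/= lerDl.
  by exists C => _ [n _ <-]; exact: hC.
by rewrite seriesEord.
Qed.

Lemma l2_cauchy_limit (g_ : nat -> cfield R) : (forall k, cmeas3 (g_ k)) ->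
  (forall k, l2 (fun x => g_ k.+1 x - g_ k x) (4 * r k)) ->
  exists g, cmeas3 g /\ {ae leb3 R, forall x, (fun k => normc (g_ k x - g x)) @ \oo --> (0 : R)}.
Proof.
move=> mg lg.
have Cx := l2_series_ae lg.
have tele n x : g_ n x = g_ 0%N x + \sum_(k < n) (g_ k.+1 x - g_ k x).
  elim: n => [|n IH]; first by rewrite big_ord0 addr0.
  by rewrite big_ord_recr/= addrA -IH addrC subrK.
have cR : {ae leb3 R, forall x, cvgn (fun n => complex.Re (g_ n x)) /\ cvgn (fun n => complex.Im (g_ n x))}.
  apply: ae_imp Cx => x [C hC]; split.
    under eq_fun do rewrite tele cReD cRe_sum.
    apply: is_cvgD; first exact: is_cvg_cst.
    apply: (@series_cvg (fun k => complex.Re (g_ k.+1 x - g_ k x)) C) => n.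
    by apply: le_trans (hC n); apply: ler_sum => k _; exact: Re_le_normc.
  under eq_fun do rewrite tele cImD cIm_sum.
  apply: is_cvgD; first exact: is_cvg_cst.
  apply: (@series_cvg (fun k => complex.Im (g_ k.+1 x - g_ k x)) C) => n.
  by apply: le_trans (hC n); apply: ler_sum => k _; exact: Im_le_normc.
(* The upper limit is measurable in the parameter and defined everywhere; it is the limit wherever
   there is one. *)
pose lsup (v : nat -> R) : R := fine (limn_esup (fun n => (v n)%:E)).
have lsupE v : cvgn v -> v @ \oo --> lsup v.
  move=> cv; suff -> : lsup v = limn v by [].
  rewrite /lsup (_ : limn_esup _ = (limn v)%:E)//.
  have h : (fun n => (v n)%:E) @ \oo --> (limn v)%:E by apply: cvg_EFin => //; exact: nearW.
  by rewrite (cvg_limn_einf_sup h).2.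
exists (fun x => lsup (fun n => complex.Re (g_ n x)) +i* lsup (fun n => complex.Im (g_ n x))); split.
  split => /=; apply: measurableT_comp => //; apply: measurable_fun_limn_esup => n; apply/measurable_EFinP.
    exact: (mg n).1.
  exact: (mg n).2.
by apply: ae_imp cR => x [c1 c2]; apply: cvg_normc => /=; exact: lsupE.
Qed.

Lemma l2_Cint_dist f g h p q e M : l2 f p -> l2 g q -> l2 (fun x => f x - g x) e -> l2 h M ->
  normc (Cint (leb3 R) (fun x => f x * h x) - Cint (leb3 R) (fun x => g x * h x)) <= e * M.
Proof.
move=> lf lg ld lh; have <- := @CintB _ _ R (leb3 R) _ _ (l2_mul lf lh).1 (l2_mul lg lh).1.
rewrite (@eq_Cint3 R _ (fun x => (f x - g x) * h x)); last by move=> x; rewrite mulrBl.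
exact: l2_Cint_mul.
Qed.

(** [g] is the limit of the transforms of truncations of [F]. It is characterized by duality with
    $L^1\cap L^2$, which contains the test functions and so identifies it with the distributional
    transform. *)
Lemma plancherel F p : l2 F p -> exists g, l2 g p /\ forall h q, L1 h -> l2 h q ->
  Cint (leb3 R) (fun x => g x * h x) = Cint (leb3 R) (fun x => F x * ifourier h x).
Proof.
move=> lF; have /boolp.choice[n_ hn] : forall k, exists n, l2 (fun x => F x - trunc n F x) (r k).
  by move=> k; apply: trunc_cvg lF (r_gt0 k).
pose G k := trunc (n_ k) F.
have hG k : L1 (G k) by exact: trunc_L1 lF.
have lG k : l2 (G k) p by exact: trunc_l2.
(* The truncations differ by $2(4^{-j}+4^{-k})\le4\cdot4^{-j}$, with the constant of [l2B]. *)
have diff j k : (j <= k)%N -> l2 (fun x => ifourier (G k) x - ifourier (G j) x) (4 * r j).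
  move=> jk; have E x : ifourier (G k) x - ifourier (G j) x = ifourier (fun x => G k x - G j x) x.
    by rewrite ifourierB.
  under eq_fun do rewrite E.
  apply: ifourier_l2; first exact: cintegB.
  rewrite (_ : (fun x => _) = (fun x => (F x - G j x) - (F x - G k x))); last first.
    by apply/funext => x; rewrite opprB [RHS]addrC addrA subrK.
  apply: l2W (l2B (hn j) (hn k)); have := r_le jk; have := r_gt0 j; lra.
have [||g [mg gl]] := @l2_cauchy_limit (fun k => ifourier (G k)).
- by move=> k; exact: cmeas_ifourier.
- by move=> k; exact: diff.
have lg j : l2 (fun x => g x - ifourier (G j) x) (4 * r j).
  apply: (@l2_fatou R (fun k x => ifourier (G (k + j)%N) x - ifourier (G j) x)).
  - by move=> k; apply: diff; rewrite leq_addl.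
  - by apply: cmeasB => //; exact: cmeas_ifourier.
  - apply: ae_imp gl => x hx.
    have hxj : (fun k => normc (ifourier (G (k + j)%N) x - g x)) @ \oo --> (0 : R).
      have sh (v : nat -> R) : v @ \oo --> (0 : R) -> (fun k => v (k + j)%N) @ \oo --> (0 : R).
        by rewrite -(cvg_shiftn j).
      exact: (sh (fun k => normc (ifourier (G k) x - g x))).
    apply: cvg0_le hxj => k; apply/andP; split; first exact: normc_ge0.
    by rewrite opprB addrA subrK.
exists g; split.
  apply: (@l2_fatou R (fun k => ifourier (G k))) => // k.
  by apply: ifourier_l2.
move=> h q hh lh; have li := ifourier_l2 hh lh; have [_ q0 _] := lh.
have lgp : l2 g (2 * (4 * r 0%N + p)).
  have := l2D (lg 0%N) (ifourier_l2 (hG 0%N) (lG 0%N)).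
  by under eq_fun do rewrite subrK.
apply: (@normc_cvg_unique R (fun k => Cint (leb3 R) (fun x => ifourier (G k) x * h x))).
  apply: cvg0_le (cvg_r (4 * q)) => k; apply/andP; split; first exact: normc_ge0.
  rewrite -normcN opprB mulrAC.
  exact: (l2_Cint_dist lgp (ifourier_l2 (hG k) (lG k)) (lg k) lh).
apply: cvg0_le (cvg_r q) => k; apply/andP; split; first exact: normc_ge0.
rewrite (_ : Cint (leb3 R) (fun x => ifourier (G k) x * h x) = Cint (leb3 R) (fun x => G k x * ifourier h x)); last first.
  by rewrite ifourier_mult//; apply: eq_Cint3 => x; rewrite mulrC.
rewrite -normcN opprB mulrC; exact: (l2_Cint_dist lF (lG k) (hn k) li).
Qed.

(** The inverse transform on $L^2$, and later on $L^1+L^2$. It is defined through [density] so that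
    it coincides literally with the functions in the statement. *)
Definition ift F : cfield R := density (ifourierD (dist_of F)).

Variable psi : R3 R -> R.
Hypothesis hpsi : lp_cutoff psi.

Lemma represents_L1 F : L1 F -> represents (ifourier F) (ifourierD (dist_of F)).
Proof.
move=> hF; split; last first.
  move=> g tg; rewrite /ifourierD /dist_of !cintE ifourier_mult//; last exact: test_L1.
  by apply: eq_Cint3 => x; rewrite mulrC.
by have [M hM] := ifourier_bound hF; apply: bounded_locint hM; exact: cmeas_ifourier.
Qed.

Lemma ift_L1 F : L1 F -> {ae leb3 R, forall x, ift F x = ifourier F x}.
Proof. by move=> hF; apply: (density_ae hpsi); exact: represents_L1. Qed.

Lemma represents_l2 F p : l2 F p -> exists g, l2 g p /\ represents g (ifourierD (dist_of F)).
Proof.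
move=> lF; have [g [lg hg]] := plancherel lF; exists g; split => //.
split; first exact: l2_locint lg.
move=> h th; have [q lh] := test_l2 th; rewrite /ifourierD /dist_of !cintE.
by rewrite (hg h q)//; exact: test_L1.
Qed.

Lemma represents_ift F p : l2 F p -> represents (ift F) (ifourierD (dist_of F)).
Proof. by move=> /represents_l2[g [_ hg]]; exact: (density_represents hg). Qed.

Lemma ift_cmeas F p : l2 F p -> cmeas3 (ift F).
Proof. by move=> /represents_ift[[m1 m2 _] _]; split. Qed.

Lemma ift_l2 F p : l2 F p -> l2 (ift F) p.
Proof.
move=> lF; have [g [lg rg]] := represents_l2 lF.
by apply: l2_ae lg; [exact: ift_cmeas lF|exact: (density_ae hpsi rg)].
Qed.

Lemma ift_Cint F p h q : l2 F p -> L1 h -> l2 h q ->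
  Cint (leb3 R) (fun x => ift F x * h x) = Cint (leb3 R) (fun x => F x * ifourier h x).
Proof.
move=> lF hh lh; have [g [lg hg]] := plancherel lF; rewrite -(hg h q)//.
have rg : represents g (ifourierD (dist_of F)).
  split; first exact: l2_locint lg.
  by move=> k tk; have [q' lk] := test_l2 tk; rewrite /ifourierD /dist_of !cintE (hg k q')//; exact: test_L1.
apply: ae_Cint.
- by apply: cmeasM; [exact: ift_cmeas lF|case: hh].
- by apply: cmeasM; [case: lg|case: hh].
- by apply: ae_imp (density_ae hpsi rg) => x; rewrite -/(ift F) => ->.
Qed.

(* Double inversion on [L^2], obtained by pairing with test functions. *)
Lemma ift_ift F p : l2 F p -> {ae leb3 R, forall x, ift (ift F) x = F (- x)}.
Proof.
move=> lF; have lg := ift_l2 lF.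
apply: (represents_ae hpsi (represents_ift lg)).
split; first exact: l2_locint (l2_reflect lF).
move=> h th; have sh := test_schwartz th; have [q lh] := schwartz_l2 (schwartz_ifourier sh).
rewrite /ifourierD /dist_of !cintE (ift_Cint lF _ lh); last exact/schwartz_L1/schwartz_ifourier.
have [r lr] := schwartz_l2 (schwartz_reflect sh).
have E x : ifourier (ifourier h) x = h (- x).
  by rewrite -{2}(ifourierK sh) fourierE opprK.
under eq_fun do rewrite E.
have := @Cint_aff R (-1) 0 (fun x => F x * h (- x)).
rewrite normrN normr1 expr1n invr1 mul1r oppr_eq0 oner_neq0 => /(_ isT (l2_mul lF lr).1) <-.
by apply: eq_Cint3 => x; rewrite addr0 scaleN1r opprK.
Qed.

Lemma iftB F G p q : l2 F p -> l2 G q ->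
  {ae leb3 R, forall x, ift (fun xi => F xi - G xi) x = ift F x - ift G x}.
Proof.
move=> lF lG; have lD := l2B lF lG.
apply: (represents_ae hpsi (represents_ift lD)).
split; first by apply: l2_locint (l2B (ift_l2 lF) (ift_l2 lG)).
move=> h th; have [r lh] := test_l2 th; have hh := test_L1 th.
have lh' := ifourier_l2 hh lh.
have -> : cint (fun x => (ift F x - ift G x) * h x) =
    Cint (leb3 R) (fun x => ift F x * h x) - Cint (leb3 R) (fun x => ift G x * h x).
  rewrite cintE -(@CintB _ _ R (leb3 R) _ _ (l2_mul (ift_l2 lF) lh).1 (l2_mul (ift_l2 lG) lh).1).
  by apply: eq_Cint3 => x; rewrite mulrBl.
rewrite (ift_Cint lF hh lh) (ift_Cint lG hh lh).
rewrite -(@CintB _ _ R (leb3 R) _ _ (l2_mul lF lh').1 (l2_mul lG lh').1).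
by rewrite /ifourierD /dist_of cintE; apply: eq_Cint3 => x; rewrite mulrBl.
Qed.

(** The pairing has no conjugation, hence the reflection of [G]. The factor [ift G] is truncated in
    physical space so that [ift_Cint] applies, and the truncation is then removed. *)
Lemma parseval F G p q : l2 F p -> l2 G q ->
  Cint (leb3 R) (fun x => ift F x * ift G x) = Cint (leb3 R) (fun xi => F xi * G (- xi)).
Proof.
move=> lF lG; have lg := ift_l2 lG; have lf := ift_l2 lF; have [_ p0 _] := lF.
have /boolp.choice[n_ hn] : forall k, exists n, l2 (fun x => ift G x - trunc n (ift G) x) (r k).
  by move=> k; apply: trunc_cvg lg (r_gt0 k).
pose g k := trunc (n_ k) (ift G).
have hg k : L1 (g k) by exact: trunc_L1 lg.
have lgk k : l2 (g k) q by exact: trunc_l2.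
have lGr := l2_reflect lG.
apply: (@normc_cvg_unique R (fun k => Cint (leb3 R) (fun x => g k x * ift F x))).
  apply: cvg0_le (cvg_r p) => k; apply/andP; split; first exact: normc_ge0.
  rewrite -normcN opprB mulrC.
  have -> : Cint (leb3 R) (fun x => ift F x * ift G x) = Cint (leb3 R) (fun x => ift G x * ift F x).
    by apply: eq_Cint3 => x; rewrite mulrC.
  exact: (l2_Cint_dist lg (lgk k) (hn k) lf).
apply: cvg0_le (cvg_r p) => k; apply/andP; split; first exact: normc_ge0.
have -> : Cint (leb3 R) (fun x => g k x * ift F x) = Cint (leb3 R) (fun x => ifourier (g k) x * F x).
  transitivity (Cint (leb3 R) (fun x => ift F x * g k x)); first by apply: eq_Cint3 => x; rewrite mulrC.
  by rewrite (ift_Cint lF (hg k) (lgk k)); apply: eq_Cint3 => x; rewrite mulrC.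
have -> : Cint (leb3 R) (fun x => F x * G (- x)) = Cint (leb3 R) (fun x => G (- x) * F x).
  by apply: eq_Cint3 => x; rewrite mulrC.
rewrite -normcN opprB mulrC.
have li := ifourier_l2 (hg k) (lgk k).
apply: (l2_Cint_dist lGr li _ lF).
have mD : cmeas3 (fun x => G (- x) - ifourier (g k) x).
  by apply: cmeasB; [case: lGr|case: li].
apply: l2_ae (ift_l2 (hn k)) => //.
have ab := ae_imp2 _ (ift_ift lG) (ift_L1 (hg k)).
apply: (ae_imp2 _ (iftB lg (lgk k)) (ab (fun x => G (- x) - ifourier (g k) x = ift (ift G) x - ift (g k) x) _)).
  by move=> x -> ->.
by move=> x -> ->.
Qed.

End plancherel.

(** * Distributions given by symbols *)

Section symbols.
Context {R : realType}.
Implicit Types (f g h F G H : cfield R) (x xi : R3 R) (T : functional R) (m : R3 R -> R).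
Local Notation L1 := (cinteg (leb3 R)).
Local Notation cmeas3 := (cmeas (T := M3 R)).

(** [T] is the inverse transform of the function [H]. All Schwartz functions are tested because a
    Fourier multiplier turns test functions into functions that are merely Schwartz. *)
Definition sym T H := forall f, schwartz f ->
  L1 (fun xi => H xi * ifourier f xi) /\ T f = Cint (leb3 R) (fun xi => H xi * ifourier f xi).

Lemma sym_mul m T H : test_fun (fun x => (m x)%:C) -> sym T H ->
  sym (ifourierD (mulD m (fourierD T))) (fun xi => (m xi)%:C * H xi).
Proof.
move=> tm sT f sf; have smf := schwartz_smooth (schwartz_ifourier sf).
have sg := test_schwartz (testM tm smf).
have [h1 h2] := sT _ (schwartz_fourier sg); rewrite (fourierK sg) in h1 h2.
have E xi : H xi * ((m xi)%:C * ifourier f xi) = (m xi)%:C * H xi * ifourier f xi by rewrite mulrCA mulrA.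
split; first by under eq_fun do rewrite -E.
by rewrite /ifourierD /mulD /fourierD h2; exact: eq_Cint3.
Qed.

Lemma sym_deriv j T H : sym T H -> sym (Defs.derivD j T) (iximul j H).
Proof.
move=> sT f sf; have [h1 h2] := sT _ (schwartz_pd j sf).
have E xi : iximul j H xi * ifourier f xi = - (H xi * ifourier (pd j f) xi).
  by rewrite ifourier_pd// /iximul; ring.
split; first by under eq_fun do rewrite E; exact: cintegN.
by rewrite /Defs.derivD h2 -(Cint3N h1); apply: eq_Cint3 => xi; rewrite E.
Qed.

Lemma sym_sub T T' H G : sym T H -> sym T' G -> sym (fun f => T f - T' f) (fun xi => H xi - G xi).
Proof.
move=> sT sT' f sf; have [h1 h2] := sT f sf; have [g1 g2] := sT' f sf.
have E xi : (H xi - G xi) * ifourier f xi = H xi * ifourier f xi - G xi * ifourier f xi by rewrite mulrBl.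
split; first by under eq_fun do rewrite E; exact: cintegB.
by rewrite h2 g2 -Cint3B//; apply: eq_Cint3 => xi; rewrite E.
Qed.

Lemma sym_sum n (T_ : 'I_n -> functional R) (H_ : 'I_n -> cfield R) : (forall i, sym (T_ i) (H_ i)) ->
  sym (fun f => \sum_(i < n) T_ i f) (fun xi => \sum_(i < n) H_ i xi).
Proof.
move=> sT f sf.
have E xi : (\sum_(i < n) H_ i xi) * ifourier f xi = \sum_(i < n) H_ i xi * ifourier f xi by rewrite mulr_suml.
split; first by under eq_fun do rewrite E; apply: cinteg_sum => i; case: (sT i f sf).
rewrite (eq_Cint3 E) (@Cint_sum _ _ R (leb3 R) _ _ (fun i xi => H_ i xi * ifourier f xi)).
  by apply: eq_bigr => i _; case: (sT i f sf).
by move=> i; case: (sT i f sf).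
Qed.

Lemma sym_sumZ a b (T_ : int -> functional R) (H_ : int -> cfield R) : (forall l, sym (T_ l) (H_ l)) ->
  sym (fun f => sumZ a b (fun l => T_ l f)) (fun xi => sumZ a b (fun l => H_ l xi)).
Proof.
move=> sT; rewrite /sumZ; case: (b - a + 1) => n; first by apply: sym_sum.
move=> f sf; under eq_fun do rewrite mul0r; split; first exact: cinteg0.
by rewrite Cint0.
Qed.

Lemma sym_density T H : sym T H -> density T = ift H.
Proof.
move=> sT; apply: density_eq => g tg; have [_ ->] := sT g (test_schwartz tg).
by rewrite /ifourierD /dist_of cintE.
Qed.

End symbols.

(** * The transform on L^1 + L^2 and disjoint spectra *)

Section sum_space.
Context {R : realType}.
Variable psi : R3 R -> R.
Hypothesis hpsi : lp_cutoff psi.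
Implicit Types (f g h F G H : cfield R) (x xi : R3 R) (p q M : R).
Local Notation L1 := (cinteg (leb3 R)).
Local Notation cmeas3 := (cmeas (T := M3 R)).

Lemma locintD f g : locally_integrable3 f -> locally_integrable3 g ->
  locally_integrable3 (fun x => f x + g x).
Proof.
move=> lf [g1 g2 gr].
have lg : locally_integrable3 (fun x => - g x).
  have mg : cmeas3 g by split.
  have [m1 m2] := cmeasN mg; split => // r.
  by under eq_integral do rewrite normcN.
have := locintB lf lg; by under eq_fun do rewrite opprK.
Qed.

(** The class to which $\hat u$ belongs: integrable at low frequencies and square integrable at high
    ones. *)
Definition L1_l2 F := exists F1 F2 : cfield R,
  [/\ L1 F1, exists p, l2 F2 p & F = (fun xi => F1 xi + F2 xi)].

Lemma L1_l2_of_L1 F : L1 F -> L1_l2 F.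
Proof.
move=> hF; exists F, (fun=> 0); split => //.
  exists 0; split => //.
  by under eq_integral do rewrite normc0 expr0n; rewrite integral0 expr0n.
by apply/funext => xi; rewrite addr0.
Qed.

Lemma L1_l2B F G : L1_l2 F -> L1_l2 G -> L1_l2 (fun xi => F xi - G xi).
Proof.
move=> [F1 [F2 [h1 [p h2] ->]]] [G1 [G2 [g1 [q g2] ->]]].
exists (fun xi => F1 xi - G1 xi), (fun xi => F2 xi - G2 xi); split.
- exact: cintegB.
- by exists (2 * (p + q)); exact: l2B.
- by apply/funext => xi; rewrite opprD addrACA.
Qed.

Lemma L1_l2_Cint F h p : L1_l2 F -> cmeas3 h -> (exists M, forall x, normc (h x) <= M) -> l2 h p ->
  L1 (fun xi => F xi * h xi).
Proof.
move=> [F1 [F2 [h1 [q h2] ->]]] mh [M hM] lh.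
under eq_fun do rewrite mulrDl; apply: cintegD; last by case: (l2_mul h2 lh).
by under eq_fun do rewrite mulrC; exact: (cintegMb (M := M)).
Qed.

Lemma ift_sum F1 F2 p : L1 F1 -> l2 F2 p ->
  represents (fun x => ifourier F1 x + ift F2 x) (ifourierD (dist_of (fun xi => F1 xi + F2 xi))).
Proof.
move=> h1 h2; split.
  apply: locintD; first by case: (represents_L1 h1).
  exact: l2_locint (ift_l2 hpsi h2).
move=> g tg; have [q lg] := test_l2 tg; have gg := test_L1 tg.
have lg' := ifourier_l2 gg lg; have [M hM] := ifourier_bound gg.
have mi := cmeas_ifourier gg.
have i1 : L1 (fun xi => F1 xi * ifourier g xi).
  by under eq_fun do rewrite mulrC; exact: (cintegMb (M := M)).
have i2 := (l2_mul h2 lg').1.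
have [M1 hM1] := ifourier_bound h1.
have i3 : L1 (fun x => ifourier F1 x * g x).
  by apply: (cintegMb (M := M1)) => //; exact: cmeas_ifourier.
have i4 := (l2_mul (ift_l2 hpsi h2) lg).1.
rewrite /ifourierD /dist_of !cintE.
rewrite (@eq_Cint3 R _ (fun xi => F1 xi * ifourier g xi + F2 xi * ifourier g xi)); last by move=> xi; rewrite mulrDl.
rewrite (CintD i1 i2).
rewrite (@eq_Cint3 R (fun x => (ifourier F1 x + ift F2 x) * g x) (fun x => ifourier F1 x * g x + ift F2 x * g x)); last by move=> xi; rewrite mulrDl.
rewrite (CintD i3 i4) (ift_Cint hpsi h2 gg lg) ifourier_mult//; congr (_ + _).
rewrite [RHS](@eq_Cint3 R _ (fun x => g x * ifourier F1 x)); last by move=> x; rewrite mulrC.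
by rewrite -ifourier_mult//; apply: eq_Cint3.
Qed.

Lemma L1_l2_represents F : L1_l2 F -> represents (ift F) (ifourierD (dist_of F)).
Proof.
by move=> [F1 [F2 [h1 [p h2] ->]]]; exact: (density_represents (ift_sum h1 h2)).
Qed.

Lemma L1_l2_cmeas F : L1_l2 F -> cmeas3 (ift F).
Proof. by move=> /L1_l2_represents[[m1 m2 _] _]; split. Qed.

Lemma L1_l2_pair F g : L1_l2 F -> test_fun g ->
  L1 (fun x => ift F x * g x) /\ L1 (fun xi => F xi * ifourier g xi) /\
  Cint (leb3 R) (fun x => ift F x * g x) = Cint (leb3 R) (fun xi => F xi * ifourier g xi).
Proof.
move=> sF tg; have [lF rF] := L1_l2_represents sF; have gg := test_L1 tg.
have [q lg] := test_l2 tg; split; first exact: locint_test.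
split; last by have := rF g tg; rewrite /ifourierD /dist_of !cintE => <-.
by apply: (L1_l2_Cint sF (cmeas_ifourier gg) (ifourier_bound gg)); exact: ifourier_l2 lg.
Qed.

Lemma ift_B F G : L1_l2 F -> L1_l2 G ->
  {ae leb3 R, forall x, ift (fun xi => F xi - G xi) x = ift F x - ift G x}.
Proof.
move=> sF sG; apply: (represents_ae hpsi (L1_l2_represents (L1_l2B sF sG))).
have [lF _] := L1_l2_represents sF; have [lG _] := L1_l2_represents sG.
split; first exact: locintB.
move=> g tg; have [f1 [f2 f3]] := L1_l2_pair sF tg; have [g1 [g2 g3]] := L1_l2_pair sG tg.
rewrite /ifourierD /dist_of !cintE.
rewrite (@eq_Cint3 R _ (fun xi => F xi * ifourier g xi - G xi * ifourier g xi)); last by move=> xi; rewrite mulrBl.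
rewrite (CintB f2 g2) -f3 -g3 -(CintB f1 g1).
by apply: eq_Cint3 => x; rewrite mulrBl.
Qed.

Lemma Cint3_eq0 F : (forall x, F x = 0) -> Cint (leb3 R) F = 0.
Proof. by move=> F0; rewrite -[RHS](Cint0 (leb3 R)); exact: eq_Cint3. Qed.

(** The transform of [A] is written as a superposition of characters $e^{ix\cdot y}$ with $|y|\le
    a$. For each of them the product with the transform of [B] has spectrum in the ball of radius
    $a+b$, where [K] vanishes, and Parseval's identity gives 0. *)
Lemma spectral_vanishing A B K p q (a b : R) : L1 A -> L1 B -> l2 B p -> l2 K q ->
  (forall xi, a < enorm xi -> A xi = 0) -> (forall xi, b < enorm xi -> B xi = 0) ->
  (forall xi, enorm xi <= a + b -> K xi = 0) ->
  Cint (leb3 R) (fun x => ifourier A x * ifourier B x * ift K x) = 0.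
Proof.
move=> hA hB lB lK A0 B0 K0.
have lBi := ifourier_l2 hB lB; have lKi := ift_l2 hpsi lK.
have [hg _] := l2_mul lBi lKi.
pose g x := ifourier B x * ift K x.
have H : cinteg (leb3s R \x leb3s R)%E (fun z : M3 R * M3 R => expi (dot3 z.1 z.2) * (g z.1 * A z.2)).
  apply: (cinteg_prod (m1 := leb3s R) (m2 := leb3s R) (M := 1) hg hA) => [|z].
    exact: (cmeas_expi measurable_dot3_pair).
  by rewrite normc_expi.
pose k (x y : R3 R) := expi (dot3 x y) * (g x * A y).
have E : Cint (leb3 R) (fun x => Cint (leb3 R) (k x)) =
    Cint (leb3 R) (fun y => Cint (leb3 R) (k^~ y)) := Cint_Fubini H.
have hL : L1 (fun x => Cint (leb3 R) (k x)) := cinteg_Fubini1 H.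
transitivity (fcst%:C * Cint (leb3 R) (fun x => Cint (leb3 R) (k x))).
  rewrite -(Cint3Z _ hL); apply: eq_Cint3 => x.
  rewrite -mulrA -/(g x) ifourierE -mulrA; congr (_ * _).
  rewrite mulrC -Cint3Z; last exact: cinteg_char.
  by apply: eq_Cint3 => y; rewrite /k mulrCA.
suff Z y : Cint (leb3 R) (k^~ y) = 0 by rewrite E (@Cint3_eq0 (fun y => Cint (leb3 R) (k^~ y)) Z) mulr0.
have [ya|ya] := leP (enorm y) a; last first.
  by apply: (@Cint3_eq0 (k^~ y)) => x; rewrite /k (A0 _ ya) !mulr0.
have hs : L1 (fun xi => B (xi - y)).
  have := @cinteg_aff R 1 (- y) B (oner_neq0 _) hB; by under eq_fun do rewrite scale1r.
have ls : l2 (fun xi => B (xi - y)) p.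
  have [mB p0 Bp] := lB; split; [by case: hs|exact: p0|].
  have [_ /(_ (fun x => (normc (B x) ^+ 2)%:E))] := scaling_leb3 (- y) (oner_neq0 R).
  under eq_integral do rewrite scale1r.
  rewrite normr1 expr1n invr1 mul1e => ->; first exact: Bp.
    exact: measurable_normc_sqr mB.
  by move=> x; rewrite lee_fin sqr_ge0.
(* Multiplication by the character translates the spectrum by [y]. *)
have Es x : ifourier (fun xi => B (xi - y)) x = expi (dot3 x y) * ifourier B x.
  rewrite !ifourierE mulrCA; congr (_ * _); rewrite -Cint3Z; last exact: cinteg_char.
  have hc : L1 (fun xi => expi (dot3 x y) * (expi (dot3 x xi) * B xi)) by apply: cintegZ; exact: cinteg_char.
  have := @Cint_aff R 1 (- y) _ (oner_neq0 _) hc.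
  rewrite normr1 expr1n invr1 mul1r => <-; apply: eq_Cint3 => xi.
  by rewrite scale1r mulrA -expiD -dot3Dr [y + _]addrC subrK.
rewrite (@eq_Cint3 R _ (fun x => A y * (ift K x * ifourier (fun xi => B (xi - y)) x))); last first.
  by move=> x; rewrite /k Es /g; ring.
rewrite Cint3Z; last by case: (l2_mul lKi (ifourier_l2 hs ls)).
suff -> : Cint (leb3 R) (fun x => ift K x * ifourier (fun xi => B (xi - y)) x) = 0 by rewrite mulr0.
rewrite (@ae_Cint _ _ R (leb3 R) _ (fun x => ift K x * ift (fun xi => B (xi - y)) x)); last first.
- by apply: ae_imp (ift_L1 hpsi hs) => x ->.
- by apply: cmeasM; [case: lKi|exact: (ift_cmeas ls)].
- by apply: cmeasM; [case: lKi|exact: cmeas_ifourier].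
rewrite (parseval hpsi lK ls); apply: Cint3_eq0 => xi.
have [h|h] := leP (enorm xi) (a + b); first by rewrite (K0 _ h) mul0r.
have hb : b < enorm (- xi - y).
  by rewrite -opprD enormN; move: (enormD (xi + y) (- y)) h ya; rewrite addrK enormN; clear; lra.
by rewrite (B0 _ hb) mulr0.
Qed.

End sum_space.

(** * The trilinear form *)

Section homogeneous_weights.
Context {R : realType}.
Variable s : R.
Hypotheses (s0 : 0 < s) (s1 : s < 1).
Implicit Types (f g h F G H m : cfield R) (x xi : R3 R) (p q M N r : R).
Local Notation L1 := (cinteg (leb3 R)).
Local Notation cmeas3 := (cmeas (T := M3 R)).

Lemma indic_iff (A B : set (R3 R)) x y : (A x <-> B y) -> \1_A x = \1_B y :> R.
Proof.
move=> AB; rewrite !indicE; congr ((nat_of_bool _)%:R).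
by apply/idP/idP; rewrite !inE => /AB.
Qed.

Lemma leb3_set1 : leb3 R [set 0] = 0%E.
Proof.
have -> : [set 0] = ([set 0] `*` [set 0]) `*` [set 0] :> set (M3 R).
  by apply/seteqP; split => [_ ->|[[a b] c] [[/= -> ->] ->]].
have E1 := @product_measure1E _ _ _ _ R (@lebesgue_measure R) (@lebesgue_measure R) [set 0] [set 0] (measurable_set1 _) (measurable_set1 _).
have mm : measurable ([set 0] `*` [set 0] : set (measurableTypeR R * measurableTypeR R)).
  by apply: measurableX; exact: measurable_set1.
have := @product_measure1E _ _ _ _ R (sfprod (@lebesgue_measure R) (@lebesgue_measure R)) (@lebesgue_measure R) _ [set 0] mm (measurable_set1 _).
move=> E; etransitivity; first exact: E.
transitivity (0 * 0 : \bar R)%E; last exact: mule0.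
congr (_ * _)%E; last exact: lebesgue_measure_set1.
etransitivity; first exact: E1.
transitivity (0 * 0 : \bar R)%E; last exact: mule0.
by congr (_ * _)%E; exact: lebesgue_measure_set1.
Qed.

(** The identity $|\xi|^{-s}|\xi|^s=1$ fails at the origin, where both powers are 0 by
    convention. *)
Lemma ae_neq0 : {ae leb3 R, forall xi, xi <> 0}.
Proof.
exists [set 0]; split => [||x /= h].
- have -> : [set 0] = [set x : M3 R | enorm (x : R3 R) <= 0].
    apply/seteqP; split => [_ ->|x /=]; first by rewrite /= -(scale0r (0 : R3 R)) enormZ normr0 mul0r.
    move=> x0; have c j : coord3 j x = 0.
      by apply/normr0_eq0/le_anti; rewrite normr_ge0 andbT (le_trans (coord3_le j x)).
    have [e0 e1 e2] := coordE x; move: e0 e1 e2; rewrite !c.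
    by case: x {x0 c} => [[a b] d] /= -> -> ->.
  exact: measurable_enorm_le.
- exact: leb3_set1.
- by apply: contrapT.
Qed.

Definition pw a xi : R := enorm xi `^ a.

Lemma measurable_pw a : measurable_fun [set: M3 R] (pw a : M3 R -> R).
Proof. exact: (measurableT_comp (@measurable_powR R a) (@measurable_enorm R)). Qed.

Lemma pw_ge0 a xi : 0 <= pw a xi. Proof. exact: powR_ge0. Qed.

Lemma enorm_gt0 xi : xi <> 0 -> 0 < enorm xi.
Proof.
move=> x0; rewrite lt_neqAle enorm_ge0 andbT eq_sym; apply/eqP => e; apply: x0.
have c j : coord3 j xi = 0.
  by apply/normr0_eq0/le_anti; rewrite normr_ge0 andbT (le_trans (coord3_le j xi)) ?e.
have [e0 e1 e2] := coordE xi; move: e0 e1 e2; rewrite !c.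
by case: xi {e c} => [[a b] d] /= -> -> ->.
Qed.

Lemma pwN_mul xi : xi <> 0 -> pw (- s) xi * pw s xi = 1.
Proof.
move=> /enorm_gt0 x0; rewrite /pw powRN mulVf//.
by rewrite gt_eqF// powR_gt0.
Qed.

Lemma l2_dilate f p r : l2 f p -> 0 < r -> l2 (fun x => f (r^-1 *: x)) (r `^ (3 / 2) * p).
Proof.
move=> [mf p0 fp] r0; have r1 : r^-1 != 0 by rewrite invr_neq0// gt_eqF.
split; last 2 first.
- by rewrite mulr_ge0 ?powR_ge0.
- have [_ /(_ _ (measurable_normc_sqr mf))] := scaling_leb3 0 r1.
  under eq_integral do rewrite addr0.
  move=> ->; last by move=> x; rewrite lee_fin sqr_ge0.
  rewrite exprMn [leRHS]EFinM -[(r `^ _) ^+ 2]powR_mulrn ?powR_ge0// -powRrM (_ : 3 / 2 * 2%:R = 3%:R); last by lra.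
  rewrite powR_mulrn ?(ltW r0)// ger0_norm ?invr_ge0 ?(ltW r0)// exprVn invrK.
  by apply: lee_wpmul2l fp; rewrite lee_fin exprn_ge0// ltW.
by under eq_fun do rewrite -[_ *: _]addr0; exact: cmeas_aff.
Qed.

(** $|\xi|^{-s}$ is square integrable on balls, with the homogeneity $r^{3/2-s}$. Polar coordinates
    are replaced by self-similarity: the integral over the shell $2^{-n-1}<|\xi|\le1$ is bounded
    through the one over $2^{-n}<|\xi|\le1$ by doubling $\xi$. Fatou's lemma and a dilation
    conclude. *)
Lemma singular_weight : exists2 C : R, 0 <= C & forall r, 0 < r ->
  l2 (fun xi => (\1_[set xi | enorm xi <= r] xi * pw (- s) xi)%:C) (C * r `^ (3 / 2 - s)).
Proof.
pose B n xi : R := \1_[set xi | 2^-1 ^+ n < enorm xi /\ enorm xi <= 1] xi.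
have mB n : measurable ([set xi | 2^-1 ^+ n < enorm xi /\ enorm xi <= 1] : set (M3 R)).
  rewrite (_ : [set xi | _] = [set xi | enorm xi <= 1] `\` [set xi | enorm xi <= 2^-1 ^+ n]).
    by apply: measurableD; exact: measurable_enorm_le.
  apply/seteqP; split => x /= [h1 h2]; first by split => //; apply/negP; rewrite -ltNge.
  by split => //; rewrite ltNge; apply/negP.
pose h n xi : R := (B n xi * pw (- s) xi) ^+ 2.
have h0 n xi : 0 <= h n xi by exact: sqr_ge0.
have mh n : measurable_fun [set: M3 R] (fun x : M3 R => (h n x)%:E).
  apply/measurable_EFinP; apply: measurable_funX; apply: measurable_funM; last exact: measurable_pw.
  by apply: measurable_indic; exact: mB.
(* $2^{2s}$ from the weight and $2^{-3}$ from the change of variables; [q] is below 1 since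
   $s<1$. *)
pose q : R := 2 `^ (2 * s) / 8.
have q1 : q < 1.
  rewrite /q ltr_pdivrMr// mul1r; apply: (@le_lt_trans _ _ (2 `^ 2%:R)); last by rewrite powR_mulrn//; lra.
  apply: ler_powR; first by rewrite ler1n.
  by rewrite -[leRHS]mulr1 ler_wpM2l// ltW.
have q0 : 0 <= q by rewrite divr_ge0 ?powR_ge0.
pose c1 : R := 2 `^ (2 * s) * (64 * wint).
have w0 : 0 <= wint :> R.
  by rewrite -lee_fin -wint_fin; apply: integral_ge0 => x _; rewrite lee_fin ltW// wgt_gt0.
have c10 : 0 <= c1 by rewrite mulr_ge0 ?powR_ge0// mulr_ge0.
(* The fixed point of $c\mapsto c_1+qc$, which bounds all the integrals by induction. *)
pose c := c1 / (1 - q).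
have c0 : 0 <= c by rewrite divr_ge0// subr_ge0 ltW.
have rec n xi : h n.+1 xi <= 2 `^ (2 * s) * (64 * wgt xi) + 2 `^ (2 * s) * h n ((2 : R) *: xi).
  have t0 : 0 <= 2 `^ (2 * s) * (64 * wgt xi) by rewrite mulr_ge0 ?powR_ge0// mulr_ge0// ltW// wgt_gt0.
  have u0 : 0 <= 2 `^ (2 * s) * h n ((2 : R) *: xi) by rewrite mulr_ge0 ?powR_ge0.
  have p2 (a : R) : (2 `^ a) ^+ 2 = 2 `^ (2 * a) :> R by rewrite -powR_mulrn ?powR_ge0// -powRrM mulrC.
  rewrite {1}/h /B indicE; case: (boolP (xi \in _)) => [|_]; last by rewrite mul0r expr0n addr_ge0.
  rewrite inE /= => -[x1 x2]; rewrite mul1r.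
  have x0 : 0 < enorm xi by apply: lt_trans x1; rewrite exprn_gt0.
  (* In the inner half ball doubling $\xi$ costs exactly $2^{2s}$; on the shell $\frac12<|\xi|\le1$
     the squared weight is at most $2^{2s}$ and [64 * wgt xi] is at least 1. *)
  have [x3|x3] := leP (enorm xi) 2^-1.
    rewrite -[leLHS]add0r lerD//.
    rewrite /h /B indicE mem_set/=; last first.
      rewrite enormZ ger0_norm//; split; last by rewrite mulrC -ler_pdivlMr// mul1r.
      by move: x1; rewrite exprS; set z := 2^-1 ^+ n; lra.
    rewrite mul1r /pw enormZ (ger0_norm (ler0n R 2)) (powRM _ (ler0n R 2) (enorm_ge0 xi)) exprMn mulrA p2 -powRD.
      by rewrite (_ : 2 * s + 2 * - s = 0) ?powRr0 ?mul1r//; lra.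
    by apply/implyP => _; rewrite pnatr_eq0.
  rewrite -[leLHS]addr0 lerD// (@le_trans _ _ (2 `^ (2 * s) * 1))//.
    rewrite mulr1 -p2 ler_sqr ?nnegrE ?powR_ge0// /pw powRN -[leRHS]invrK lef_pV2 ?posrE ?powR_gt0 ?invr_gt0 ?powR_gt0//.
    rewrite -powRN (_ : 2 `^ (- s) = 2^-1 `^ s); last by rewrite -powR_inv1// -powRrM mulN1r.
    by apply: ge0_ler_powR; rewrite ?nnegrE ?(ltW x3) ?(ltW s0) ?enorm_ge0 ?invr_ge0.
  rewrite ler_wpM2l ?powR_ge0//; have := one_le_wgt x2.
  by rewrite (_ : (1 + 1) ^+ 6 = 64 :> R)//; ring.
have In n : (\int[leb3 R]_xi (h n xi)%:E <= c%:E)%E.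
  elim: n => [|n IH].
    under eq_integral => xi _.
      rewrite /h /B indicE memNset/=; last by case=> h1 h2; move: (lt_le_trans h1 h2); rewrite expr0 ltxx.
      rewrite mul0r expr0n/=; over.
    by rewrite integral0 lee_fin.
  apply: (@le_trans _ _ (\int[leb3 R]_xi ((2 `^ (2 * s) * 64)%:E * (wgt xi)%:E + (2 `^ (2 * s))%:E * (h n ((2 : R) *: xi + 0))%:E))%E).
    apply: ge0_le_integral => //.
    - by move=> xi _; rewrite lee_fin.
    - apply: emeasurable_funD; apply: measurable_funeM.
        by apply/measurable_EFinP; exact: measurable_wgt.
      have m2 : (2 : R) != 0 by rewrite pnatr_eq0.
      exact: (measurableT_comp (mh n) (measurable_aff 0 m2)).
    - by move=> xi _; rewrite addr0 -!EFinM -EFinD lee_fin -mulrA.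
  have m2 : (2 : R) != 0 by rewrite pnatr_eq0.
  have mhn : measurable_fun [set: M3 R] (fun x : M3 R => (h n ((2 : R) *: (x : R3 R) + 0))%:E).
    exact: (measurableT_comp (mh n) (measurable_aff 0 m2)).
  have mw : measurable_fun [set: M3 R] (fun x : M3 R => (wgt (x : R3 R))%:E).
    by apply/measurable_EFinP; exact: measurable_wgt.
  rewrite ge0_integralD//; last 4 first.
  - by move=> x _; rewrite -EFinM lee_fin mulr_ge0 ?mulr_ge0 ?powR_ge0 ?(ltW (wgt_gt0 _)).
  - exact: measurable_funeM.
  - by move=> x _; rewrite -EFinM lee_fin mulr_ge0 ?powR_ge0.
  - exact: measurable_funeM.
  rewrite !ge0_integralZl ?lee_fin ?mulr_ge0 ?powR_ge0//; last 2 first.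
  - by move=> x _; rewrite lee_fin.
  - by move=> x _; rewrite lee_fin ltW// wgt_gt0.
  have [_ Hs] := scaling_leb3 0 m2; rewrite (Hs (fun x => (h n x)%:E) (mh n)); last first.
    by move=> x; rewrite lee_fin.
  rewrite wint_fin ger0_norm// muleA -!EFinM.
  apply: (@le_trans _ _ ((2 `^ (2 * s) * 64 * wint)%:E + (2 `^ (2 * s) * (2 ^- 3))%:E * c%:E)%E).
    by apply: leeD => //; apply: lee_wpmul2l => //; rewrite lee_fin mulr_ge0 ?powR_ge0 ?invr_ge0.
  rewrite -EFinM -EFinD lee_fin -mulrA -/c1.
  have -> : 2 `^ (2 * s) * (2 ^- 3) = q by rewrite /q; congr (_ * _); congr (_^-1); ring.
  by rewrite le_eqVlt; apply/orP; left; apply/eqP; rewrite /c; field; lra.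
pose C : R := Num.sqrt c; have C2 : C ^+ 2 = c by rewrite sqr_sqrtr.
have hr r : cmeas3 (fun xi => (\1_[set xi | enorm xi <= r] xi * pw (- s) xi)%:C).
  apply: cmeas_real; apply: measurable_funM; last exact: measurable_pw.
  by apply: measurable_indic; exact: measurable_enorm_le.
have l1 : l2 (fun xi => (\1_[set xi | enorm xi <= 1] xi * pw (- s) xi)%:C) C.
  apply: (@l2_fatou R (fun n xi => (B n xi * pw (- s) xi)%:C)) => //.
    move=> n; split; [|exact: sqrtr_ge0|].
      apply: cmeas_real; apply: measurable_funM; last exact: measurable_pw.
      by apply: measurable_indic; exact: mB.
    by under eq_integral do rewrite normcC real_normK ?num_real//; rewrite C2; exact: In.
  apply: aeW => xi.
  have [-> |x0] := pselect (xi = 0).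
    have -> : pw (- s) 0 = 0.
      by rewrite /pw -(scale0r (0 : R3 R)) enormZ normr0 mul0r powR0// oppr_eq0 gt_eqF.
    by under eq_fun do rewrite !mulr0 subrr normc0; exact: cvg_cst.
  apply: cvg_near_cst; have e0 := enorm_gt0 x0.
  have h2 : (fun n => 2^-1 ^+ n) @ \oo --> (0 : R) by apply: cvg_expr; rewrite ger0_norm; lra.
  have : \forall n \near \oo, 2^-1 ^+ n < enorm xi by apply: cvgr_lt h2 _ _.
  apply: filterS => n hn.
  rewrite (_ : B n xi = \1_[set xi | enorm xi <= 1] xi) ?subrr ?normc0//.
  by apply: indic_iff; split => [[]|].
exists C; first exact: sqrtr_ge0.
move=> r r0; have := l2Z (r `^ (- s))%:C (l2_dilate l1 r0).
rewrite normcC ger0_norm ?powR_ge0// mulrA -powRD; last by apply/implyP => _; rewrite gt_eqF.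
rewrite mulrC (_ : - s + 3 / 2 = 3 / 2 - s); last by rewrite addrC.
congr (l2 _ _); apply/funext => xi; rewrite -rmorphM; congr (_%:C); rewrite mulrCA; congr (_ * _).
  by apply: indic_iff => /=; rewrite enormZ ger0_norm ?invr_ge0 ?(ltW r0)// mulrC ler_pdivrMr// mul1r.
rewrite /pw enormZ ger0_norm ?invr_ge0 ?(ltW r0)// -powRM ?mulr_ge0 ?invr_ge0 ?enorm_ge0 ?(ltW r0)//.
by rewrite mulrA mulfV ?mul1r// gt_eqF.
Qed.

(** A bound [N] on the homogeneous Sobolev norm, in terms of the Fourier transform [H]. *)
Definition hs H N := cmeas3 H /\ l2 (fun xi => (pw s xi)%:C * H xi) N.

Lemma hs_weight m H M N : hs H N -> cmeas3 m -> 0 <= M ->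
  (forall xi, normc (m xi) <= M * pw s xi) -> l2 (fun xi => m xi * H xi) (M * N).
Proof.
move=> [mH lH] mm M0 hm; have := l2Z M%:C lH; rewrite normcC ger0_norm//.
apply: l2_le; first exact: cmeasM.
move=> xi; rewrite !normcM !normcC mulrA ler_wpM2r ?normc_ge0//.
by rewrite !ger0_norm ?pw_ge0.
Qed.

(** Cauchy-Schwarz between the truncated singular weight and $|\xi|^sH$. This $L^1$ bound on the
    spectrum is the source of all sup bounds. *)
Lemma hs_low : exists2 C : R, 0 <= C & forall m H M N r, hs H N -> cmeas3 m -> 0 < r ->
  (forall xi, normc (m xi) <= M) -> (forall xi, r < enorm xi -> m xi = 0) ->
  L1 (fun xi => m xi * H xi) /\
  (\int[leb3 R]_xi (normc (m xi * H xi))%:E <= (C * M * r `^ (3 / 2 - s) * N)%:E)%E.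
Proof.
have [C C0 hC] := singular_weight; exists C => // m H M N r [mH lH] mm r0 hM m0.
have M0 : 0 <= M := le_trans (normc_ge0 _) (hM 0).
have lm : l2 (fun xi => m xi * (\1_[set xi | enorm xi <= r] xi * pw (- s) xi)%:C) (M * (C * r `^ (3 / 2 - s))).
  exact: l2Mb (hC r r0).
have [i1 i2] := l2_mul lm lH.
have ae : {ae leb3 R, forall xi, m xi * (\1_[set xi | enorm xi <= r] xi * pw (- s) xi)%:C * ((pw s xi)%:C * H xi) = m xi * H xi}.
  apply: ae_imp ae_neq0 => xi x0.
  have [xr|xr] := leP (enorm xi) r; last by rewrite m0// !mul0r.
  rewrite indicE mem_set//= mul1r -mulrA [X in _ * X]mulrA -rmorphM pwN_mul//.
  by rewrite mul1r.
have mmH : cmeas3 (fun xi => m xi * H xi) by exact: cmeasM.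
split; first exact: (ae_cinteg i1 mmH ae).
rewrite (_ : C * M * _ * N = M * (C * r `^ (3 / 2 - s)) * N); last by ring.
apply: le_trans i2.
rewrite (@ae_eq_integral _ _ _ (leb3 R) setT (fun xi => (normc (m xi * (\1_[set xi | enorm xi <= r] xi * pw (- s) xi)%:C * ((pw s xi)%:C * H xi)))%:E))//.
- exact: measurable_enormc.
- by apply: measurable_enormc; case: i1.
- by apply: ae_imp ae => xi -> _.
Qed.

Lemma pw_le_low r xi : 0 < r -> enorm xi <= r -> enorm xi <= r `^ (1 - s) * pw s xi.
Proof.
move=> r0 xr; have [-> |x0] := pselect (xi = 0).
  by rewrite -(scale0r (0 : R3 R)) enormZ normr0 mul0r mulr_ge0 ?powR_ge0 ?pw_ge0.
have e0 := enorm_gt0 x0.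
rewrite -[leLHS]powRr1 ?(ltW e0)// -{1}(subrK s 1) powRD; last by apply/implyP => _; rewrite gt_eqF.
apply: ler_wpM2r; first exact: powR_ge0.
have s2 : 0 <= 1 - s by rewrite subr_ge0 ltW.
by apply: (ge0_ler_powR s2) => //; rewrite nnegrE ltW.
Qed.

Lemma pw_ge_high r xi : 0 < r -> r < enorm xi -> 1 <= r `^ (- s) * pw s xi.
Proof.
move=> r0 xr; rewrite powRN mulrC ler_pdivlMr ?powR_gt0// mul1r.
by apply: ge0_ler_powR; rewrite ?nnegrE ?(ltW r0) ?(ltW s0) ?enorm_ge0// ltW.
Qed.

End homogeneous_weights.

(** * Fourier multipliers, Bernstein bounds and the form itself *)

Section trilinear_form.
Context {R : realType}.
Variable psi : R3 R -> R.
Hypothesis hpsi : lp_cutoff psi.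
Variable s : R.
Hypotheses (s0 : 0 < s) (s1 : s < 1).
Variables (v : 'I_3 -> cfield R) (N : R).
Hypothesis hv : forall i, hs s (v i) N.
Implicit Types (f g h F G H m : cfield R) (x xi : R3 R) (p q M r : R) (al be ga : R3 R -> R).
Local Notation L1 := (cinteg (leb3 R)).
Local Notation cmeas3 := (cmeas (T := M3 R)).

Definition mb M al := measurable_fun [set: M3 R] (al : M3 R -> R) /\ forall xi, `|al xi| <= M.
Definition low r al := forall xi, r < enorm xi -> al xi = 0.
Definition high r al := forall xi, enorm xi <= r -> al xi = 0.
Definition mult al := exists M, mb M al.
Definition lowm al := mult al /\ exists2 r, 0 < r & low r al.
Definition highm al := mult al /\ exists2 r, 0 < r & high r al.

(** Linearity of the form is stated for differences, because the block multipliers are differences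
    of cut-offs and sums over blocks telescope. *)
Definition msub al be xi : R := al xi - be xi.
Definition mmul al be xi : R := al xi * be xi.

Lemma mb_ge0 M al : mb M al -> 0 <= M.
Proof. by move=> [_ /(_ 0)]; exact: le_trans. Qed.

Lemma mb_sub M M' al be : mb M al -> mb M' be -> mb (M + M') (msub al be).
Proof.
move=> [ma ha] [mbe hb]; split; first exact: measurable_funB.
by move=> xi; apply: (le_trans (ler_normB _ _)); exact: lerD.
Qed.

Lemma mb_mul M M' al be : mb M al -> mb M' be -> mb (M * M') (mmul al be).
Proof.
move=> [ma ha] [mbe hb]; split; first exact: measurable_funM.
by move=> xi; rewrite normrM ler_pM.
Qed.

Lemma mult_sub al be : mult al -> mult be -> mult (msub al be).
Proof. by move=> [M h] [M' h']; exists (M + M'); exact: mb_sub. Qed.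

Lemma mult_mul al be : mult al -> mult be -> mult (mmul al be).
Proof. by move=> [M h] [M' h']; exists (M * M'); exact: mb_mul. Qed.

Lemma lowm_mult al : lowm al -> mult al. Proof. by case. Qed.
Lemma highm_mult al : highm al -> mult al. Proof. by case. Qed.

Lemma lowm_sub al be : lowm al -> lowm be -> lowm (msub al be).
Proof.
move=> [ma [r r0 la]] [mbe [t t0 lb]]; split; first exact: mult_sub.
exists (r + t); first exact: addr_gt0.
by move=> xi h; rewrite /msub la ?lb ?subrr//; apply: le_lt_trans h; rewrite ?lerDl ?lerDr ltW.
Qed.

Lemma highm_sub al be : highm al -> highm be -> highm (msub al be).
Proof.
move=> [ma [r r0 la]] [mbe [t t0 lb]]; split; first exact: mult_sub.
exists (Num.min r t); first by rewrite lt_min r0.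
by move=> xi; rewrite le_min => /andP[h1 h2]; rewrite /msub la// lb// subrr.
Qed.

(** The spectra of the fields $X(\cdot)$ and of their gradients: [sY be j i] belongs to $\partial_j$
    of the $i$-th component, the factor $\partial_jb_i$ of [convect]. *)
Definition sX al j : cfield R := fun xi => (al xi)%:C * v j xi.
Definition sY be j i : cfield R := iximul j (sX be i).
Definition X al j := ift (sX al j).
Definition Y be j i := ift (sY be j i).

Lemma mb_cmeas M al : mb M al -> cmeas3 (fun xi => (al xi)%:C).
Proof. by move=> [ma _]; exact: cmeas_real. Qed.

Lemma X_high M r al j : mb M al -> 0 < r -> high r al -> l2 (sX al j) (M * r `^ (- s) * N).
Proof.
move=> ha r0 la; have M0 := mb_ge0 ha; have [_ hM] := ha.
apply: (hs_weight (hv j)); first exact: mb_cmeas ha.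
  by rewrite mulr_ge0 ?powR_ge0.
move=> xi; rewrite normcC; have [xr|xr] := leP (enorm xi) r.
  by rewrite la// normr0 !mulr_ge0 ?powR_ge0 ?pw_ge0.
apply: (le_trans (hM xi)); rewrite -mulrA ler_peMr//; exact: pw_ge_high.
Qed.

Lemma X_low_L1 M r al j : mb M al -> 0 < r -> low r al -> L1 (sX al j).
Proof.
move=> ha r0 la; have [C C0 hC] := hs_low s0 s1; have [_ hM] := ha.
have [] // := hC (fun xi => (al xi)%:C) (v j) M N r (hv j) (mb_cmeas ha) r0.
  by move=> xi; rewrite normcC.
by move=> xi /la ->.
Qed.

Lemma sYE be j i xi : sY be j i xi = ii * (coord3 j xi * be xi)%:C * v i xi.
Proof. by rewrite /sY /iximul /sX rmorphM; ring. Qed.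

Lemma sY_mult M r be j : mb M be -> 0 <= r -> low r be ->
  cmeas3 (fun xi => ii * (coord3 j xi * be xi)%:C) /\
  (forall xi, normc (ii * (coord3 j xi * be xi)%:C) <= r * M) /\
  (forall xi, r < enorm xi -> ii * (coord3 j xi * be xi)%:C = 0).
Proof.
move=> hb r0 lb; have M0 := mb_ge0 hb; have [mbe hM] := hb; split.
  apply: cmeasM; first exact: cmeas_cst.
  by apply: cmeas_real; apply: measurable_funM => //; exact: measurable_coord3.
split=> [xi|xi /lb ->]; last by rewrite !mulr0.
rewrite normcM normc_ii mul1r normcC normrM; have [xr|/lb ->] := leP (enorm xi) r.
  by rewrite ler_pM// (le_trans (coord3_le j xi)).
by rewrite normr0 mulr0 mulr_ge0.
Qed.

Lemma Y_low_L1 M r be j i : mb M be -> 0 < r -> low r be -> L1 (sY be j i).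
Proof.
move=> hb r0 lb; have [C C0 hC] := hs_low s0 s1.
have [m1 [m2 m3]] := sY_mult j hb (ltW r0) lb.
have [h _] := hC _ (v i) (r * M) N r (hv i) m1 r0 m2 m3.
by rewrite (_ : sY be j i = (fun xi => ii * (coord3 j xi * be xi)%:C * v i xi))//; apply/funext => xi; exact: sYE.
Qed.

Lemma Y_low_l2 M r be j i : mb M be -> 0 < r -> low r be -> l2 (sY be j i) (M * r `^ (1 - s) * N).
Proof.
move=> hb r0 lb; have M0 := mb_ge0 hb; have [_ hM] := hb.
have [m1 _] := sY_mult j hb (ltW r0) lb.
rewrite (_ : sY be j i = (fun xi => ii * (coord3 j xi * be xi)%:C * v i xi)); last by apply/funext => xi; exact: sYE.
apply: (hs_weight (hv i)) => //; first by rewrite mulr_ge0 ?powR_ge0.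
move=> xi; rewrite normcM normc_ii mul1r normcC normrM mulrC; have [xr|/lb ->] := leP (enorm xi) r.
  rewrite -mulrA ler_pM//; apply: (le_trans (coord3_le j xi)); exact: pw_le_low.
by rewrite normr0 mul0r !mulr_ge0 ?powR_ge0 ?pw_ge0.
Qed.

Lemma ift_bdd F A : L1 F -> (\int[leb3 R]_xi (normc (F xi))%:E <= A%:E)%E ->
  {ae leb3 R, forall x, normc (ift F x) <= 2 * fcst * A}.
Proof.
move=> hF FA; apply: ae_imp (ift_L1 hpsi hF) => x ->.
rewrite -lee_fin; apply: (le_trans (ifourier_le x hF)).
by rewrite [leRHS]EFinM; apply: lee_wpmul2l => //; rewrite lee_fin mulr_ge0// fcst_ge0.
Qed.

(** Bernstein's inequality through the $L^1$ norm of the symbol: [hs_low] gives $r^{3/2-s}$, and a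
    derivative costs one more factor $r$. *)
Lemma low_bdd : exists2 C : R, 0 <= C & forall M r al, mb M al -> 0 < r -> low r al ->
  (forall j, {ae leb3 R, forall x, normc (X al j x) <= C * (M * r `^ (3 / 2 - s) * N)}) /\
  (forall j i, {ae leb3 R, forall x, normc (Y al j i x) <= C * (M * r `^ (5 / 2 - s) * N)}).
Proof.
have [C C0 hC] := hs_low s0 s1.
exists (2 * fcst * C) => [|M r al ha r0 la]; first by rewrite !mulr_ge0 ?fcst_ge0.
have [_ hM] := ha; split => [j|j i].
  rewrite (_ : 2 * fcst * C * (M * r `^ (3 / 2 - s) * N) = 2 * fcst * (C * M * r `^ (3 / 2 - s) * N)); last by ring.
  have [||h1 h2] := hC (fun xi => (al xi)%:C) (v j) M N r (hv j) (mb_cmeas ha) r0.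
  - by move=> xi; rewrite normcC.
  - by move=> xi /la ->.
  exact: ift_bdd.
have [m1 [m2 m3]] := sY_mult j ha (ltW r0) la.
have [h1 h2] := hC _ (v i) (r * M) N r (hv i) m1 r0 m2 m3.
have -> : 2 * fcst * C * (M * r `^ (5 / 2 - s) * N) = 2 * fcst * (C * (r * M) * r `^ (3 / 2 - s) * N).
  rewrite (_ : 5 / 2 - s = 1 + (3 / 2 - s)); last by lra.
  rewrite powRD; last by apply/implyP => _; rewrite gt_eqF.
  by rewrite powRr1 ?(ltW r0)//; ring.
apply: ift_bdd; first exact: Y_low_L1 ha r0 la.
rewrite (_ : sY al j i = (fun xi => ii * (coord3 j xi * al xi)%:C * v i xi))//.
by apply/funext => xi; exact: sYE.
Qed.

Lemma bdd_l2_l2 f g h (A p q : R) : cmeas3 f -> 0 <= A -> {ae leb3 R, forall x, normc (f x) <= A} ->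
  l2 g p -> l2 h q -> L1 (fun x => f x * g x * h x) /\
  (\int[leb3 R]_x (normc (f x * g x * h x))%:E <= (A * (p * q))%:E)%E.
Proof.
move=> mf A0 fA lg lh; have [mg _ _] := lg; have [mh _ _] := lh.
have [i1 i2] := l2_mul lg lh.
have mm : cmeas3 (fun x => f x * g x * h x) by apply: cmeasM => //; exact: cmeasM.
have key : (\int[leb3 R]_x (normc (f x * g x * h x))%:E <= (A * (p * q))%:E)%E.
  apply: (@le_trans _ _ (\int[leb3 R]_x (A%:E * (normc (g x * h x))%:E))%E).
    apply: ae_ge0_le_integral => //.
    - by move=> x _; rewrite lee_fin normc_ge0.
    - exact: measurable_enormc.
    - by move=> x _; rewrite -EFinM lee_fin mulr_ge0// normc_ge0.
    - by apply: measurable_funeM; apply: measurable_enormc; case: i1.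
    - apply: ae_imp fA => x hx _; rewrite -EFinM lee_fin -mulrA normcM.
      by apply: ler_wpM2r hx; exact: normc_ge0.
  rewrite ge0_integralZl ?lee_fin//.
  - by rewrite [leRHS]EFinM; apply: lee_wpmul2l i2; rewrite lee_fin.
  - by apply: measurable_enormc; case: i1.
  - by move=> x _; rewrite lee_fin normc_ge0.
by split => //; split => //; exact: le_lt_trans key (ltry _).
Qed.

Lemma ift_decomp F : L1_l2 F -> exists F1 F2 p, [/\ L1 F1, l2 F2 p &
  {ae leb3 R, forall x, ift F x = ifourier F1 x + ift F2 x}].
Proof.
move=> [F1 [F2 [h1 [p h2] ->]]]; exists F1, F2, p; split => //.
exact: (density_ae hpsi (ift_sum hpsi h1 h2)).
Qed.

(** The symbol is split at $|\xi|=1$. *)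
Lemma X_L1_l2 al j : mult al -> L1_l2 (sX al j).
Proof.
move=> [M ha]; have [ma hM] := ha.
pose a1 xi : R := al xi * \1_[set xi | enorm xi <= 1] xi.
pose a2 xi : R := al xi - a1 xi.
have mi : mb 1 (\1_[set xi | enorm xi <= 1] : R3 R -> R).
  by split => [|xi]; [apply: measurable_indic; exact: measurable_enorm_le|exact: indic_norm].
have h1 : mb (M * 1) a1 by exact: mb_mul.
have h2 : mb (M + M * 1) a2 by exact: mb_sub.
exists (sX a1 j), (sX a2 j); split.
- by apply: (X_low_L1 j h1 ltr01) => xi h; rewrite /a1 indicE memNset ?mulr0//= => h'; move: (lt_le_trans h h'); rewrite ltxx.
- by exists ((M + M * 1) * 1 `^ (- s) * N); apply: (X_high j h2 ltr01) => xi h; rewrite /a2 /a1 indicE mem_set// mulr1 subrr.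
- by apply/funext => xi; rewrite /sX -mulrDl -rmorphD /a2 addrC subrK.
Qed.

Lemma X_cmeas al j : mult al -> cmeas3 (X al j).
Proof. by move=> /(X_L1_l2 j); exact: L1_l2_cmeas hpsi _. Qed.

Definition term al be ga i j x := X al j x * Y be j i x * X ga i x.

Lemma lowm_Y be j i : lowm be -> exists A p, [/\ 0 <= A, l2 (Y be j i) p &
  {ae leb3 R, forall x, normc (Y be j i x) <= A}].
Proof.
move=> [[M hM] [r r0 lb]]; have [C C0 hC] := low_bdd; have M0 := mb_ge0 hM.
have lY := ift_l2 hpsi (Y_low_l2 j i hM r0 lb); have [_ p0 _] := Y_low_l2 j i hM r0 lb.
exists (C * (M * r `^ (5 / 2 - s) * N)), (M * r `^ (1 - s) * N); split => //.
  have [_ [_ N0 _]] := hv 0; by rewrite !mulr_ge0 ?powR_ge0.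
by have [_ h] := hC M r be hM r0 lb.
Qed.

Lemma highm_X ga j : highm ga -> exists p, l2 (X ga j) p.
Proof.
move=> [[M hM] [r r0 lb]]; exists (M * r `^ (- s) * N).
exact: (ift_l2 hpsi (X_high j hM r0 lb)).
Qed.

(** The first factor is only a sum of a bounded and a square integrable function. The bounded part
    is paired with the $L^2$ norms of the other two factors, the square integrable part with the sup
    norm of the gradient. *)
Lemma term_L1 al be ga i j : mult al -> lowm be -> highm ga -> L1 (term al be ga i j).
Proof.
move=> ma lb hg.
have [A [p [A0 lY bY]]] := lowm_Y j i lb; have [q lX] := highm_X i hg.
have [F1 [F2 [t [h1 h2 ae]]]] := ift_decomp (X_L1_l2 j ma).
have [B hB] := ifourier_bound h1.
have mY : cmeas3 (Y be j i) by case: lY.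
have mX : cmeas3 (X ga i) by case: lX.
have hB' : {ae leb3 R, forall x, normc (ifourier F1 x) <= B} by exact: aeW.
have [i1 _] := bdd_l2_l2 (cmeas_ifourier h1) (le_trans (normc_ge0 _) (hB 0)) hB' lY lX.
have [i2 _] := bdd_l2_l2 mY A0 bY (ift_l2 hpsi h2) lX.
have i3 := cintegD i1 i2.
apply: (ae_cinteg i3).
  exact: (cmeasM (cmeasM (X_cmeas j ma) mY) mX).
apply: ae_imp ae => x E; have E2 : X al j x = ifourier F1 x + ift F2 x := E.
by rewrite /term E2 !mulrDl [Y be j i x * _]mulrC.
Qed.

Definition Tri al be ga : R[i] := \sum_(i < 3) \sum_(j < 3) Cint (leb3 R) (term al be ga i j).

Lemma X_sub al be j : mult al -> mult be ->
  {ae leb3 R, forall x, X (msub al be) j x = X al j x - X be j x}.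
Proof.
move=> ha hb; have := ift_B hpsi (X_L1_l2 j ha) (X_L1_l2 j hb).
rewrite (_ : (fun xi => sX al j xi - sX be j xi) = sX (msub al be) j)//.
by apply/funext => xi; rewrite /sX /msub rmorphB mulrBl.
Qed.

Lemma Y_sub al be j i : lowm al -> lowm be ->
  {ae leb3 R, forall x, Y (msub al be) j i x = Y al j i x - Y be j i x}.
Proof.
move=> [[M ha] [r r0 la]] [[M' hb] [t t0 lb]].
have := ift_B hpsi (L1_l2_of_L1 (Y_low_L1 j i ha r0 la)) (L1_l2_of_L1 (Y_low_L1 j i hb t0 lb)).
rewrite (_ : (fun xi => sY al j i xi - sY be j i xi) = sY (msub al be) j i)//.
by apply/funext => xi; rewrite !sYE -mulrBl -mulrBr -rmorphB -mulrBr.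
Qed.

Lemma Tri_ae_sub a b c a' b' c' a'' b'' c'' :
  (mult a /\ lowm b /\ highm c) -> (mult a' /\ lowm b' /\ highm c') -> (mult a'' /\ lowm b'' /\ highm c'') ->
  (forall i j, {ae leb3 R, forall x, term a b c i j x = term a' b' c' i j x - term a'' b'' c'' i j x}) ->
  Tri a b c = Tri a' b' c' - Tri a'' b'' c''.
Proof.
move=> [h1 [h2 h3]] [h1' [h2' h3']] [h1'' [h2'' h3'']] ae.
rewrite /Tri -sumrB; apply: eq_bigr => i _; rewrite -sumrB; apply: eq_bigr => j _.
have i1 := term_L1 i j h1 h2 h3; have i2 := term_L1 i j h1' h2' h3'; have i3 := term_L1 i j h1'' h2'' h3''.
rewrite -(Cint3B i2 i3); apply: ae_Cint; [by case: i1|by apply: cmeasB; [case: i2|case: i3]|exact: ae].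
Qed.

Lemma Tri_sub1 al al' be ga : mult al -> mult al' -> lowm be -> highm ga ->
  Tri (msub al al') be ga = Tri al be ga - Tri al' be ga.
Proof.
move=> h1 h2 h3 h4; apply: Tri_ae_sub => //; first by split => //; exact: mult_sub.
by move=> i j; apply: ae_imp (X_sub j h1 h2) => x E; rewrite /term E !mulrBl.
Qed.

Lemma Tri_sub2 al be be' ga : mult al -> lowm be -> lowm be' -> highm ga ->
  Tri al (msub be be') ga = Tri al be ga - Tri al be' ga.
Proof.
move=> h1 h2 h3 h4; apply: Tri_ae_sub => //; first by split => //; split => //; exact: lowm_sub.
by move=> i j; apply: ae_imp (Y_sub j i h2 h3) => x E; rewrite /term E mulrBr mulrBl.
Qed.

Lemma Tri_sub3 al be ga ga' : mult al -> lowm be -> highm ga -> highm ga' ->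
  Tri al be (msub ga ga') = Tri al be ga - Tri al be ga'.
Proof.
move=> h1 h2 h3 h4; apply: Tri_ae_sub => //; first by split => //; split => //; exact: highm_sub.
by move=> i j; apply: ae_imp (X_sub i (highm_mult h3) (highm_mult h4)) => x E; rewrite /term E mulrBr.
Qed.

(** The product of the first two factors has spectrum in the ball of radius $a+b$; being low, both
    have integrable symbols, as [spectral_vanishing] demands. *)
Lemma Tri_vanish1 al be ga (a b : R) : 0 < a -> 0 < b -> mult al -> low a al -> mult be -> low b be ->
  mult ga -> high (a + b) ga -> Tri al be ga = 0.
Proof.
move=> a0 b0 [M ha] la [M' hb] lb [M'' hg] hga; have ab0 : 0 < a + b by exact: addr_gt0.
rewrite /Tri big1// => i _; rewrite big1// => j _.
have h1 := X_low_L1 j ha a0 la; have h2 := Y_low_L1 j i hb b0 lb.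
have h3 := Y_low_l2 j i hb b0 lb; have h4 := X_high i hg ab0 hga.
have e1 := ift_L1 hpsi h1; have e2 := ift_L1 hpsi h2.
rewrite -[RHS](@spectral_vanishing R psi hpsi (sX al j) (sY be j i) (sX ga i) _ _ a b h1 h2 h3 h4).
- apply: ae_Cint.
  + apply: cmeasM; first apply: cmeasM.
    * exact: X_cmeas (ex_intro _ M ha).
    * exact: (ift_cmeas h3).
    * exact: (ift_cmeas h4).
  + apply: cmeasM; last exact: (ift_cmeas h4).
    by apply: cmeasM; exact: cmeas_ifourier.
  + by apply: ae_imp2 e1 e2 => x E1 E2; rewrite /term /X /Y E1 E2.
- by move=> xi h; rewrite /sX la// mul0r.
- by move=> xi h; rewrite sYE lb// !mulr0 mul0r.
- by move=> xi h; rewrite /sX hga// mul0r.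
Qed.

Lemma Tri_vanish3 al be ga (a b : R) : 0 < a -> 0 < b -> mult al -> high (a + b) al -> mult be -> low b be ->
  highm ga -> low a ga -> Tri al be ga = 0.
Proof.
move=> a0 b0 [M ha] la [M' hb] lb hg lga; have ab0 : 0 < a + b by exact: addr_gt0.
have [[M'' hgm] _] := hg.
rewrite /Tri big1// => i _; rewrite big1// => j _.
have h1 := X_low_L1 i hgm a0 lga; have h2 := Y_low_L1 j i hb b0 lb.
have h3 := Y_low_l2 j i hb b0 lb; have h4 := X_high j ha ab0 la.
have e1 := ift_L1 hpsi h1; have e2 := ift_L1 hpsi h2.
rewrite -[RHS](@spectral_vanishing R psi hpsi (sX ga i) (sY be j i) (sX al j) _ _ a b h1 h2 h3 h4).
- apply: ae_Cint.
  + apply: cmeasM; first apply: cmeasM.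
    * exact: (ift_cmeas h4).
    * exact: (ift_cmeas h3).
    * exact: X_cmeas (ex_intro _ M'' hgm).
  + apply: cmeasM; last exact: (ift_cmeas h4).
    by apply: cmeasM; exact: cmeas_ifourier.
  + by apply: ae_imp2 e1 e2 => x E1 E2; rewrite /term /X /Y E1 E2 mulrC mulrCA mulrC.
- by move=> xi h; rewrite /sX lga// mul0r.
- by move=> xi h; rewrite sYE lb// !mulr0 mul0r.
- by move=> xi h; rewrite /sX la// mul0r.
Qed.

End trilinear_form.

(** * The paraproduct decomposition *)

Section integer_sums.
Context {V : zmodType}.
Implicit Types (a b k : int) (G : int -> V).

Lemma sumZE a n G : sumZ a (a + n%:Z - 1) G = \sum_(i < n) G (a + i%:Z).
Proof. by rewrite /sumZ (_ : a + n%:Z - 1 - a + 1 = n%:Z)//; lia. Qed.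

Lemma sumZ_size a b : a <= b + 1 -> exists n : nat, b = a + n%:Z - 1.
Proof. by move=> ab; exists (absz (b + 1 - a)%R); lia. Qed.

(** The case $b=a-1$ is the empty sum, for which the two end terms coincide. *)
Lemma sumZ_telescope a b G : a <= b + 1 -> sumZ a b (fun l => G (l + 1) - G l) = G (b + 1) - G a.
Proof.
move=> /sumZ_size[n ->]; rewrite sumZE; elim: n => [|n IH].
  by rewrite big_ord0 (_ : a + 0%:Z - 1 + 1 = a) ?subrr//; lia.
rewrite big_ord_recr/= IH (_ : a + n%:Z - 1 + 1 = a + n%:Z); last by lia.
rewrite (_ : a + n.+1%:Z - 1 + 1 = a + n%:Z + 1); last by lia.
by rewrite addrC addrA subrK.
Qed.

Lemma eq_sumZ a b G G' : (forall l, a <= l <= b -> G l = G' l) -> sumZ a b G = sumZ a b G'.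
Proof.
move=> GG; rewrite /sumZ; case E : (b - a + 1) => [n|//].
by apply: eq_bigr => i _; apply: GG; have := ltn_ord i; lia.
Qed.

Lemma sumZD a b G G' : sumZ a b (fun l => G l + G' l) = sumZ a b G + sumZ a b G'.
Proof. by rewrite /sumZ; case: (b - a + 1) => n; rewrite ?addr0// big_split. Qed.

Lemma sumZ_n a b n G : b = a + n%:Z - 1 -> sumZ a b G = \sum_(i < n) G (a + i%:Z).
Proof. by move=> ->; exact: sumZE. Qed.

Lemma sumZ1 a b G : b = a -> sumZ a b G = G a.
Proof.
move=> ->; rewrite (@sumZ_n _ _ 1); last by lia.
by rewrite big_ord_recl big_ord0 /= !addr0.
Qed.

Lemma sumZ_recr a b G : a <= b -> sumZ a b G = sumZ a (b - 1) G + G b.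
Proof.
move=> ab; have [n e] : exists n : nat, b = a + n%:Z by exists (absz (b - a)%R); lia.
rewrite (@sumZ_n _ _ n.+1); last by lia.
by rewrite [in RHS](@sumZ_n _ _ n) ?e// big_ord_recr.
Qed.

Lemma sumZ2 a b G : b = a + 1 -> sumZ a b G = G a + G (a + 1).
Proof. by move=> ->; rewrite sumZ_recr ?sumZ1//; lia. Qed.

Lemma sumZ3 a b G : b = a + 2 -> sumZ a b G = G a + G (a + 1) + G (a + 2).
Proof. by move=> ->; rewrite sumZ_recr ?sumZ2//; lia. Qed.

Lemma sumZ4 a b G : b = a + 3 -> sumZ a b G = G a + G (a + 1) + G (a + 2) + G (a + 3).
Proof. by move=> ->; rewrite sumZ_recr ?sumZ3//; lia. Qed.

(** Exchange of summations over the triangle $k-1\le l$, $l-2\le m\le k$; it has ten points, so both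
    sides are expanded. *)
Lemma sumZ_triangle k (g : int -> int -> V) :
  sumZ (k - 1) (k + 2) (fun l => sumZ (l - 2) k (fun m => g m l)) =
  sumZ (k - 3) k (fun m => sumZ (k - 1) (m + 2) (fun l => g m l)).
Proof.
rewrite !(@sumZ4 (k - 1)) ?(@sumZ4 (k - 3) k); try lia.
rewrite (@sumZ4 (k - 1 - 2)) ?(@sumZ3 (k - 1 + 1 - 2)) ?(@sumZ2 (k - 1 + 2 - 2)) ?(@sumZ1 (k - 1 + 3 - 2)); try lia.
rewrite (@sumZ1 (k - 1)) ?(@sumZ2 (k - 1) (k - 3 + 1 + 2)) ?(@sumZ3 (k - 1) (k - 3 + 2 + 2))
  ?(@sumZ4 (k - 1) (k - 3 + 3 + 2)); try lia.
rewrite !addrA [LHS](ACl (1*2*5*3*6*8*4*7*9*10)) /=.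
have e1 : k - 1 - 2 = k - 3 by lia.
have e2 : k - 1 + 1 - 2 = k - 3 + 1 by lia.
have e3 : k - 1 + 1 + 1 - 2 = k - 3 + 1 + 1 by lia.
have e4 : k - 1 + 1 + 1 + 1 - 2 = k - 3 + 1 + 1 + 1 by lia.
by rewrite e1 e2 e3 e4.
Qed.

End integer_sums.

(** * The Littlewood-Paley multipliers *)

Section littlewood_paley.
Context {R : realType}.
Variable psi : R3 R -> R.
Hypothesis hpsi : lp_cutoff psi.
Implicit Types (k l m : int) (xi : R3 R) (r M : R).

Definition two k : R := (2 : R) ^ k.

Lemma two_gt0 k : 0 < two k. Proof. by rewrite /two exprz_gt0. Qed.

Lemma twoS k : two (k + 1) = 2 * two k.
Proof. by rewrite /two expfzDr ?pnatr_eq0// expr1z mulrC. Qed.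

Lemma two_le k l : k <= l -> two k <= two l.
Proof. by move=> kl; rewrite /two ler_eXz2l// ltr1n. Qed.

Lemma twoN k : two (- k) = (two k)^-1.
Proof. by rewrite /two invr_expz. Qed.

(** [ps k], [ph l], [wh k] and, below, [ta l] are the symbols of $\dot S_k$, $\dot\Delta_l$,
    $u\mapsto u^k$ and $\tilde{\dot\Delta}_l$. *)
Definition ps k : R3 R -> R := fun xi => psi (two (- k) *: xi).
Definition ph l : R3 R -> R := fun xi => lp_annulus psi (two (- l) *: xi).
Definition wh k : R3 R -> R := msub (fun=> 1) (ps k).

Lemma phE l : ph l = msub (ps (l + 1)) (ps l).
Proof.
apply/funext => xi; rewrite /ph /lp_annulus /msub /ps scalerA; congr (psi (_ *: _) - _).
by rewrite !twoN twoS invfM.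
Qed.

Lemma ps_test k : test_fun (fun xi => (ps k xi)%:C).
Proof.
have := @test_aff R (two (- k)) 0 _ _ (psi_test hpsi).
by under eq_fun do rewrite addr0; apply; rewrite gt_eqF// two_gt0.
Qed.

Lemma ph_test l : test_fun (fun xi => (ph l xi)%:C).
Proof. by rewrite phE; under eq_fun do rewrite rmorphB; apply: testB; exact: ps_test. Qed.

Lemma scale_enorm k xi : enorm (two (- k) *: xi) = enorm xi / two k.
Proof. by rewrite enormZ twoN ger0_norm ?invr_ge0 ?(ltW (two_gt0 k))// mulrC. Qed.

Lemma ps_low k : low (two k) (ps k).
Proof.
move=> xi h; have [_ _ p1 _] := hpsi; apply: p1.
by rewrite scale_enorm ltr_pdivlMr ?two_gt0// mul1r.
Qed.

Lemma ps_one k xi : enorm xi <= two (k - 1) -> ps k xi = 1.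
Proof.
move=> h; have [_ _ _ p1] := hpsi; apply: p1.
rewrite scale_enorm ler_pdivrMr ?two_gt0//; apply: (le_trans h).
by rewrite -[in leRHS](subrK 1 k) twoS mulrA mulVf ?mul1r.
Qed.

Lemma wh_high k : high (two (k - 1)) (wh k).
Proof. by move=> xi h; rewrite /wh /msub ps_one ?subrr. Qed.

Lemma ph_low l : low (two (l + 1)) (ph l).
Proof.
move=> xi h; rewrite phE /msub !ps_low ?subrr//; apply: le_lt_trans h.
by rewrite two_le//; lia.
Qed.

Lemma ph_high l : high (two (l - 1)) (ph l).
Proof.
move=> xi h; rewrite phE /msub !ps_one ?subrr//; apply: (le_trans h).
by rewrite two_le//; lia.
Qed.

Lemma ps_bound : exists2 M : R, 1 <= M & [/\ forall k, mb M (ps k), forall l, mb (2 * M) (ph l) &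
  forall k, mb (2 * M) (wh k)].
Proof.
have [M M1 hM] := psi_bdd hpsi; exists M => //.
have mp k : mb M (ps k).
  split => [|xi]; first by have [] := smooth_cmeas (proj1 (ps_test k)).
  by have /andP[h0 h1] := hM (two (- k) *: xi); rewrite ger0_norm.
have m1 : mb M (fun _ : R3 R => 1 : R) by split => // xi; rewrite normr1.
rewrite (_ : 2 * M = M + M); last by ring.
by split => // [l|k]; [rewrite phE|]; exact: mb_sub.
Qed.

Lemma mult_ps k : mult (ps k).
Proof. by have [M _ [h _ _]] := ps_bound; exists M. Qed.

Lemma mult_ph l : mult (ph l).
Proof. by have [M _ [_ h _]] := ps_bound; exists (2 * M). Qed.

Lemma mult_wh k : mult (wh k).
Proof. by have [M _ [_ _ h]] := ps_bound; exists (2 * M). Qed.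

Lemma lowm_ps k : lowm (ps k).
Proof. by split; [exact: mult_ps|exists (two k); [exact: two_gt0|exact: ps_low]]. Qed.

Lemma lowm_ph l : lowm (ph l).
Proof. by split; [exact: mult_ph|exists (two (l + 1)); [exact: two_gt0|exact: ph_low]]. Qed.

Lemma highm_wh k : highm (wh k).
Proof. by split; [exact: mult_wh|exists (two (k - 1)); [exact: two_gt0|exact: wh_high]]. Qed.

Lemma highm_mul (al ga : R3 R -> R) : mult al -> highm ga -> highm (mmul al ga).
Proof.
move=> ma [mg [r r0 hg]]; split; first exact: mult_mul.
by exists r => // xi h; rewrite /mmul hg// mulr0.
Qed.

(** [wh k] vanishes up to $2^{k-1}$ and [ps l] beyond $2^l$. In telescoped sums this removes the
    lower end. *)
Lemma ps_wh0 k l : l <= k - 1 -> mmul (ps l) (wh k) = (fun=> 0).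
Proof.
move=> lk; apply/funext => xi; rewrite /mmul.
have [h|h] := leP (enorm xi) (two (k - 1)); first by rewrite wh_high// mulr0.
by rewrite ps_low ?mul0r//; apply: le_lt_trans h; exact: two_le.
Qed.

Definition ta l : R3 R -> R := fun xi => sumZ (l - 2) (l + 2) (fun l' => ph l' xi).

Lemma taE l : ta l = msub (ps (l + 3)) (ps (l - 2)).
Proof.
apply/funext => xi; rewrite /ta /msub (_ : l + 3 = l + 2 + 1); last by lia.
rewrite -(@sumZ_telescope _ (l - 2) (l + 2) (ps^~ xi)); last by lia.
by apply: eq_sumZ => i _; rewrite phE.
Qed.

Variable s : R.
Hypotheses (s0 : 0 < s) (s1 : s < 1).
Variables (v : 'I_3 -> cfield R) (N : R).
Hypothesis hv : forall i, hs s (v i) N.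
Local Notation T := (Tri v).

Lemma Tri_high0 al be : mult al -> lowm be -> T al be (fun=> 0) = 0.
Proof.
move=> ma lb; have hz : highm (fun _ : R3 R => 0 : R).
  split; last by exists 1.
  by exists 0; split => // xi; rewrite normr0.
have := Tri_sub3 hpsi s0 s1 hv ma lb hz hz; rewrite subrr.
by rewrite (_ : msub _ _ = (fun=> 0))//; apply/funext => xi; rewrite /msub subrr.
Qed.

Lemma Tri_telescope1 al be ga (a b : int) : a <= b + 1 -> mult al -> lowm be -> highm ga ->
  sumZ a b (fun l => T (mmul al (ph l)) be ga) =
  T (mmul al (ps (b + 1))) be ga - T (mmul al (ps a)) be ga.
Proof.
move=> ab ma lb hg; rewrite -(@sumZ_telescope _ a b (fun l => T (mmul al (ps l)) be ga))//; apply: eq_sumZ => l _.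
rewrite -(Tri_sub1 hpsi s0 s1 hv (mult_mul ma (mult_ps _)) (mult_mul ma (mult_ps _)) lb hg).
suff -> : mmul al (ph l) = msub (mmul al (ps (l + 1))) (mmul al (ps l)) by [].
by apply/funext => xi; rewrite /mmul phE /msub mulrBr.
Qed.

Lemma Tri_telescope2 al ga (a b : int) : a <= b + 1 -> mult al -> highm ga ->
  sumZ a b (fun l => T al (ph l) ga) = T al (ps (b + 1)) ga - T al (ps a) ga.
Proof.
move=> ab ma hg; rewrite -(@sumZ_telescope _ a b (fun l => T al (ps l) ga))//; apply: eq_sumZ => l _.
by rewrite phE (Tri_sub2 hpsi s0 s1 hv ma (lowm_ps _) (lowm_ps _) hg).
Qed.

Lemma Tri_telescope3 al be k (a b : int) : a <= b + 1 -> mult al -> lowm be ->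
  sumZ a b (fun l => T al be (mmul (ph l) (wh k))) =
  T al be (mmul (ps (b + 1)) (wh k)) - T al be (mmul (ps a) (wh k)).
Proof.
move=> ab ma lb; rewrite -(@sumZ_telescope _ a b (fun l => T al be (mmul (ps l) (wh k))))//; apply: eq_sumZ => l _.
rewrite -(Tri_sub3 hpsi s0 s1 hv ma lb (highm_mul (mult_ps _) (highm_wh _)) (highm_mul (mult_ps _) (highm_wh _))).
suff -> : mmul (ph l) (wh k) = msub (mmul (ps (l + 1)) (wh k)) (mmul (ps l) (wh k)) by [].
by apply/funext => xi; rewrite /mmul phE /msub mulrBl.
Qed.

End littlewood_paley.

(** * Interaction of frequency blocks and the exact decomposition *)

Section paraproduct.
Context {R : realType}.
Variable psi : R3 R -> R.
Hypothesis hpsi : lp_cutoff psi.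
Variable s : R.
Hypotheses (s0 : 0 < s) (s1 : s < 1).
Variables (v : 'I_3 -> cfield R) (N : R).
Hypothesis hv : forall i, hs s (v i) N.
Implicit Types (k l a h : int) (xi : R3 R) (al be ga : R3 R -> R).
Local Notation T := (Tri v).
Local Notation ps := (ps psi).
Local Notation ph := (ph psi).
Local Notation wh := (wh psi).
Local Notation ta := (ta psi).
Local Notation one := (fun _ : R3 R => 1 : R).
Let mps k : mult (ps k) := mult_ps hpsi k.
Let mph k : mult (ph k) := mult_ph hpsi k.
Let lps k : lowm (ps k) := lowm_ps hpsi k.
Let lph k : lowm (ph k) := lowm_ph hpsi k.
Let hwh k : highm (wh k) := highm_wh hpsi k.

Let lowps k : low (two k) (ps k) := @ps_low _ _ hpsi k.

Lemma mult_one : mult one.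
Proof. by exists 1; split => // xi; rewrite normr1. Qed.

Lemma low_mull r al be : low r al -> low r (mmul al be).
Proof. by move=> h xi /h e; rewrite /mmul e mul0r. Qed.

Lemma low_le r r' al : r <= r' -> low r al -> low r' al.
Proof. by move=> rr h xi x; apply: h; exact: le_lt_trans x. Qed.

Lemma high_mull r al be : high r al -> high r (mmul al be).
Proof. by move=> h xi /h e; rewrite /mmul e mul0r. Qed.

Lemma high_le r r' al : r <= r' -> high r' al -> high r al.
Proof. by move=> rr h xi x; apply: h; exact: le_trans rr. Qed.

Lemma mmulC al be : mmul al be = mmul be al.
Proof. by apply/funext => xi; rewrite /mmul mulrC. Qed.

Lemma two_add k : two k + two k = two (k + 1) :> R.
Proof. by rewrite twoS; ring. Qed.

(** The symbol of $\dot\Delta_lu^k$. *)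
Definition ga l k := mmul (ph l) (wh k).

Lemma ga_highm l k : highm (ga l k). Proof. exact: highm_mul (mph l) (hwh k). Qed.

Lemma ga_high l k : high (two (l - 1)) (ga l k).
Proof. by apply: high_mull; exact: ph_high. Qed.

Lemma ga_low l k : low (two (l + 1)) (ga l k).
Proof. by apply: low_mull; exact: ph_low. Qed.

Lemma wh_compl k l : high (two (l - 1)) (msub (wh k) (mmul (ps l) (wh k))).
Proof. by move=> xi h; rewrite /msub /mmul (ps_one hpsi h) mul1r subrr. Qed.

(** Two factors below $2^k$ interact only with frequencies up to $2^{k+1}\le2^{l-1}$, where [ps l]
    is 1. *)
Lemma Tri_localize3 k al be l : mult al -> low (two k) al -> lowm be -> low (two k) be -> k + 2 <= l ->
  T al be (mmul (ps l) (wh k)) = T al be (wh k).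
Proof.
move=> ma la lb lb' kl; have hm := highm_mul (mps l) (hwh k).
apply/eqP; rewrite eq_sym -subr_eq0 -(Tri_sub3 hpsi s0 s1 hv ma lb (hwh k) hm); apply/eqP.
apply: (Tri_vanish1 hpsi s0 s1 hv (two_gt0 k) (two_gt0 k) ma la (lowm_mult lb) lb').
  exact: mult_sub (highm_mult (hwh k)) (highm_mult hm).
rewrite two_add; apply: (high_le _ (@wh_compl k l)); apply: two_le; lia.
Qed.

(** Blocks beyond $l=k+2$ do not interact with the two low factors, and those before $l=k-1$ are not
    seen by [wh k]. *)
Lemma Tri_blocks3 k al be : mult al -> low (two k) al -> lowm be -> low (two k) be ->
  T al be (wh k) = sumZ (k - 1) (k + 2) (fun l => T al be (ga l k)).
Proof.
move=> ma la lb lb'; rewrite (Tri_telescope3 hpsi s0 s1 hv k _ ma lb); last by lia.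
rewrite (Tri_localize3 ma la lb lb'); last by lia.
by rewrite (ps_wh0 hpsi (lexx _)) (Tri_high0 hpsi s0 s1 hv ma lb) subr0.
Qed.

(** With the first factor below $2^{l-2}$ and the third above $2^{l-1}$, the second must reach
    beyond $2^{l-2}$. *)
Lemma Tri_blocks2 k l al : l - 2 <= k -> mult al -> low (two (l - 2)) al ->
  T al (ps k) (ga l k) = sumZ (l - 2) (k - 1) (fun l' => T al (ph l') (ga l k)).
Proof.
move=> lk ma la; rewrite (Tri_telescope2 hpsi s0 s1 hv _ ma (ga_highm l k)); last by lia.
rewrite subrK (_ : T al (ps (l - 2)) (ga l k) = 0) ?subr0//.
apply: (Tri_vanish1 hpsi s0 s1 hv (two_gt0 (l - 2)) (two_gt0 (l - 2)) ma la (mps _) (@lowps _)).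
  exact: highm_mult (ga_highm l k).
by rewrite two_add (_ : l - 2 + 1 = l - 1); [exact: ga_high|lia].
Qed.

(** The second factor is localized by [Tri_blocks2] and the first is expanded down to block [a];
    what lies below [a] is the truncation error. *)
Lemma low_high_block k l a : l - 2 <= k -> a <= k ->
  T (mmul (ps (l - 2)) (ps k)) (ps k) (ga l k) =
  sumZ (l - 2) (k - 1) (fun l' => sumZ a (k - 1) (fun l'' => T (mmul (ps (l - 2)) (ph l'')) (ph l') (ga l k)))
  + T (mmul (ps (l - 2)) (ps a)) (ps k) (ga l k).
Proof.
move=> lk ak; have mm b := mult_mul (mps (l - 2)) (mps b).
have lw b : low (two (l - 2)) (mmul (ps (l - 2)) (ps b)) by apply: low_mull; exact: lowps.
rewrite (Tri_blocks2 lk (mm k) (lw k)) (Tri_blocks2 lk (mm a) (lw a)) -sumZD; apply: eq_sumZ => l' _.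
rewrite (Tri_telescope1 hpsi s0 s1 hv _ (mps _) (lph l') (ga_highm l k)); last by lia.
by rewrite !subrK.
Qed.

(** The complement of $\dot S_{l-2}$ within $\dot S_k$ is the sum of the blocks from $l-2$ to $k$;
    it stops there because $\dot S_{k+1}\dot S_k=\dot S_k$. *)
Lemma high_high_block k l : l - 2 <= k ->
  T (msub (ps k) (mmul (ps (l - 2)) (ps k))) (ps k) (ga l k) =
  sumZ (l - 2) k (fun m => T (mmul (ph m) (ps k)) (ps k) (ga l k)).
Proof.
move=> lk; under eq_sumZ do rewrite mmulC.
rewrite (Tri_telescope1 hpsi s0 s1 hv _ (mps _) (lps k) (ga_highm l k)); last by lia.
rewrite -(Tri_sub1 hpsi s0 s1 hv (mult_mul (mps _) (mps _)) (mult_mul (mps _) (mps _)) (lps k) (ga_highm l k)).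
suff -> : mmul (ps k) (ps (k + 1)) = ps k by rewrite (mmulC (ps k) (ps (l - 2))).
apply/funext => xi; rewrite /mmul; have [x|x] := leP (enorm xi) (two k).
  by rewrite (ps_one hpsi (k := k + 1)) ?mulr1// addrK.
by rewrite (ps_low hpsi x) mul0r.
Qed.

(** For a fixed block [m] the sum over [l] rebuilds $\tilde{\dot\Delta}_mu^k$: both multipliers have
    their upper cut-off at $m+3$, and both lower cut-offs are annihilated by [wh k]. *)
Lemma tilde_block k m al : k - 3 <= m <= k -> mult al ->
  sumZ (k - 1) (m + 2) (fun l => T al (ps k) (ga l k)) = T al (ps k) (mmul (ta m) (wh k)).
Proof.
move=> /andP[km mk] ma; rewrite (Tri_telescope3 hpsi s0 s1 hv k _ ma (lps k)); last by lia.
rewrite (ps_wh0 hpsi (lexx _)) (Tri_high0 hpsi s0 s1 hv ma (lps k)) subr0.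
suff -> : mmul (ta m) (wh k) = mmul (ps (m + 2 + 1)) (wh k) by [].
apply/funext => xi; rewrite taE /mmul /msub mulrBl (_ : m + 2 + 1 = m + 3); last by lia.
have /(congr1 (fun f => f xi)) := @ps_wh0 _ _ hpsi k (m - 2) ltac:(lia).
by rewrite /mmul => ->; rewrite subr0.
Qed.

Lemma Tri_blocks2h k h al be : h <= k -> mult al -> highm be ->
  T al (ps k) be = sumZ h (k - 1) (fun l => T al (ph l) be) + T al (ps h) be.
Proof.
move=> hk ma hb; rewrite (Tri_telescope2 hpsi s0 s1 hv _ ma hb); last by lia.
by rewrite !subrK.
Qed.

(** The bookkeeping of [decomposition] with abstract summands: [p] is the part with the first factor
    below $2^{l-2}$, [q] the remaining blocks, which are regrouped by block of the first factor. *)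
Lemma sumZ_paraproduct (V : zmodType) k (t p A e B f : int -> V) (q : int -> int -> V) :
  (forall l, k - 1 <= l <= k + 2 -> t l = p l + sumZ (l - 2) k (fun m => q m l)) ->
  (forall l, k - 1 <= l <= k + 2 -> p l = A l + e l) ->
  (forall m, k - 3 <= m <= k -> sumZ (k - 1) (m + 2) (q m) = B m + f m) ->
  sumZ (k - 1) (k + 2) t = sumZ (k - 1) (k + 2) A + sumZ (k - 1) (k + 2) e + (sumZ (k - 3) k B + sumZ (k - 3) k f).
Proof.
move=> ht hp hq; rewrite (@eq_sumZ _ _ _ t _ ht) sumZD sumZ_triangle.
by rewrite (@eq_sumZ _ _ _ p _ hp) sumZD (@eq_sumZ _ _ _ _ _ hq) sumZD.
Qed.

(** Bony's decomposition as an exact identity. The first factor is split into $\dot S_ku$ and $u^k$,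
    the third is localized at [l], and then $\dot S_ku$ is split once more at $2^{l-2}$. The final
    bracket collects what lies below the thresholds [a] and [h]. *)
Lemma decomposition k a h : a <= k -> h <= k ->
  T one (ps k) (wh k) =
    sumZ (k - 1) (k + 2) (fun l => sumZ (l - 2) (k - 1) (fun l' => sumZ a (k - 1) (fun l'' =>
      T (mmul (ps (l - 2)) (ph l'')) (ph l') (ga l k))))
  + sumZ (k - 3) k (fun m => sumZ h (k - 1) (fun l'' =>
      T (mmul (ph m) (ps k)) (ph l'') (mmul (ta m) (wh k))))
  + sumZ h (k - 1) (fun l'' => T (wh k) (ph l'') (wh k))
  + (sumZ (k - 1) (k + 2) (fun l => T (mmul (ps (l - 2)) (ps a)) (ps k) (ga l k))
  + sumZ (k - 3) k (fun m => T (mmul (ph m) (ps k)) (ps h) (mmul (ta m) (wh k)))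
  + T (wh k) (ps h) (wh k)).
Proof.
move=> ak hk.
have e1 : T one (ps k) (wh k) = T (ps k) (ps k) (wh k) + T (wh k) (ps k) (wh k).
  by rewrite [X in _ + X](Tri_sub1 hpsi s0 s1 hv mult_one (mps k) (lps k) (hwh k)) addrC subrK.
have hta m : highm (mmul (ta m) (wh k)).
  by apply: highm_mul (hwh k); rewrite taE; exact: mult_sub (mps _) (mps _).
rewrite e1 (Tri_blocks2h hk (highm_mult (hwh k)) (hwh k)).
rewrite (Tri_blocks3 (mps k) (@lowps k) (lps k) (@lowps k)).
have e2 l : k - 1 <= l <= k + 2 -> T (ps k) (ps k) (ga l k) =
    T (mmul (ps (l - 2)) (ps k)) (ps k) (ga l k) + sumZ (l - 2) k (fun m => T (mmul (ph m) (ps k)) (ps k) (ga l k)).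
  move=> lk; rewrite -(high_high_block (k := k) (l := l)); last by lia.
  rewrite (Tri_sub1 hpsi s0 s1 hv (mps k) (mult_mul (mps _) (mps _)) (lps k) (ga_highm l k)).
  by rewrite addrC subrK.
have e3 m : k - 3 <= m <= k -> sumZ (k - 1) (m + 2) (fun l => T (mmul (ph m) (ps k)) (ps k) (ga l k)) =
   sumZ h (k - 1) (fun l'' => T (mmul (ph m) (ps k)) (ph l'') (mmul (ta m) (wh k))) +
   T (mmul (ph m) (ps k)) (ps h) (mmul (ta m) (wh k)).
  move=> mk; rewrite (tilde_block mk (mult_mul (mph _) (mps _))).
  exact: (Tri_blocks2h hk (mult_mul (mph _) (mps _)) (hta m)).
have e4 l : k - 1 <= l <= k + 2 -> T (mmul (ps (l - 2)) (ps k)) (ps k) (ga l k) =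
  sumZ (l - 2) (k - 1) (fun l' => sumZ a (k - 1) (fun l'' => T (mmul (ps (l - 2)) (ph l'')) (ph l') (ga l k)))
  + T (mmul (ps (l - 2)) (ps a)) (ps k) (ga l k).
  by move=> lk; apply: low_high_block => //; lia.
move: e1 e2 e3 e4; move: (Tri v) => T0 _ e2 e3 e4; rewrite (sumZ_paraproduct e2 e4 e3).
have alg (x1 x2 x3 x4 x5 x6 : R[i]) : x1 + x2 + (x3 + x4) + (x5 + x6) = x1 + x3 + x5 + (x2 + x4 + x6) by ring.
exact: alg.
Qed.

(** With the second factor below $2^k$ and the third near $2^l$, the first must be near $2^l$ too:
    its part below $2^{l-2}$ is removed by [Tri_vanish1], the one above $2^{l+2}$ by [Tri_vanish3].
    For $l\le k+1$ the lower part is empty because of [wh k]. *)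
Lemma resonant_block k l be : k - 1 <= l -> lowm be -> low (two k) be ->
  T (mmul (ta l) (wh k)) be (ga l k) = T (wh k) be (ga l k).
Proof.
move=> kl lb lb'; have mw := highm_mult (hwh k); have hg := ga_highm l k.
have mlow : mult (mmul (ps (l - 2)) (wh k)) := mult_mul (mps _) mw.
have mhi : mult (mmul (ps (l + 3)) (wh k)) := mult_mul (mps _) mw.
have e : mmul (ta l) (wh k) = msub (mmul (ps (l + 3)) (wh k)) (mmul (ps (l - 2)) (wh k)).
  by apply/funext => xi; rewrite taE /mmul /msub mulrBl.
have z1 : T (mmul (ps (l - 2)) (wh k)) be (ga l k) = 0.
  have [lk|lk] := leP l (k + 1).
    have e0 : mmul (ps (l - 2)) (wh k) = msub (wh k) (wh k).
      by rewrite ps_wh0//; [apply/funext => xi; rewrite /msub subrr|lia].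
    by rewrite e0 (Tri_sub1 hpsi s0 s1 hv mw mw lb hg) subrr.
  apply: (Tri_vanish1 hpsi s0 s1 hv (two_gt0 (l - 2)) (two_gt0 (l - 2)) mlow _ (lowm_mult lb)).
  - by apply: low_mull; exact: lowps.
  - by apply: low_le lb'; apply: two_le; lia.
  - exact: highm_mult hg.
  - by rewrite two_add (_ : l - 2 + 1 = l - 1); [exact: ga_high|lia].
rewrite e (Tri_sub1 hpsi s0 s1 hv mhi mlow lb hg) z1 subr0.
apply/eqP; rewrite eq_sym -subr_eq0 -(Tri_sub1 hpsi s0 s1 hv mw mhi lb hg); apply/eqP.
apply: (Tri_vanish3 hpsi s0 s1 hv (two_gt0 (l + 1)) (two_gt0 (l + 1)) (mult_sub mw mhi) _ (lowm_mult lb) _ hg).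
- rewrite two_add; apply: (high_le _ (@wh_compl k (l + 3))); apply: two_le; lia.
- by apply: low_le lb'; apply: two_le; lia.
- exact: ga_low.
Qed.

Lemma resonant_sum k L be : k - 1 <= L -> lowm be -> low (two k) be ->
  sumZ (k - 1) L (fun l => T (mmul (ta l) (wh k)) be (ga l k)) = T (wh k) be (mmul (ps (L + 1)) (wh k)).
Proof.
move=> kL lb lb'; have mw := highm_mult (hwh k).
rewrite (@eq_sumZ _ _ _ _ (fun l => T (wh k) be (ga l k))); last first.
  by move=> l /andP[kl _]; exact: resonant_block.
rewrite (Tri_telescope3 hpsi s0 s1 hv k _ mw lb); last by lia.
by rewrite (ps_wh0 hpsi (lexx _)) (Tri_high0 hpsi s0 s1 hv mw lb) subr0.
Qed.

End paraproduct.

(** * Estimates *)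

Section series_of_fields.
Context {R : realType}.
Implicit Types (f g h F G H : cfield R) (x xi : R3 R).
Local Notation L1 := (cinteg (leb3 R)).
Local Notation cmeas3 := (cmeas (T := M3 R)).

(** Convergence is not assumed. By Cauchy's criterion the set [E] of convergence is measurable, and
    off [E] the operator [limn] returns the default value [point], which is a constant. *)
Lemma measurable_limn (F_ : nat -> M3 R -> R) : (forall n, measurable_fun setT (F_ n)) ->
  measurable_fun setT (fun x => limn (F_ ^~ x)).
Proof.
move=> mF; pose E := \bigcap_k \bigcup_n \bigcap_m [set x | `|F_ (n + m)%N x - F_ n x| <= harmonic k].
have mE : measurable E.
  apply: bigcapT_measurable => k; apply: bigcupT_measurable => n; apply: bigcapT_measurable => m.
  have mf : measurable_fun setT (fun x => `|F_ (n + m)%N x - F_ n x|).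
    by apply: (measurableT_comp (@normr_measurable R setT)); apply: measurable_funB; exact: mF.
  have := mf measurableT _ (measurable_itv `]-oo, harmonic k]); rewrite setTI.
  by congr measurable; apply/seteqP; split => x /=; rewrite in_itv.
have EP x : E x <-> cvgn (F_ ^~ x).
  split => [Ex|cF k _].
    apply: cauchy_cvg; apply: cauchy_exP => e e0.
    have [k ke] : exists k, harmonic k < e.
      have /cvgrPdist_lt/(_ _ e0)[k _ /(_ k (leqnn k))] := @cvg_harmonic R.
      by rewrite sub0r normrN ger0_norm ?(ltW (harmonic_gt0 k))// => ?; exists k.
    have [n _ hn] := Ex k I; exists (F_ n x); exists n => // m /= nm.
    rewrite -ball_normE /ball_ /= distrC; apply: le_lt_trans ke.
    by have /= := hn (m - n)%N I; rewrite subnKC.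
  have /cvgrPdist_lt/(_ (harmonic k / 2)) [|n _ hn] := cF; first by rewrite divr_gt0 ?harmonic_gt0.
  exists n => // m _ /=; have /= h1 := hn (n + m)%N (leq_addr _ _); have /= h2 := hn n (leqnn n).
  have := ler_distD (limn (F_ ^~ x)) (F_ (n + m)%N x) (F_ n x).
  by move: h1 h2; rewrite (distrC (F_ (n + m)%N x) (limn _)); set e := _^-1; lra.
have e (y : M3 R) : (fun n => \1_E y * F_ n y + (1 - \1_E y) * (point : R)) @ \oo --> limn (F_ ^~ y).
  have [Ey|Ey] := pselect (E y).
    rewrite indicE mem_set//=; under eq_fun do rewrite mul1r subrr mul0r addr0.
    exact/EP.
  rewrite indicE memNset//= (_ : limn (F_ ^~ y) = (point : R)); last first.
    by apply: dvgP => c; apply: Ey; apply/EP.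
  under eq_fun do rewrite mul0r subr0 mul1r add0r; exact: cvg_cst.
apply: (measurable_fun_cvg (h := fun n y => \1_E y * F_ n y + (1 - \1_E y) * (point : R))) => [n|y _].
  have mi : measurable_fun setT (\1_E : M3 R -> R) by exact: measurable_indic.
  by apply: measurable_funD; apply: measurable_funM => //; exact: measurable_funB.
exact: e.
Qed.

(** The pointwise sum in the encoding of [sumZ_ge], with real and imaginary parts treated
    separately. *)
Definition lim_sum (D : nat -> cfield R) : cfield R := fun x =>
  limn (fun n => complex.Re (\sum_(i < n) D i x) : R) +i* limn (fun n => complex.Im (\sum_(i < n) D i x) : R).

(** The geometric bound makes $\sum_n|D_n|$ integrable, hence finite almost everywhere; it dominates
    the partial sums and the limit. *)
Lemma series_Cint (D : nat -> cfield R) (c q : R) : 0 <= c -> 0 <= q < 1 -> (forall n, L1 (D n)) ->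
  (forall n, \int[leb3 R]_x (normc (D n x))%:E <= (c * q ^+ n)%:E)%E ->
  L1 (lim_sum D) /\
  (fun n => normc (\sum_(i < n) Cint (leb3 R) (D i) - Cint (leb3 R) (lim_sum D))) @ \oo --> (0 : R).
Proof.
move=> c0 /andP[q0 q1] iD hD.
have mD n : cmeas3 (D n) by case: (iD n).
have mn n : measurable_fun [set: M3 R] (fun x : M3 R => (normc (D n x))%:E).
  by apply/measurable_EFinP; exact: measurable_normc.
have n0 n x : (0 <= (normc (D n x))%:E)%E by rewrite lee_fin normc_ge0.
pose g (x : M3 R) : \bar R := (\sum_(0 <= i <oo) (normc (D i x))%:E)%E.
have mg : measurable_fun [set: M3 R] g by apply: ge0_emeasurable_sum => // k x _ _; exact: n0.
have g0 x : (0 <= g x)%E by apply: nneseries_ge0 => n _ _; exact: n0.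
have geom n : \sum_(i < n) c * q ^+ i <= c / (1 - q).
  rewrite -mulr_sumr ler_wpM2l//.
  have h : \sum_(i < n) q ^+ i * (1 - q) = 1 - q ^+ n.
    elim: n => [|n IH]; first by rewrite big_ord0 expr0 subrr.
    by rewrite big_ord_recr/= IH exprS; ring.
  by rewrite -[leRHS]div1r ler_pdivlMr ?subr_gt0// mulr_suml h gerBl exprn_ge0.
have Ig : (\int[leb3 R]_x g x <= (c / (1 - q))%:E)%E.
  rewrite /g integral_nneseries//; apply: lime_le.
    by apply: is_cvg_nneseries => n _ _; apply: integral_ge0 => x _; exact: n0.
  apply: nearW => n; apply: (@le_trans _ _ (\sum_(0 <= i < n) (c * q ^+ i)%:E)%E).
    by apply: lee_sum => i _; exact: hD.
  by rewrite sumEFin lee_fin big_mkord.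
have ig : (leb3 R).-integrable setT g.
  apply/integrableP; split => //; under eq_integral do rewrite gee0_abs//.
  exact: le_lt_trans Ig (ltry _).
have gae : {ae leb3 R, forall x, g x < +oo}%E.
  have := integrable_ae measurableT ig; apply: ae_imp => x /(_ I).
  by rewrite fin_numE ltey => /andP[_ ->].
have part n x : (g x < +oo)%E -> \sum_(i < n) normc (D i x) <= fine (g x).
  move=> gx; rewrite -lee_fin fineK ?ge0_fin_numE// -sumEFin -(big_mkord xpredT (fun i => (normc (D i x))%:E)).
  by apply: nneseries_lim_ge => i _ _; exact: n0.
have cvgRe x : (g x < +oo)%E -> cvgn (fun n => \sum_(i < n) complex.Re (D i x)).
  move=> gx; apply: (@series_cvg _ (fun i => _ (D i x)) (fine (g x))) => n; apply: le_trans (part n x gx).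
  by apply: ler_sum => i _; exact: Re_le_normc.
have cvgIm x : (g x < +oo)%E -> cvgn (fun n => \sum_(i < n) complex.Im (D i x)).
  move=> gx; apply: (@series_cvg _ (fun i => _ (D i x)) (fine (g x))) => n; apply: le_trans (part n x gx).
  by apply: ler_sum => i _; exact: Im_le_normc.
have ReS x n : complex.Re (\sum_(i < n) D i x) = \sum_(i < n) complex.Re (D i x).
  exact: (big_morph _ (fun a b => @cReD R a b)).
have ImS x n : complex.Im (\sum_(i < n) D i x) = \sum_(i < n) complex.Im (D i x).
  exact: (big_morph _ (fun a b => @cImD R a b)).
have mG : cmeas3 (lim_sum D).
  have mS n : cmeas3 (fun x => \sum_(i < n) D i x).
    by have [] := @cinteg_sum _ _ _ (leb3 R) _ (index_enum 'I_n) (fun i => D i) (fun i => iD i).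
  by split; apply: (@measurable_limn (fun n x => _)) => n; [exact: (mS n).1|exact: (mS n).2].
have cv x : (g x < +oo)%E -> (fun n => normc (\sum_(i < n) D i x - lim_sum D x)) @ \oo --> (0 : R).
  move=> gx; apply: cvg_normc; rewrite /lim_sum /=; under eq_fun do rewrite ?ReS ?ImS.
    exact: cvgRe.
  exact: cvgIm.
have bS x n : (g x < +oo)%E -> normc (\sum_(i < n) D i x) <= fine (g x).
  by move=> gx; apply: le_trans (part n x gx); exact: normc_sum.
have bG x : (g x < +oo)%E -> normc (lim_sum D x) <= fine (g x).
  move=> gx; apply/ler_addgt0Pr => e e0.
  have /cvgrPdist_lt/(_ _ e0)[n _ /(_ n (leqnn n))] := cv x gx.
  rewrite sub0r normrN ger0_norm ?normc_ge0// => h.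
  have := normcD (\sum_(i < n) D i x) (- (\sum_(i < n) D i x - lim_sum D x)).
  rewrite normcN opprB addrC subrK => h2; have := bS x n gx; lra.
have mfg : measurable_fun [set: M3 R] (fun x => fine (g x)).
  by apply: measurableT_comp mg; exact: fine_measurable.
have Ifg : (\int[leb3 R]_x (fine (g x))%:E < +oo)%E.
  rewrite (@ae_eq_integral _ _ _ _ _ g) => //.
  - exact: le_lt_trans Ig (ltry _).
  - exact/measurable_EFinP.
  - by move: gae; apply: ae_imp => x gx _; rewrite fineK// ge0_fin_numE.
have iG : L1 (lim_sum D).
  split => //; apply: le_lt_trans Ifg; apply: ae_ge0_le_integral => //.
  - by move=> x _; rewrite lee_fin normc_ge0.
  - by apply/measurable_EFinP; exact: measurable_normc.
  - by move=> x _; rewrite lee_fin fine_ge0.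
  - exact/measurable_EFinP.
  - by move: gae; apply: ae_imp => x gx _; rewrite lee_fin bG.
split => //; under eq_fun do rewrite -Cint_sum//.
apply: (@dominated_Cint _ _ _ (leb3 R) _ _ (fun x => 2 * fine (g x))) => //.
- by move=> n; apply: cinteg_sum.
- by apply: measurable_funM.
- under eq_integral do rewrite EFinM.
  rewrite ge0_integralZl//; last by move=> x _; rewrite lee_fin fine_ge0.
    by apply: lte_mul_pinfty => //; rewrite lee_fin.
  exact/measurable_EFinP.
- move: gae; apply: ae_imp => x gx n; apply: le_trans (normcD _ _) _; rewrite normcN.
  by have := bS x n gx; have := bG x gx; lra.
- by move: gae; apply: ae_imp => x gx; exact: cv.
Qed.

End series_of_fields.

(** * Size of the form and the tail of the energy *)

Section trilinear_bounds.
Context {R : realType}.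
Variable psi : R3 R -> R.
Hypothesis hpsi : lp_cutoff psi.
Variable s : R.
Hypotheses (s0 : 0 < s) (s1 : s < 1).
Variables (v : 'I_3 -> cfield R) (N : R).
Hypothesis hv : forall i, hs s (v i) N.
Implicit Types (k l a h : int) (xi : R3 R) (al be ga : R3 R -> R) (M r p q e : R).
Local Notation T := (Tri v).
Local Notation L1 := (cinteg (leb3 R)).

Lemma N_ge0 : 0 <= N. Proof. by have [_ []] := hv ord0. Qed.

(** 9 is the number of pairs of components. *)
Lemma Tri_le al be ga A : (forall i j, L1 (term v al be ga i j) /\
    (\int[leb3 R]_x (normc (term v al be ga i j x))%:E <= A%:E)%E) -> normc (T al be ga) <= 9 * A.
Proof.
move=> h; apply: le_trans (normc_sum _ _ _) _.
apply: (@le_trans _ _ (\sum_(i < 3) 3 * A)).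
  apply: ler_sum => i _; apply: le_trans (normc_sum _ _ _) _.
  apply: (@le_trans _ _ (\sum_(j < 3) A)).
    by apply: ler_sum => j _; have [i1 i2] := h i j; rewrite -lee_fin; exact: le_trans (normc_Cint_le1 i1) i2.
  by rewrite !big_ord_recl big_ord0; lra.
by rewrite !big_ord_recl big_ord0; lra.
Qed.

(* [L^2 * L^oo * L^2] and [L^oo * L^2 * L^2], by Bernstein's inequality for the
   low-frequency factors. *)
Lemma Tri_bounds : exists2 C : R, 0 <= C &
  (forall M r al be ga p q, mult al -> mb M be -> 0 < r -> low r be ->
    (forall j, l2 (sX v al j) p) -> mult ga -> (forall j, l2 (sX v ga j) q) ->
    forall i j, L1 (term v al be ga i j) /\
    (\int[leb3 R]_x (normc (term v al be ga i j x))%:E <= (C * (M * r `^ (5 / 2 - s)) * (p * q))%:E)%E) /\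
  (forall M M' r r' al be ga q, mb M al -> 0 < r -> low r al -> mb M' be -> 0 < r' -> low r' be ->
    mult ga -> (forall j, l2 (sX v ga j) q) ->
    normc (T al be ga) <= 9 * (C * (M * r `^ (3 / 2 - s)) * (M' * r' `^ (1 - s) * N * q))).
Proof.
have [C C0 hC] := low_bdd hpsi s0 s1 hv; have N0 := N_ge0.
exists (C * N); first exact: mulr_ge0.
split => [M r al be ga p q ma mbe r0 lb la mg lg i j|M M' r r' al be ga q ma r0 la mbe r'0 lb mg lg].
  have [_ /(_ j i) hY] := hC M r be mbe r0 lb.
  have mY : cmeas (T := M3 R) (Y v be j i) by apply: ift_cmeas; exact: (Y_low_l2 s1 hv j i mbe r0 lb).
  have A0 : 0 <= C * (M * r `^ (5 / 2 - s) * N).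
    by apply: mulr_ge0 => //; apply: mulr_ge0 => //; apply: mulr_ge0; [exact: mb_ge0 mbe|exact: powR_ge0].
  have [i1 i2] := bdd_l2_l2 mY A0 hY (ift_l2 hpsi (la j)) (ift_l2 hpsi (lg i)).
  have E : term v al be ga i j = (fun x => Y v be j i x * ift (sX v al j) x * ift (sX v ga i) x).
    by apply/funext => x; rewrite /term /X (mulrC (ift (sX v al j) x)).
  rewrite E; split; first exact: i1.
  by rewrite (_ : C * N * (M * r `^ (5 / 2 - s)) = C * (M * r `^ (5 / 2 - s) * N)); [exact: i2|ring].
rewrite (_ : C * N * (M * r `^ (3 / 2 - s)) = C * (M * r `^ (3 / 2 - s) * N)); last by ring.
apply: Tri_le => i j.
have [/(_ j) hX _] := hC M r al ma r0 la.
have mX : cmeas (T := M3 R) (X v al j) by apply: (X_cmeas hpsi s0 s1 hv); exists M.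
have A0 : 0 <= C * (M * r `^ (3 / 2 - s) * N).
  by apply: mulr_ge0 => //; apply: mulr_ge0 => //; apply: mulr_ge0; [exact: mb_ge0 ma|exact: powR_ge0].
exact: (bdd_l2_l2 mX A0 hX (ift_l2 hpsi (Y_low_l2 s1 hv j i mbe r'0 lb)) (ift_l2 hpsi (lg i))).
Qed.

(** A multiplier that vanishes up to frequency [n] does not see the truncation of [v] at [n], and
    what is left of [v] has small Sobolev norm. This is the small factor in the first error. *)
Lemma X_tail e : 0 < e -> exists n : nat, forall M r al, mb M al -> 0 < r -> n%:R <= r -> high r al ->
  forall j, l2 (sX v al j) (M * r `^ (- s) * e).
Proof.
move=> e0; have hj j : exists n, l2 (fun xi => (pw s xi)%:C * v j xi - trunc n (fun xi => (pw s xi)%:C * v j xi) xi) e.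
  by have [_ h] := hv j; exact: trunc_cvg h e0.
have [n_ hn] := choice hj; exists (\max_(j < 3) n_ j)%N => M r al ma r0 nr hal j.
pose v' j xi := v j xi - trunc (n_ j) (v j) xi.
have hv' i : hs s (v' i) e.
  have [mv _] := hv i; split; first by apply: cmeasB => //; exact: trunc_cmeas.
  rewrite (_ : (fun xi => _) = (fun xi => (pw s xi)%:C * v i xi - trunc (n_ i) (fun xi => (pw s xi)%:C * v i xi) xi)) //.
  by apply/funext => xi; rewrite /v' /trunc mulrBr; congr (_ - _); rewrite mulrCA.
have E : sX v al j = sX v' al j.
  apply/funext => xi; rewrite /sX /v' /trunc indicE.
  have [h|h] := leP (enorm xi) (n_ j)%:R.
    rewrite hal ?mul0r//; apply: (le_trans h); apply: le_trans nr.
    by rewrite ler_nat; exact: (leq_bigmax j).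
  by rewrite memNset ?mul0r ?subr0//= => h'; move: h; rewrite ltNge h'.
by rewrite E; exact: (X_high s0 hv').
Qed.

End trilinear_bounds.

(** * The truncation errors tend to 0 *)

Section error_terms.
Context {R : realType}.
Variable psi : R3 R -> R.
Hypothesis hpsi : lp_cutoff psi.
Variable s : R.
Hypotheses (s_gt : 1 / 2 < s) (s_lt : s < 5 / 6).
Variables (v : 'I_3 -> cfield R) (N : R).
Hypothesis hv : forall i, hs s (v i) N.
Implicit Types (k l a h : int) (xi : R3 R) (al be ga : R3 R -> R) (M r p q e : R).
Local Notation T := (Tri v).
Local Notation L1 := (cinteg (leb3 R)).
Local Notation ps := (ps psi).
Local Notation ph := (ph psi).
Local Notation wh := (wh psi).
Local Notation ta := (ta psi).

Let s0 : 0 < s. Proof. by move: s_gt; lra. Qed.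
Let s1 : s < 1. Proof. by move: s_lt; lra. Qed.

Lemma two_powR k (x : R) : two k `^ x = 2 `^ (k%:~R * x).
Proof. by rewrite powRrM powR_intmul. Qed.

Lemma ler_two_powR (x y : R) : x <= y -> 2 `^ x <= 2 `^ y :> R.
Proof. by apply: ler_powR; rewrite ler1n. Qed.

Lemma powR2D (x y : R) : 2 `^ x * 2 `^ y = 2 `^ (x + y) :> R.
Proof. by rewrite powRD//; apply/implyP => _; rewrite pnatr_eq0. Qed.

Lemma powR2_nat_cvg0 (c : R) : c < 0 -> (fun n : nat => (2 : R) `^ (n%:R * c)) @ \oo --> (0 : R).
Proof.
move=> c0; under eq_fun do rewrite mulrC powRrM powR_mulrn ?powR_ge0//.
apply: cvg_expr; rewrite ger0_norm ?powR_ge0// /powR pnatr_eq0/= expR_lt1.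
by rewrite nmulr_rlt0// ln_gt0// ltr1n.
Qed.

Lemma nat_lt_two (n : nat) : n%:R < two n%:Z :> R.
Proof. by rewrite /two -exprnP -natrX ltr_nat; exact: ltn_expl. Qed.

(** The three remainders of [decomposition] at the thresholds of the statement. *)
Definition err1 (n : nat) := let k : int := n%:Z in
  sumZ (k - 1) (k + 2) (fun l => T (mmul (ps (l - 2)) (ps (Num.floor (theta s * k%:~R)))) (ps k) (ga psi l k)).
Definition err2 (n : nat) := let k : int := n%:Z in
  sumZ (k - 3) k (fun m => T (mmul (ph m) (ps k)) (ps (Num.floor (k%:~R / 2 : R))) (mmul (ta m) (wh k))).
Definition err3 (n : nat) := let k : int := n%:Z in
  T (wh k) (ps (Num.floor (k%:~R / 2 : R))) (wh k).

Lemma normc_sum4 (z : int -> R[i]) (A : R) a b : b = a + 3 -> (forall l, a <= l <= b -> normc (z l) <= A) ->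
  normc (sumZ a b z) <= 4 * A.
Proof.
move=> ab h; rewrite (sumZ4 _ ab).
have h1 : normc (z a) <= A by apply: h; lia.
have h2 : normc (z (a + 1)) <= A by apply: h; lia.
have h3 : normc (z (a + 2)) <= A by apply: h; lia.
have h4 : normc (z (a + 3)) <= A by apply: h; lia.
have := normcD (z a + z (a + 1) + z (a + 2)) (z (a + 3)).
have := normcD (z a + z (a + 1)) (z (a + 2)).
have := normcD (z a) (z (a + 1)).
lra.
Qed.

(** The powers of $2^k$ are $\theta(\frac32-s)=2s-1$ from the sup norm, $1-s$ from the gradient and
    $-s$ from the high factor. They cancel exactly, so the convergence rests on [X_tail]. *)
Lemma cvg_err1 : (fun n => normc (err1 n)) @ \oo --> (0 : R).
Proof.
have [M M1 [bp bf bw]] := ps_bound hpsi; have M0 : 0 <= M by lra.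
have [C C0 [_ B]] := Tri_bounds hpsi s0 s1 hv; have N0 := N_ge0 hv.
(* 4 blocks, 9 components, and a last factor 4 bounding $2^{2s}$, as the high factor lives above
   $2^{k-2}$. *)
pose K := 4 * (9 * (C * (M * M) * (M * N * (2 * M * (2 * M) * 4)))).
have K0 : 0 <= K by rewrite !mulr_ge0.
apply/cvgrPdist_le => e e0; have e1 : 0 < e / (K + 1) by rewrite divr_gt0// ltr_wpDl.
(* [ga psi l k] lives above $2^{l-1}\ge2^{k-2}$, which exceeds [n0] as soon as $k\ge n_0+2$. *)
have [n0 hn0] := X_tail s0 hv e1; exists (n0 + 2)%N => // n /= nn.
rewrite sub0r normrN ger0_norm ?normc_ge0//; set k : int := n%:Z; set a := Num.floor (theta s * k%:~R).
suff h l : k - 1 <= l <= k + 2 -> normc (T (mmul (ps (l - 2)) (ps a)) (ps k) (ga psi l k)) <= K / 4 * (e / (K + 1)).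
  have kk : k + 2 = k - 1 + 3 by clear; lia.
  apply: (le_trans (normc_sum4 kk h)).
  rewrite (_ : 4 * (K / 4 * (e / (K + 1))) = e * K / (K + 1)); last by field; rewrite gt_eqF// ltr_wpDl.
  by rewrite ler_pdivrMr ?ltr_wpDl// ler_wpM2l ?(ltW e0)// lerDl.
move=> lk; have lk1 : k - 2 <= l - 1 by move: lk; clear; lia.
have nk : n0%:Z <= k - 2 by move: nn; rewrite /k; clear; lia.
have hhigh : high (two (k - 2)) (ga psi l k).
  by apply: (high_le _ (@ga_high _ _ hpsi l k)); exact: two_le.
have tn : n0%:R <= two (k - 2) :> R.
  by apply: le_trans (ltW (nat_lt_two n0)) _; exact: two_le.
have mg := mb_mul (bf l) (bw k).
have lg := hn0 _ _ _ mg (two_gt0 (k - 2)) tn hhigh.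
have lowa : low (two a) (mmul (ps (l - 2)) (ps a)).
  by rewrite mmulC; apply: low_mull; exact: (@ps_low _ _ hpsi a).
have := B _ _ _ _ _ _ _ _ (mb_mul (bp (l - 2)) (bp a)) (two_gt0 a) lowa (bp k) (two_gt0 k)
   (@ps_low _ _ hpsi k) (highm_mult (ga_highm hpsi l k)) lg.
move=> /le_trans; apply.
have t1 : two a `^ (3 / 2 - s) <= 2 `^ (k%:~R * (2 * s - 1)).
  rewrite two_powR; apply: ler_two_powR.
  apply: (@le_trans _ _ (theta s * k%:~R * (3 / 2 - s))).
    by apply: ler_wpM2r; [move: s_lt; lra|exact: floor_le].
  suff -> : theta s * k%:~R * (3 / 2 - s) = k%:~R * (2 * s - 1) by [].
    by rewrite /theta; field; move: s_lt => s_lt'; rewrite gt_eqF//; lra.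
have t3 : two (k - 2) `^ (- s) <= 4 * 2 `^ (k%:~R * (- s)).
  rewrite two_powR (_ : (4 : R) = 2 `^ 2); last by rewrite powR_mulrn// -natrX.
  by rewrite powR2D; apply: ler_two_powR; rewrite intrB; move: s1; set kk := k%:~R; nra.
have t2 : 2 `^ (k%:~R * (2 * s - 1)) * two k `^ (1 - s) * 2 `^ (k%:~R * (- s)) = 1.
  by rewrite two_powR !powR2D (_ : _ + _ = 0) ?powRr0//; ring.
have e2 := ltW e1; set E := e / (K + 1) in e2 *.
have := ler_pM (powR_ge0 _ _) (powR_ge0 _ _) t1 t3 => t4.
rewrite (_ : K / 4 * E = 9 * (C * (M * M) * (M * N * (2 * M * (2 * M) * 4))) * E *
   (2 `^ (k%:~R * (2 * s - 1)) * two k `^ (1 - s) * 2 `^ (k%:~R * (- s)))); last by rewrite t2 /K; field.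
set x := two a `^ _ in t4 *; set y := two (k - 2) `^ _ in t4 *; set z := two k `^ _.
set x' := 2 `^ _ in t4 *; set y' := 2 `^ _ in t4 *.
rewrite (_ : 9 * (C * (M * M * x) * (M * z * N * (2 * M * (2 * M) * y * E))) =
  9 * (C * (M * M) * (M * N * (2 * M * (2 * M)))) * E * z * (x * y)); last by ring.
rewrite (_ : 9 * (C * (M * M) * (M * N * (2 * M * (2 * M) * 4))) * E * (x' * z * y') =
  9 * (C * (M * M) * (M * N * (2 * M * (2 * M)))) * E * z * (x' * (4 * y'))); last by ring.
have z0 : 0 <= z by exact: powR_ge0.
by apply: ler_wpM2l t4; do ?[apply: mulr_ge0 => //].
Qed.

(** Two square integrable factors above $2^{k-4}$ and a bounded gradient below $2^{k/2}$ give the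
    exponent $\frac12(\frac52-s)-2s$. The bound $2^{k-4}$ accommodates the lowest block $m=k-3$ of
    the second error; each factor 16 bounds $2^{4s}$. *)
Lemma err23_bound : forall M', 0 <= M' -> exists2 K : R, 0 <= K & forall (n : nat) al ga, let k : int := n%:Z in
  mb M' al -> high (two (k - 4)) al -> mb M' ga -> high (two (k - 4)) ga ->
  normc (T al (ps (Num.floor (k%:~R / 2 : R))) ga) <= K * 2 `^ (n%:R * ((5 - 10 * s) / 4)).
Proof.
move=> M' M'0; have [M M1 [bp bf bw]] := ps_bound hpsi; have M0 : 0 <= M by lra.
have [C C0 [B _]] := Tri_bounds hpsi s0 s1 hv; have N0 := N_ge0 hv.
exists (9 * (C * M * (M' * N * 16 * (M' * N * 16)))); first by rewrite !mulr_ge0.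
move=> n al ga k ma ha mg hg; set h := Num.floor _.
have la j := X_high s0 hv j ma (two_gt0 (k - 4)) ha.
have lg j := X_high s0 hv j mg (two_gt0 (k - 4)) hg.
have mal : mult al by exists M'.
have mga : mult ga by exists M'.
apply: le_trans (Tri_le (B _ _ _ _ _ _ _ mal (bp h) (two_gt0 h) (@ps_low _ _ hpsi h) la mga lg)) _.
have t1 : two h `^ (5 / 2 - s) <= 2 `^ (k%:~R * (5 / 4 - s / 2)).
  rewrite two_powR; apply: ler_two_powR.
  apply: (@le_trans _ _ (k%:~R / 2 * (5 / 2 - s))).
    by apply: ler_wpM2r; [move: s_lt; lra|exact: floor_le].
  suff -> : k%:~R / 2 * (5 / 2 - s) = k%:~R * (5 / 4 - s / 2) by [].
    by field.
have t3 : two (k - 4) `^ (- s) <= 16 * 2 `^ (k%:~R * (- s)).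
  rewrite two_powR (_ : (16 : R) = 2 `^ 4); last by rewrite powR_mulrn// -natrX.
  by rewrite powR2D; apply: ler_two_powR; rewrite intrB; move: s1; set kk := k%:~R; nra.
have t2 : 2 `^ (n%:R * ((5 - 10 * s) / 4)) = 2 `^ (k%:~R * (5 / 4 - s / 2)) * (2 `^ (k%:~R * (- s)) * 2 `^ (k%:~R * (- s))).
  by rewrite !powR2D; congr (_ `^ _); rewrite /k -pmulrn; field.
have t4 := ler_pM (powR_ge0 _ _) (powR_ge0 _ _) t3 t3.
have t5 := ler_pM (powR_ge0 _ _) (mulr_ge0 (powR_ge0 _ _) (powR_ge0 _ _)) t1 t4.
rewrite t2; move: t5; set x := two h `^ _; set y := two (k - 4) `^ _; set x' := 2 `^ _; set y' := 2 `^ _ => t5.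
rewrite (_ : 9 * (C * (M * x) * (M' * y * N * (M' * y * N))) = 9 * (C * M * (M' * N * (M' * N))) * (x * (y * y))); last by ring.
rewrite [leRHS](_ : _ = 9 * (C * M * (M' * N * (M' * N))) * (x' * (16 * y' * (16 * y')))); last by ring.
by apply: ler_wpM2l t5; rewrite !mulr_ge0.
Qed.

Lemma cvg_err2 : (fun n => normc (err2 n)) @ \oo --> (0 : R).
Proof.
have [M M1 [bp bf bw]] := ps_bound hpsi; have M0 : 0 <= M by lra.
have mm : 1 <= M * M by rewrite -[leLHS]mulr1 ler_pM.
pose M' := (M + M) * (2 * M); have M'0 : 0 <= M' by rewrite !mulr_ge0// addr_ge0.
have [K K0 hK] := err23_bound M'0.
have c0 : (5 - 10 * s) / 4 < 0 by move: s_gt; lra.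
apply: (@cvg0_le _ _ (fun n => 4 * K * 2 `^ (n%:R * ((5 - 10 * s) / 4)))); last first.
  by rewrite -[X in _ --> X](mulr0 (4 * K)); apply: cvgMr; exact: powR2_nat_cvg0.
move=> n; apply/andP; split; first exact: normc_ge0.
rewrite -mulrA; apply: (@normc_sum4 _ _ (n%:Z - 3) n%:Z); first by clear; lia.
move=> m mk; have mk1 : n%:Z - 4 <= m - 1 by move: mk; clear; lia.
have nk : n%:Z - 4 <= n%:Z - 1 by clear; lia.
apply: hK.
- have [h1 h2] := mb_mul (bf m) (bp n%:Z); split => // xi; apply: (le_trans (h2 xi)).
  by rewrite /M'; nra.
- by apply: high_mull; apply: (high_le _ (@ph_high _ _ hpsi m)); exact: two_le.
- by apply: mb_mul (bw _); rewrite taE; exact: mb_sub.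
- by rewrite mmulC; apply: high_mull; apply: (high_le _ (@wh_high _ _ hpsi n%:Z)); exact: two_le.
Qed.

Lemma cvg_err3 : (fun n => normc (err3 n)) @ \oo --> (0 : R).
Proof.
have [M M1 [bp bf bw]] := ps_bound hpsi; have M0 : 0 <= 2 * M by lra.
have [K K0 hK] := err23_bound M0.
have c0 : (5 - 10 * s) / 4 < 0 by move: s_gt; lra.
apply: (@cvg0_le _ _ (fun n => K * 2 `^ (n%:R * ((5 - 10 * s) / 4)))); last first.
  by rewrite -[X in _ --> X](mulr0 K); apply: cvgMr; exact: powR2_nat_cvg0.
move=> n; apply/andP; split; first exact: normc_ge0.
have hw : high (two (n%:Z - 4)) (wh n%:Z).
  by apply: (high_le _ (@wh_high _ _ hpsi n%:Z)); apply: two_le; lia.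
exact: hK.
Qed.

End error_terms.

(** * Term-by-term integration of the infinite sum *)

Section resonant_term.
Context {R : realType}.
Variable psi : R3 R -> R.
Hypothesis hpsi : lp_cutoff psi.
Variable s : R.
Hypotheses (s0 : 0 < s) (s1 : s < 1).
Variables (v : 'I_3 -> cfield R) (N : R).
Hypothesis hv : forall i, hs s (v i) N.
Implicit Types (k l a h : int) (xi : R3 R) (al be ga : R3 R -> R) (M r p q e : R).
Local Notation T := (Tri v).
Local Notation L1 := (cinteg (leb3 R)).
Local Notation ps := (ps psi).
Local Notation ph := (ph psi).
Local Notation wh := (wh psi).
Local Notation ta := (ta psi).

Definition integrand al be ga : cfield R := fun x => \sum_(i < 3) \sum_(j < 3) term v al be ga i j x.

Lemma integrand_Cint al be ga : mult al -> lowm be -> highm ga ->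
  L1 (integrand al be ga) /\ Cint (leb3 R) (integrand al be ga) = T al be ga.
Proof.
move=> ma lb hg; have h i j := term_L1 hpsi s0 s1 hv i j ma lb hg.
have h1 i : L1 (fun x => \sum_(j < 3) term v al be ga i j x) by exact: cinteg_sum (h i).
split; first exact: cinteg_sum h1.
rewrite /integrand (Cint_sum _ h1); apply: eq_bigr => i _.
exact: (Cint_sum _ (h i)).
Qed.

Lemma integrand_le al be ga A : (forall i j, L1 (term v al be ga i j) /\
    (\int[leb3 R]_x (normc (term v al be ga i j x))%:E <= A%:E)%E) ->
  (\int[leb3 R]_x (normc (integrand al be ga x))%:E <= (9 * A)%:E)%E.
Proof.
move=> h; have mt i j : measurable_fun [set: M3 R] (fun x : M3 R => (normc (term v al be ga i j x))%:E).
  by apply/measurable_EFinP; apply: measurable_normc; have [[]] := h i j.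
have n0 i j x : (0 <= (normc (term v al be ga i j x))%:E)%E by rewrite lee_fin normc_ge0.
have mi : measurable_fun [set: M3 R] (fun x : M3 R => (normc (integrand al be ga x))%:E).
  apply/measurable_EFinP; apply: measurable_normc.
  have h1 i : L1 (fun x => \sum_(j < 3) term v al be ga i j x).
    by apply: cinteg_sum => j; have [] := h i j.
  by have [] := cinteg_sum (index_enum 'I_3) h1.
apply: (@le_trans _ _ (\int[leb3 R]_x (\sum_(i < 3) \sum_(j < 3) (normc (term v al be ga i j x))%:E))%E).
  apply: ge0_le_integral => //.
  - by move=> x _; rewrite lee_fin normc_ge0.
  - by apply: emeasurable_sum => i; apply: emeasurable_sum => j.
  - move=> x _; rewrite /integrand; under [leRHS]eq_bigr do rewrite sumEFin.
    rewrite sumEFin lee_fin; apply: le_trans (normc_sum _ _ _) _.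
    by apply: ler_sum => i _; exact: normc_sum.
rewrite ge0_integral_sum//; last 2 first.
- by move=> i; apply: emeasurable_sum => j.
- by move=> i x _; apply: sume_ge0 => j _; exact: n0.
apply: (@le_trans _ _ (\sum_(i < 3) (3 * A)%:E)%E).
  apply: lee_sum => i _; rewrite ge0_integral_sum//.
  apply: (@le_trans _ _ (\sum_(j < 3) A%:E)%E).
    by apply: lee_sum => j _; have [] := h i j.
  by rewrite sumEFin lee_fin !big_ord_recl big_ord0; lra.
by rewrite sumEFin lee_fin !big_ord_recl big_ord0; lra.
Qed.

Lemma two_addn k (n : nat) (x : R) : two (k + n%:Z) `^ x = two k `^ x * (2 `^ x) ^+ n.
Proof.
rewrite !two_powR intrD mulrDl -powR2D; suff -> : (2 : R) `^ (n%:~R * x) = (2 `^ x) ^+ n by [].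
by rewrite mulrC powRrM -pmulrn powR_mulrn// powR_ge0.
Qed.

Lemma powR2N_lt1 : 0 <= (2 : R) `^ (- s) < 1.
Proof.
apply/andP; split; first exact: powR_ge0.
by rewrite /powR pnatr_eq0/= expR_lt1 nmulr_rlt0 ?oppr_lt0// ln_gt0// ltr1n.
Qed.

(** Both high factors are square integrable and the third gains $2^{-s}$ with every step of [l], so
    the terms have geometric $L^1$ bounds and the series can be integrated term by term. The partial
    sums are known from [resonant_sum]. *)
Lemma resonant_series k be : lowm be -> low (two k) be ->
  let D := fun n : nat => integrand (mmul (ta (k - 1 + n%:Z)) (wh k)) be (ga psi (k - 1 + n%:Z) k) in
  L1 (lim_sum D) /\ Cint (leb3 R) (lim_sum D) = T (wh k) be (wh k).
Proof.
move=> lb lb' D; have [M M1 [bp bf bw]] := ps_bound hpsi; have M0 : 0 <= M by lra.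
have [C C0 [B _]] := Tri_bounds hpsi s0 s1 hv; have N0 := N_ge0 hv.
have [[Mb mbe] _] := lb; have Mb0 := mb_ge0 mbe.
have hw := highm_wh hpsi k; have mw := highm_mult hw.
have bt l : mb (2 * M) (ta l) by rewrite taE (_ : 2 * M = M + M); [exact: mb_sub|ring].
have hta l : mb (2 * M * (2 * M)) (mmul (ta l) (wh k)) by exact: mb_mul.
have hig l : high (two (k - 1)) (mmul (ta l) (wh k)).
  by rewrite mmulC; apply: high_mull; exact: wh_high.
have mta l : mult (mmul (ta l) (wh k)) by exists (2 * M * (2 * M)).
have la l j := X_high s0 hv j (hta l) (two_gt0 (k - 1)) (hig l).
have lg l j := X_high s0 hv j (mb_mul (bf l) (bw k)) (two_gt0 (l - 1)) (@ga_high _ _ hpsi l k).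
pose q := (2 : R) `^ (- s); have /andP[q0 q1] := powR2N_lt1.
pose A := C * (Mb * two k `^ (5 / 2 - s)) * (2 * M * (2 * M) * two (k - 1) `^ (- s) * N).
have A0 : 0 <= A by do ?[apply: mulr_ge0 => //]; exact: powR_ge0.
pose A' := 9 * (A * (2 * M * (2 * M) * two (k - 2) `^ (- s) * N)).
have A'0 : 0 <= A' by do ?[apply: mulr_ge0 => //]; exact: powR_ge0.
have iD n : L1 (D n).
  exact: (proj1 (integrand_Cint (mta _) lb (ga_highm hpsi _ k))).
have bD n : (\int[leb3 R]_x (normc (D n x))%:E <= (A' * q ^+ n)%:E)%E.
  have := integrand_le (B _ _ _ _ _ _ _ (mta (k - 1 + n%:Z)) mbe (two_gt0 k) lb' (la (k - 1 + n%:Z))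
    (highm_mult (ga_highm hpsi (k - 1 + n%:Z) k)) (lg (k - 1 + n%:Z))).
  have e : k - 1 + n%:Z - 1 = k - 2 + n%:Z by clear; lia.
  by rewrite e two_addn -/q /A' /A; set z := 9 * _; set z' := _ * q ^+ n; rewrite (_ : z = z')//; rewrite /z /z'; ring.
have [i1 i2] := series_Cint A'0 powR2N_lt1 iD bD.
split => //.
have mps l : mult (ps l) by exists M.
have hps l : highm (mmul (ps l) (wh k)) := highm_mul (mps l) hw.
have sumD n : \sum_(i < n.+1) Cint (leb3 R) (D i) = T (wh k) be (mmul (ps (k - 1 + n%:Z + 1)) (wh k)).
  rewrite -(resonant_sum hpsi s0 s1 hv _ lb lb'); last by clear; lia.
  rewrite (@sumZ_n _ _ _ n.+1); last by clear; lia.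
  by apply: eq_bigr => i _; exact: (proj2 (integrand_Cint (mta _) lb (ga_highm hpsi _ k))).
have c1 : (fun n => normc (\sum_(i < n.+1) Cint (leb3 R) (D i) - Cint (leb3 R) (lim_sum D))) @ \oo --> (0 : R).
  by have := i2; rewrite -(cvg_shiftS (fun n => normc (\sum_(i < n) Cint (leb3 R) (D i) - Cint (leb3 R) (lim_sum D)))).
(* The difference is the form with a third multiplier supported above $2^{k-1+n}$, again
   geometrically small. *)
have c2 : (fun n => normc (\sum_(i < n.+1) Cint (leb3 R) (D i) - T (wh k) be (wh k))) @ \oo --> (0 : R).
  pose A2 := 9 * (C * (Mb * two k `^ (5 / 2 - s)) * (2 * M * two (k - 1) `^ (- s) * N * ((2 * M + M * (2 * M)) * two (k - 1) `^ (- s) * N))).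
  apply: (@cvg0_le _ _ (fun n => A2 * q ^+ n)); last first.
    by rewrite -[X in _ --> X](mulr0 A2); apply: cvgMr; apply: cvg_expr; rewrite ger0_norm.
  move=> n; apply/andP; split; first exact: normc_ge0.
  rewrite sumD -normcN opprB -(Tri_sub3 hpsi s0 s1 hv mw lb hw (hps _)).
  set ga' := msub _ _; have mga : mb (2 * M + M * (2 * M)) ga' by exact: mb_sub (bw k) (mb_mul (bp _) (bw k)).
  have hga : high (two (k - 1 + n%:Z)) ga'.
    by rewrite /ga' (_ : k - 1 + n%:Z = k - 1 + n%:Z + 1 - 1); [rewrite subrK; exact: wh_compl|clear; lia].
  have mga' : mult ga' by exists (2 * M + M * (2 * M)).
  have la' j := X_high s0 hv j (bw k) (two_gt0 (k - 1)) (@wh_high _ _ hpsi k).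
  have lg' j := X_high s0 hv j mga (two_gt0 _) hga.
  apply: (le_trans (Tri_le (B _ _ _ _ _ _ _ mw mbe (two_gt0 k) lb' la' mga' lg'))).
  by rewrite two_addn -/q /A2; set z := 9 * _; set z' := _ * q ^+ n; rewrite (_ : z = z')//; rewrite /z /z'; ring.
exact: normc_cvg_unique c1 c2.
Qed.

Lemma cinteg_sumZ a b (F : int -> cfield R) : (forall l, a <= l <= b -> L1 (F l)) ->
  L1 (fun x => sumZ a b (fun l => F l x)) /\
  Cint (leb3 R) (fun x => sumZ a b (fun l => F l x)) = sumZ a b (fun l => Cint (leb3 R) (F l)).
Proof.
move=> hF; rewrite /sumZ; case E : (b - a + 1) => [n|n]; last first.
  by split; [exact: cinteg0|exact: Cint3_eq0].
have h (i : 'I_n) : L1 (F (a + i%:Z)) by apply: hF; move: E (ltn_ord i); clear; lia.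
by split; [exact: cinteg_sum h|exact: Cint_sum].
Qed.

End resonant_term.

(** * The Fourier transform of a weak solution *)

Section fourier_side.
Context {R : realType}.
Variable psi : R3 R -> R.
Hypothesis hpsi : lp_cutoff psi.
Variable s : R.
Hypotheses (s0 : 0 < s) (s1 : s < 1).
Variable u : vfunctional R.
Hypothesis hu : forall i, Hdot s (u i).
Implicit Types (k l a : int) (xi : R3 R) (h : cfield R) (i j : 'I_3) (al be ga : R3 R -> R) (M r p q e : R).
Local Notation L1 := (cinteg (leb3 R)).
Local Notation cmeas3 := (cmeas (T := M3 R)).

Definition uh i : cfield R := density (fourierD (u i)).

Lemma uh_represents i : represents (uh i) (fourierD (u i)).
Proof. by have [_ [g rg] _] := hu i; exact: density_represents rg. Qed.

Lemma uh_hs : exists N, forall i, hs s (uh i) N.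
Proof.
have h i : exists N, hs s (uh i) N.
  have [_ _ hn] := hu i; have [[m1 m2 _] _] := uh_represents i.
  have mu : cmeas3 (uh i) by split.
  have mp : cmeas3 (fun xi => (pw s xi)%:C * uh i xi).
    by apply: cmeasM mu; apply: cmeas_real; exact: measurable_pw.
  have Ioo : (\int[leb3 R]_xi (normc ((pw s xi)%:C * uh i xi) ^+ 2)%:E < +oo)%E.
    rewrite (_ : (fun xi => _) = (fun xi => (enorm xi `^ (2 * s) * normc (density (fourierD (u i)) xi) ^+ 2)%:E)); last first.
      apply/funext => xi; rewrite normcM normcC ger0_norm ?pw_ge0// exprMn /pw; congr (_ * _)%:E.
      by rewrite -powR_mulrn ?powR_ge0// -powRrM mulrC.
    by apply: lty_poweRy hn; rewrite invr_eq0 pnatr_eq0.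
  set I := (\int[leb3 R]_xi _)%E in Ioo; have I0 : (0 <= I)%E by apply: integral_ge0 => xi _; rewrite lee_fin sqr_ge0.
  exists (Num.sqrt (fine I)); split => //; split => //.
  by rewrite sqr_sqrtr ?fine_ge0// fineK// ge0_fin_numE.
have [N_ hN] := choice h; have N0 i : 0 <= N_ i by have [_ []] := hN i.
exists (\sum_(i < 3) N_ i) => i; have [mu lu] := hN i; split => //; apply: l2W lu.
by rewrite (bigD1 i)//= lerDl sumr_ge0.
Qed.

Lemma uh_sX i : sX uh (fun=> 1) i = uh i.
Proof. by apply/funext => xi; rewrite /sX mul1r. Qed.

Lemma uh_L1_l2 i : L1_l2 (uh i).
Proof. by have [N hN] := uh_hs; rewrite -uh_sX; exact: (X_L1_l2 s0 s1 hN i mult_one). Qed.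

Lemma uh_schwartz i h : schwartz h -> L1 (fun xi => uh i xi * h xi).
Proof.
move=> sh; have [p lh] := schwartz_l2 sh; have [mh _ _] := lh.
exact: L1_l2_Cint (uh_L1_l2 i) mh (schwartz_bdd sh) lh.
Qed.

(** [represents] only speaks of test functions. A Schwartz function is approximated by its cutoffs:
    the distribution converges by temperedness, the integral by domination. *)
Lemma uh_sym i : sym (u i) (uh i).
Proof.
move=> f sf; have sh := schwartz_ifourier sf; split; first exact: uh_schwartz.
have [tu _ _] := hu i; have [_ rep0] := uh_represents i.
have rep g : test_fun g -> u i (fourier g) = Cint (leb3 R) (fun xi => uh i xi * g xi) := rep0 g.
set h := ifourier f in sh *.
pose d n : cfield R := fun x => (cutoff psi n x - 1) * h x.
have vd : vanishing d := vanishing_cutoff hpsi sh.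
have [sd _] := vd.
have Ec n : Cint (leb3 R) (fun xi => uh i xi * (cutoff psi n xi * h xi)) =
    Cint (leb3 R) (fun xi => uh i xi * d n xi) + Cint (leb3 R) (fun xi => uh i xi * h xi).
  rewrite -CintD; [|exact: uh_schwartz (sd n)|exact: uh_schwartz sh].
  by apply: eq_Cint3 => xi; rewrite /d; ring.
have Tc n : u i (fourier (fun xi => cutoff psi n xi * h xi)) = u i (fourier (d n)) + u i f.
  have e : fourier (fun xi => cutoff psi n xi * h xi) = (fun x => 1 * fourier (d n) x + f x).
    rewrite (_ : f = fourier h); last by rewrite /h ifourierK.
    apply/funext => x; rewrite mul1r.
    rewrite !fourier_reflectE//; last by apply: test_schwartz; apply: (cutoffM_test hpsi); case: sh.
    rewrite -ifourier_add; last 2 first.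
    - by apply: schwartz_L1; apply: schwartz_reflect; exact: sd.
    - by apply: schwartz_L1; apply: schwartz_reflect.
    by congr (ifourier _ x); apply/funext => y; rewrite /d; ring.
  rewrite e (tu.1 1); [by rewrite mul1r|exact: schwartz_fourier (sd n)|exact: sf].
have cT : (fun n => normc (u i (fourier (d n)))) @ \oo --> (0 : R).
  exact: tempered_vanishing tu (vanishing_fourier vd).
have key n : u i (fourier (d n)) + u i f = Cint (leb3 R) (fun xi => uh i xi * d n xi) + Cint (leb3 R) (fun xi => uh i xi * h xi).
  by rewrite -Tc -Ec -rep//; apply: (cutoffM_test hpsi); case: sh.
have cC : (fun n => normc (Cint (leb3 R) (fun xi => uh i xi * d n xi))) @ \oo --> (0 : R).
  have [M M1 hM] := psi_bdd hpsi.
  have := @dominated3 R (fun n xi => uh i xi * d n xi) (fun=> 0) (fun xi => (M + 1) * normc (uh i xi * h xi)).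
  have c0 : Cint (leb3 R) (fun=> 0) = 0 := Cint3_eq0 (fun=> erefl).
  rewrite c0 => dom; suff : (fun n => normc (Cint (leb3 R) (fun xi => uh i xi * d n xi) - 0)) @ \oo --> (0 : R).
    by under eq_fun do rewrite subr0.
  apply: dom.
  - by move=> n; exact: uh_schwartz (sd n).
  - exact: cinteg0.
  - by apply: L1_realZ; apply: L1_normc; exact: uh_schwartz.
  - move=> x n; have -> : uh i x * d n x - 0 = (cutoff psi n x - 1) * (uh i x * h x) by rewrite subr0 /d mulrCA.
    rewrite (normcM (cutoff psi n x - 1)); apply: ler_wpM2r; first exact: normc_ge0.
    rewrite /cutoff; have /andP[h0 h1] := hM (harmonic n *: x).
    by apply: le_trans (normcD _ _) _; rewrite normcN normc1 normcC ger0_norm// lerD2r.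
  - move=> x; rewrite -[X in _ --> X](mul0r (normc (uh i x * h x))).
    by under eq_fun do rewrite subr0 /d mulrCA normcM; apply: cvgMl; exact: cvg_cutoff.
apply: (@normc_cvg_unique _ (fun n => u i (fourier (d n)) + u i f)).
  by under eq_fun do rewrite addrK.
by under eq_fun do rewrite key addrK.
Qed.

(** [U] is the field obtained from [u] by the Fourier multiplier [al]. *)
Definition symf (U : vfunctional R) al := forall i, sym (U i) (sX uh al i).

Lemma symf_u : symf u (fun=> 1).
Proof. by move=> i; rewrite uh_sX; exact: uh_sym. Qed.

Lemma sX_mmul al be i : sX uh (mmul al be) i = (fun xi => (al xi)%:C * sX uh be i xi).
Proof. by apply/funext => xi; rewrite /sX /mmul rmorphM mulrA. Qed.

Lemma symf_S k U al : symf U al -> symf (lpS psi k U) (mmul (ps psi k) al).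
Proof. by move=> h i; rewrite sX_mmul; exact: (sym_mul (ps_test hpsi k) (h i)). Qed.

Lemma symf_Delta k U al : symf U al -> symf (lpDelta psi k U) (mmul (ph psi k) al).
Proof. by move=> h i; rewrite sX_mmul; exact: (sym_mul (ph_test hpsi k) (h i)). Qed.

Lemma symf_High k U al : symf U al -> symf (lpHigh psi k U) (msub al (mmul (ps psi k) al)).
Proof.
move=> h i; rewrite (_ : sX uh _ i = (fun xi => sX uh al i xi - sX uh (mmul (ps psi k) al) i xi)).
  exact: sym_sub (h i) (symf_S k h i).
by apply/funext => xi; rewrite /sX /msub rmorphB mulrBl.
Qed.

Lemma symf_Tilde k U al : symf U al -> symf (lpTilde psi k U) (mmul (ta psi k) al).
Proof.
move=> h i; rewrite (_ : sX uh _ i = (fun xi => sumZ (k - 2) (k + 2) (fun l => sX uh (mmul (ph psi l) al) i xi))).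
  exact: sym_sumZ (fun l => symf_Delta l h i).
apply/funext => xi; rewrite /sX /mmul /ta /sumZ; case: (k + 2 - (k - 2) + 1) => n; last by rewrite !mul0r.
by rewrite mulr_suml rmorph_sum mulr_suml.
Qed.

Lemma symf_eq U al be : symf U al -> (forall xi, al xi = be xi) -> symf U be.
Proof. by move=> h /funext <-. Qed.

(** The two functions are equal at every point, by [sym_density]; so the integrands of the statement
    can be rewritten even inside the pointwise limit of [sumZ_ge]. *)
Lemma convectE U V W al be ga : symf U al -> symf V be -> symf W ga ->
  convect U V W = integrand uh al be ga.
Proof.
move=> hU hV hW; apply/funext => x; apply: eq_bigr => i _; apply: eq_bigr => j _.
by rewrite (sym_density (hU j)) (sym_density (sym_deriv j (hV i))) (sym_density (hW i)).
Qed.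

End fourier_side.

(** * Reality and incompressibility on the Fourier side *)

Section reality_incompressibility.
Context {R : realType}.
Variable psi : R3 R -> R.
Hypothesis hpsi : lp_cutoff psi.
Variable s : R.
Hypotheses (s0 : 0 < s) (s1 : s < 1).
Variable u : vfunctional R.
Hypothesis hu : forall i, Hdot s (u i).
Local Notation L1 := (cinteg (leb3 R)).
Local Notation cmeas3 := (cmeas (T := M3 R)).
Local Notation uh := (uh u).

(** $f+\bar f$ and $i(f-\bar f)$ are real, so [T] is real on both. *)
Lemma real_valued_conj (T : functional R) f : tempered T -> real_valued T -> schwartz f ->
  T (fun x => (f x)^*%C) = (T f)^*%C.
Proof.
move=> [lin _] re sf; have sc := schwartz_conj sf.
have s0' := @schwartz0 R.
have T0 : T (fun=> 0) = 0.
  have := lin 1 _ _ s0' s0'; rewrite (_ : (fun x => 1 * 0 + 0) = (fun=> 0)); last by apply/funext => x; rewrite mulr0 addr0.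
  by rewrite mul1r => /(congr1 (fun z => z - T (fun=> 0))); rewrite subrr addrK.
have TZ (z : R[i]) g : schwartz g -> T (fun x => z * g x) = z * T g.
  by move=> sg; have := lin z _ _ sg s0'; rewrite T0 addr0 => <-; congr T; apply/funext => x; rewrite addr0.
have e1 : T (fun x => 1 * f x + (f x)^*%C) = T f + T (fun x => (f x)^*%C) by rewrite lin// mul1r.
have e2 : T (fun x => ii * f x + - ii * (f x)^*%C) = ii * T f + - ii * T (fun x => (f x)^*%C).
  by rewrite lin//; [rewrite TZ|exact: schwartzZ].
have r1 : complex.Im (T (fun x => 1 * f x + (f x)^*%C)) = 0.
  apply: re => [|x]; first by apply: schwartzD => //; exact: schwartzZ.
  by case: (f x) => a b /=; ring.
have r2 : complex.Im (T (fun x => ii * f x + - ii * (f x)^*%C)) = 0.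
  apply: re => [|x]; first by apply: schwartzD; exact: schwartzZ.
  by case: (f x) => a b /=; ring.
move: r1 r2; rewrite e1 e2; case: (T f) => a b; case: (T _) => c d /= r1 r2.
apply: complex_eq => /=; lra.
Qed.

Lemma Cint_refl (f : cfield R) : L1 f -> Cint (leb3 R) (fun x => f (- x)) = Cint (leb3 R) f.
Proof.
have m1 : (-1 : R) != 0 by rewrite oppr_eq0 oner_neq0.
move=> /(@Cint_aff R (-1) 0 f m1); rewrite normrN normr1 expr1n invr1 mul1r => <-.
by apply: eq_Cint3 => x; rewrite addr0 scaleN1r.
Qed.

Lemma cmeas_refl (f : cfield R) : cmeas3 f -> cmeas3 (fun x => f (- x)).
Proof.
have m1 : (-1 : R) != 0 by rewrite oppr_eq0 oner_neq0.
by move=> /(cmeas_aff 0 m1); under eq_fun do rewrite addr0 scaleN1r.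
Qed.

(** This symmetry turns the bilinear product $\hat u_i(\xi)\hat u_i(-\xi)$ into $|\hat u_i(\xi)|^2$.
    It is proved by showing that both sides represent the same distribution. *)
Lemma uh_conj i : real_valued (u i) -> {ae leb3 R, forall xi, uh i (- xi) = (uh i xi)^*%C}.
Proof.
move=> re; have [tu _ _] := hu i; have rep := uh_represents hu i; have [N hN] := uh_hs hu.
have [mu _] := hN i.
pose G : cfield R := fun xi => (uh i (- xi))^*%C.
suff rG : represents G (fourierD (u i)).
  have := represents_ae hpsi rG rep; apply: ae_imp => xi <-; by rewrite /G conjcK.
have lG : locally_integrable3 G.
  have hG : hs s G N.
    have [mu' lu] := hN i; split; first by apply: cmeas_conj; exact: cmeas_refl.
    rewrite (_ : (fun xi => _) = (fun xi => ((pw s (- xi))%:C * uh i (- xi))^*%C)).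
      by apply: l2_conj; exact: (l2_reflect lu).
    by apply/funext => xi; rewrite conjcM conjc_real /pw enormN.
  have [C C0 hC] := hs_low s0 s1; apply: locint_bound => [|r]; first by have [] := hG.
  pose r' := Num.max r 1; have r'0 : 0 < r' by rewrite lt_max ltr01 orbT.
  pose al : R3 R -> R := \1_[set xi | enorm xi <= r'].
  have mal : cmeas3 (fun xi => (al xi)%:C) by apply: cmeas_real; apply: measurable_indic; exact: measurable_enorm_le.
  have h1 xi : normc (al xi)%:C <= 1 by rewrite normcC indic_norm.
  have h2 xi : r' < enorm xi -> (al xi)%:C = 0.
    by move=> h; rewrite /al indicE memNset//= => h'; move: h; rewrite ltNge h'.
  have [iG _] := hC _ _ 1 _ r' hG mal r'0 h1 h2.
  exists (fun xi => normc ((al xi)%:C * G xi)); split; first exact: L1_normc.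
  by move=> xi hx; rewrite /al indicE mem_set ?mul1r//= le_max hx.
split => // g tg; have sg := test_schwartz tg.
have sgr : schwartz (fun y => (g (- y))^*%C) by apply: schwartz_conj; exact: schwartz_reflect.
have sy f := uh_sym hpsi s0 s1 hu i (f := f).
have e : (fun x => (fourier (fun y => (g (- y))^*%C) x)^*%C) = fourier g.
  apply/funext => x; rewrite (fourier_reflectE sgr) conj_ifourier; last first.
    by apply: schwartz_L1; exact: schwartz_reflect sgr.
  rewrite (fourier_reflectE sg); congr (ifourier _ x); apply/funext => y.
  by rewrite conjcK opprK.
rewrite /fourierD -e real_valued_conj//; last exact: schwartz_fourier.
have [_ ->] := sy _ (schwartz_fourier sgr).
rewrite (fourierK sgr) -Cint_conj.
rewrite -(Cint_refl (f := fun xi => (uh i xi * (g (- xi))^*%C)^*%C)); last first.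
  by apply: cinteg_conj; exact: (uh_schwartz s0 s1 hu).
  by apply: eq_Cint3 => xi; rewrite conjcM conjcK opprK.
exact: (uh_schwartz s0 s1 hu).
Qed.

Lemma cvg_sum0 I (r : seq I) (a : I -> nat -> R) : (forall i, a i @ \oo --> (0 : R)) ->
  (fun n => \sum_(i <- r) a i n) @ \oo --> (0 : R).
Proof.
move=> h; elim: r => [|i r IH]; first by under eq_fun do rewrite big_nil; exact: cvg_cst.
rewrite -[X in _ --> X](addr0 (0 : R)); under eq_fun do rewrite big_cons; exact: cvgD.
Qed.

(** The divergence condition is first extended from test to Schwartz functions by cutoffs; applied
    to transforms of test functions it says that the locally integrable $i\xi\cdot\hat u$ vanishes
    as a distribution. *)
Lemma uh_div : div_free u -> {ae leb3 R, forall xi, \sum_(j < 3) (coord3 j xi)%:C * uh j xi = 0}.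
Proof.
move=> df.
have dfs h : schwartz h -> \sum_(j < 3) u j (pd j h) = 0.
  move=> sh; pose d n : cfield R := fun x => (cutoff psi n x - 1) * h x.
  have vd : vanishing d := vanishing_cutoff hpsi sh; have [sd _] := vd.
  have e n : \sum_(j < 3) u j (pd j (d n)) = - \sum_(j < 3) u j (pd j h).
    apply/eqP; rewrite -addr_eq0 -big_split/=; apply/eqP.
    rewrite -[RHS](df _ (cutoffM_test hpsi n (proj1 sh))); apply: eq_bigr => j _.
    have [[lin _] _ _] := hu j.
    have <- : (fun x => 1 * pd j (d n) x + pd j h x) = pd j (fun x => cutoff psi n x * h x).
      rewrite (_ : (fun x => cutoff psi n x * h x) = (fun x => d n x + h x)); last first.
        by apply/funext => x; rewrite /d; ring.
      have := @pdsD R [:: j] (d n) h (proj1 (sd n)) (proj1 sh) => /= ->.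
      by apply/funext => x; rewrite mul1r.
    by rewrite lin ?mul1r//; apply: schwartz_pd.
  have c1 : (fun n => normc (\sum_(j < 3) u j (pd j (d n)) - 0)) @ \oo --> (0 : R).
    apply: (@cvg0_le _ _ (fun n => \sum_(j < 3) normc (u j (pd j (d n))))).
      by move=> n; rewrite normc_ge0 subr0 normc_sum.
    apply: cvg_sum0 => j; have [tu _ _] := hu j.
    exact: tempered_vanishing tu (vanishing_pd j vd).
  have c2 : (fun n => normc (\sum_(j < 3) u j (pd j (d n)) - - \sum_(j < 3) u j (pd j h))) @ \oo --> (0 : R).
    by under eq_fun do rewrite e subrr normc0; exact: cvg_cst.
  by apply/eqP; rewrite -oppr_eq0 -(normc_cvg_unique c1 c2).
have [N hN] := uh_hs hu.
pose H : cfield R := fun xi => \sum_(j < 3) iximul j (uh j) xi.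
have lj j : locally_integrable3 (iximul j (uh j)).
  apply: locint_bound => [|r].
    have [mu _] := hN j; apply: cmeasM mu; apply: cmeasM; first exact: cmeas_cst.
    by apply: cmeas_real; exact: measurable_coord3.
  pose r' := Num.max r 1; have r'0 : 0 < r' by rewrite lt_max ltr01 orbT.
  pose al : R3 R -> R := \1_[set xi | enorm xi <= r'].
  have mal : mb 1 al by split => [|xi]; [apply: measurable_indic; exact: measurable_enorm_le|exact: indic_norm].
  have lal : low r' al by move=> xi h; rewrite /al indicE memNset//= => h'; move: h; rewrite ltNge h'.
  exists (fun xi => normc (sY uh al j j xi)); split.
    by apply: L1_normc; exact: (Y_low_L1 s0 s1 hN j j mal r'0 lal).
  move=> xi hx; suff -> : sY uh al j j xi = iximul j (uh j) xi by [].
  rewrite /sY /sX /iximul /al indicE mem_set ?mul1r//=.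
  by rewrite le_max hx.
have lH : locally_integrable3 H.
  rewrite /H (_ : (fun xi => _) = (fun xi => iximul 0 (uh 0) xi + (iximul 1 (uh 1) xi + iximul 2%:R (uh 2%:R) xi))).
    by apply: locintD => //; exact: locintD.
  by apply/funext => xi; rewrite !big_ord_recl big_ord0 addr0; do 2 congr (_ + _); congr (iximul _ (uh _) xi); apply: val_inj.
have := fundamental hpsi lH => h0.
have {h0}: {ae leb3 R, forall xi, H xi = 0}.
  apply: h0 => g tg; have sg := test_schwartz tg; have sf := schwartz_fourier sg.
  have key j : L1 (fun xi => iximul j (uh j) xi * g xi) /\
      - u j (pd j (fourier g)) = Cint (leb3 R) (fun xi => iximul j (uh j) xi * g xi).
    have := sym_deriv j (uh_sym hpsi s0 s1 hu j) sf; rewrite fourierK//.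
  rewrite (@eq_Cint3 R _ (fun xi => \sum_(j < 3) (iximul j (uh j) xi * g xi))); last first.
    by move=> xi; rewrite /H mulr_suml.
  rewrite (Cint_sum (index_enum 'I_3) (fun j => proj1 (key j))).
  transitivity (- \sum_(j < 3) u j (pd j (fourier g))); last by rewrite (dfs _ sf) oppr0.
  by rewrite -sumrN; apply: eq_bigr => j _; rewrite -(proj2 (key j)).
apply: ae_imp => xi; rewrite /H /iximul => h0.
have : ii * \sum_(j < 3) (coord3 j xi)%:C * uh j xi = 0 :> R[i].
  by rewrite -[RHS]h0 mulr_sumr; apply: eq_bigr => j _; rewrite mulrA.
by move/eqP; rewrite mulf_eq0 /ii eq_complex /= oner_eq0 andbF => /eqP.
Qed.

End reality_incompressibility.

(** * The energy balance *)

Section approximation.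
Context {R : realType}.
Implicit Types (f g h F G q : cfield R) (x xi : R3 R) (D : R3 R -> R) (p M r : R) (j l : 'I_3).
Local Notation L1 := (cinteg (leb3 R)).
Local Notation cmeas3 := (cmeas (T := M3 R)).
Local Notation eps n := (harmonic n : R).

Definition bl2 f := (exists p, l2 f p) /\ exists M, forall x, normc (f x) <= M.

Lemma bl2D f g : bl2 f -> bl2 g -> bl2 (fun x => f x + g x).
Proof.
move=> [[p lf] [M bf]] [[p' lg] [M' bg]]; split; first by exists (2 * (p + p')); exact: l2D.
by exists (M + M') => x; apply: le_trans (normcD _ _) _; exact: lerD.
Qed.

Lemma bl2Z (z : R[i]) f : bl2 f -> bl2 (fun x => z * f x).
Proof.
move=> [[p lf] [M bf]]; split; first by exists (normc z * p); exact: l2Z.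
by exists (normc z * M) => x; rewrite normcM ler_wpM2l ?normc_ge0.
Qed.

Lemma bl2_normc f : bl2 f -> bl2 (fun x => (normc (f x))%:C).
Proof.
move=> [[p lf] [M bf]]; have [mf _ _] := lf; split.
  exists p; apply: l2_le lf; first by apply: cmeas_real; exact: measurable_normc.
  by move=> x; rewrite normcC ger0_norm ?normc_ge0.
by exists M => x; rewrite normcC ger0_norm ?normc_ge0.
Qed.

Lemma bl2_sum I (s : seq I) (F : I -> cfield R) : (forall i, bl2 (F i)) -> bl2 (fun x => \sum_(i <- s) F i x).
Proof.
move=> h; elim: s => [|i s IH].
  rewrite (_ : (fun x => _) = (fun=> 0)); last by apply/funext => x; rewrite big_nil.
  split; last by exists 0 => x; rewrite normc0.
  exists 0; split => //.
  by under eq_integral do rewrite normc0 expr0n/=; rewrite integral0 expr0n.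
rewrite (_ : (fun x => _) = (fun x => F i x + \sum_(j <- s) F j x)); first exact: bl2D.
by apply/funext => x; rewrite big_cons.
Qed.

(** Pointwise convergence with one majorant in $L^2\cap L^\infty$: this passes to the limit against
    $u_ja$ with [a] in $L^2$, although $u_j$ is only in $L^\infty+L^2$. *)
Definition test_approx (g_ : nat -> cfield R) g := [/\ forall n, test_fun (g_ n), cmeas3 g, forall x, (fun n => normc (g_ n x - g x)) @ \oo --> (0 : R) &
  exists D, bl2 (fun x => (D x)%:C) /\ forall x, normc (g x) <= D x /\ forall n, normc (g_ n x) <= D x].

Lemma approx_bl2 (g_ : nat -> cfield R) g : test_approx g_ g -> bl2 g.
Proof.
move=> [_ mg _ [D [[[p lD] [M bD]] hD]]]; split.
  exists p; apply: (l2_le mg _ lD) => x; have [h _] := hD x.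
  by rewrite normcC ger0_norm//; exact: le_trans (normc_ge0 _) h.
exists M => x; have [h _] := hD x; apply: (le_trans h); apply: le_trans (bD x).
by rewrite normcC ler_norm.
Qed.

Lemma approxD (g_ h_ : nat -> cfield R) g h : test_approx g_ g -> test_approx h_ h -> test_approx (fun n x => g_ n x + h_ n x) (fun x => g x + h x).
Proof.
move=> [tg mg cg [D [bD hD]]] [th mh ch [D' [bD' hD']]]; split.
- by move=> n; exact: testD.
- exact: cmeasD.
- move=> x; apply: (@cvg0_le _ _ (fun n => normc (g_ n x - g x) + normc (h_ n x - h x))).
    move=> n; rewrite normc_ge0/= (_ : _ - _ = (g_ n x - g x) + (h_ n x - h x)); last by ring.
    exact: normcD.
  by rewrite -[X in _ --> X](addr0 (0 : R)); apply: cvgD.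
- exists (fun x => D x + D' x); split.
    by under eq_fun do rewrite rmorphD; exact: bl2D.
  move=> x; have [h1 h2] := hD x; have [h3 h4] := hD' x.
  by split => [|n]; apply: le_trans (normcD _ _) _; exact: lerD.
Qed.

Lemma approx_sum I (s : seq I) (F : I -> nat -> cfield R) (G : I -> cfield R) : (forall i, test_approx (F i) (G i)) ->
  test_approx (fun n x => \sum_(i <- s) F i n x) (fun x => \sum_(i <- s) G i x).
Proof.
move=> h; elim: s => [|i s IH].
  have -> : (fun (n : nat) (x : R3 R) => \sum_(i <- [::]) F i n x) = (fun _ _ => 0) by apply/funext => n; apply/funext => x; rewrite big_nil.
  have -> : (fun (x : R3 R) => \sum_(i <- [::]) G i x) = (fun _ => 0) by apply/funext => x; rewrite big_nil.
  split => [n||x|].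
  - split; first exact: smooth_cst.
    by exists 0.
  - exact: cmeas_cst.
  - by under eq_fun do rewrite subr0 normc0; exact: cvg_cst.
  - exists (fun=> 0); split; last by move=> x; rewrite normc0.
    by have := @bl2_sum I [::] G; under eq_fun do rewrite big_nil; apply => j; exact: approx_bl2 (h j).
have -> : (fun (n : nat) (x : R3 R) => \sum_(i <- i :: s) F i n x) = (fun n x => F i n x + \sum_(j <- s) F j n x).
  by apply/funext => n; apply/funext => x; rewrite big_cons.
have -> : (fun (x : R3 R) => \sum_(i <- i :: s) G i x) = (fun x => G i x + \sum_(j <- s) G j x).
  by apply/funext => x; rewrite big_cons.
exact: approxD.
Qed.

(** Disposes of the terms in which a derivative falls on the cutoff. *)
Lemma approx_eps (g_ : nat -> cfield R) g : test_approx g_ g -> test_approx (fun n x => (eps n)%:C * g_ n x) (fun=> 0).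
Proof.
move=> [tg mg cg [D [bD hD]]]; have D0 x : 0 <= D x by apply: le_trans (normc_ge0 (g x)) _; have [] := hD x.
have b n x : normc ((eps n)%:C * g_ n x) <= eps n * D x.
  rewrite normcM normcC ger0_norm ?(ltW (eps_gt0 n))//; apply: ler_wpM2l; first exact: ltW (eps_gt0 n).
  by have [_] := hD x.
split => [n||x|].
- exact: testZ.
- exact: cmeas_cst.
- apply: (@cvg0_le _ _ (fun n => eps n * D x)); first by move=> n; rewrite normc_ge0 subr0/=; exact: b.
  rewrite -[X in _ --> X](mul0r (D x)); apply: cvgMl; exact: cvg_harmonic.
- exists D; split => // x; split; first by rewrite normc0.
  by move=> n; apply: (le_trans (b n x)); rewrite -[leRHS]mul1r ler_wpM2r// eps_le1.
Qed.

Lemma test_continuous0 q x : test_fun q -> (fun n => normc (q (eps n *: x) - q 0)) @ \oo --> (0 : R).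
Proof.
move=> [sq _]; have [d1 d2] := sq [::] 0.
have c (a : R3 R -> R) : differentiable a (0 : R3 R) -> (fun n => a (eps n *: x)) @ \oo --> a 0.
  move=> /differentiable_continuous ca; apply: continuous_cvg; first exact: ca.
  rewrite -[X in _ --> X](scale0r x); apply: cvgZr_tmp; exact: cvg_harmonic.
exact: (@cvg_normc R (fun n => q (eps n *: x)) (q 0) (c _ d1) (c _ d2)).
Qed.

Lemma approx_dilate q f : test_fun q -> smooth f -> bl2 f ->
  test_approx (fun n x => q (eps n *: x) * f x) (fun x => q 0 * f x).
Proof.
move=> tq sf bf; have [[p lf] _] := bf; have [mf _ _] := lf.
have [M hM] := test_bounded tq; have M0 : 0 <= M := le_trans (normc_ge0 _) (hM 0).
split => [n||x|].
- apply: testM => //; have := @test_aff R (eps n) 0 q _ tq; under eq_fun do rewrite addr0.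
  by apply; rewrite gt_eqF// eps_gt0.
- by apply: cmeasM mf; exact: cmeas_cst.
- rewrite -[X in _ --> X](mul0r (normc (f x))); under eq_fun do rewrite -mulrBl normcM.
  by apply: cvgMl; exact: test_continuous0.
- exists (fun x => M * normc (f x)); split.
    by under eq_fun do rewrite rmorphM; apply: bl2Z; exact: bl2_normc.
  by move=> x; split => [|n]; rewrite normcM ler_wpM2r ?normc_ge0.
Qed.

Lemma pd_dilateM q f j n : test_fun q -> smooth f ->
  pd j (fun x => q (eps n *: x) * f x) =
  (fun x => (eps n)%:C * (pd j q (eps n *: x) * f x) + q (eps n *: x) * pd j f x).
Proof.
move=> [sq _] sf; have := @pds_dilate R [:: j] (eps n) q sq => /= h.
have sd : smooth (fun x => q (eps n *: x)).
  by have := @smooth_aff R (eps n) 0 q sq; under eq_fun do rewrite addr0.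
by rewrite pdME// h; apply/funext => x; rewrite expr1 mulrA.
Qed.

Lemma approx_pd q f j : test_fun q -> smooth f -> bl2 f -> bl2 (pd j f) ->
  test_approx (fun n => pd j (fun x => q (eps n *: x) * f x)) (fun x => q 0 * pd j f x).
Proof.
move=> tq sf bf bjf; rewrite (_ : (fun n => _) = (fun n x => (eps n)%:C * (pd j q (eps n *: x) * f x) + q (eps n *: x) * pd j f x)).
  rewrite (_ : (fun x => q 0 * _) = (fun x => 0 + q 0 * pd j f x)); last by apply/funext => x; rewrite add0r.
  apply: approxD; last by apply: approx_dilate => //; exact: smooth_pd.
  by apply: approx_eps; apply: approx_dilate => //; exact: test_pd.
by apply/funext => n; exact: pd_dilateM.
Qed.

Lemma approx_pd2 q f j l : test_fun q -> smooth f -> bl2 f -> bl2 (pd j f) -> bl2 (pd l f) -> bl2 (pd l (pd j f)) ->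
  test_approx (fun n => pd l (pd j (fun x => q (eps n *: x) * f x))) (fun x => q 0 * pd l (pd j f) x).
Proof.
move=> tq sf bf bjf blf bljf.
have tqn q' n : test_fun q' -> test_fun (fun x => q' (eps n *: x)).
  move=> tq'; have := @test_aff R (eps n) 0 q' _ tq'; under eq_fun do rewrite addr0.
  by apply; rewrite gt_eqF// eps_gt0.
rewrite (_ : (fun n => _) = (fun n x => (eps n)%:C * (pd l (fun x => pd j q (eps n *: x) * f x) x) +
    pd l (fun x => q (eps n *: x) * pd j f x) x)).
  rewrite (_ : (fun x => q 0 * _) = (fun x => 0 + q 0 * pd l (pd j f) x)); last by apply/funext => x; rewrite add0r.
  apply: approxD; last by apply: approx_pd => //; exact: smooth_pd.
  by apply: approx_eps; apply: approx_pd => //; exact: test_pd.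
apply/funext => n; rewrite pd_dilateM//.
have s1 : smooth (fun x => pd j q (eps n *: x) * f x).
  by apply: smoothM => //; have [] := tqn _ n (test_pd j tq).
have s2 : smooth (fun x => q (eps n *: x) * pd j f x).
  by apply: smoothM; [have [] := tqn _ n tq|exact: smooth_pd].
by rewrite pdDE//; [rewrite pdZE|exact: smoothZ].
Qed.

Lemma Cint_approx G (g_ : nat -> cfield R) g : test_approx g_ g -> cmeas3 G -> (forall h, bl2 h -> L1 (fun x => G x * h x)) ->
  (fun n => normc (Cint (leb3 R) (fun x => G x * g_ n x) - Cint (leb3 R) (fun x => G x * g x))) @ \oo --> (0 : R).
Proof.
move=> ag mG hG; have bg := approx_bl2 ag; have [tg mg cg [D [bD hD]]] := ag.
have D0 x : 0 <= D x by apply: le_trans (normc_ge0 (g x)) _; have [] := hD x.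
have iD := L1_realZ 2 (L1_normc (hG _ bD)).
apply: (@dominated3 R _ _ (fun x => 2 * normc (G x * (D x)%:C))) => //.
- move=> n; apply: hG; split; first by have [p lp] := test_l2 (tg n); exists p.
  exact: test_bounded.
- exact: hG.
- move=> x n; rewrite -mulrBr !normcM normcC ger0_norm// mulrCA; apply: ler_wpM2l; first exact: normc_ge0.
  have [h1 h2] := hD x; have h3 := h2 n; apply: le_trans (normcD _ _) _; rewrite normcN; lra.
- move=> x; rewrite -[X in _ --> X](mulr0 (normc (G x))); under eq_fun do rewrite -mulrBr normcM.
  by apply: cvgMr; exact: cg.
Qed.

Definition band F := (exists p, l2 F p) /\ exists r, forall xi, r < enorm xi -> F xi = 0.

Lemma band_L1 F : band F -> L1 F.
Proof.
move=> [[p lF] [r hr]]; pose n := (Num.trunc (Num.max r 0)).+1.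
rewrite (_ : F = trunc n F); first exact: trunc_L1 lF.
apply/funext => xi; rewrite /trunc indicE; have [h|h] := leP (enorm xi) n%:R.
  by rewrite mem_set ?mul1r.
rewrite hr ?mulr0//; apply: le_lt_trans h.
by apply: (@le_trans _ _ (Num.max r 0)); [rewrite le_max lexx|apply: ltW; exact: truncnS_gt].
Qed.

Lemma band_bounded F (m : cfield R) : band F -> cmeas3 m ->
  (forall r, exists M, forall xi, enorm xi <= r -> normc (m xi) <= M) -> band (fun xi => m xi * F xi).
Proof.
move=> [[p lF] [r hr]] mm hm; have [mF _ _] := lF; split; last by exists r => xi /hr ->; rewrite mulr0.
have [M hM] := hm r; exists (Num.max M 0 * p).
pose m' xi := (\1_[set xi | enorm xi <= r] xi)%:C * m xi.
rewrite (_ : (fun xi => _) = (fun xi => m' xi * F xi)).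
  apply: l2Mb => //; first by apply: cmeasM mm; apply: cmeas_real; apply: measurable_indic; exact: measurable_enorm_le.
  move=> xi; rewrite /m' indicE; have [h|h] := leP (enorm xi) r.
    by rewrite mem_set// mul1r le_max hM.
  rewrite memNset/=; last by move=> h'; move: h; rewrite ltNge h'.
  by rewrite mul0r normc0 le_max lexx orbT.
apply/funext => xi; rewrite /m' indicE; have [h|h] := leP (enorm xi) r.
  by rewrite mem_set// mul1r.
by rewrite hr ?mulr0.
Qed.

Lemma band_iximul j F : band F -> band (iximul j F).
Proof.
move=> bF; apply: band_bounded => //.
  by apply: cmeasM; [exact: cmeas_cst|exact: cmeas_coord].
move=> r; exists r => xi hx; rewrite normcM normc_ii mul1r normcC; apply: le_trans hx; exact: coord3_le.
Qed.

Lemma band_moment F : band F -> moment F.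
Proof.
move=> bF N; apply: band_L1; apply: band_bounded => //.
  by apply: cmeas_real; exact: measurable_wX.
move=> r; exists ((1 + r) ^+ N) => xi hx; rewrite normcC ger0_norm ?exprn_ge0 ?addr_ge0 ?enorm_ge0//.
by rewrite lerXn2r ?nnegrE ?addr_ge0 ?enorm_ge0 ?lerD2l//; exact: le_trans (enorm_ge0 _) hx.
Qed.

Lemma bl2_ifourier F : band F -> bl2 (ifourier F).
Proof.
move=> bF; have iF := band_L1 bF; have [[p lF] _] := bF; split; last exact: ifourier_bound.
by exists p; exact: ifourier_l2.
Qed.

Lemma band_smooth F : band F -> smooth (ifourier F).
Proof. by move=> bF; apply: smooth_ifourier; exact: band_moment. Qed.

Lemma band_pd j F : band F -> pd j (ifourier F) = ifourier (iximul j F).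
Proof. by move=> bF; apply: pd_ifourier; exact: band_moment. Qed.

End approximation.

(** * The convective and dissipative terms against test fields *)

Section transport_and_dissipation.
Context {R : realType}.
Variable psi : R3 R -> R.
Hypothesis hpsi : lp_cutoff psi.
Variable s : R.
Hypotheses (s0 : 0 < s) (s1 : s < 1).
Variable u : vfunctional R.
Hypothesis hu : forall i, Hdot s (u i).
Hypothesis hdiv : div_free u.
Variable N : R.
Hypothesis hN : forall i, hs s (uh u i) N.
Implicit Types (h F G phi : cfield R) (x xi : R3 R) (p M r : R) (i j l : 'I_3).
Local Notation L1 := (cinteg (leb3 R)).
Local Notation cmeas3 := (cmeas (T := M3 R)).
Local Notation uh := (uh u).
Local Notation U j := (ift (uh j)).

Lemma density_u j : density (u j) = U j.
Proof. exact: sym_density (uh_sym hpsi s0 s1 hu j). Qed.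

Lemma U_L1_l2 j : L1_l2 (uh j).
Proof. exact: (uh_L1_l2 s0 s1 hu). Qed.

Lemma U_test j g : test_fun g -> L1 (fun x => U j x * g x) /\ u j g = Cint (leb3 R) (fun x => U j x * g x).
Proof.
move=> tg; have [h1 [_ ->]] := L1_l2_pair hpsi (U_L1_l2 j) tg; split => //.
by have [] := uh_sym hpsi s0 s1 hu j (test_schwartz tg).
Qed.

(** The bounded part of $u_j$ uses the $L^2$ bounds of [a] and [h], its square integrable part uses
    [a] in $L^2$ and the sup bound of [h]. *)
Lemma U_pair j a h p : l2 a p -> bl2 h -> L1 (fun x => U j x * a x * h x).
Proof.
move=> la [[q lh] [M bh]].
have [F1 [F2 [t [h1 h2 ae]]]] := ift_decomp hpsi (U_L1_l2 j).
have [B hB] := ifourier_bound h1; have [ma _ _] := la; have [mh _ _] := lh.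
have hB' : {ae leb3 R, forall x, normc (ifourier F1 x) <= B} by exact: aeW.
have [i1 _] := bdd_l2_l2 (cmeas_ifourier h1) (le_trans (normc_ge0 _) (hB 0)) hB' la lh.
have bh' : {ae leb3 R, forall x, normc (h x) <= M} by exact: aeW.
have [i2 _] := bdd_l2_l2 mh (le_trans (normc_ge0 _) (bh 0)) bh' (ift_l2 hpsi h2) la.
have i3 := cintegD i1 i2; apply: (ae_cinteg i3).
  exact: (cmeasM (cmeasM (L1_l2_cmeas hpsi (U_L1_l2 j)) ma) mh).
by apply: ae_imp ae => x ->; rewrite !mulrDl; congr (_ + _); rewrite [RHS]mulrC mulrA mulrC mulrA mulrAC.
Qed.

Lemma div_test g : test_fun g -> \sum_(j < 3) Cint (leb3 R) (fun x => U j x * pd j g x) = 0.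
Proof.
move=> tg; rewrite -[RHS](hdiv tg); apply: eq_bigr => j _.
by have [_ ->] := U_test j (test_pd j tg).
Qed.

(** The divergence condition tested with the product of [z] and [phi]. *)
Lemma transport z phi : smooth z -> test_fun phi ->
  \sum_(j < 3) Cint (leb3 R) (fun x => U j x * z x * pd j phi x) =
  - \sum_(j < 3) Cint (leb3 R) (fun x => U j x * pd j z x * phi x).
Proof.
move=> sz tp; apply/eqP; rewrite -addr_eq0 -big_split/= -[X in _ == X](div_test (testMl sz tp)); apply/eqP.
apply: eq_bigr => j _.
have [i1 _] := U_test j (testMl sz (test_pd j tp)); have [i2 _] := U_test j (testMl (smooth_pd j sz) tp).
rewrite (pdME j sz (proj1 tp)).
rewrite (@eq_Cint3 R (fun x => U j x * z x * pd j phi x) (fun x => U j x * (z x * pd j phi x))); last by move=> x; rewrite mulrA.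
rewrite (@eq_Cint3 R (fun x => U j x * pd j z x * phi x) (fun x => U j x * (pd j z x * phi x))); last by move=> x; rewrite mulrA.
by rewrite -(Cint3D i1 i2); apply: eq_Cint3 => x; rewrite -mulrDr addrC.
Qed.

Lemma pw2 xi : pw (2 * s) xi = pw s xi * pw s xi.
Proof. by rewrite /pw mulrC powRrM powR_mulrn ?powR_ge0// expr2. Qed.

Lemma pw_opp (a : R) xi : pw a (- xi) = pw a xi. Proof. by rewrite /pw enormN. Qed.

Lemma pw_le1 xi : enorm xi <= 1 -> pw s xi <= 1.
Proof.
move=> h; rewrite /pw (_ : 1 = 1 `^ s); last by rewrite powR1.
apply: ge0_ler_powR => //; rewrite ?nnegrE ?enorm_ge0//; exact: ltW.
Qed.

Lemma pw_le_add xi : pw s xi <= 1 + enorm xi.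
Proof.
have [h|h] := leP (enorm xi) 1; first by apply: (le_trans (pw_le1 h)); rewrite lerDl enorm_ge0.
apply: (@le_trans _ _ (enorm xi)); last by rewrite lerDr.
rewrite -[leRHS]powRr1 ?enorm_ge0// /pw; apply: ler_powR; exact: ltW.
Qed.

Lemma schwartz_pw_l2 h : schwartz h -> exists p, l2 (fun xi => (pw s xi)%:C * h xi) p.
Proof.
move=> sh; have mh := schwartz_cmeas sh.
pose D xi : R := normc (h xi) + \sum_(l < 3) normc (iximul l h xi).
have [p lD] : exists p, l2 (fun xi => (D xi)%:C) p.
  have b g : schwartz g -> bl2 (fun xi => (normc (g xi))%:C).
    by move=> sg; apply: bl2_normc; split; [exact: schwartz_l2|exact: schwartz_bdd].
  have := bl2D (b _ sh) (bl2_sum (index_enum 'I_3) (fun l => b _ (schwartz_iximul l sh))).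
  by move=> [[p lp] _]; exists p; rewrite /D; under eq_fun do rewrite rmorphD rmorph_sum.
exists p; apply: l2_le lD.
  by apply: cmeasM mh; apply: cmeas_real; exact: measurable_pw.
have e xi l : normc (iximul l h xi) = `|coord3 l xi| * normc (h xi).
  by rewrite /iximul !normcM normc_ii mul1r normcC.
move=> xi; rewrite normcM !normcC ger0_norm ?pw_ge0//; apply: le_trans (ler_norm _).
apply: (@le_trans _ _ ((1 + enorm xi) * normc (h xi))).
  by rewrite ler_wpM2r ?normc_ge0 ?pw_le_add.
rewrite /D mulrDl mul1r lerD2l; under eq_bigr do rewrite e.
rewrite -mulr_suml ler_wpM2r ?normc_ge0//; apply: le_trans (enorm_le_sum xi) _.
by rewrite !big_ord_recl big_ord0 addr0 addrA le_eqVlt; apply/orP; left; apply/eqP; congr (`|coord3 _ xi| + `|coord3 _ xi| + `|coord3 _ xi|); apply: val_inj.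
Qed.

Lemma fourier_represents phi : test_fun phi -> represents (fourier phi) (fourierD (dist_of phi)).
Proof.
move=> tp; have sp := test_schwartz tp; have sf := schwartz_fourier sp.
split; first exact: L1_locint (schwartz_L1 sf).
move=> g tg; have sg := test_schwartz tg; rewrite /fourierD /dist_of.
have i1 := schwartz_L1 (schwartz_reflect sp); have i2 := schwartz_L1 (schwartz_reflect sg).
have iM : L1 (fun x => phi (- x) * ifourier g x).
  have [p lp] := schwartz_l2 (schwartz_reflect sp); have [q lq] := schwartz_l2 (schwartz_ifourier sg).
  by have [] := l2_mul lp lq.
transitivity (Cint (leb3 R) (fun x => phi (- x) * ifourier g x)).
  rewrite -[RHS](Cint_refl iM); apply: eq_Cint3 => x; rewrite opprK fourier_reflectE//.
  by rewrite ifourier_reflect//; exact: schwartz_L1.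
rewrite (ifourier_mult i1 (schwartz_L1 sg)); apply: eq_Cint3 => x.
by rewrite -fourier_reflectE// mulrC.
Qed.

Lemma fracLapE (T : functional R) :
  density (fracLap (s / 2) T) = ift (fun xi => (pw s xi)%:C * density (fourierD T) xi).
Proof. by rewrite /fracLap /ift /pw (_ : 2 * (s / 2) = s)//; field. Qed.

(** Parseval's identity; its reflection turns the transform of [phi] into [ifourier phi]. *)
Lemma dissipation_test i phi : test_fun phi ->
  L1 (fun x => density (fracLap (s / 2) (u i)) x * density (fracLap (s / 2) (dist_of phi)) x) /\
  Cint (leb3 R) (fun x => density (fracLap (s / 2) (u i)) x * density (fracLap (s / 2) (dist_of phi)) x) =
  Cint (leb3 R) (fun xi => (pw (2 * s) xi)%:C * uh i xi * ifourier phi xi).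
Proof.
move=> tp; have sp := test_schwartz tp; have sf := schwartz_fourier sp.
rewrite !fracLapE; have [mu lu] := hN i; have [p lf] := schwartz_pw_l2 sf.
have rp := fourier_represents tp.
have mD : cmeas3 (density (fourierD (dist_of phi))) by have [[m1 m2 _] _] := density_represents rp; split.
have mpw : cmeas3 (fun xi => (pw s xi)%:C) by apply: cmeas_real; exact: measurable_pw.
have lD : l2 (fun xi => (pw s xi)%:C * density (fourierD (dist_of phi)) xi) p.
  apply: l2_ae lf; first exact: cmeasM.
  by apply: ae_imp (density_ae hpsi rp) => xi ->.
split; first by have [] := l2_mul (ift_l2 hpsi lu) (ift_l2 hpsi lD).
set d := density (fourierD (dist_of phi)) in mD lD *.
rewrite (@eq_Cint3 R _ (fun x => ift (fun xi => (pw s xi)%:C * d xi) x * ift (fun xi => (pw s xi)%:C * uh i xi) x)); last first.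
  by move=> x; rewrite mulrC.
rewrite (parseval hpsi lD lu).
have [q li] := schwartz_pw_l2 (schwartz_ifourier sp).
have i1 : L1 (fun xi => (pw (2 * s) xi)%:C * uh i xi * ifourier phi xi).
  have [] := l2_mul lu li; rewrite (_ : (fun x => _ * _ * (_ * _)) = (fun xi => (pw (2 * s) xi)%:C * uh i xi * ifourier phi xi))//.
  by apply/funext => xi; rewrite pw2 rmorphM; ring.
have [_ [mu' _ _]] := (tt, l2_reflect lu).
rewrite -(Cint_refl i1); apply: ae_Cint.
- by apply: cmeasM; [exact: cmeasM|exact: mu'].
- by have [mi _] := i1; exact: cmeas_refl mi.
- by apply: ae_imp (density_ae hpsi rp) => xi; rewrite -/d => ->; rewrite fourierE !pw_opp pw2 rmorphM; ring.
Qed.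

Lemma cvgC_sum I (rr : seq I) (a : I -> nat -> R[i]) (A : I -> R[i]) :
  (forall i : I, (fun n => normc (a i n - A i)) @ \oo --> (0 : R)) ->
  (fun n => normc (\sum_(i <- rr) a i n - \sum_(i <- rr) A i)) @ \oo --> (0 : R).
Proof.
move=> h; apply: (@cvg0_le _ _ (fun n => \sum_(i <- rr) normc (a i n - A i))); last exact: cvg_sum0.
by move=> n; rewrite normc_ge0/= -sumrB normc_sum.
Qed.

Lemma cvgCB (a b : nat -> R[i]) (A B : R[i]) : (fun n => normc (a n - A)) @ \oo --> (0 : R) ->
  (fun n => normc (b n - B)) @ \oo --> (0 : R) -> (fun n => normc (a n - b n - (A - B))) @ \oo --> (0 : R).
Proof.
move=> ha hb; apply: (@cvg0_le _ _ (fun n => normc (a n - A) + normc (b n - B))).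
  move=> n; rewrite normc_ge0/= (_ : _ - (A - B) = (a n - A) + - (b n - B)); last by ring.
  by apply: le_trans (normcD _ _) _; rewrite normcN.
by rewrite -[X in _ --> X](addr0 (0 : R)); apply: cvgD.
Qed.

(* [|xi|^(2s) u^ = H1 + div H2] with square integrable [H1], [H2]. *)
Lemma dissipation_split i : exists H1 (H2 : 'I_3 -> cfield R), [/\ exists p, l2 H1 p, forall l, exists p, l2 (H2 l) p &
  forall xi, (pw (2 * s) xi)%:C * uh i xi = H1 xi + \sum_(l < 3) iximul l (H2 l) xi].
Proof.
pose I0 : R3 R -> R := \1_[set xi | enorm xi <= 1].
have I0E xi : (enorm xi <= 1 /\ I0 xi = 1) \/ (1 < enorm xi /\ I0 xi = 0).
  have [h|h] := leP (enorm xi) 1; [left|right]; rewrite /I0 indicE; first by rewrite mem_set.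
  by rewrite memNset//= => h'; move: h; rewrite ltNge h'.
have mI : measurable_fun [set: M3 R] (I0 : M3 R -> R) by apply: measurable_indic; exact: measurable_enorm_le.
(* Both multipliers are bounded by $|\xi|^s$: $|\xi|^{2s}\le|\xi|^s$ for $|\xi|\le1$, and
   $|\xi_l||\xi|^{2s-2}\le|\xi|^{2s-1}\le|\xi|^s$ for $|\xi|>1$ since $s<1$. *)
pose m1 xi : R := I0 xi * pw (2 * s) xi.
pose m2 l xi : R := - ((1 - I0 xi) * (coord3 l xi * pw (2 * s - 2) xi)).
have mm1 : cmeas3 (fun xi => (m1 xi)%:C).
  by apply: cmeas_real; apply: measurable_funM => //; exact: measurable_pw.
have mm2 l : cmeas3 (fun xi => (m2 l xi)%:C).
  apply: cmeas_real; apply: measurableT_comp => //; apply: measurable_funM; first exact: measurable_funB.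
  by apply: measurable_funM; [exact: measurable_coord3|exact: measurable_pw].
have b1 xi : normc (m1 xi)%:C <= 1 * pw s xi.
  rewrite normcC mul1r /m1; have [[h ->]|[h ->]] := I0E xi; last by rewrite mul0r normr0 pw_ge0.
  rewrite mul1r ger0_norm ?pw_ge0// pw2 -[leRHS]mul1r ler_wpM2r ?pw_ge0//; exact: pw_le1.
have b2 l xi : normc (m2 l xi)%:C <= 1 * pw s xi.
  rewrite normcC mul1r /m2 normrN; have [[h ->]|[h ->]] := I0E xi.
    by rewrite subrr mul0r normr0 pw_ge0.
  rewrite subr0 mul1r normrM [`|pw _ _|]ger0_norm ?pw_ge0//.
  apply: (@le_trans _ _ (enorm xi * pw (2 * s - 2) xi)).
    by rewrite ler_wpM2r ?pw_ge0// coord3_le.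
  rewrite -{1}[enorm xi]powRr1 ?enorm_ge0// /pw -powRD; last by apply/implyP => _; rewrite gt_eqF// (lt_trans ltr01).
  by apply: ler_powR; [exact: ltW|move: s1; lra].
exists (fun xi => (m1 xi)%:C * uh i xi), (fun l xi => (ii * (m2 l xi)%:C) * uh i xi); split.
- by exists (1 * N); exact: (hs_weight (hN i) mm1).
- move=> l; exists (1 * N); apply: (hs_weight (hN i)) => //; first by apply: cmeasM => //; exact: cmeas_cst.
  by move=> xi; rewrite normcM normc_ii mul1r.
- move=> xi; rewrite /iximul.
  have E l : ii * (coord3 l xi)%:C * (ii * (m2 l xi)%:C * uh i xi) =
     ((1 - I0 xi) * (coord3 l xi * coord3 l xi * pw (2 * s - 2) xi))%:C * uh i xi.
    have i2 : ii * ii = -1 :> R[i] by rewrite /ii; apply: complex_eq => /=; ring.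
    rewrite (_ : ii * (coord3 l xi)%:C * (ii * (m2 l xi)%:C * uh i xi) = ii * ii * ((coord3 l xi)%:C * (m2 l xi)%:C) * uh i xi); last by ring.
    by rewrite i2 -rmorphM mulN1r -rmorphN /m2; congr (_%:C * _); ring.
  under eq_bigr do rewrite E.
  rewrite -mulr_suml -rmorph_sum -mulrDl -rmorphD /=; congr (_%:C * _).
  rewrite -mulr_sumr -mulr_suml (_ : \sum_(l < 3) coord3 l xi * coord3 l xi = enorm xi ^+ 2); last by rewrite enorm_sqr.
  rewrite /m1; have [[h ->]|[h ->]] := I0E xi; first by rewrite subrr mul0r addr0 mul1r.
  rewrite mul0r add0r subr0 mul1r -powR_mulrn ?enorm_ge0// /pw -powRD; last by apply/implyP => _; rewrite gt_eqF// (lt_trans ltr01).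
  by congr (_ `^ _); ring.
Qed.

(** By [dissipation_split] the pairing only involves [p_ n] and its first derivatives against square
    integrable functions, and these are what the hypotheses control. *)
Lemma cvg_dissipation i (p_ : nat -> cfield R) F : band F -> test_approx p_ (ifourier F) ->
  (forall l, test_approx (fun n => pd l (p_ n)) (pd l (ifourier F))) ->
  (fun n => normc (Cint (leb3 R) (fun xi => (pw (2 * s) xi)%:C * uh i xi * ifourier (p_ n) xi) -
     Cint (leb3 R) (fun xi => (pw (2 * s) xi)%:C * uh i xi * F (- xi)))) @ \oo --> (0 : R).
Proof.
move=> bF ap apl; have [H1 [H2 [[p l1] l2' E]]] := dissipation_split i.
have tp n : test_fun (p_ n) by case: ap.
have pairing H q h : l2 H q -> bl2 h -> L1 (fun x => ift H x * h x).
  by move=> lH [[q' lh] _]; have [] := l2_mul (ift_l2 hpsi lH) lh.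
have key h : (exists q, l2 h q) -> (forall l, exists q, l2 (iximul l h) q) ->
    Cint (leb3 R) (fun xi => (pw (2 * s) xi)%:C * uh i xi * h xi) =
    Cint (leb3 R) (fun xi => H1 xi * h xi) + \sum_(l < 3) Cint (leb3 R) (fun xi => H2 l xi * iximul l h xi).
  move=> [q lh] lih.
  have i1 := proj1 (l2_mul l1 lh).
  have i2 l : L1 (fun xi => H2 l xi * iximul l h xi).
    by have [q1 h1] := l2' l; have [q2 h2] := lih l; have [] := l2_mul h1 h2.
  rewrite -(Cint_sum (index_enum 'I_3) i2) -(Cint3D i1 (cinteg_sum (index_enum 'I_3) i2)).
  apply: eq_Cint3 => xi; rewrite E mulrDl mulr_suml; congr (_ + _); apply: eq_bigr => l _.
  by rewrite /iximul; ring.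
have En n : Cint (leb3 R) (fun xi => (pw (2 * s) xi)%:C * uh i xi * ifourier (p_ n) xi) =
    Cint (leb3 R) (fun x => ift H1 x * p_ n x) - \sum_(l < 3) Cint (leb3 R) (fun x => ift (H2 l) x * pd l (p_ n) x).
  have sp := test_schwartz (tp n); have sf := schwartz_ifourier sp.
  rewrite key; [|exact: schwartz_l2|by move=> l; apply: schwartz_l2; exact: schwartz_iximul].
  have [q lq] := test_l2 (tp n); rewrite (ift_Cint hpsi l1 (schwartz_L1 sp) lq) -sumrN; congr (_ + _).
  apply: eq_bigr => l _; have spl := schwartz_pd l sp; have [q' lq'] := schwartz_l2 spl; have [q2 h2] := l2' l.
  rewrite (ift_Cint hpsi h2 (schwartz_L1 spl) lq').
  have i3 : L1 (fun xi => H2 l xi * ifourier (pd l (p_ n)) xi).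
    by have [q3 l3] := schwartz_l2 (schwartz_ifourier spl); have [] := l2_mul h2 l3.
  rewrite -(Cint3N i3); apply: eq_Cint3 => xi; rewrite (ifourier_pd l xi sp) /iximul; ring.
have EF : Cint (leb3 R) (fun xi => (pw (2 * s) xi)%:C * uh i xi * F (- xi)) =
    Cint (leb3 R) (fun x => ift H1 x * ifourier F x) - \sum_(l < 3) Cint (leb3 R) (fun x => ift (H2 l) x * pd l (ifourier F) x).
  have [[q lF] _] := bF.
  have pv H q1 G : l2 H q1 -> band G -> Cint (leb3 R) (fun x => ift H x * ifourier G x) = Cint (leb3 R) (fun xi => H xi * G (- xi)).
    move=> lH bG; have [[q2 lG] _] := bG; rewrite -(parseval hpsi lH lG).
    have iG := band_L1 bG.
    apply: ae_Cint; [by apply: cmeasM; [exact: ift_cmeas lH|exact: cmeas_ifourier]|by apply: cmeasM; [exact: ift_cmeas lH|exact: ift_cmeas lG]|].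
    by apply: ae_imp (ift_L1 hpsi iG) => x ->.
  have e2 l xi : iximul l (fun xi => F (- xi)) xi = - iximul l F (- xi).
    by rewrite /iximul coord3N rmorphN; ring.
  rewrite key; last 2 first.
  - by exists q; exact: l2_reflect.
  - move=> l; have [[q' lF'] _] := band_iximul l bF; exists q'; have := l2N (l2_reflect lF').
    by under eq_fun do rewrite -e2.
  rewrite (pv _ _ _ l1 bF) -sumrN; congr (_ + _); apply: eq_bigr => l _.
  have [q2 h2] := l2' l; rewrite band_pd// (pv _ _ _ h2 (band_iximul l bF)).
  have i3 : L1 (fun xi => H2 l xi * iximul l F (- xi)).
    by have [[q' lF'] _] := band_iximul l bF; have [] := l2_mul h2 (l2_reflect lF').
  by rewrite -(Cint3N i3); apply: eq_Cint3 => xi; rewrite e2 mulrN.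
rewrite EF; under eq_fun do rewrite En.
apply: cvgCB.
  by apply: Cint_approx => //; [exact: ift_cmeas l1|move=> h bh; exact: pairing l1 bh].
apply: cvgC_sum => l; have [q2 h2] := l2' l.
by apply: Cint_approx => //; [exact: ift_cmeas h2|move=> h bh; exact: pairing h2 bh].
Qed.

End transport_and_dissipation.

(** * Testing the equation with localized fields *)

Section energy_balance.
Context {R : realType}.
Variable psi : R3 R -> R.
Hypothesis hpsi : lp_cutoff psi.
Variable s : R.
Hypotheses (s0 : 0 < s) (s1 : s < 1).
Variable u : vfunctional R.
Hypothesis hu : forall i, Hdot s (u i).
Hypothesis hdiv : div_free u.
Variable N : R.
Hypothesis hN : forall i, hs s (uh u i) N.
Variable P : functional R.
Hypothesis tP : tempered P.
Hypothesis hmom : forall phi : 'I_3 -> cfield R, (forall i, test_fun (phi i)) -> momentum_eq s u P phi.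
Implicit Types (h F G : cfield R) (x xi : R3 R) (p M r : R) (i j : 'I_3) (al be ga : R3 R -> R).
Local Notation L1 := (cinteg (leb3 R)).
Local Notation cmeas3 := (cmeas (T := M3 R)).
Local Notation uh := (uh u).
Local Notation U j := (ift (uh j)).
Local Notation T := (Tri uh).
Local Notation one := (fun _ : R3 R => 1 : R).

Lemma X_one j : X uh one j = U j.
Proof. by rewrite /X uh_sX. Qed.

(** The pressure disappears because [phi] is exactly divergence free. [b] and [z] stand for the
    high- and low-frequency parts of [u]: in the product with the smooth [z] the derivative is moved
    off [phi], so that only the gradient of [z], and not [z] itself, remains. *)
Lemma momentum_test (phi : 'I_3 -> cfield R) (b : 'I_3 -> cfield R) (z : 'I_3 -> cfield R) :
  (forall i, test_fun (phi i)) -> (forall x, \sum_(j < 3) pd j (phi j) x = 0) ->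
  (forall i, exists p, l2 (b i) p) -> (forall i, smooth (z i)) ->
  (forall i, {ae leb3 R, forall x, U i x = b i x + z i x}) ->
  \sum_(i < 3) Cint (leb3 R) (fun xi => (pw (2 * s) xi)%:C * uh i xi * ifourier (phi i) xi) =
  \sum_(i < 3) \sum_(j < 3) Cint (leb3 R) (fun x => U j x * b i x * pd j (phi i) x) -
  \sum_(i < 3) \sum_(j < 3) Cint (leb3 R) (fun x => U j x * pd j (z i) x * phi i x).
Proof.
move=> tp dp lb sz Ub; have hm := hmom tp.
have D i := dissipation_test hpsi s0 s1 hN i (tp i).
have P0 : P (fun x => \sum_(j < 3) pd j (phi j) x) = 0.
  have -> : (fun x => \sum_(j < 3) pd j (phi j) x) = (fun=> 0) by apply/funext.
  have s0' := @schwartz0 R; have := tP.1 1 _ _ s0' s0'.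
  rewrite (_ : (fun x : R3 R => 1 * 0 + 0) = (fun=> 0)); last by apply/funext => x; rewrite mulr0 addr0.
  by rewrite mul1r => /(congr1 (fun z => z - P (fun=> 0))); rewrite subrr addrK.
have bpd i j : bl2 (pd j (phi i)).
  have tpd := test_pd j (tp i); split; [exact: test_l2|exact: test_bounded].
have mU j : cmeas3 (U j) := L1_l2_cmeas hpsi (U_L1_l2 s0 s1 hu j).
have mb i : cmeas3 (b i) by have [p []] := lb i.
have i1 i j : L1 (fun x => U j x * b i x * pd j (phi i) x).
  by have [p lp] := lb i; exact: (U_pair hpsi s0 s1 hu j lp (bpd i j)).
have i2 i j : L1 (fun x => U j x * z i x * pd j (phi i) x).
  have [] := U_test hpsi s0 s1 hu j (testMl (sz i) (test_pd j (tp i))).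
  by under eq_fun do rewrite mulrA.
have i3 i j : L1 (fun x => U i x * U j x * pd j (phi i) x).
  apply: (ae_cinteg (cintegD (i1 i j) (i2 i j))).
    by apply: cmeasM; [exact: cmeasM|have [[q [m _ _]] _] := bpd i j].
  by apply: ae_imp (Ub i) => x ->; ring.
have e3 i j : Cint (leb3 R) (fun x => U i x * U j x * pd j (phi i) x) =
    Cint (leb3 R) (fun x => U j x * b i x * pd j (phi i) x) + Cint (leb3 R) (fun x => U j x * z i x * pd j (phi i) x).
  rewrite -(Cint3D (i1 i j) (i2 i j)); apply: ae_Cint; [by case: (i3 i j)|by case: (cintegD (i1 i j) (i2 i j))|].
  by apply: ae_imp (Ub i) => x ->; ring.
have lhs : Cint (leb3 R) (fun x => \sum_(i < 3) density (fracLap (s / 2) (u i)) x * density (fracLap (s / 2) (dist_of (phi i))) x) =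
    \sum_(i < 3) Cint (leb3 R) (fun xi => (pw (2 * s) xi)%:C * uh i xi * ifourier (phi i) xi).
  rewrite (Cint_sum (index_enum 'I_3) (fun i => proj1 (D i))); apply: eq_bigr => i _; exact: proj2 (D i).
have rhs : Cint (leb3 R) (fun x => \sum_(i < 3) \sum_(j < 3) density (u i) x * density (u j) x * pd j (phi i) x) =
    \sum_(i < 3) \sum_(j < 3) Cint (leb3 R) (fun x => U i x * U j x * pd j (phi i) x).
  rewrite (@eq_Cint3 R _ (fun x => \sum_(i < 3) \sum_(j < 3) U i x * U j x * pd j (phi i) x)); last first.
    by move=> x; apply: eq_bigr => i _; apply: eq_bigr => j _; rewrite !(density_u hpsi s0 s1 hu).
  rewrite (Cint_sum (index_enum 'I_3) (fun i => cinteg_sum (index_enum 'I_3) (i3 i))).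
  by apply: eq_bigr => i _; exact: (Cint_sum (index_enum 'I_3) (i3 i)).
have {}hm : \sum_(i < 3) Cint (leb3 R) (fun xi => (pw (2 * s) xi)%:C * uh i xi * ifourier (phi i) xi) =
    \sum_(i < 3) \sum_(j < 3) Cint (leb3 R) (fun x => U i x * U j x * pd j (phi i) x).
  have hm' : Cint (leb3 R) (fun x => \sum_(i < 3) density (fracLap (s / 2) (u i)) x * density (fracLap (s / 2) (dist_of (phi i))) x) =
    Cint (leb3 R) (fun x => \sum_(i < 3) \sum_(j < 3) density (u i) x * density (u j) x * pd j (phi i) x) +
    P (fun x => \sum_(j < 3) pd j (phi j) x) := hm.
  by rewrite P0 addr0 lhs rhs in hm'.
rewrite hm -sumrB; apply: eq_bigr => i _.
rewrite (eq_bigr _ (fun j _ => e3 i j)) big_split/=; congr (_ + _).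
exact: (transport hpsi s0 s1 hu hdiv (sz i) (tp i)).
Qed.

(** * Antisymmetric potentials of divergence-free fields *)

Section potential.
Variables (rho : R) (v : 'I_3 -> cfield R).
Hypothesis rho0 : 0 < rho.
Hypothesis bv : forall i, band (v i).
Hypothesis v0 : forall i xi, enorm xi <= rho -> v i xi = 0.
Hypothesis vdiv : {ae leb3 R, forall xi, \sum_(j < 3) (coord3 j xi)%:C * v j xi = 0}.

(** $\xi_j/|\xi|^2$ with the denominator frozen for $|\xi|\le\rho$. As [v] vanishes there, nothing
    changes in [pot], and the symbol is bounded on balls. *)
Definition kap j xi : R := coord3 j xi * (Num.max rho (enorm xi)) `^ (- 2).

Lemma kap_band j F : band F -> band (fun xi => (kap j xi)%:C * F xi).
Proof.
move=> bF; apply: band_bounded => //.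
  apply: cmeas_real; apply: measurable_funM; first exact: measurable_coord3.
  have mm : measurable_fun [set: M3 R] (fun xi : M3 R => Num.max rho (enorm (xi : R3 R))).
    by apply: measurable_maxr => //; exact: measurable_enorm.
  exact: (measurableT_comp (@measurable_powR R (- 2)) mm).
move=> r; exists (r * rho `^ (- 2)) => xi hx; rewrite normcC /kap normrM [`|_ `^ _|]ger0_norm ?powR_ge0//.
apply: ler_pM => //; [exact: powR_ge0|exact: le_trans (coord3_le j xi) hx|].
rewrite !powRN lef_pV2 ?posrE ?powR_gt0 ?lt_max ?rho0//.
apply: ge0_ler_powR => //; rewrite ?nnegrE ?le_max ?(ltW rho0) ?lexx//.
Qed.

(** The symbol of $\Delta^{-1}(\partial_jv_i-\partial_iv_j)$, the matrix form of a vector potential;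
    its divergence in [j] recovers $v_i$ because $\xi\cdot v=0$. *)
Definition pot i j : cfield R := fun xi => - ii * ((kap j xi)%:C * v i xi - (kap i xi)%:C * v j xi).

Lemma bandZ (z : R[i]) F : band F -> band (fun xi => z * F xi).
Proof. by move=> bF; apply: band_bounded => // r; exists (normc z). Qed.

Lemma bandD F G : band F -> band G -> band (fun xi => F xi + G xi).
Proof.
move=> [[p lF] [r hr]] [[q lG] [t ht]]; split; first by exists (2 * (p + q)); exact: l2D.
by exists (Num.max r t) => xi; rewrite gt_max => /andP[h1 h2]; rewrite hr// ht// addr0.
Qed.

Lemma pot_band i j : band (pot i j).
Proof.
apply: bandZ; apply: (bandD (kap_band j (bv i))).
have := bandZ (-1) (kap_band i (bv j)); by under eq_fun do rewrite mulN1r.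
Qed.

Lemma pot_anti i j xi : pot j i xi = - pot i j xi.
Proof. by rewrite /pot; ring. Qed.

Lemma pot_div i : {ae leb3 R, forall xi, \sum_(j < 3) iximul j (pot i j) xi = v i xi}.
Proof.
apply: ae_imp vdiv => xi dv.
have ii2 : ii * ii = -1 :> R[i] by rewrite /ii; apply: complex_eq => /=; ring.
have E j : iximul j (pot i j) xi = (coord3 j xi * kap j xi)%:C * v i xi - (kap i xi)%:C * ((coord3 j xi)%:C * v j xi).
  rewrite /iximul /pot; move: (kap j xi) (kap i xi) => K K'; rewrite rmorphM.
  rewrite (_ : _ * (- ii * _) = - (ii * ii) * ((coord3 j xi)%:C * (K%:C * v i xi - K'%:C * v j xi))); last by ring.
  by rewrite ii2; ring.
rewrite (eq_bigr _ (fun j _ => E j)) sumrB -mulr_sumr dv mulr0 subr0 -mulr_suml -rmorph_sum/=.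
have [h|h] := leP (enorm xi) rho; first by rewrite v0// mulr0.
suff -> : \sum_(j < 3) coord3 j xi * kap j xi = 1 by rewrite mul1r.
rewrite (eq_bigr (fun j => (coord3 j xi * coord3 j xi) * (enorm xi) `^ (- 2))); last first.
  by move=> j _; rewrite /kap mulrA max_r// ltW.
rewrite -mulr_suml (_ : \sum_(l < 3) coord3 l xi * coord3 l xi = enorm xi ^+ 2); last by rewrite enorm_sqr.
by rewrite powRN powR_mulrn ?enorm_ge0// mulfV// expf_neq0// gt_eqF// (lt_trans rho0).
Qed.

(** The cutoff is applied to the potential and the derivative afterwards, so that the field has
    compact support and is still divergence free. *)
Definition vec n i : cfield R := fun x => \sum_(j < 3) pd j (fun y => cutoff psi n y * ifourier (pot i j) y) x.

Lemma vec_pot i : (fun x => \sum_(j < 3) pd j (ifourier (pot i j)) x) = ifourier (v i).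
Proof.
apply/funext => x.
have i1 j := band_L1 (band_iximul j (pot_band i j)).
rewrite (eq_bigr (fun j => ifourier (iximul j (pot i j)) x)); last first.
  by move=> j _; rewrite band_pd//; exact: pot_band.
rewrite (eq_bigr _ (fun j _ => ifourierE _ _)) -mulr_sumr ifourierE.
rewrite -(Cint_sum (index_enum 'I_3) (fun j => cinteg_char x (i1 j))); congr (_ * _).
apply: ae_Cint.
- by have [] := cinteg_sum (index_enum 'I_3) (fun j => cinteg_char x (i1 j)).
- by have [] := cinteg_char x (band_L1 (bv i)).
- by apply: ae_imp (pot_div i) => xi <-; rewrite mulr_sumr.
Qed.

Lemma vec_comp_test n i j : test_fun (fun y => cutoff psi n y * ifourier (pot i j) y).
Proof. apply: (cutoffM_test hpsi); apply: band_smooth; exact: pot_band. Qed.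

Lemma vec_test n i : test_fun (vec n i).
Proof. by apply: test_sum => j; apply: test_pd; exact: vec_comp_test. Qed.

(** Second derivatives commute and the cut-off potential is still antisymmetric, so the double sum
    is its own opposite. *)
Lemma vec_div n x : \sum_(i < 3) pd i (vec n i) x = 0.
Proof.
pose c i j : cfield R := fun y => cutoff psi n y * ifourier (pot i j) y.
have sc i j : schwartz (c i j) by apply: test_schwartz; exact: vec_comp_test.
have ac i j : c j i = (fun y => -1 * c i j y).
  apply/funext => y; rewrite /c (_ : pot j i = (fun xi => -1 * pot i j xi)); last by apply/funext => xi; rewrite pot_anti mulN1r.
  by rewrite ifourierZ; [ring|exact: band_L1 (pot_band i j)].
have a i j : pd i (pd j (c i j)) x = - pd j (pd i (c j i)) x.
  rewrite (ac i j) pdZE; last by case: (sc i j).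
  by rewrite pdZE; [rewrite mulN1r opprK (pdC _ _ (sc i j))|apply: smooth_pd; case: (sc i j)].
have e i : pd i (vec n i) x = \sum_(j < 3) pd i (pd j (c i j)) x.
  rewrite /vec (pd_sumE i (index_enum 'I_3) (F := fun j => pd j (c i j)))// => j.
  by apply: smooth_pd; case: (sc i j).
rewrite (eq_bigr _ (fun i _ => e i)); set S := \sum_(i < 3) _.
suff h : S = - S by apply/eqP; move/eqP: h; rewrite -addr_eq0 -mulr2n mulrn_eq0.
rewrite {1}/S (eq_bigr _ (fun i _ => eq_bigr _ (fun j _ => a i j))).
rewrite exchange_big/= /S -sumrN; apply: eq_bigr => i _; by rewrite -sumrN.
Qed.

Lemma psi0 : (psi 0)%:C = 1.
Proof. by have [_ _ _ p1] := hpsi; rewrite p1// (_ : enorm 0 = 0) ?invr_ge0// /enorm /dot3 !big_ord_recl big_ord0 /coord3/= !mulr0 !addr0 sqrtr0. Qed.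

Lemma approx_vec i : test_approx (fun n => vec n i) (ifourier (v i)).
Proof.
rewrite -vec_pot; apply: approx_sum => j; have bp := pot_band i j.
have := approx_pd (j := j) (psi_test hpsi) (band_smooth bp) (bl2_ifourier bp) _.
rewrite psi0 (_ : (fun x => 1 * _) = pd j (ifourier (pot i j))); last by apply/funext => x; rewrite mul1r.
by apply; rewrite band_pd//; apply: bl2_ifourier; exact: band_iximul.
Qed.

Lemma approx_vec_pd i l : test_approx (fun n => pd l (vec n i)) (pd l (ifourier (v i))).
Proof.
have sb j : smooth (ifourier (pot i j)) := band_smooth (pot_band i j).
rewrite -vec_pot (pd_sumE l (index_enum 'I_3) (F := fun j => pd j (ifourier (pot i j)))); last by move=> j; exact: smooth_pd.
rewrite (_ : (fun n => _) = (fun n x => \sum_(j < 3) pd l (pd j (fun y => cutoff psi n y * ifourier (pot i j) y)) x)); last first.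
  apply/funext => n; rewrite /vec (pd_sumE l (index_enum 'I_3) (F := fun j => pd j (fun y => cutoff psi n y * ifourier (pot i j) y)))// => j.
  by apply: smooth_pd; case: (vec_comp_test n i j).
apply: approx_sum => j; have bp := pot_band i j.
have := approx_pd2 (j := j) (l := l) (psi_test hpsi) (sb j) (bl2_ifourier bp) _ _ _.
rewrite psi0 (_ : (fun x => 1 * _) = pd l (pd j (ifourier (pot i j)))); last by apply/funext => x; rewrite mul1r.
have bi := band_iximul j bp.
by apply; rewrite !band_pd//; apply: bl2_ifourier => //; exact: band_iximul.
Qed.

End potential.

Lemma cvgC_eq_lim (a c : nat -> R[i]) (A B : R[i]) : (forall n, a n = c n) ->
  (fun n => normc (a n - A)) @ \oo --> (0 : R) -> (fun n => normc (c n - B)) @ \oo --> (0 : R) -> A = B.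
Proof. by move=> /funext -> ; exact: normc_cvg_unique. Qed.

(** [momentum_test] for the fields [vec], in the limit where the cutoff is removed. *)
Lemma dissipation_identity rho (v b z : 'I_3 -> cfield R) : 0 < rho ->
  (forall i, band (v i)) -> (forall i xi, enorm xi <= rho -> v i xi = 0) ->
  {ae leb3 R, forall xi, \sum_(j < 3) (coord3 j xi)%:C * v j xi = 0} ->
  (forall i, exists p, l2 (b i) p) -> (forall i, smooth (z i)) -> (forall i j, exists p, l2 (pd j (z i)) p) ->
  (forall i, {ae leb3 R, forall x, U i x = b i x + z i x}) ->
  \sum_(i < 3) Cint (leb3 R) (fun xi => (pw (2 * s) xi)%:C * uh i xi * v i (- xi)) =
  \sum_(i < 3) \sum_(j < 3) Cint (leb3 R) (fun x => U j x * b i x * pd j (ifourier (v i)) x) -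
  \sum_(i < 3) \sum_(j < 3) Cint (leb3 R) (fun x => U j x * pd j (z i) x * ifourier (v i) x).
Proof.
move=> r0 bv v0 vd lb sz lz Ub.
have ap := approx_vec r0 bv v0 vd; have apl := approx_vec_pd r0 bv v0 vd.
have mU j : cmeas3 (U j) := L1_l2_cmeas hpsi (U_L1_l2 s0 s1 hu j).
have eq n := momentum_test (vec_test r0 bv n) (vec_div r0 bv n) lb sz Ub.
have c1 := cvgC_sum (index_enum 'I_3) (fun i => cvg_dissipation hpsi s0 s1 hN i (bv i) (ap i) (apl i)).
have c2 : (fun n => normc (\sum_(i < 3) \sum_(j < 3) Cint (leb3 R) (fun x => U j x * b i x * pd j (vec rho v n i) x) -
  \sum_(i < 3) \sum_(j < 3) Cint (leb3 R) (fun x => U j x * pd j (z i) x * vec rho v n i x) -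
  (\sum_(i < 3) \sum_(j < 3) Cint (leb3 R) (fun x => U j x * b i x * pd j (ifourier (v i)) x) -
  \sum_(i < 3) \sum_(j < 3) Cint (leb3 R) (fun x => U j x * pd j (z i) x * ifourier (v i) x)))) @ \oo --> (0 : R).
  apply: cvgCB; apply: cvgC_sum => i; apply: cvgC_sum => j.
    have [p lp] := lb i; have [mb _ _] := lp.
    by apply: (Cint_approx (apl i j)); [exact: cmeasM|move=> h bh; exact: (U_pair hpsi s0 s1 hu j lp bh)].
  have [p lp] := lz i j; have [mb _ _] := lp.
  by apply: (Cint_approx (ap i)); [exact: cmeasM|move=> h bh; exact: (U_pair hpsi s0 s1 hu j lp bh)].
exact: cvgC_eq_lim eq c1 c2.
Qed.

End energy_balance.

(** * The energy flux through a frequency *)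

Section energy_flux.
Context {R : realType}.
Variable psi : R3 R -> R.
Hypothesis hpsi : lp_cutoff psi.
Variable s : R.
Hypotheses (s_gt : 1 / 2 < s) (s_lt : s < 5 / 6).
Variable u : vfunctional R.
Hypothesis hu : forall i, Hdot s (u i).
Hypothesis hdiv : div_free u.
Variable N : R.
Hypothesis hN : forall i, hs s (uh u i) N.
Variable P : functional R.
Hypothesis tP : tempered P.
Hypothesis hmom : forall phi : 'I_3 -> cfield R, (forall i, test_fun (phi i)) -> momentum_eq s u P phi.
Implicit Types (h F G : cfield R) (x xi : R3 R) (p M r : R) (i j : 'I_3) (al be ga : R3 R -> R) (k l : int).
Local Notation L1 := (cinteg (leb3 R)).
Local Notation cmeas3 := (cmeas (T := M3 R)).
Local Notation uh := (uh u).
Local Notation U j := (ift (uh j)).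
Local Notation T := (Tri uh).
Local Notation one := (fun _ : R3 R => 1 : R).
Local Notation ps := (ps psi).
Local Notation wh := (wh psi).

Let s0 : 0 < s. Proof. by move: s_gt; lra. Qed.
Let s1 : s < 1. Proof. by move: s_lt; lra. Qed.
Let mps k : mult (ps k) := mult_ps hpsi k.
Let lps k : lowm (ps k) := lowm_ps hpsi k.
Let hwh k : highm (wh k) := highm_wh hpsi k.
Let mU j : cmeas3 (U j) := L1_l2_cmeas hpsi (U_L1_l2 s0 s1 hu j).

Definition Q k := T one (ps k) (wh k).
Definition band_mult k l := msub (ps k) (ps l).
(** For a real field this is $\int|\xi|^{2s}|\hat u|^2(\psi_k-\psi_l)$ with the multiplier
    reflected, by [uh_conj]. *)
Definition spectral_energy k l := \sum_(i < 3)
  Cint (leb3 R) (fun xi => (pw (2 * s) xi)%:C * uh i xi * sX uh (band_mult k l) i (- xi)).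

Lemma band_mult_mult k l : mult (band_mult k l).
Proof. exact: mult_sub. Qed.

Lemma band_mult_low k l : l <= k -> low (two k) (band_mult k l).
Proof.
move=> lk xi h; rewrite /band_mult /msub !(ps_low hpsi) ?subrr//.
by apply: le_lt_trans h; exact: two_le.
Qed.

Lemma band_mult_high k l : l <= k -> high (two (l - 1)) (band_mult k l).
Proof.
move=> lk xi h; rewrite /band_mult /msub !(ps_one hpsi) ?subrr//.
by apply: (le_trans h); apply: two_le; lia.
Qed.

Lemma band_sX k l i : l <= k -> band (sX uh (band_mult k l) i).
Proof.
move=> lk; have [M mM] := band_mult_mult k l; split.
  by exists (M * two (l - 1) `^ (- s) * N); exact: (X_high s0 hN i mM (two_gt0 _) (band_mult_high lk)).
by exists (two k) => xi h; rewrite /sX (band_mult_low lk h) mul0r.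
Qed.

Lemma moment_sX k i : moment (sX uh (ps k) i).
Proof.
move=> n; have [M mM] := mps k.
(* The polynomial weight is absorbed into the multiplier; truncating it at $2^k$, beyond which
   [ps k] vanishes, keeps the multiplier bounded. *)
pose al xi : R := (if enorm xi <= two k then (1 + enorm xi) ^+ n else 0) * ps k xi.
have E : (fun xi => ((1 + enorm xi) ^+ n)%:C * sX uh (ps k) i xi) = sX uh al i.
  apply/funext => xi; rewrite /sX /al; case: ifP => h; first by rewrite rmorphM mulrA.
  by rewrite (ps_low hpsi) ?mulr0 ?mul0r ?mulr0// ltNge h.
rewrite E; apply: (X_low_L1 s0 s1 hN (M := (1 + two k) ^+ n * M) (r := two k)).
- split.
    rewrite (_ : al = (fun xi => (1 + enorm xi) ^+ n * ps k xi)).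
      by apply: measurable_funM; [exact: measurable_wX|exact: mM.1].
    apply/funext => xi; rewrite /al; case: ifP => h //.
    by rewrite (ps_low hpsi) ?mulr0// ltNge h.
  move=> xi; rewrite /al normrM; apply: ler_pM => //; last exact: mM.2.
  case: ifP => h; last by rewrite normr0 exprn_ge0 ?addr_ge0 ?(ltW (two_gt0 k)).
  rewrite ger0_norm ?exprn_ge0 ?addr_ge0 ?enorm_ge0//.
  by rewrite lerXn2r ?nnegrE ?addr_ge0 ?enorm_ge0 ?(ltW (two_gt0 k))// lerD2l.
- exact: two_gt0.
- by move=> xi h; rewrite /al (ps_low hpsi) ?mulr0.
Qed.

(** Formally $\int V\,u\cdot\nabla V=\frac12\int u\cdot\nabla(V^2)=0$ for each component $V$. As $V$
    is not compactly supported, the divergence condition is tested with the cutoff times $V^2$, and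
    in the limit [S] equals [- S]. *)
Lemma self_flux k l : l <= k -> T one (band_mult k l) (band_mult k l) = 0.
Proof.
move=> lk; apply: big1 => i _; set v := sX uh (band_mult k l) i.
have bv : band v := band_sX i lk; have sv := band_smooth bv.
pose V := ifourier v; have bV : bl2 V := bl2_ifourier bv; have [[p lV] _] := bV.
have bdV j : bl2 (pd j V) by rewrite /V band_pd//; apply: bl2_ifourier; exact: band_iximul.
have e0 j : Cint (leb3 R) (term uh one (band_mult k l) (band_mult k l) i j) = Cint (leb3 R) (fun x => U j x * V x * pd j V x).
  have [q lq] := (bdV j).1.
  apply: ae_Cint.
  - have [M mM] := band_mult_mult k l.
    by have [] := term_L1 hpsi s0 s1 hN i j mult_one (conj (band_mult_mult k l) (ex_intro2 _ _ (two k) (two_gt0 k) (band_mult_low lk))) (conj (band_mult_mult k l) (ex_intro2 _ _ (two (l - 1)) (two_gt0 (l - 1)) (band_mult_high lk))).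
  - by have [] := U_pair hpsi s0 s1 hu j lV (bdV j).
  - apply: (ae_imp2 _ (ift_L1 hpsi (band_L1 bv)) (ift_L1 hpsi (band_L1 (band_iximul j bv)))) => x h1 h2.
    by rewrite /term X_one /X /Y -/v h1 /sY -/v h2 /V band_pd//; ring.
rewrite (eq_bigr _ (fun j _ => e0 j)).
have sV : smooth V := sv.
pose g n : cfield R := fun x => cutoff psi n x * V x * V x.
have tcV n : test_fun (fun x => cutoff psi n x * V x) := cutoffM_test hpsi n sV.
have tg n : test_fun (g n) by apply: testM.
have bcV n : bl2 (fun x => cutoff psi n x * V x) by split; [exact: test_l2|exact: test_bounded].
have bpcV n j : bl2 (pd j (fun x => cutoff psi n x * V x)).
  by have t := test_pd j (tcV n); split; [exact: test_l2|exact: test_bounded].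
have key n : \sum_(j < 3) Cint (leb3 R) (fun x => U j x * V x * pd j (fun y => cutoff psi n y * V y) x) +
   \sum_(j < 3) Cint (leb3 R) (fun x => U j x * pd j V x * (cutoff psi n x * V x)) = 0.
  rewrite -[RHS](div_test hpsi s0 s1 hu hdiv (tg n)) -big_split/=; apply: eq_bigr => j _.
  have [q lq] := (bdV j).1.
  have i1 := U_pair hpsi s0 s1 hu j lV (bpcV n j); have i2 := U_pair hpsi s0 s1 hu j lq (bcV n).
  rewrite -(Cint3D i1 i2); apply: eq_Cint3 => x.
  have e := congr1 (fun F => F x) (pdME j (proj1 (tcV n)) sV); rewrite [pd j (g n) x]e; ring.
have c1 := cvgC_sum (index_enum 'I_3) (fun j => Cint_approx (approx_pd (j := j) (psi_test hpsi) sV bV (bdV j))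
   (cmeasM (mU j) (let: And3 m _ _ := lV in m)) (fun h bh => U_pair hpsi s0 s1 hu j lV bh)).
have c2 := cvgC_sum (index_enum 'I_3) (fun j => let: ex_intro q lq := (bdV j).1 in
   Cint_approx (approx_dilate (psi_test hpsi) sV bV)
   (cmeasM (mU j) (let: And3 m _ _ := lq in m)) (fun h bh => U_pair hpsi s0 s1 hu j lq bh)).
set S := \sum_(j < 3) _.
have e1 : \sum_(j < 3) Cint (leb3 R) (fun x => U j x * V x * ((psi 0)%:C * pd j V x)) = S.
  by apply: eq_bigr => j _; rewrite (psi0 hpsi); apply: eq_Cint3 => x; rewrite mul1r.
have e2 : \sum_(j < 3) Cint (leb3 R) (fun x => U j x * pd j V x * ((psi 0)%:C * V x)) = S.
  by apply: eq_bigr => j _; rewrite (psi0 hpsi); apply: eq_Cint3 => x; rewrite mul1r; ring.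
rewrite e1 in c1; rewrite e2 in c2.
have c3 : (fun n : nat => normc (- \sum_(j < 3) Cint (leb3 R) (fun x => U j x * pd j V x * (cutoff psi n x * V x)) - - S)) @ \oo --> (0 : R).
  have nE (x y : R[i]) : normc (- x - - y) = normc (x - y) by rewrite -normcN; congr normc; ring.
  by under eq_fun do rewrite nE; exact: c2.
have /eqP : S = - S.
  apply: (cvgC_eq_lim _ c1 c3) => n; apply/eqP; rewrite -addr_eq0; apply/eqP; exact: key.
by rewrite -addr_eq0 -mulr2n mulrn_eq0 /= => /eqP.
Qed.

(** With $\beta=\psi_k-\psi_l=w_l-w_k$, the dissipation is $T\,1\,\beta\,w_l-T\,1\,\psi_l\,\beta$.
    Since $T\,1\,\beta\,\beta=0$, $w_l$ may be replaced by $w_k$ in the first term; expanding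
    $\beta$ in both leaves the difference of the fluxes. *)
Lemma spectral_energy_Q k l : l <= k -> spectral_energy k l = Q k - Q l.
Proof.
move=> lk; pose v i := sX uh (band_mult k l) i.
have bv i : band (v i) := band_sX i lk.
have mm := band_mult_mult k l.
have lm : lowm (band_mult k l) by split => //; exists (two k); [exact: two_gt0|exact: band_mult_low].
have hm : highm (band_mult k l) by split => //; exists (two (l - 1)); [exact: two_gt0|exact: band_mult_high].
have v0 i xi : enorm xi <= two (l - 1) -> v i xi = 0 by move=> h; rewrite /v /sX (band_mult_high lk h) mul0r.
have vd : {ae leb3 R, forall xi, \sum_(j < 3) (coord3 j xi)%:C * v j xi = 0}.
  apply: ae_imp (uh_div hpsi s0 s1 hu hdiv) => xi h; rewrite /v /sX.
  transitivity ((band_mult k l xi)%:C * \sum_(j < 3) (coord3 j xi)%:C * uh j xi); last by rewrite h mulr0.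
  by rewrite mulr_sumr; apply: eq_bigr => j _; rewrite mulrCA.
pose b i := X uh (wh l) i; have lb i : exists p, l2 (b i) p := highm_X hpsi s0 hN i (hwh l).
pose z i := ifourier (sX uh (ps l) i).
have sz i : smooth (z i) by apply: smooth_ifourier; exact: moment_sX.
have [M mM] := mps l.
have iX i := X_low_L1 s0 s1 hN i mM (two_gt0 l) (@ps_low _ _ hpsi l).
have iY j i := Y_low_L1 s0 s1 hN j i mM (two_gt0 l) (@ps_low _ _ hpsi l).
have pz i j : pd j (z i) = ifourier (sY uh (ps l) j i) by rewrite /z pd_ifourier//; exact: moment_sX.
have lz i j : exists p, l2 (pd j (z i)) p.
  rewrite pz; exists (M * two l `^ (1 - s) * N).
  exact: (ifourier_l2 (iY j i) (Y_low_l2 s1 hN j i mM (two_gt0 l) (@ps_low _ _ hpsi l))).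
have Ub i : {ae leb3 R, forall x, U i x = b i x + z i x}.
  apply: (ae_imp2 _ (X_sub hpsi s0 s1 hN i mult_one (mps l)) (ift_L1 hpsi (iX i))) => x.
  by rewrite X_one => h1 h2; rewrite /b /wh h1 /z -h2 subrK.
have Vb i : bl2 (ifourier (v i)) := bl2_ifourier (bv i).
have pVb i j : bl2 (pd j (ifourier (v i))).
  by rewrite band_pd//; apply: bl2_ifourier; exact: band_iximul.
rewrite /spectral_energy (dissipation_identity hpsi s0 s1 hu hdiv hN tP hmom (two_gt0 (l - 1)) bv v0 vd lb sz lz Ub).
have r1 : \sum_(i < 3) \sum_(j < 3) Cint (leb3 R) (fun x => U j x * b i x * pd j (ifourier (v i)) x) = T one (band_mult k l) (wh l).
  apply: eq_bigr => i _; apply: eq_bigr => j _; have [p lp] := lb i; apply: ae_Cint.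
  - by have [] := U_pair hpsi s0 s1 hu j lp (pVb i j).
  - by have [] := term_L1 hpsi s0 s1 hN i j mult_one lm (hwh l).
  - apply: ae_imp (ift_L1 hpsi (band_L1 (band_iximul j (bv i)))) => x h2.
    by rewrite /term X_one /b /Y band_pd// -h2 mulrAC.
have r2 : \sum_(i < 3) \sum_(j < 3) Cint (leb3 R) (fun x => U j x * pd j (z i) x * ifourier (v i) x) = T one (ps l) (band_mult k l).
  apply: eq_bigr => i _; apply: eq_bigr => j _; have [p lp] := lz i j; apply: ae_Cint.
  - by have [] := U_pair hpsi s0 s1 hu j lp (Vb i).
  - by have [] := term_L1 hpsi s0 s1 hN i j mult_one (lps l) hm.
  - apply: (ae_imp2 _ (ift_L1 hpsi (band_L1 (bv i))) (ift_L1 hpsi (iY j i))) => x h1 h2.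
    by rewrite /term X_one pz -h2 -h1.
rewrite r1 r2.
have eB : msub (wh l) (wh k) = band_mult k l.
  have alg (a b' : R) : (1 - a) - (1 - b') = b' - a by ring.
  by apply/funext => xi; exact: alg.
have t1 : T one (band_mult k l) (band_mult k l) = T one (band_mult k l) (wh l) - T one (band_mult k l) (wh k).
  rewrite -(Tri_sub3 hpsi s0 s1 hN mult_one lm (hwh l) (hwh k)).
  exact (f_equal (fun m => T one _ m) (esym eB)).
have t2 : T one (band_mult k l) (wh k) = T one (ps k) (wh k) - T one (ps l) (wh k).
  exact: (Tri_sub2 hpsi s0 s1 hN mult_one (lps k) (lps l) (hwh k)).
have t3 : T one (ps l) (band_mult k l) = T one (ps l) (wh l) - T one (ps l) (wh k).
  rewrite -(Tri_sub3 hpsi s0 s1 hN mult_one (lps l) (hwh l) (hwh k)).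
  exact (f_equal (fun m => T one _ m) (esym eB)).
move: t1; rewrite (self_flux lk) t3 t2 => /eqP; rewrite eq_sym subr_eq0 => /eqP ->.
have alg (a b' c : R[i]) : a - b' - (c - b') = a - c by ring.
exact: alg.
Qed.

(** At $r=2^k$ the two parts of the flux have exponents $(\frac32-s)+(1-s)-s$ and $(\frac52-s)-2s$,
    both equal to $\frac52-3s$, which is positive because $s<5/6$. *)
Lemma cvg_QN : (fun n : nat => normc (Q (- n%:Z))) @ \oo --> (0 : R).
Proof.
have [M M1 [bp bf bw]] := ps_bound hpsi; have M0 : 0 <= M by lra.
have [C C0 [B1 B2]] := Tri_bounds hpsi s0 s1 hN; have N0 := N_ge0 hN.
have c0 : - (5 / 2 - 3 * s) < 0 by move: s_lt; lra.
pose K := 9 * (C * M * (M * N * (2 * M * 2 * N))) + 9 * (C * M * (2 * M * 2 * N * (2 * M * 2 * N))).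
apply: (@cvg0_le _ _ (fun n => K * 2 `^ (n%:R * - (5 / 2 - 3 * s)))); last first.
  by rewrite -[X in _ --> X](mulr0 K); apply: cvgMr; exact: powR2_nat_cvg0.
move=> n; apply/andP; split; first exact: normc_ge0.
set k := - n%:Z; have mw := highm_mult (hwh k).
have lw j := X_high s0 hN j (bw k) (two_gt0 (k - 1)) (@wh_high _ _ hpsi k).
have e : Q k = T (ps k) (ps k) (wh k) + T (wh k) (ps k) (wh k).
  by rewrite [X in _ + X](Tri_sub1 hpsi s0 s1 hN mult_one (mps k) (lps k) (hwh k)) addrC subrK.
have b2 := B2 _ _ _ _ _ _ _ _ (bp k) (two_gt0 k) (@ps_low _ _ hpsi k) (bp k) (two_gt0 k) (@ps_low _ _ hpsi k) mw lw.
have b1 := Tri_le (B1 _ _ _ _ _ _ _ mw (bp k) (two_gt0 k) (@ps_low _ _ hpsi k) lw mw lw).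
have t3 : two (k - 1) `^ (- s) <= 2 * 2 `^ (k%:~R * (- s)).
  have e2 : (2 : R) = 2 `^ 1 by rewrite powRr1.
  rewrite two_powR [in leRHS](_ : 2 * _ = 2 `^ 1 * 2 `^ (k%:~R * (- s))); last by rewrite -e2.
  rewrite powR2D; apply: ler_two_powR; rewrite intrB mulrBl mulr1z mul1r opprK addrC lerD2r.
  exact: ltW s1.
have t2 : 2 `^ (n%:R * - (5 / 2 - 3 * s)) = two k `^ (3 / 2 - s) * (two k `^ (1 - s) * 2 `^ (k%:~R * (- s))).
  by rewrite !two_powR !powR2D; congr (_ `^ _); rewrite /k mulrNz -pmulrn; field.
have t2' : 2 `^ (n%:R * - (5 / 2 - 3 * s)) = two k `^ (5 / 2 - s) * (2 `^ (k%:~R * (- s)) * 2 `^ (k%:~R * (- s))).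
  by rewrite !two_powR !powR2D; congr (_ `^ _); rewrite /k mulrNz -pmulrn; field.
rewrite e; apply: (le_trans (normcD _ _)); rewrite /K mulrDl; apply: lerD.
  apply: (le_trans b2); rewrite t2.
  have := ler_wpM2l (mulr_ge0 (powR_ge0 (two k) (3 / 2 - s)) (powR_ge0 (two k) (1 - s))) t3.
  set x := two k `^ _; set y := two k `^ _; set w := two (k - 1) `^ _; set w' := 2 `^ _ => t4.
  rewrite (_ : 9 * (C * (M * x) * (M * y * N * (2 * M * w * N))) = 9 * (C * M * (M * N * (2 * M * N))) * (x * y * w)); last by ring.
  rewrite [leRHS](_ : _ = 9 * (C * M * (M * N * (2 * M * N))) * (x * y * (2 * w'))); last by ring.
  by apply: ler_wpM2l t4; do ?[apply: mulr_ge0 => //].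
apply: (le_trans b1); rewrite t2'.
have := ler_wpM2l (powR_ge0 (two k) (5 / 2 - s)) (ler_pM (powR_ge0 _ _) (powR_ge0 _ _) t3 t3).
set x := two k `^ _; set w := two (k - 1) `^ _; set w' := 2 `^ _ => t4.
rewrite (_ : 9 * (C * (M * x) * (2 * M * w * N * (2 * M * w * N))) = 9 * (C * M * (2 * M * N * (2 * M * N))) * (x * (w * w))); last by ring.
rewrite [leRHS](_ : _ = 9 * (C * M * (2 * M * N * (2 * M * N))) * (x * (2 * w' * (2 * w')))); last by ring.
by apply: ler_wpM2l t4; do ?[apply: mulr_ge0 => //].
Qed.

End energy_flux.

(** * The energy, the three integrals and the limit *)

Section conclusion.
Context {R : realType}.
Variable psi : R3 R -> R.
Hypothesis hpsi : lp_cutoff psi.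
Variable s : R.
Hypotheses (s_gt : 1 / 2 < s) (s_lt : s < 5 / 6).
Variable u : vfunctional R.
Hypothesis hu : forall i, Hdot s (u i).
Hypothesis hreal : forall i, real_valued (u i).
Variable N : R.
Hypothesis hN : forall i, hs s (uh u i) N.
Implicit Types (h F G : cfield R) (x xi : R3 R) (p M r : R) (i j : 'I_3) (al be ga : R3 R -> R) (k l : int).
Local Notation L1 := (cinteg (leb3 R)).
Local Notation cmeas3 := (cmeas (T := M3 R)).
Local Notation uh := (uh u).
Local Notation T := (Tri uh).
Local Notation ps := (ps psi).
Local Notation ph := (ph psi).
Local Notation wh := (wh psi).
Local Notation ta := (ta psi).

Let s0 : 0 < s. Proof. by move: s_gt; lra. Qed.
Let s1 : s < 1. Proof. by move: s_lt; lra. Qed.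

(** [ift_l2] says that [ift] does not increase the norm; by [ift_ift] a second application returns
    the reflection of [F], so the first cannot decrease it either. *)
Lemma ift_isometry F p : l2 F p ->
  (\int[leb3 R]_x (normc (ift F x) ^+ 2)%:E = \int[leb3 R]_x (normc (F x) ^+ 2)%:E)%E.
Proof.
have exact_norm G q : l2 G q -> l2 G (Num.sqrt (fine (\int[leb3 R]_x (normc (G x) ^+ 2)%:E)%E)) /\
    ((Num.sqrt (fine (\int[leb3 R]_x (normc (G x) ^+ 2)%:E)%E) ^+ 2)%:E = \int[leb3 R]_x (normc (G x) ^+ 2)%:E)%E.
  move=> [mG q0 Gq]; have I0 : (0 <= \int[leb3 R]_x (normc (G x) ^+ 2)%:E)%E.
    by apply: integral_ge0 => x _; rewrite lee_fin sqr_ge0.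
  have e : ((Num.sqrt (fine (\int[leb3 R]_x (normc (G x) ^+ 2)%:E)%E) ^+ 2)%:E = \int[leb3 R]_x (normc (G x) ^+ 2)%:E)%E.
    by rewrite sqr_sqrtr ?fine_ge0// fineK// ge0_fin_numE//; exact: le_lt_trans Gq (ltry _).
  split; last exact: e.
  by split; [exact: mG|exact: sqrtr_ge0|rewrite e].
move=> lF; have [l1 e1] := exact_norm _ _ lF.
have lI := ift_l2 hpsi l1; have [l2' e2] := exact_norm _ _ lI.
apply/eqP; rewrite eq_le; apply/andP; split; first by have [_ _ h] := lI; rewrite -e1.
have lII := ift_l2 hpsi l2'; have [mF _ _] := lF.
have lr : l2 (fun x => F (- x)) (Num.sqrt (fine (\int[leb3 R]_x (normc (ift F x) ^+ 2)%:E)%E)).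
  apply: l2_ae lII; first exact: cmeas_refl mF.
  by apply: ae_imp (ift_ift hpsi lF) => x ->.
have [_ _] := l2_reflect lr; under eq_integral do rewrite opprK.
by rewrite e2.
Qed.

Definition G i : cfield R := fun xi => (pw s xi)%:C * uh i xi.

Lemma G_sqr i : L1 (fun xi => (normc (G i xi) ^+ 2)%:C).
Proof. by have [_ lG] := hN i; exact: l2_normc_sqr lG. Qed.

Definition full_energy : R[i] := \sum_(i < 3) Cint (leb3 R) (fun xi => (normc (G i xi) ^+ 2)%:C).

Lemma energyE : energy s u = (complex.Re full_energy)%:E.
Proof.
rewrite /energy.
under eq_integral do (under eq_bigr do rewrite fracLapE; rewrite -sumEFin).
rewrite ge0_integral_sum//; last 2 first.
- move=> i; apply: measurable_normc_sqr; have [_ lG] := hN i; exact: ift_cmeas lG.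
- by move=> i x _; rewrite lee_fin sqr_ge0.
rewrite /full_energy cRe_sum -sumEFin; apply: eq_bigr => i _.
by have [_ lG] := hN i; rewrite (ift_isometry lG) (integral_Cint (G_sqr i)).
Qed.

Lemma cvg_band_mult xi : xi <> 0 -> (fun n : nat => `|band_mult psi n%:Z (- n%:Z) xi - 1|) @ \oo --> (0 : R).
Proof.
move=> /enorm_gt0 x0; pose c := Num.max (enorm xi) (enorm xi)^-1; pose m := (Num.trunc c).+1.
have cm : c < m%:R by exact: truncnS_gt.
apply/cvgrPdist_le => e e0; exists m.+1 => // n /= mn.
have h1 : enorm xi <= two (n%:Z - 1).
  apply: (@le_trans _ _ c); first by rewrite le_max lexx.
  apply: (le_trans (ltW cm)); apply: (le_trans (ltW (nat_lt_two m))); apply: two_le; lia.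
have h2 : two (- n%:Z) < enorm xi.
  rewrite twoN -[enorm xi]invrK ltf_pV2 ?posrE ?two_gt0 ?invr_gt0//.
  apply: (@le_lt_trans _ _ c); first by rewrite le_max lexx orbT.
  by apply: (lt_trans cm); apply: (lt_le_trans (nat_lt_two m)); apply: two_le; lia.
by rewrite /band_mult /msub (ps_one hpsi h1) (ps_low hpsi h2) subr0 subrr normr0 subr0 normr0 ltW.
Qed.

(** Dominated convergence: the multipliers are uniformly bounded and tend to 1 away from the origin,
    where the energy density is 0. *)
Lemma cvg_spectral_energy :
  (fun n : nat => normc (spectral_energy psi s u n%:Z (- n%:Z) - full_energy)) @ \oo --> (0 : R).
Proof.
apply: cvgC_sum => i; have [mu lG] := hN i; have iG := G_sqr i.
have [M M1 [bp _ _]] := ps_bound hpsi.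
pose m n xi : R := band_mult psi n%:Z (- n%:Z) (- xi).
have bm n xi : `|m n xi| <= M + M by have [_] := mb_sub (bp n%:Z) (bp (- n%:Z)); exact.
have mm n : cmeas3 (fun xi => (m n xi)%:C).
  have [mb _] := mb_sub (bp n%:Z) (bp (- n%:Z)).
  exact: (cmeas_refl (f := fun xi => (band_mult psi n%:Z (- n%:Z) xi)%:C) (cmeas_real mb)).
have i1 n : L1 (fun xi => (m n xi)%:C * (normc (G i xi) ^+ 2)%:C).
  by apply: (cintegMb (M := M + M)) => //; move=> xi; rewrite normcC.
have e n : Cint (leb3 R) (fun xi => (pw (2 * s) xi)%:C * uh i xi * sX uh (band_mult psi n%:Z (- n%:Z)) i (- xi)) =
    Cint (leb3 R) (fun xi => (m n xi)%:C * (normc (G i xi) ^+ 2)%:C).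
  apply: ae_Cint.
  - apply: cmeasM; first by apply: cmeasM mu; apply: cmeas_real; exact: measurable_pw.
    by rewrite /sX; apply: (cmeasM (mm n)); exact: cmeas_refl mu.
  - by case: (i1 n).
  - apply: ae_imp (uh_conj hpsi s0 s1 hu (hreal i)) => xi h; rewrite /sX h -/(m n xi) -mul_conjc /G conjcM pw2 rmorphM.
    have -> : ((pw s xi)%:C)^*%C = (pw s xi)%:C by apply: complex_eq => /=; rewrite ?oppr0.
    by ring.
under eq_fun do rewrite e.
apply: (@dominated3 R _ _ (fun xi => (M + M + 1) * normc (normc (G i xi) ^+ 2)%:C)) => //.
- by apply: L1_realZ; exact: L1_normc.
- move=> xi n; rewrite -{2}[(normc (G i xi) ^+ 2)%:C]mul1r -mulrBl normcM ler_wpM2r ?normc_ge0//.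
  by apply: le_trans (normcD _ _) _; rewrite normcN normc1 normcC lerD2r.
- move=> xi; have [->|/eqP xi0] := eqVneq xi 0.
    have G0 : G i 0 = 0.
      by rewrite /G /pw (_ : enorm 0 = 0) ?powR0 ?mul0r ?gt_eqF// /enorm /dot3 !big_ord_recl big_ord0 /coord3/= !mulr0 !addr0 sqrtr0.
    have Z : (normc (G i 0) ^+ 2)%:C = 0 :> R[i] by rewrite G0 normc0 expr0n.
  by under eq_fun do rewrite Z mulr0 subrr normc0; exact: cvg_cst.
  have xin : - xi <> 0 by move=> h; apply: xi0; rewrite -[xi]opprK h oppr0.
  rewrite -[X in _ --> X](mul0r (normc (normc (G i xi) ^+ 2)%:C)).
  have alg (a X : R) : normc (a%:C * X%:C - X%:C) = `|a - 1| * normc X%:C.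
    have -> : a%:C * X%:C - X%:C = (a - 1)%:C * X%:C by rewrite rmorphB mulrBl mul1r.
    by rewrite normcM normcC.
  have E n : normc ((m n xi)%:C * (normc (G i xi) ^+ 2)%:C - (normc (G i xi) ^+ 2)%:C) =
     `|band_mult psi n%:Z (- n%:Z) (- xi) - 1| * normc (normc (G i xi) ^+ 2)%:C.
    exact: alg.
  by under eq_fun do rewrite E; apply: cvgMl; exact: cvg_band_mult.
Qed.

Lemma low_high_Cint k a :
  Cint (leb3 R) (fun x => sumZ (k - 1) (k + 2) (fun l => sumZ (l - 2) (k - 1) (fun l' => sumZ a (k - 1) (fun l'' =>
    convect (lpS psi (l - 2) (lpDelta psi l'' u)) (lpDelta psi l' u) (lpDelta psi l (lpHigh psi k u)) x)))) =
  sumZ (k - 1) (k + 2) (fun l => sumZ (l - 2) (k - 1) (fun l' => sumZ a (k - 1) (fun l'' =>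
    T (mmul (ps (l - 2)) (ph l'')) (ph l') (ga psi l k)))).
Proof.
have su := symf_u hpsi s0 s1 hu.
have E l l' l'' : convect (lpS psi (l - 2) (lpDelta psi l'' u)) (lpDelta psi l' u) (lpDelta psi l (lpHigh psi k u)) =
    integrand uh (mmul (ps (l - 2)) (ph l'')) (ph l') (ga psi l k).
  apply: convectE.
  - by apply: (symf_eq (symf_S hpsi (l - 2) (symf_Delta hpsi l'' su))) => xi; rewrite /mmul mulr1.
  - by apply: (symf_eq (symf_Delta hpsi l' su)) => xi; rewrite /mmul mulr1.
  - by apply: (symf_eq (symf_Delta hpsi l (symf_High hpsi k su))) => xi; rewrite /ga /mmul /wh /msub mulr1.
have I l l' l'' := integrand_Cint hpsi s0 s1 hN (mult_mul (mult_ps hpsi (l - 2)) (mult_ph hpsi l'')) (lowm_ph hpsi l') (ga_highm hpsi l k).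
have S3 l l' := @cinteg_sumZ R a (k - 1) _ (fun l'' _ => proj1 (I l l' l'')).
have S2 l := @cinteg_sumZ R (l - 2) (k - 1) _ (fun l' _ => proj1 (S3 l l')).
have S1 := @cinteg_sumZ R (k - 1) (k + 2) _ (fun l _ => proj1 (S2 l)).
rewrite (@eq_Cint3 R _ (fun x => sumZ (k - 1) (k + 2) (fun l => sumZ (l - 2) (k - 1) (fun l' => sumZ a (k - 1) (fun l'' =>
   integrand uh (mmul (ps (l - 2)) (ph l'')) (ph l') (ga psi l k) x))))); last first.
  move=> x; apply: eq_sumZ => l _; apply: eq_sumZ => l' _; apply: eq_sumZ => l'' _; exact: (congr1 (fun f => f x) (E l l' l'')).
rewrite (proj2 S1); apply: eq_sumZ => l _; rewrite (proj2 (S2 l)); apply: eq_sumZ => l' _.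
rewrite (proj2 (S3 l l')); apply: eq_sumZ => l'' _; exact: proj2 (I l l' l'').
Qed.

Lemma high_high_Cint k (h : int) :
  Cint (leb3 R) (fun x => sumZ (k - 3) k (fun l => sumZ h (k - 1) (fun l'' =>
    convect (lpDelta psi l (lpS psi k u)) (lpDelta psi l'' u) (lpTilde psi l (lpHigh psi k u)) x))) =
  sumZ (k - 3) k (fun l => sumZ h (k - 1) (fun l'' => T (mmul (ph l) (ps k)) (ph l'') (mmul (ta l) (wh k)))).
Proof.
have su := symf_u hpsi s0 s1 hu.
have E l l'' : convect (lpDelta psi l (lpS psi k u)) (lpDelta psi l'' u) (lpTilde psi l (lpHigh psi k u)) =
    integrand uh (mmul (ph l) (ps k)) (ph l'') (mmul (ta l) (wh k)).
  apply: convectE.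
  - by apply: (symf_eq (symf_Delta hpsi l (symf_S hpsi k su))) => xi; rewrite /mmul mulr1.
  - by apply: (symf_eq (symf_Delta hpsi l'' su)) => xi; rewrite /mmul mulr1.
  - by apply: (symf_eq (symf_Tilde hpsi l (symf_High hpsi k su))) => xi; rewrite /mmul /wh /msub mulr1.
have mta l : mult (ta l) by rewrite taE; apply: mult_sub; exact: mult_ps.
have I l l'' := integrand_Cint hpsi s0 s1 hN (mult_mul (mult_ph hpsi l) (mult_ps hpsi k)) (lowm_ph hpsi l'') (highm_mul (mta l) (highm_wh hpsi k)).
have S2 l := @cinteg_sumZ R h (k - 1) _ (fun l'' _ => proj1 (I l l'')).
have S1 := @cinteg_sumZ R (k - 3) k _ (fun l _ => proj1 (S2 l)).
rewrite (@eq_Cint3 R _ (fun x => sumZ (k - 3) k (fun l => sumZ h (k - 1) (fun l'' =>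
   integrand uh (mmul (ph l) (ps k)) (ph l'') (mmul (ta l) (wh k)) x)))); last first.
  move=> x; apply: eq_sumZ => l _; apply: eq_sumZ => l'' _; exact: (congr1 (fun f => f x) (E l l'')).
rewrite (proj2 S1); apply: eq_sumZ => l _; rewrite (proj2 (S2 l)); apply: eq_sumZ => l'' _.
exact: proj2 (I l l'').
Qed.

Lemma resonant_Cint k (h : int) :
  Cint (leb3 R) (fun x => sumZ h (k - 1) (fun l'' => sumZ_ge (k - 1) (fun l =>
    convect (lpTilde psi l (lpHigh psi k u)) (lpDelta psi l'' u) (lpDelta psi l (lpHigh psi k u)) x))) =
  sumZ h (k - 1) (fun l'' => T (wh k) (ph l'') (wh k)).
Proof.
have su := symf_u hpsi s0 s1 hu.
have E l l'' : convect (lpTilde psi l (lpHigh psi k u)) (lpDelta psi l'' u) (lpDelta psi l (lpHigh psi k u)) =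
    integrand uh (mmul (ta l) (wh k)) (ph l'') (ga psi l k).
  apply: convectE.
  - by apply: (symf_eq (symf_Tilde hpsi l (symf_High hpsi k su))) => xi; rewrite /mmul /wh /msub mulr1.
  - by apply: (symf_eq (symf_Delta hpsi l'' su)) => xi; rewrite /mmul mulr1.
  - by apply: (symf_eq (symf_Delta hpsi l (symf_High hpsi k su))) => xi; rewrite /ga /mmul /wh /msub mulr1.
pose D l'' (n : nat) := integrand uh (mmul (ta (k - 1 + n%:Z)) (wh k)) (ph l'') (ga psi (k - 1 + n%:Z) k).
have I l'' : h <= l'' <= k - 1 -> L1 (lim_sum (D l'')) /\ Cint (leb3 R) (lim_sum (D l'')) = T (wh k) (ph l'') (wh k).
  move=> /andP[_ lk]; apply: (resonant_series hpsi s0 s1 hN (lowm_ph hpsi l'')).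
  (* [ph l''] lives below $2^{l''+1}\le2^k$, as [resonant_series] requires. *)
  by apply: (low_le _ (@ph_low _ _ hpsi l'')); apply: two_le; lia.
rewrite (@eq_Cint3 R _ (fun x => sumZ h (k - 1) (fun l'' => lim_sum (D l'') x))); last first.
  move=> x; apply: eq_sumZ => l'' _; rewrite /sumZ_ge /lim_sum.
  have e (n : nat) : \sum_(i < n) convect (lpTilde psi (k - 1 + i%:Z) (lpHigh psi k u)) (lpDelta psi l'' u)
     (lpDelta psi (k - 1 + i%:Z) (lpHigh psi k u)) x = \sum_(i < n) D l'' i x.
    by apply: eq_bigr => i _; rewrite E.
  by congr (limn _ +i* limn _); apply/funext => n; rewrite e.
rewrite (proj2 (@cinteg_sumZ R h (k - 1) _ (fun l'' hl => proj1 (I l'' hl)))); apply: eq_sumZ => l'' hl.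
exact: proj2 (I l'' hl).
Qed.

End conclusion.

Unset Implicit Arguments.

Theorem theorem1p3 (R : realType) (psi : R3 R -> R) (s : R)
    (u : vfunctional R) :
  lp_cutoff psi ->
  1 / 2 < s -> s < 5 / 6 ->
  weak_solution s u ->
  (energy s u < +oo)%E ->
  energy s u = limn_einf (fun n : nat =>
    let k : int := n%:Z in
    let uk := lpHigh psi k u in
    (complex.Re (
      cint (fun x =>
        sumZ (k - 1) (k + 2) (fun l =>
        sumZ (l - 2) (k - 1) (fun l' =>
        sumZ (Num.floor (theta s * k%:~R)) (k - 1) (fun l'' =>
          convect (lpS psi (l - 2) (lpDelta psi l'' u))
                  (lpDelta psi l' u)
                  (lpDelta psi l uk) x))))
      + cint (fun x =>
        sumZ (k - 3) k (fun l =>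
        sumZ (Num.floor (k%:~R / 2 : R)) (k - 1) (fun l'' =>
          convect (lpDelta psi l (lpS psi k u))
                  (lpDelta psi l'' u)
                  (lpTilde psi l uk) x)))
      + cint (fun x =>
        sumZ (Num.floor (k%:~R / 2 : R)) (k - 1) (fun l'' =>
        sumZ_ge (k - 1) (fun l =>
          convect (lpTilde psi l uk)
                  (lpDelta psi l'' u)
                  (lpDelta psi l uk) x)))))%:E).
Proof.
move=> hpsi s_gt s_lt [hd hdiv [P [tP hmom]]] _.
have hu i : Hdot s (u i) by have [] := hd i.
have hreal i : real_valued (u i) by have [] := hd i.
have [N hN] := uh_hs hu.
have s0 : 0 < s by move: s_gt; lra.
have s1 : s < 1 by move: s_lt; lra.
have [th0 th1] := andP (theta_itv s_gt s_lt).
set F := (fun n : nat => _).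
(* The lower limit is in fact a limit. *)
suff cF : F @ \oo --> energy s u by rewrite (cvg_limn_einf_sup cF).1.
pose Z (n : nat) := Q psi u n%:Z - (err1 psi s (uh u) n + err2 psi (uh u) n + err3 psi (uh u) n).
have FZ n : F n = (complex.Re (Z n))%:E.
  have kn0 : (0 : R) <= n%:Z%:~R by rewrite -pmulrn ler0n.
  (* $\theta<1$ keeps the threshold at or below [k], as [decomposition] requires. *)
  have ak : Num.floor (theta s * n%:Z%:~R) <= n%:Z.
    rewrite -(ler_int R); apply: (le_trans (floor_le _)).
    by rewrite -[leRHS]mul1r ler_wpM2r//; exact: ltW th1.
  have hk : Num.floor (n%:Z%:~R / 2 : R) <= n%:Z.
    by rewrite -(ler_int R); apply: (le_trans (floor_le _)); move: kn0; lra.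
  rewrite /F; congr (complex.Re _)%:E.
  rewrite /Z /Q (decomposition hpsi s0 s1 hN ak hk).
  have e1 := low_high_Cint hpsi s_gt s_lt hu hN n%:Z (Num.floor (theta s * n%:Z%:~R)).
  have e2 := high_high_Cint hpsi s_gt s_lt hu hN n%:Z (Num.floor (n%:Z%:~R / 2 : R)).
  have e3 := resonant_Cint hpsi s_gt s_lt hu hN n%:Z (Num.floor (n%:Z%:~R / 2 : R)).
  have alg (x y : R[i]) : x = x + y - y by rewrite addrK.
  etransitivity; last exact: alg.
  exact: (f_equal2 +%R (f_equal2 +%R e1 e2) e3).
have cQ : (fun n => normc (Q psi u n%:Z - full_energy s u)) @ \oo --> (0 : R).
  have c1 := cvg_spectral_energy hpsi s_gt s_lt hu hreal hN.
  have c2 := cvg_QN hpsi s_gt s_lt hN.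
  (* The lower cut-off is placed at $2^{-n}$ when the upper one is at $2^n$, so that one sequence
     serves for both limits. *)
  apply: (@cvg0_le _ _ (fun n => normc (spectral_energy psi s u n%:Z (- n%:Z) - full_energy s u) + normc (Q psi u (- n%:Z)))).
    move=> n; rewrite normc_ge0/= (spectral_energy_Q hpsi s_gt s_lt hu hdiv hN tP hmom); last by lia.
    rewrite -[X in normc X <= _](subrK (Q psi u (- n%:Z))) [X in normc (X + _)]addrAC; exact: normcD.
  by rewrite -[X in _ --> X](addr0 (0 : R)); exact: cvgD.
have cE : (fun n => normc (err1 psi s (uh u) n + err2 psi (uh u) n + err3 psi (uh u) n)) @ \oo --> (0 : R).
  apply: (@cvg0_le _ _ (fun n => normc (err1 psi s (uh u) n) + normc (err2 psi (uh u) n) + normc (err3 psi (uh u) n))).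
    move=> n; rewrite normc_ge0/=; apply: le_trans (normcD _ _) _; apply: lerD => //; exact: normcD.
  rewrite -[X in _ --> X](addr0 (0 : R)); apply: cvgD; last exact: (cvg_err3 hpsi s_gt s_lt hN).
  rewrite -[X in _ --> X](addr0 (0 : R)); apply: cvgD; first exact: (cvg_err1 hpsi s_gt s_lt hN).
  exact: (cvg_err2 hpsi s_gt s_lt hN).
rewrite (energyE hpsi hN) (_ : F = (fun n => (complex.Re (Z n))%:E)); last by apply/funext.
apply: cvg_EFin; first by apply: nearW.
apply/cvgrPdist_le => e e0.
have e2 : 0 < e / 2 by rewrite divr_gt0.
have /cvgrPdist_le/(_ _ e2)[n1 _ h1] := cQ; have /cvgrPdist_le/(_ _ e2)[n2 _ h2] := cE.
exists (maxn n1 n2) => // n; rewrite /= geq_max => /andP[/h1 {}h1 /h2 {}h2].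
have nz (z : R[i]) : `|0 - normc z| = normc z by rewrite sub0r normrN ger0_norm ?normc_ge0.
rewrite nz in h1; rewrite nz in h2.
rewrite distrC -cReN -cReD; apply: le_trans (Re_le_normc _) _.
pose err := err1 psi s (uh u) n + err2 psi (uh u) n + err3 psi (uh u) n.
have -> : Z n - full_energy s u = (Q psi u n%:Z - full_energy s u) + - err by exact: (addrAC (Q psi u n%:Z) (- err) (- full_energy s u)).
have h3 := normcD (Q psi u n%:Z - full_energy s u) (- err); rewrite normcN in h3.
by rewrite (splitr e); exact: (le_trans h3 (lerD h1 h2)).
Qed.
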